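(* Consider the partially functional linear regression model $Y_t=\sum_{j=1}^p\int_{\mathcal U}X_{tj}(u)\beta_j(u)du+\sum_{k=1}^dZ_{tk}\gamma_k+\epsilon_t$, $t=1,\dots,n$, where $\{\mathbf X_t(\cdot)\}$ is a $p$-dimensional mean-zero sub-Gaussian functional linear process on $\mathcal U$, $\{\mathbf Z_t\}$ is a $d$-dimensional mean-zero sub-Gaussian linear process (jointly weakly stationary with $\{\mathbf X_t\}$), and $\{\epsilon_t\}$ is a mean-zero scalar sub-Gaussian linear process independent of $\{\mathbf X_t\}$ and $\{\mathbf Z_t\}$. Let $S_1=\{j:\|\beta_j\|\ne0\}$, $s_1=|S_1|$. Assume: (i) $\boldsymbol f_\theta^X,\boldsymbol f_\theta^Z,f_\theta^\epsilon$ exist and $\mathcal M^X,\mathcal M^Z,\mathcal M^\epsilon<\infty$; (ii) $\boldsymbol f_\theta^{X,Z}$ exists and $\mathcal M^{X,Z}<\infty$; (iii) $\sum_{l\ge0}\|\mathbf A_l\|_\infty=O(1)$ (and the coefficients of $\{\mathbf Z_t\}$, $\{\epsilon_t\}$ are absolutely summable); (iv) the marginal covariance functions $\Sigma_{0,jj}^\varepsilon$ of the innovations of $\{\mathbf X_t\}$ are continuous on $\mathcal U^2$ and uniformly bounded over $j$, with $\omega_0^\varepsilon=\max_j\int_{\mathcal U}\Sigma_{0,jj}^\varepsilon(u,u)du=O(1)$; (v) for each $j$, $\omega_{j1}^X>\omega_{j2}^X>\cdots>0$, and $\omega_{jl}^X-\omega_{j(l+1)}^X\ge c_0l^{-\alpha-1}$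 for all $l\ge1$ with constants $c_0>0,\alpha>1$; (vi) for $j\in S_1$, $\beta_j=\sum_{l\ge1}a_{jl}\psi_{jl}$ with $|a_{jl}|\le\mu_jl^{-\kappa}$ for all $l\ge1$, for some $\mu_j>0$, $\kappa>\alpha/2+1$. Then there exist positive constants $C,C_0^*,c_1^*,c_2^*$ such that, for $n\ge C\log(pqd)q^{3\alpha+2}\mathcal M_{X,Z}^2$, with probability greater than $1-c_1^*(pq+d)^{-c_2^*}$, $$\frac1n\|\mathcal Z^T(\mathcal Y-\widehat\Omega B-\mathcal Z\gamma)\|_{\max}\le C_0^*s_1(\mathcal M_{X,Z}+\mathcal M^\epsilon)\Big\{q^{\alpha+1}\sqrt{\frac{\log(pq+d)}n}+q^{-\kappa+1/2}\Big\}.$$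
   Context: Function spaces. $\mathcal U$ compact interval; $\langle f,g\rangle=\int fg$, $\|f\|=\langle f,f\rangle^{1/2}$. $\mathbb H\subseteq L_2(\mathcal U)$ a Hilbert space, $\mathbb S=\mathbb H\otimes\mathbb H$, $\mathbb H^p$ the product with $\langle\boldsymbol f,\boldsymbol g\rangle=\sum_i\langle f_i,g_i\rangle$. A kernel matrix $\mathbf K=(K_{ij})$ also denotes the operator $\mathbf K(\boldsymbol f)(u)=(\sum_j\int K_{ij}(u,v)f_j(v)dv)_i$; $\|K\|_{\mathcal S}=(\iint K^2)^{1/2}$, $\|\mathbf K\|_\infty=\max_i\sum_j\|K_{ij}\|_{\mathcal S}$. For a vector, $\|x\|_{\max}=\max_j|x_j|$. Covariances and stability. $\boldsymbol\Sigma_h^X(u,v)=\mathrm{Cov}\{\mathbf X_t(u),\mathbf X_{t+h}(v)\}$, $\boldsymbol\Sigma_h^Z=\mathrm{Cov}(\mathbf Z_t,\mathbf Z_{t+h})$, $\boldsymbol\Sigma_h^{X,Z}(u)=\mathrm{Cov}\{\mathbf X_t(u),\mathbf Z_{t+h}\}$; $\boldsymbol f_\theta=\frac1{2\pi}\sum_{h\in\mathbb Z}\boldsymbol\Sigma_he^{-ih\theta}$ with the relevant superscript. Suprema below are essential suprema over $\theta\in[-\pi,\pi]$ and over arguments for which the quadratic forms in the denominator lie in $(0,\infty)$: $\mathcal M^X=2\pi\sup\frac{\langle\boldsymbol\Phi,\boldsymbol f_\theta^X(\boldsymbol\Phi)\rangle}{\langle\boldsymbol\Phi,\boldsymbol\Sigma_0^X(\boldsymbol\Phi)\rangle}$,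 $\mathcal M^Z=2\pi\sup\frac{\boldsymbol\nu^T\boldsymbol f_\theta^Z\boldsymbol\nu}{\boldsymbol\nu^T\boldsymbol\Sigma_0^Z\boldsymbol\nu}$ ($\mathcal M^\epsilon$ likewise for $\{\epsilon_t\}$), $\mathcal M^{X,Z}=2\pi\sup\frac{|\langle\boldsymbol\Phi,\boldsymbol f_\theta^{X,Z}\boldsymbol\nu\rangle|}{\sqrt{\langle\boldsymbol\Phi,\boldsymbol\Sigma_0^X(\boldsymbol\Phi)\rangle}\sqrt{\boldsymbol\nu^T\boldsymbol\Sigma_0^Z\boldsymbol\nu}}$; $\mathcal M_1^X,\mathcal M_1^Z,\mathcal M_{1,1}^{X,Z}$ are the same with arguments restricted to have at most one nonzero component. $\mathcal M_{X,Z}=\mathcal M_1^X+\mathcal M_1^Z+\mathcal M_{1,1}^{X,Z}$. Processes. A mean-zero random element $X$ of $\mathbb H$ with covariance operator $\Sigma_0$ is a sub-Gaussian process if for some $a\ge0$, $\mathbb Ee^{\langle x,X\rangle}\le e^{a^2\langle x,\Sigma_0(x)\rangle/2}$ for all $x\in\mathbb H$. A sub-Gaussian functional linear process is $\mathbf X_t=\sum_{l\ge0}\mathbf A_l(\boldsymbol\varepsilon_{t-l})$, $\mathbf A_l$ a $p\times p$ matrix of kernels in $\mathbb S$, $\boldsymbol\varepsilon_t$ i.i.d. over $t$ with independent mean-zero sub-Gaussian process components with covariance functions $\Sigma^\varepsilon_{0,jj}$. A sub-Gaussian linear process is the analogue with real coefficient matrices and i.i.d. error vectors with independent mean-zero sub-Gaussian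 components; its coefficients are absolutely summable (with $O(1)$ sums) and its variances are bounded. FPCA and matrices. $(\omega_{jl}^X,\psi_{jl})_l$ are the eigenpairs of $\Sigma_{0,jj}^X$; $\widehat\psi_{jl}$ the orthonormal eigenfunctions (decreasing eigenvalues) of $n^{-1}\sum_{t=1}^nX_{tj}(u)X_{tj}(v)$, signs chosen so that $\langle\widehat\psi_{jl},\psi_{jl}\rangle\ge0$; $\widehat\zeta_{tjl}=\langle X_{tj},\widehat\psi_{jl}\rangle$. With truncation level $q$, $\widehat{\mathcal X}_j\in\mathbb R^{n\times q}$ has rows $(\widehat\zeta_{tj1},\dots,\widehat\zeta_{tjq})$, $\widehat{\mathcal X}=(\widehat{\mathcal X}_1,\dots,\widehat{\mathcal X}_p)$, $\widehat D=\mathrm{diag}(\widehat D_1,\dots,\widehat D_p)$ with $\widehat D_j=\{n^{-1}\widehat{\mathcal X}_j^T\widehat{\mathcal X}_j\}^{1/2}$, $\widehat\Omega=\widehat{\mathcal X}\widehat D^{-1}$, $\mathcal Y=(Y_1,\dots,Y_n)^T$, $\mathcal Z=(Z_{tk})\in\mathbb R^{n\times d}$, $\gamma=(\gamma_1,\dots,\gamma_d)^T$. $B=D\Psi$, where $D=\mathrm{diag}(D_1,\dots,D_p)$, $D_j=\mathrm{diag}(\sqrt{\omega_{j1}^X},\dots,\sqrt{\omega_{jq}^X})$, and $\Psi=(\Psi_1^T,\dots,\Psi_p^T)^T$, $\Psi_j=(\langle\psi_{jl},\beta_j\rangle)_{l\le q}$. Convention: $p,d,q,s_1$ may vary with $n$;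 constants do not depend on them or on $n$ (they may depend on $c_0,\alpha,\kappa$, an upper bound for the $\mu_j$, the sub-Gaussian parameters and the bounds in the $O(1)$ assumptions).
   Formalization: The formal statement assumes s_1 ≥ 1 (some β_j is nonzero); for s_1 = 0 the right-hand side is 0 while the left-hand side is the generally nonzero maximum of |Z^T ε|/n, so the claim fails there. *)

(* Defs.v *)
From HB Require Import structures.
From mathcomp Require Import all_boot all_order all_algebra finmap.
From mathcomp Require Import all_classical all_reals all_analysis ess_sup_inf.
From mathcomp Require Import complex.

Set Implicit Arguments.
Unset Strict Implicit.
Unset Printing Implicit Defensive.

Import Order.TTheory GRing.Theory Num.Theory.
Import numFieldNormedType.Exports.
Local Open Scope classical_set_scope.
Local Open Scope ring_scope.

(* The time set of every process is Z. A function on U is a total function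
   R -> R whose values outside U are never used, and functions on U are only
   compared through [nrm], i.e. up to Lebesgue-null sets. Eigenpairs and
   expansion coefficients are numbered from 0: index l stands for the textbook
   index l + 1. *)

Section FunctionSpace.
Context {R : realType}.
Variable U : set R.
Notation leb := (@lebesgue_measure R).
Notation leb2 := (leb \x leb)%E.

Definition ip (f g : R -> R) : R := \int[leb]_(u in U) (f u * g u).

Definition nrm (f : R -> R) : R := Num.sqrt (ip f f).

Definition L2 : set (R -> R) :=
  [set f : R -> R | measurable_fun U f /\
           leb.-integrable U (fun u => (f u ^+ 2)%:E)].

Definition L2_kernel : set (R -> R -> R) :=
  [set K : R -> R -> R | measurable_fun (U `*` U) (fun z : R * R => K z.1 z.2) /\
           leb2.-integrable (U `*` U)
             (fun z : R * R => (K z.1 z.2 ^+ 2)%:E)].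

Definition HSnorm (K : R -> R -> R) : R :=
  Num.sqrt (\int[leb2]_(z in U `*` U) (K z.1 z.2 ^+ 2)).

(* A closed linear subspace of L_2(U); closedness also makes it stable under
   modification on null sets. *)
Definition hilbert_subspace (H : set (R -> R)) : Prop :=
  [/\ H `<=` L2,
      H (fun=> 0),
      (forall (c : R) f g, H f -> H g -> H (fun u => c * f u + g u)) &
      (forall (g : nat -> R -> R) f, (forall N, H (g N)) -> L2 f ->
         nrm (fun u => f u - g N u) @[N --> \oo] --> (0 : R) -> H f)].

(* H (x) H: Hilbert-Schmidt limits of finite sums of f (x) g, f, g in H. *)
Definition tensor_space (H : set (R -> R)) : set (R -> R -> R) :=
  [set K : R -> R -> R | L2_kernel K /\
    forall e : R, 0 < e -> exists m (f g : 'I_m -> R -> R),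
      (forall i, H (f i) /\ H (g i)) /\
      HSnorm (fun u v => K u v - \sum_(i < m) f i u * g i v) < e].

Definition kop (K : R -> R -> R) (f : R -> R) : R -> R :=
  fun u => \int[leb]_(v in U) (K u v * f v).

Section KernelMatrix.
Variable p : nat.

Definition kmx_op (K : 'I_p -> 'I_p -> R -> R -> R) (f : 'I_p -> R -> R) :
  'I_p -> R -> R := fun i u => \sum_(j < p) kop (K i j) (f j) u.

Definition ip_prod (f g : 'I_p -> R -> R) : R := \sum_(i < p) ip (f i) (g i).

Definition kmx_form (K : 'I_p -> 'I_p -> R -> R -> R) (Phi : 'I_p -> R -> R) :
  R := ip_prod Phi (kmx_op K Phi).

Definition kmx_norm_inf (K : 'I_p -> 'I_p -> R -> R -> R) : R :=
  \big[Num.max/0]_(i < p) \sum_(j < p) HSnorm (K i j).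

Definition prod_space (H : set (R -> R)) : set ('I_p -> R -> R) :=
  [set Phi | forall i, H (Phi i)].

Definition one_component : set ('I_p -> R -> R) :=
  [set Phi | forall i i', nrm (Phi i) != 0 -> nrm (Phi i') != 0 -> i = i'].

End KernelMatrix.

(* (lam_l, psi_l) lists the eigenpairs of the self-adjoint kernel operator K on
   H, with multiplicity: nonincreasing eigenvalues, orthonormal eigenfunctions,
   and no eigenfunction of a nonzero eigenvalue is missing. For K of finite
   rank the list is continued by eigenfunctions of the eigenvalue 0. *)
Record eigen_system (H : set (R -> R)) (K : R -> R -> R)
    (lam : nat -> R) (psi : nat -> R -> R) : Prop := {
  eig_in : forall l, H (psi l);
  eig_orthonormal : forall l m, ip (psi l) (psi m) = (l == m)%:R;
  eig_eq : forall l, nrm (fun u => kop K (psi l) u - lam l * psi l u) = 0;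
  eig_decr : forall l, lam l.+1 <= lam l;
  eig_exhaustive : forall (c : R) f, H f -> c != 0 ->
    nrm (fun u => kop K f u - c * f u) = 0 ->
    (forall l, ip f (psi l) = 0) -> nrm f = 0 }.

End FunctionSpace.

Section Spectral.
Context {R : realType}.
Notation leb := (@lebesgue_measure R).
Notation leb2 := (leb \x leb)%E.
Notation C := (complex R).

Definition expNi (x : R) : C := (cos x -i* sin x)%C.

(* (2 pi)^-1 \sum_(-N <= h <= N) c_h e^(- i h theta) *)
Definition fourier_sum (c : int -> R) (theta : R) (N : nat) : C :=
  (real_complex R (2 * pi))^-1 *
  \sum_(k < N.*2.+1) (let h : int := (k : nat)%:Z - N%:Z in
     real_complex R (c h) * expNi (h%:~R * theta)).

Definition sqmod (z : C) : R := (Normc.normc z) ^+ 2.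

Definition freq : set R := `[- pi, pi].

(* f_theta = (2 pi)^-1 \sum_h Sigma_h e^(- i h theta), the series converging
   entrywise in L_2(U x U). *)
Definition spectral_density_fun (U : set R) (p : nat)
    (Sigma : int -> 'I_p -> 'I_p -> R -> R -> R)
    (f : R -> 'I_p -> 'I_p -> R -> R -> C) : Prop :=
  forall theta, freq theta -> forall i j,
    [/\ L2_kernel U (fun u v => complex.Re (f theta i j u v)),
        L2_kernel U (fun u v => complex.Im (f theta i j u v)) &
        (\int[leb2]_(z in U `*` U)
           (sqmod (f theta i j z.1 z.2 -
              fourier_sum (fun h => Sigma h i j z.1 z.2) theta N))%:E)%E
        @[N --> \oo] --> 0%E].

Definition spectral_density_vec (d : nat) (Sigma : int -> 'M[R]_d)
    (f : R -> 'M[C]_d) : Prop :=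
  forall theta, freq theta -> forall k k',
    Normc.normc (f theta k k' - fourier_sum (fun h => Sigma h k k') theta N)
    @[N --> \oo] --> (0 : R).

Definition spectral_density_cross (U : set R) (p d : nat)
    (Sigma : int -> 'I_p -> 'I_d -> R -> R)
    (f : R -> 'I_p -> 'I_d -> R -> C) : Prop :=
  forall theta, freq theta -> forall j k,
    [/\ L2 U (fun u => complex.Re (f theta j k u)),
        L2 U (fun u => complex.Im (f theta j k u)) &
        (\int[leb]_(u in U)
           (sqmod (f theta j k u -
              fourier_sum (fun h => Sigma h j k u) theta N))%:E)%E
        @[N --> \oo] --> 0%E].

Definition spectral_form_fun (U : set R) (p : nat)
    (f : 'I_p -> 'I_p -> R -> R -> C) (Phi : 'I_p -> R -> R) : C :=
  (kmx_form U (fun i j u v => complex.Re (f i j u v)) Phi +i*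
   kmx_form U (fun i j u v => complex.Im (f i j u v)) Phi)%C.

Definition spectral_form_vec (d : nat) (f : 'M[C]_d) (nu : 'cV[R]_d) : C :=
  ((map_mx (real_complex R) nu)^T *m f *m map_mx (real_complex R) nu) 0 0.

Definition spectral_form_cross (U : set R) (p d : nat)
    (f : 'I_p -> 'I_d -> R -> C) (Phi : 'I_p -> R -> R) (nu : 'cV[R]_d) : C :=
  (ip_prod U Phi (fun j u => \sum_(k < d) complex.Re (f j k u) * nu k 0) +i*
   ip_prod U Phi (fun j u => \sum_(k < d) complex.Im (f j k u) * nu k 0))%C.

Definition vec_form (d : nat) (S : 'M[R]_d) (nu : 'cV[R]_d) : R :=
  (nu^T *m S *m nu) 0 0.

Definition one_entry (d : nat) : set 'cV[R]_d :=
  [set nu | forall k k', nu k 0 != 0 -> nu k' 0 != 0 -> k = k'].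

Definition ess_sup_freq (g : R -> R) : \bar R :=
  ess_sup (mrestr leb (measurable_itv `[- pi : R, pi])) (EFin \o g).

(* In the next three definitions 0 is added to the set of values, so that a
   supremum over no argument at all is 0; the values are nonnegative, hence
   nothing else changes. The spectral densities being Hermitian, the forms on
   the diagonal are real and [complex.Re] only changes their type. *)
Definition stability_fun (U : set R) (p : nat)
    (f : R -> 'I_p -> 'I_p -> R -> R -> C) (S0 : 'I_p -> 'I_p -> R -> R -> R)
    (A : set ('I_p -> R -> R)) : \bar R :=
  ((2 * pi)%:E * ereal_sup (0%E |`
    [set ess_sup_freq (fun theta =>
           (complex.Re (spectral_form_fun U (f theta) Phi) / kmx_form U S0 Phi)%R)
    | Phi in A `&` [set Phi | (0 < kmx_form U S0 Phi)%R]]))%E.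

Definition stability_vec (d : nat) (f : R -> 'M[C]_d) (S0 : 'M[R]_d)
    (A : set 'cV[R]_d) : \bar R :=
  ((2 * pi)%:E * ereal_sup (0%E |`
    [set ess_sup_freq (fun theta =>
           (complex.Re (spectral_form_vec (f theta) nu) / vec_form S0 nu)%R)
    | nu in A `&` [set nu | (0 < vec_form S0 nu)%R]]))%E.

Definition stability_cross (U : set R) (p d : nat)
    (f : R -> 'I_p -> 'I_d -> R -> C)
    (SX : 'I_p -> 'I_p -> R -> R -> R) (SZ : 'M[R]_d)
    (A : set ('I_p -> R -> R)) (B : set 'cV[R]_d) : \bar R :=
  ((2 * pi)%:E * ereal_sup (0%E |`
    [set ess_sup_freq (fun theta =>
           (Normc.normc (spectral_form_cross U (f theta) a.1 a.2) /
           (Num.sqrt (kmx_form U SX a.1) * Num.sqrt (vec_form SZ a.2)))%R)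
    | a in (A `*` B) `&`
           [set a | (0 < kmx_form U SX a.1)%R /\ (0 < vec_form SZ a.2)%R]]))%E.

End Spectral.

Section Processes.
Context {R : realType} {dsp : measure_display} {Om : measurableType dsp}.
Variable P : probability Om R.

(* Only meaningful for square-integrable variables: [fine] sends an infinite
   value to 0. *)
Definition cov (V W : Om -> R) : R := fine (covariance P V W).

Definition mutually_independent (I : choiceType) (F : I -> set (set Om)) :
    Prop :=
  forall (J : {fset I}) (A : I -> set Om),
    (forall i, i \in J -> F i (A i)) ->
    P [set w | forall i, i \in J -> A i w] = (\prod_(i <- J) P (A i))%E.

Definition independent (F G : set (set Om)) : Prop :=
  forall A B, F A -> G B -> P (A `&` B) = (P A * P B)%E.

(* sigma-algebra generated by a family of real random variables *)
Definition sigma_rv (I : Type) (D : set I) (V : I -> Om -> R) :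
    set (set Om) :=
  <<s [set E | exists i B, [/\ D i, measurable B & E = V i @^-1` B]] >>.

Section Functional.
Variables (U : set R) (H : set (R -> R)).

(* sigma-algebra of the random element V of H (Borel = cylindrical, H being
   separable) *)
Definition sigma_fun (V : Om -> R -> R) : set (set Om) :=
  sigma_rv H (fun x w => ip U x (V w)).

Definition same_law_fun (V W : Om -> R -> R) : Prop :=
  forall m (x : 'I_m -> R -> R) (B : 'I_m -> set R),
    (forall i, H (x i)) -> (forall i, measurable (B i)) ->
    P [set w | forall i, B i (ip U (x i) (V w))] =
    P [set w | forall i, B i (ip U (x i) (W w))].

Definition random_element (V : Om -> R -> R) : Prop :=
  measurable_fun (setT `*` U) (fun z : Om * R => V z.1 z.2) /\
  forall w, H (V w).

Definition cov_fun (V W : Om -> R -> R) : R -> R -> R :=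
  fun u v => cov (V ^~ u) (W ^~ v).

Record sub_gaussian_process (a : R) (V : Om -> R -> R) : Prop := {
  sgp_random : random_element V;
  sgp_square : (\int[P]_w (ip U (V w) (V w))%:E < +oo)%E;
  sgp_mean : forall x, H x -> ('E_P[fun w => ip U x (V w)] = 0)%E;
  sgp_mgf : forall x, H x ->
    ('E_P[fun w => expR (ip U x (V w))] <=
     (expR (a ^+ 2 * ip U x (kop U (cov_fun V V) x) / 2))%:E)%E }.

(* X_t = \sum_(l >= 0) A_l (eps_(t-l)), the series converging in mean square.
   Independence of the array (t, j) |-> eps_(t,j) expresses both the
   independence over t and that of the components. *)
Record functional_linear_process (a : R) (p : nat)
    (A : nat -> 'I_p -> 'I_p -> R -> R -> R)
    (eps X : int -> 'I_p -> Om -> R -> R) : Prop := {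
  flp_kernel : forall l i j, tensor_space U H (A l i j);
  flp_subgauss : forall t j, sub_gaussian_process a (eps t j);
  flp_indep : mutually_independent
    (fun s : (int * 'I_p)%type => sigma_fun (eps s.1 s.2));
  flp_ident : forall t t' j, same_law_fun (eps t j) (eps t' j);
  flp_random : forall t j, random_element (X t j);
  flp_series : forall t j,
    (\int[P]_w (nrm U (fun u => X t j w u -
        \sum_(l < N) kmx_op U (A l)
          (fun i => eps (t - (l : nat)%:Z) i w) j u) ^+ 2)%:E)%E
    @[N --> \oo] --> 0%E }.

End Functional.

Record sub_gaussian_rv (a : R) (V : Om -> R) : Prop := {
  sgv_meas : measurable_fun setT V;
  sgv_square : P.-integrable setT (fun w => (V w ^+ 2)%:E);
  sgv_mean : ('E_P[V] = 0)%E;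
  sgv_mgf : forall x : R,
    ('E_P[fun w => expR (x * V w)] <=
     (expR (a ^+ 2 * (x ^+ 2 * cov V V) / 2))%:E)%E }.

Record linear_process (a : R) (d : nat) (B : nat -> 'M[R]_d)
    (eta Z : int -> 'I_d -> Om -> R) : Prop := {
  lp_subgauss : forall t k, sub_gaussian_rv a (eta t k);
  lp_indep : mutually_independent
    (fun s : (int * 'I_d)%type => sigma_rv [set: unit] (fun=> eta s.1 s.2));
  lp_ident : forall t t' k (S : set R), measurable S ->
    P (eta t k @^-1` S) = P (eta t' k @^-1` S);
  lp_meas : forall t k, measurable_fun setT (Z t k);
  lp_series : forall t k,
    (\int[P]_w ((Z t k w - \sum_(l < N) \sum_(m < d)
        B l k m * eta (t - (l : nat)%:Z) m w) ^+ 2)%:E)%E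
    @[N --> \oo] --> 0%E }.

Definition mx_norm_inf (d : nat) (B : 'M[R]_d) : R :=
  \big[Num.max/0]_(k < d) \sum_(m < d) `|B k m|.

Definition SigmaX (p : nat) (X : int -> 'I_p -> Om -> R -> R) (h : int) :
  'I_p -> 'I_p -> R -> R -> R := fun i j => cov_fun (X 0 i) (X h j).

Definition SigmaZ (d : nat) (Z : int -> 'I_d -> Om -> R) (h : int) : 'M[R]_d :=
  \matrix_(k, k') cov (Z 0 k) (Z h k').

Definition SigmaXZ (p d : nat) (X : int -> 'I_p -> Om -> R -> R)
    (Z : int -> 'I_d -> Om -> R) (h : int) : 'I_p -> 'I_d -> R -> R :=
  fun j k u => cov (X 0 j ^~ u) (Z h k).

(* The second-order structure does not depend on the time origin, which makes
   the three autocovariances above, taken at t = 0, those at any t. *)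
Record jointly_weakly_stationary (U : set R) (p d : nat)
    (X : int -> 'I_p -> Om -> R -> R) (Z : int -> 'I_d -> Om -> R) : Prop := {
  jws_X : forall t (h : int) i j, {ae (@lebesgue_measure R \x @lebesgue_measure R)%E,
    forall z, (U `*` U) z ->
    cov_fun (X t i) (X (t + h) j) z.1 z.2 = SigmaX X h i j z.1 z.2};
  jws_Z : forall t (h : int) k k', cov (Z t k) (Z (t + h) k') = SigmaZ Z h k k';
  jws_XZ : forall t (h : int) j k, {ae @lebesgue_measure R,
    forall u, U u -> cov (X t j ^~ u) (Z (t + h) k) = SigmaXZ X Z h j k u} }.

Definition sigma_fun_process (U : set R) (H : set (R -> R)) (p : nat)
    (X : int -> 'I_p -> Om -> R -> R) : set (set Om) :=
  sigma_rv [set s : int * 'I_p * (R -> R) | H s.2]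
    (fun s w => ip U s.2 (X s.1.1 s.1.2 w)).

Definition sigma_process (d : nat) (Z : int -> 'I_d -> Om -> R) :
    set (set Om) :=
  sigma_rv [set: int * 'I_d] (fun s => Z s.1 s.2).

End Processes.

(* a scalar process as a one-dimensional vector process *)
Definition scalar_proc (R : realType) (Om : Type) (e : int -> Om -> R) :
  int -> 'I_1 -> Om -> R := fun t _ => e t.

Section Regression.
Context {R : realType}.
Variable U : set R.

(* observation times t = 1, ..., n, indexed by 'I_n *)
Definition obs n (t : 'I_n) : int := (t.+1)%:Z.

Definition sample_cov n p (x : int -> 'I_p -> R -> R) (j : 'I_p) :
  R -> R -> R :=
  fun u v => n%:R^-1 * \sum_(t < n) x (obs t) j u * x (obs t) j v.

(* Xhat_j, for a realization x of the functional process *)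
Definition score_mx n p q (x : int -> 'I_p -> R -> R)
    (psih : 'I_p -> nat -> R -> R) (j : 'I_p) : 'M[R]_(n, q) :=
  \matrix_(t, l) ip U (x (obs t) j) (psih j l).

Definition is_psd_sqrt q (S M : 'M[R]_q) : Prop :=
  [/\ S^T = S, (forall x : 'cV[R]_q, 0 <= vec_form S x) & S *m S = M].

(* Xhat Dhat^-1; [invmx] leaves a singular Dhat (some sample eigenvalue of index
   below q is 0) unchanged, so the value is then conventional. *)
Definition Omega_hat n p q (x : int -> 'I_p -> R -> R)
    (psih : 'I_p -> nat -> R -> R) (Dh : 'I_p -> 'M[R]_q) :
  'M[R]_(n, \sum_(j < p) q) :=
  (\mxrow_(j < p) score_mx n q x psih j) *m invmx (\mxdiag_(j < p) Dh j).

Definition B_coef p q (omega : 'I_p -> nat -> R) (psi : 'I_p -> nat -> R -> R)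
    (beta : 'I_p -> R -> R) : 'cV[R]_(\sum_(j < p) q) :=
  (\mxdiag_(j < p) diag_mx (\row_(l < q) Num.sqrt (omega j l))) *m
  (\mxcol_(j < p) \col_(l < q) ip U (psi j l) (beta j)).

Definition Y_vec n (y : int -> R) : 'cV[R]_n := \col_t y (obs t).

Definition Z_mx n d (z : int -> 'I_d -> R) : 'M[R]_(n, d) :=
  \matrix_(t, k) z (obs t) k.

Definition max_norm d (x : 'cV[R]_d) : R := \big[Num.max/0]_(k < d) `|x k 0|.

Definition active_set p (beta : 'I_p -> R -> R) : {set 'I_p} :=
  [set j | nrm U (beta j) != 0]%SET.

End Regression.

Arguments one_component {R} U {p}.
Arguments one_entry {R d}.

(* Main.v *)
Require Import Defs.
From HB Require Import structures.
From mathcomp Require Import all_boot all_order all_algebra finmap.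
From mathcomp Require Import all_classical all_reals all_analysis ess_sup_inf.
From mathcomp Require Import complex.
From mathcomp Require Import measurable_realfun.
From mathcomp Require Import ring lra zify.

Set Implicit Arguments.
Unset Strict Implicit.
Unset Printing Implicit Defensive.

Import Order.TTheory GRing.Theory Num.Theory.
Import numFieldNormedType.Exports.
Local Open Scope classical_set_scope.
Local Open Scope ring_scope.

(** The residual [Y - Omega_hat B - Z gamma] at time [t] is the noise plus, for every
    active [j], the score [<X_tj, R_j>] of the estimation error
    [R_j = beta_j - sum_(l < q) sqrt (w_l / wh_l) <psi_l, beta_j> psih_l], where [w_l] and
    [wh_l] are the population and the sample eigenvalues. By Cauchy-Schwarz in [t]
    ([residual_score_le]), entry [k] of the score vector is at most
    [s_1 * sqrt (|Z_k|^2 / n) * sqrt (khat (R_j, R_j)) + |<Z_k, noise>| / n], with [khat]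
    the form of the sample covariance of [X_j]. The three quantities [khat (R_j, R_j)],
    [|Z_k|^2] and [<Z_k, noise>] are bounded on separate events.

    The form [khat (R_j, R_j)] is bounded for each realization ([projection_error],
    [projection_rate]). It is the squared distance between the square root of the sample
    operator at [beta_j] and [sum_(l < q) sqrt w_l <psi_l, beta_j> psih_l]. The square
    roots of the sample and the population operators solve a Sylvester equation. Its
    denominators are at least [sqrt w_l] on [psi_l], and [sum_l a_l^2 / w_l] converges,
    [a_l = <psi_l, beta_j>], because [2 kappa - alpha > 2]. What is left is the
    perturbation of the first [q] eigenfunctions, of size [delta] over the spacing
    [c_0 q^(- alpha - 1)], and the tail of [beta_j]. Here [delta] is the Hilbert-Schmidt
    norm of the deviation of the sample second moments of the scores
    [zeta_tl = <X_tj, psi_l>]. Working with scores requires that almost every [X_tj] lies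
    in the closed span of the [psi_l] ([X_in_span]), a consequence of the completeness of
    the eigenfunctions of a compact form ([form_orthogonal_null]).

    For [delta] ([gram_tail]), the process is replaced by moving averages of finite order
    with kernels of finite rank. The Gram deviations are then linear combinations of
    bilinear sums of normalized innovation scores. Each bilinear sum is a sum of
    independent terms or a martingale, and has the moments of a Gaussian variable of
    variance [O(1 / n)] ([bilinear_moment]); the weights in the combination are
    controlled by the Hilbert-Schmidt norms of the kernels ([frobenius_moment]). Moments
    of order [ln N], [N = p q + d], give [delta^2 = O(ln N / n)] outside an event of
    probability [2 N^(- 2)].

    The covariates and the noise satisfy
    [E exp (sum_t c_t Z_t) <= exp (C M |c|^2)], [M] the stability measure: the variance
    of the sum is a Toeplitz form, bounded by the essential supremum of the spectral
    density ([spectral_toeplitz_le]). A Gaussian linearization turns this into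
    [|Z_k|^2 = O(M n)] ([lp_norm_tail]), and freezing [Z] gives
    [<Z_k, noise> = O(M sqrt (n ln N))] ([noise_tail]). If some covariate is not
    degenerate, then [M >= 1] ([autocov_stability_ge1]), so that one power of [M] is enough
    in the bound; otherwise all covariates vanish and there is nothing to prove. *)

(** * Semi-inner product spaces *)

Section SemiInner.
Context {R : realType} {V : lmodType R}.

(** Semidefinite, and only on a subset: the spaces below consist of functions, not of
    classes modulo null sets. *)
Record semi_inner (H : set V) (b : V -> V -> R) : Prop := {
  si_0 : H 0;
  si_lin : forall c f g, H f -> H g -> H (c *: f + g);
  si_sym : forall f g, H f -> H g -> b f g = b g f;
  si_linl : forall c f g h, H f -> H g -> H h ->
    b (c *: f + g) h = c * b f h + b g h;
  si_ge0 : forall f, H f -> 0 <= b f f }.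

Definition orthonormal (b : V -> V -> R) (e : nat -> V) :=
  forall i j, b (e i) (e j) = (i == j)%:R.

Section Basics.
Variables (H : set V) (b : V -> V -> R).
Hypothesis S : semi_inner H b.

Lemma siD f g : H f -> H g -> H (f + g).
Proof. by move=> Hf Hg; rewrite -(scale1r f); apply: (si_lin S). Qed.

Lemma siZ c f : H f -> H (c *: f).
Proof. by move=> Hf; rewrite -(addr0 (_ *: _)); apply: (si_lin S) => //; apply: (si_0 S). Qed.

Lemma siN f : H f -> H (- f).
Proof. by move=> Hf; rewrite -scaleN1r; apply: siZ. Qed.

Lemma siB f g : H f -> H g -> H (f - g).
Proof. by move=> Hf Hg; apply: siD => //; apply: siN. Qed.

Lemma si_sum I (r : seq I) (P : pred I) (F : I -> V) :
  (forall i, P i -> H (F i)) -> H (\sum_(i <- r | P i) F i).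
Proof. by move=> HF; elim/big_rec: _ => [|i x Pi Hx]; [exact: (si_0 S) | apply: siD; auto]. Qed.

Lemma formDl f g h : H f -> H g -> H h -> b (f + g) h = b f h + b g h.
Proof. by move=> Hf Hg Hh; rewrite -{1}(scale1r f) (si_linl S) // mul1r. Qed.

Lemma form0l h : H h -> b 0 h = 0.
Proof.
move=> Hh; have H0 := si_0 S; have := formDl H0 H0 Hh.
by rewrite addr0 => /eqP; rewrite -subr_eq0 opprD addNKr oppr_eq0 => /eqP.
Qed.

Lemma formZl c f h : H f -> H h -> b (c *: f) h = c * b f h.
Proof.
move=> Hf Hh; have H0 := si_0 S.
by rewrite -{1}(addr0 (_ *: _)) (si_linl S) // form0l // addr0.
Qed.

Lemma formNl f h : H f -> H h -> b (- f) h = - b f h.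
Proof. by move=> Hf Hh; rewrite -scaleN1r formZl // mulN1r. Qed.

Lemma formBl f g h : H f -> H g -> H h -> b (f - g) h = b f h - b g h.
Proof. by move=> Hf Hg Hh; rewrite formDl ?formNl //; apply: siN. Qed.

Lemma form_suml I (r : seq I) (P : pred I) (F : I -> V) h :
  (forall i, P i -> H (F i)) -> H h ->
  b (\sum_(i <- r | P i) F i) h = \sum_(i <- r | P i) b (F i) h.
Proof.
move=> HF Hh; elim: r => [|i r IH]; first by rewrite !big_nil form0l.
rewrite !big_cons; case: ifP => // Pi.
by rewrite formDl ?IH //; [exact: HF|exact: si_sum].
Qed.

Lemma formDr f g h : H f -> H g -> H h -> b h (f + g) = b h f + b h g.
Proof.
move=> Hf Hg Hh; rewrite (si_sym S) ?formDl //; last exact: siD.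
by rewrite (si_sym S Hf Hh) (si_sym S Hg Hh).
Qed.

Lemma formZr c f h : H f -> H h -> b h (c *: f) = c * b h f.
Proof. by move=> Hf Hh; rewrite (si_sym S) ?formZl ?(si_sym S Hf Hh) //; apply: siZ. Qed.

Lemma formBr f g h : H f -> H g -> H h -> b h (f - g) = b h f - b h g.
Proof.
move=> Hf Hg Hh; rewrite (si_sym S) ?formBl //; last exact: siB.
by rewrite (si_sym S Hf Hh) (si_sym S Hg Hh).
Qed.

Lemma form_sumr I (r : seq I) (P : pred I) (F : I -> V) h :
  (forall i, P i -> H (F i)) -> H h ->
  b h (\sum_(i <- r | P i) F i) = \sum_(i <- r | P i) b h (F i).
Proof.
move=> HF Hh; rewrite (si_sym S) ?form_suml //; last exact: si_sum.
by apply: eq_bigr => i Pi; rewrite (si_sym S) //; apply: HF.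
Qed.

Lemma form_sqD f g : H f -> H g ->
  b (f + g) (f + g) = b f f + 2 * b f g + b g g.
Proof.
move=> Hf Hg; rewrite formDl ?formDr //; try exact: siD.
by rewrite (si_sym S Hg Hf); ring.
Qed.

Lemma form_sqB f g : H f -> H g ->
  b (f - g) (f - g) = b f f - 2 * b f g + b g g.
Proof.
move=> Hf Hg; rewrite formBl ?formBr //; try exact: siB.
by rewrite (si_sym S Hg Hf); ring.
Qed.

Lemma form_sqZ c f : H f -> b (c *: f) (c *: f) = c ^+ 2 * b f f.
Proof. by move=> Hf; rewrite formZl ?formZr //; [ring | exact: siZ]. Qed.

Lemma form_CS f g : H f -> H g -> b f g ^+ 2 <= b f f * b g g.
Proof.
move=> Hf Hg; have Bf := si_ge0 S Hf; have Bg := si_ge0 S Hg.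
have key t : 0 <= t ^+ 2 * b f f - 2 * t * b f g + b g g.
  have := si_ge0 S (siB (siZ t Hf) Hg).
  rewrite form_sqB ?form_sqZ ?formZl //; last exact: siZ.
  by move=> h; apply: le_trans h _; lra.
have [ff0|ffn0] := eqVneq (b f f) 0.
  rewrite ff0 mul0r; have [->|fgn0] := eqVneq (b f g) 0; first by rewrite expr0n.
  have := key ((b g g + 1) / (2 * b f g)).
  have -> : 2 * ((b g g + 1) / (2 * b f g)) * b f g = b g g + 1 by field.
  by rewrite ff0; lra.
have fp : 0 < b f f by rewrite lt_def ffn0.
have := key (b f g / b f f).
have -> : (b f g / b f f) ^+ 2 * b f f - 2 * (b f g / b f f) * b f g + b g g
  = (b f f * b g g - b f g ^+ 2) / b f f by field.
by rewrite pmulr_lge0 ?invr_gt0 // subr_ge0.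
Qed.

Lemma form_null f g : H f -> H g -> b f f = 0 -> b f g = 0.
Proof.
move=> Hf Hg f0; have := form_CS Hf Hg; rewrite f0 mul0r => h.
by apply/eqP; rewrite -sqrf_eq0 eq_le h sqr_ge0.
Qed.

Lemma form_sqD_le f g : H f -> H g ->
  b (f + g) (f + g) <= 2 * b f f + 2 * b g g.
Proof.
move=> Hf Hg; have := si_ge0 S (siB Hf Hg).
by rewrite form_sqB // form_sqD //; lra.
Qed.

Lemma form_sqB_le f g : H f -> H g ->
  b (f - g) (f - g) <= 2 * b f f + 2 * b g g.
Proof.
move=> Hf Hg; have := si_ge0 S (siD Hf Hg).
by rewrite form_sqD // form_sqB //; lra.
Qed.

Definition snorm f := Num.sqrt (b f f).

Lemma snorm_ge0 f : 0 <= snorm f. Proof. exact: sqrtr_ge0. Qed.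

Lemma snorm_sq f : H f -> snorm f ^+ 2 = b f f.
Proof. by move=> Hf; rewrite sqr_sqrtr //; exact: (si_ge0 S). Qed.

Lemma form_CS_norm f g : H f -> H g -> `|b f g| <= snorm f * snorm g.
Proof.
move=> Hf Hg; rewrite -ler_sqr ?nnegrE ?mulr_ge0 ?sqrtr_ge0 //.
by rewrite real_normK ?num_real // exprMn !snorm_sq //; exact: form_CS.
Qed.

Lemma snorm_triangle f g : H f -> H g -> snorm (f + g) <= snorm f + snorm g.
Proof.
move=> Hf Hg; rewrite -ler_sqr ?nnegrE ?addr_ge0 ?sqrtr_ge0 //.
rewrite snorm_sq ?form_sqD //; last exact: siD.
rewrite sqrrD !snorm_sq //.
have := le_trans (ler_norm _) (form_CS_norm Hf Hg).
by move=> h; rewrite mulr2n; lra.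
Qed.

Lemma snorm0 : snorm 0 = 0.
Proof. by rewrite /snorm form0l ?sqrtr0 //; apply: (si_0 S). Qed.

Lemma snormZ c f : H f -> snorm (c *: f) = `|c| * snorm f.
Proof. by move=> Hf; rewrite /snorm form_sqZ // sqrtrM ?sqr_ge0 // sqrtr_sqr. Qed.

Lemma snorm_sum I (r : seq I) (P : pred I) (F : I -> V) :
  (forall i, P i -> H (F i)) ->
  snorm (\sum_(i <- r | P i) F i) <= \sum_(i <- r | P i) snorm (F i).
Proof.
move=> HF; elim: r => [|i r IH]; first by rewrite !big_nil snorm0.
rewrite !big_cons; case: ifP => // Pi.
apply: le_trans (snorm_triangle (HF _ Pi) _) _; first exact: si_sum.
by rewrite lerD2l.
Qed.

Lemma semi_inner_sub (H' : set V) : H' `<=` H -> H' 0 ->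
  (forall c f g, H' f -> H' g -> H' (c *: f + g)) -> semi_inner H' b.
Proof.
move=> sH H0 HL; split=> //.
- by move=> f g /sH Hf /sH Hg; apply: (si_sym S).
- by move=> c f g h /sH ? /sH ? /sH ?; apply: (si_linl S).
- by move=> f /sH; apply: (si_ge0 S).
Qed.

(** ** Finite orthonormal families *)

Section Ortho.
Variables (e : nat -> V) (N : nat).
Hypothesis He : forall i, (i < N)%N -> H (e i).
Hypothesis one : forall i j, (i < N)%N -> (j < N)%N -> b (e i) (e j) = (i == j)%:R.

Lemma ortho_coord (c : nat -> R) j : (j < N)%N ->
  b (\sum_(i < N) c i *: e i) (e j) = c j.
Proof.
move=> jN; have Hj := He jN.
rewrite form_suml //; last by move=> i _; apply: siZ; apply: He.
rewrite (bigD1 (Ordinal jN)) //= formZl // one // eqxx mulr1 big1 ?addr0 // => i ij.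
rewrite formZl ?one //; last exact: He.
by case: eqP => [ij'|]; rewrite ?mulr0 //; move: ij; rewrite -val_eqE /= ij' eqxx.
Qed.

Lemma Hcomb (c : nat -> R) : H (\sum_(i < N) c i *: e i).
Proof. by apply: si_sum => i _; apply: siZ; apply: He. Qed.

Lemma ortho_sqnorm (c : nat -> R) :
  b (\sum_(i < N) c i *: e i) (\sum_(i < N) c i *: e i) = \sum_(i < N) c i ^+ 2.
Proof.
rewrite {2}(eq_bigr (fun i : 'I_N => c i *: e i)) // form_sumr.
- apply: eq_bigr => i _; rewrite formZr ?ortho_coord //; first exact: He.
  exact: Hcomb.
- by move=> i _; apply: siZ; apply: He.
- exact: Hcomb.
Qed.

Lemma ortho_residual f : H f ->
  b (f - \sum_(i < N) b f (e i) *: e i) (f - \sum_(i < N) b f (e i) *: e i)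
  = b f f - \sum_(i < N) b f (e i) ^+ 2.
Proof.
move=> Hf; rewrite form_sqB //; last exact: (Hcomb (fun i => b f (e i))).
rewrite (ortho_sqnorm (fun i => b f (e i))) form_sumr //; last first.
  by move=> i _; apply: siZ; apply: He.
have -> : \sum_(i < N) b f (b f (e i) *: e i) = \sum_(i < N) b f (e i) ^+ 2.
  by apply: eq_bigr => i _; have Hi := He (ltn_ord i); rewrite formZr // expr2.
ring.
Qed.

Lemma bessel f : H f -> \sum_(i < N) b f (e i) ^+ 2 <= b f f.
Proof.
move=> Hf; rewrite -subr_ge0 -ortho_residual //.
by apply: (si_ge0 S); apply: siB => //; apply: (Hcomb (fun i => b f (e i))).
Qed.

Lemma ortho_residualP f j : H f -> (j < N)%N ->
  b (f - \sum_(i < N) b f (e i) *: e i) (e j) = 0.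
Proof.
move=> Hf jN; have Hj := He jN; rewrite formBl //; last exact: (Hcomb (fun i => b f (e i))).
by rewrite (ortho_coord (fun i => b f (e i))) // subrr.
Qed.

End Ortho.

(** Gram-Schmidt: vectors that depend on the previous ones are dropped, so the
    orthonormal family may be shorter than [s]; it has the same orthogonal. *)
Lemma gram_schmidt (s : seq V) : (forall g, g \in s -> H g) ->
  exists N (e : nat -> V),
   [/\ forall i, (i < N)%N -> H (e i),
       forall i j, (i < N)%N -> (j < N)%N -> b (e i) (e j) = (i == j)%:R &
       forall f, H f -> (forall i, (i < N)%N -> b f (e i) = 0) ->
         forall g, g \in s -> b f g = 0].
Proof.
elim: s => [|g s IH] Hs; first by exists 0%N, (fun=> 0); split.
have Hg : H g by apply: Hs; rewrite inE eqxx.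
have [|N [e [He one eP]]] := IH; first by move=> h hs; apply: Hs; rewrite inE hs orbT.
pose r := g - \sum_(i < N) b g (e i) *: e i.
have HP : H (\sum_(i < N) b g (e i) *: e i) by apply: (Hcomb He (fun i => b g (e i))).
have Hr : H r by apply: siB.
have re j : (j < N)%N -> b r (e j) = 0 by move=> jN; apply: ortho_residualP.
have fg f : H f -> (forall i, (i < N)%N -> b f (e i) = 0) -> b f g = b f r.
  move=> Hf fe; rewrite formBr // form_sumr //; last by move=> i _; apply: siZ; apply: He.
  by rewrite big1 ?subr0 // => i _; rewrite formZr ?fe ?mulr0 //; apply: He.
have [r0|rn0] := eqVneq (b r r) 0.
  exists N, e; split=> // f Hf fe h; rewrite inE => /orP[/eqP ->|hs]; last exact: eP.
  by rewrite fg // (si_sym S) // form_null.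
have rp : 0 < b r r by rewrite lt_def rn0; apply: (si_ge0 S).
pose k := (Num.sqrt (b r r))^-1.
have kn0 : k != 0 by rewrite invr_eq0 sqrtr_eq0 -ltNge.
have kk : k * k * b r r = 1.
  by rewrite /k -invfM -expr2 sqr_sqrtr ?ltW // mulVf.
exists N.+1, (fun i => if (i == N)%N then k *: r else e i); split.
- move=> i; rewrite ltnS leq_eqVlt; case: eqP => [_ _|_ /=]; first exact: siZ.
  by move=> iN; apply: He.
- move=> i j; rewrite !ltnS (leq_eqVlt i) (leq_eqVlt j).
  case: eqP => [-> _|_ /= iN]; case: eqP => [->|_ /=].
  + by rewrite formZl ?formZr ?eqxx //; [rewrite mulrA kk | exact: siZ].
  + by move=> jN; rewrite formZl ?re ?mulr0 ?(gtn_eqF jN) //; apply: He.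
  + have Hi := He _ iN.
    by rewrite formZr // (si_sym S) // re // mulr0 (ltn_eqF iN).
  + exact: one.
- move=> f Hf fe.
  have fe' i : (i < N)%N -> b f (e i) = 0.
    by move=> iN; have := fe i (ltnW iN); rewrite (ltn_eqF iN); apply.
  move=> h; rewrite inE => /orP[/eqP ->|hs]; last exact: eP.
  rewrite fg //; have := fe N (ltnSn N); rewrite eqxx formZr // => /eqP.
  by rewrite mulf_eq0 (negPf kn0) => /eqP.
Qed.

End Basics.
End SemiInner.

(** * Compact forms and their eigenvectors *)

Section Spectrum.
Context {R : realType} {V : lmodType R}.
Implicit Types (H : set V) (b k : V -> V -> R).

(** Limits are only unique up to vectors on which [b] vanishes. *)
Definition complete_form H b := forall u : nat -> V, (forall n, H (u n)) ->
  (forall e, 0 < e -> exists N, forall m n, (N <= m)%N -> (N <= n)%N ->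
     b (u m - u n) (u m - u n) < e) ->
  exists2 f, H f & forall e, 0 < e -> exists N, forall n, (N <= n)%N ->
     b (f - u n) (f - u n) < e.

(** On a Hilbert space this says that the operator of [k] is compact; the list [s]
    can be read off a finite-rank approximation of the operator. *)
Definition compact_form H b k := forall e, 0 < e -> exists2 s : seq V,
  (forall g, g \in s -> H g) &
  forall f, H f -> (forall g, g \in s -> b f g = 0) -> k f f <= e * b f f.

(** Bolzano-Weierstrass, with a rate at which the limit point is approached. *)
Lemma bounded_sequence_cluster N (x : nat -> 'I_N -> R) (B : R) :
  (forall n i, `|x n i| <= B) ->
  exists (c : 'I_N -> R) (g : nat -> nat), forall n, (n <= g n)%N /\
    forall i, `|c i - x (g n) i| < n.+1%:R^-1.
Proof.
move=> xB; pose y n : 'rV[R]_N := \row_i x n i.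
have cA : compact [set v : 'rV[R]_N | forall i, `[- B, B]%classic (v ord0 i)].
  by apply: (@rV_compact R N (fun=> `[- B, B]%classic)) => i; exact: segment_compact.
have [|c [_ cl]] := cA (y @ \oo) _.
  by exists 0%N => // n _ i /=; rewrite mxE in_itv /= -ler_norml.
have ex n : exists m, (n <= m)%N /\ forall i, `|c ord0 i - x m i| < n.+1%:R^-1.
  have [||z [[m /= nm <-] zc]] := cl [set y m | m in [set m | (n <= m)%N]]
      (ball c n.+1%:R^-1) _ _.
  - by exists n => // m nm; exists m.
  - by apply: nbhsx_ballx; rewrite invr_gt0.
  exists m; split => // i; have := zc.2 ord0 i; rewrite /ball /= /y mxE.
  by [].
have [g gP] := choice ex.
by exists (fun i => c ord0 i), g.
Qed.

Lemma invSn_lt (e : R) : 0 < e -> exists N, forall n, (N <= n)%N -> n.+1%:R^-1 < e.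
Proof.
move=> e0; exists (Num.truncn e^-1) => n Nn.
rewrite -(invrK e) ltf_pV2 ?posrE ?invr_gt0 ?ltr0n //.
by apply: lt_le_trans (truncnS_gt _) _; rewrite ler_nat.
Qed.

Section Top.
Variables (H H1 : set V) (b k : V -> V -> R) (B : R).
Hypotheses (S : semi_inner H b) (K : semi_inner H k).
Hypotheses (H1H : H1 `<=` H) (H10 : H1 0)
  (H1lin : forall c f g, H1 f -> H1 g -> H1 (c *: f + g))
  (H1c : complete_form H1 b).
Hypothesis B_ge0 : 0 <= B.
Hypothesis kB : forall f, H f -> k f f <= B * b f f.
Hypothesis kc : compact_form H b k.

Let S1 : semi_inner H1 b := semi_inner_sub S H1H H10 H1lin.
Let K1 : semi_inner H1 k := semi_inner_sub K H1H H10 H1lin.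

(** A maximizing sequence of the Rayleigh quotient is almost orthogonal, after
    passing to a subsequence, to the finitely many directions outside of which
    [k] is small; the form [mu * b - k] then controls its increments. *)
Lemma top_eigenvector f0 : H1 f0 -> 0 < k f0 f0 ->
  exists f mu, [/\ H1 f, 0 < b f f, 0 < mu & forall h, H1 h -> k f h = mu * b f h].
Proof.
move=> Hf0 kf0.
pose E : set R := [set x | exists f, [/\ H1 f, b f f <= 1 & x = k f f]].
have Eub : has_sup E.
  split; first by exists (k 0 0), 0; rewrite (form0l S1).
  exists B => _ [f [Hf bf ->]]; apply: le_trans (kB (H1H Hf)) _.
  by rewrite -[leRHS]mulr1 ler_wpM2l.
pose mu := sup E.
have muE f : H1 f -> k f f <= mu * b f f.
  move=> Hf; have [b0|bn0] := eqVneq (b f f) 0.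
    by have := kB (H1H Hf); rewrite b0 !mulr0.
  have bp : 0 < b f f by rewrite lt_def bn0; apply: (si_ge0 S1).
  rewrite -ler_pdivrMr //; apply: ub_le_sup; first by case: Eub.
  exists ((Num.sqrt (b f f))^-1 *: f).
  have e : (Num.sqrt (b f f))^-1 ^+ 2 = (b f f)^-1.
    by rewrite exprVn sqr_sqrtr // ltW.
  split; first exact: (siZ S1).
    by rewrite (form_sqZ S1) // e mulVf.
  by rewrite (form_sqZ K1) // e mulrC.
have mu0 : 0 < mu.
  rewrite ltNge; apply/negP => m0; have := mulr_le0_ge0 m0 (si_ge0 S1 Hf0).
  by rewrite leNgt (lt_le_trans kf0 (muE _ Hf0)).
pose m f g := mu * b f g - k f g.
have M1 : semi_inner H1 m.
  split=> //.
  - by move=> f g Hf Hg; rewrite /m (si_sym S1) // (si_sym K1).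
  - by move=> c f g h Hf Hg Hh; rewrite /m (si_linl S1) // (si_linl K1) //; ring.
  - by move=> f Hf; rewrite /m subr_ge0 muE.
have exf n : exists f, [/\ H1 f, b f f <= 1 & mu - n.+1%:R^-1 < k f f].
  have n0 : 0 < n.+1%:R^-1 :> R by rewrite invr_gt0.
  have [_ [f [Hf bf ->]] lt] := sup_adherent n0 Eub.
  by exists f.
have [f fP] := choice exf.
have Hf n : H1 (f n) by case: (fP n).
(* outside the span of [s] the form stays below half of its supremum *)
have [s Hs sP] := kc (divr_gt0 mu0 (ltr0n _ 2)).
have [N [e [He one eP]]] := gram_schmidt S Hs.
have [|c [g gP]] := @bounded_sequence_cluster N (fun n i => b (f n) (e i)) 1.
  move=> n i; rewrite -(@ler_pXn2r _ 2) ?nnegrE // expr1n real_normK ?num_real //.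
  have [_ bf _] := fP n.
  apply: le_trans (form_CS S (H1H (Hf n)) (He _ (ltn_ord i))) _.
  by rewrite one // eqxx mulr1.
pose u n := f (g n).
have Hu n : H1 (u n) := Hf (g n).
have mu_n n : m (u n) (u n) < n.+1%:R^-1.
  have [_ bf lt] := fP (g n).
  have : mu * b (u n) (u n) <= mu by rewrite -[leRHS]mulr1 ler_wpM2l // ltW.
  have : (g n).+1%:R^-1 <= n.+1%:R^-1 :> R.
    by rewrite lef_pV2 ?posrE ?ltr0n // ler_nat ltnS; case: (gP n).
  move: lt; rewrite /m -/(u n) => h1 h2 h3.
  rewrite ltrBlDr; apply: le_lt_trans h3 _; rewrite addrC -ltrBlDr.
  by apply: le_lt_trans h1; rewrite lerB.
have cu n i : `|c i - b (u n) (e i)| < n.+1%:R^-1 by case: (gP n) => _; apply.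
(* the increment [d] splits into its coordinates along [e], which are small,
   and [h], on which [k] is at most [mu / 2 * b] *)
have incr n n' r : n.+1%:R^-1 <= r -> n'.+1%:R^-1 <= r ->
    mu * b (u n - u n') (u n - u n') <= 48 * B * N%:R * r ^+ 2 + 16 * r.
  move=> nr n'r; set d := u n - u n'.
  have Hd1 : H1 d by apply: (siB S1).
  have Hd := H1H Hd1.
  pose w := \sum_(i < N) b d (e i) *: e i.
  have Hw : H w by apply: (Hcomb S He (fun i => b d (e i))).
  pose h := d - w; have Hh : H h by apply: (siB S).
  have hh : b h h = b d d - b w w.
    by rewrite /h (ortho_residual S He one) // (ortho_sqnorm S He one (fun i => b d (e i))).
  have he i : (i < N)%N -> b h (e i) = 0 by move=> iN; apply: (ortho_residualP S He one).
  have kh : k h h <= mu / 2 * b h h by apply: sP => //; apply: eP.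
  have bw : b w w <= 4 * N%:R * r ^+ 2.
    rewrite (ortho_sqnorm S He one (fun i => b d (e i))).
    have -> : 4 * N%:R * r ^+ 2 = \sum_(i < N) (2 * r) ^+ 2.
      by rewrite sumr_const card_ord -[RHS]mulr_natl; ring.
    apply: ler_sum => i _; have Hi := He _ (ltn_ord i).
    rewrite -[leLHS]real_normK ?num_real //.
    have r0 : 0 <= r by apply: le_trans nr; rewrite invr_ge0.
    rewrite ler_sqr ?nnegrE ?mulr_ge0 // /d (formBl S) ?H1H //; try exact: H1H.
    have := lt_le_trans (cu n i) nr; have := lt_le_trans (cu n' i) n'r; rewrite !ltr_norml ler_norml.
    by move=> /andP[? ?] /andP[? ?]; apply/andP; split; lra.
  have kw : k w w <= B * (4 * N%:R * r ^+ 2).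
    by apply: le_trans (kB Hw) _; rewrite ler_wpM2l.
  have bw0 : 0 <= b w w by apply: (si_ge0 S).
  (* k (h + w) <= 3/2 k h + 3 k w *)
  have kd : k d d <= 3 / 2 * k h h + 3 * k w w.
    have Hz : H (2^-1 *: h - w) by apply: (siB S) => //; apply: (siZ S).
    have -> : d = h + w by rewrite /h subrK.
    rewrite (form_sqD K) //; have := si_ge0 K Hz.
    rewrite (form_sqB K) ?(form_sqZ K) ?(formZl K) //; last exact: (siZ S).
    by move=> ?; lra.
  have md : m d d <= 4 * r.
    apply: le_trans (form_sqB_le M1 (Hu _) (Hu _)) _.
    by have := lt_le_trans (mu_n n) nr; have := lt_le_trans (mu_n n') n'r => ? ?; lra.
  have mub : mu * b h h <= mu * b d d by apply: ler_wpM2l; [exact: ltW | rewrite hh lerBlDr lerDl].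
  by move: md; rewrite /m => ?; nra.
have [e' e'0|v Hv uv] := H1c Hu.
  pose A := 48 * B * N%:R + 16.
  have A0 : 0 < A by rewrite /A; have := mulr_ge0 B_ge0 (ler0n R N) => ?; lra.
  pose r := Num.min 1 (mu * e' / (2 * A)).
  have r0 : 0 < r by rewrite lt_min ltr01 divr_gt0 // mulr_gt0.
  have r1 : r <= 1 by rewrite ge_min lexx.
  have rA : A * r <= mu * e' / 2.
    have -> : mu * e' / 2 = A * (mu * e' / (2 * A)) by field; rewrite gt_eqF.
    by apply: ler_wpM2l; [exact: ltW | rewrite ge_min lexx orbT].
  have [N0 N0P] := invSn_lt r0; exists N0 => n n' Nn Nn'.
  have := incr n n' r (ltW (N0P _ Nn)) (ltW (N0P _ Nn')).
  have rr : 48 * B * N%:R * r ^+ 2 <= 48 * B * N%:R * r.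
    apply: ler_wpM2l; first by rewrite !mulr_ge0.
    by rewrite expr2 -[leRHS]mulr1; apply: ler_wpM2l => //; exact: ltW.
  move=> hh; rewrite -(ltr_pM2l mu0); apply: le_lt_trans hh _.
  have : 0 < mu * e' by rewrite mulr_gt0.
  by move: rA; rewrite /A => ? ?; lra.
have mv : m v v = 0.
  apply/eqP; rewrite eq_le (si_ge0 M1) // andbT leNgt; apply/negP => mv0.
  pose e' := m v v / (4 * (mu + 1)).
  have e'0 : 0 < e' by rewrite divr_gt0 // mulr_gt0 // addr_gt0.
  have [N1 N1P] := uv _ e'0.
  have [N2 N2P] := invSn_lt (divr_gt0 mv0 (ltr0n _ 4)).
  pose n := maxn N1 N2.
  have vE : v = (v - u n) + u n by rewrite subrK.
  have := form_sqD_le M1 (siB S1 Hv (Hu n)) (Hu n); rewrite -vE.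
  have m1 : m (v - u n) (v - u n) <= mu * b (v - u n) (v - u n).
    by rewrite /m lerBlDr lerDl (si_ge0 K1) //; apply: (siB S1).
  have m3 := N1P n (leq_maxl _ _); have m4 := lt_trans (mu_n n) (N2P n (leq_maxr _ _)).
  have : mu * b (v - u n) (v - u n) <= mu * e' by apply: ler_wpM2l; apply: ltW.
  have : mu * e' < m v v / 4.
    have -> : m v v / 4 = (mu + 1) * e' by rewrite /e'; field; rewrite gt_eqF // addr_gt0.
    by rewrite ltr_pM2r // ltrDl.
  by move=> ? ? ?; lra.
exists v, mu; split=> //; last first.
  move=> h Hh; have := form_null M1 Hv Hh mv.
  by rewrite /m => /eqP; rewrite subr_eq0 => /eqP.
rewrite lt_def (si_ge0 S1) // andbT; apply/eqP => bv0.
have e8 : 0 < 1 / 8 :> R by lra.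
have [N1 N1P] := uv _ e8.
have mu80 : 0 < mu / 8 by lra.
have [N2 N2P] := invSn_lt mu80.
pose n := maxn N1 N2.
have := form_null S1 Hv (Hu n) bv0 => vu0.
have := N1P n (leq_maxl _ _); rewrite (form_sqB S1) // bv0 vu0 => b8.
have : mu * b (u n) (u n) <= mu * 8^-1 by apply: ler_wpM2l; [exact: ltW|lra].
have [_ _ lt] := fP (g n); have h2 := muE _ (Hu n).
have : (g n).+1%:R^-1 <= n.+1%:R^-1 :> R.
  by rewrite lef_pV2 ?posrE ?ltr0n // ler_nat ltnS; case: (gP n).
move=> /le_lt_trans/(_ (N2P n (leq_maxr _ _))).
by move: lt; rewrite -/(u n); set z := (g n).+1%:R^-1; move: z => z ? ? ?; lra.
Qed.
End Top.
End Spectrum.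

(** ** Limits and finite sums *)

Section Limits.
Context {R : realType}.

Lemma le_of_cvg0 (u : nat -> R) (x y : R) (M : nat) :
  u @ \oo --> (0 : R) -> (forall m, (M <= m)%N -> x <= y + u m) -> x <= y.
Proof.
move=> u0 h; apply/ler_addgt0Pr => e e0.
have /cvgrPdist_lt/(_ _ e0)[N _ NP] := u0.
have := NP (maxn M N) (leq_maxr _ _); rewrite sub0r normrN => /ltW ue.
apply: le_trans (h _ (leq_maxl _ _)) _; rewrite lerD2l.
exact: le_trans (ler_norm _) ue.
Qed.

Lemma cvg0_sum I (r : seq I) (u : I -> nat -> R) :
  (forall i, u i @ \oo --> (0 : R)) ->
  (fun m => \sum_(i <- r) u i m) @ \oo --> (0 : R).
Proof.
move=> h; elim: r => [|i r IH].
  by under eq_fun do rewrite big_nil; exact: cvg_cst.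
under eq_fun do rewrite big_cons.
by have := cvgD (h i) IH; rewrite addr0 => H; apply: H.
Qed.

Lemma cvg0_sqrt (u : nat -> R) : u @ \oo --> (0 : R) ->
  (fun m => Num.sqrt (u m)) @ \oo --> (0 : R).
Proof.
move=> h; apply/cvgrPdist_lt => e e0.
have /cvgrPdist_lt/(_ _ (exprn_gt0 2 e0))[N _ NP] := h.
exists N => // n Nn /=; rewrite sub0r normrN ger0_norm ?sqrtr_ge0 //.
rewrite -[ltRHS](ger0_norm (ltW e0)) -sqrtr_sqr ltr_sqrt ?exprn_gt0 //.
by have /= := NP n Nn; rewrite sub0r normrN; exact/le_lt_trans/ler_norm.
Qed.

Lemma cvg0_Ml (c : R) (u : nat -> R) : u @ \oo --> (0 : R) ->
  (fun m => c * u m) @ \oo --> (0 : R).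
Proof. by move=> h; rewrite -(mulr0 c); apply: cvgMr. Qed.

Lemma cvg0_le (u v : nat -> R) : (forall m, 0 <= v m <= u m) ->
  u @ \oo --> (0 : R) -> v @ \oo --> (0 : R).
Proof.
move=> h u0; apply: (@squeeze_cvgr _ _ _ _ (fun=> 0) u) => //.
  by near=> m; exact: h.
exact: cvg_cst.
Unshelve. all: by end_near. Qed.

Lemma sum_CS (I : finType) (x y : I -> R) :
  (\sum_i x i * y i) ^+ 2 <= (\sum_i x i ^+ 2) * (\sum_i y i ^+ 2).
Proof.
pose bb (f g : {ffun I -> R^o}) : R := \sum_i (f i : R) * g i.
have S : semi_inner setT bb.
  split=> //.
  - by move=> f g _ _; apply: eq_bigr => i _; rewrite mulrC.
  - move=> c f g h _ _ _; rewrite /bb mulr_sumr -big_split /=.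
    by apply: eq_bigr => i _; rewrite !ffunE mulrDl -mulrA.
  - by move=> f _; apply: sumr_ge0 => i _; rewrite -expr2 sqr_ge0.
have := @form_CS _ _ _ _ S [ffun i => x i] [ffun i => y i] Logic.I Logic.I.
rewrite /bb; under eq_bigr do rewrite !ffunE.
under [X in _ <= X * _]eq_bigr do rewrite !ffunE -expr2.
by under [X in _ <= _ * X]eq_bigr do rewrite !ffunE -expr2.
Qed.

Lemma nonincr_le (w : nat -> R) : (forall l, w l.+1 <= w l) ->
  forall m a, (m <= a)%N -> w a <= w m.
Proof.
move=> h m a /subnK <-; elim: (a - m)%N => // i IH.
by rewrite addSn; apply: le_trans IH.
Qed.

(** There are fewer equations than unknowns. In Weyl's inequalities the solution is a
    vector in the span of [m + 1] eigenvectors orthogonal to [m] others. *)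
Lemma homogeneous_solution m (A : nat -> nat -> R) :
  exists c : nat -> R, 0 < \sum_(i < m.+1) c i ^+ 2 /\
    forall a, (a < m)%N -> \sum_(i < m.+1) c i * A i a = 0.
Proof.
pose M : 'M[R]_(m.+1, m) := \matrix_(i, j) A i j.
have kn0 : kermx M != 0.
  rewrite -mxrank_eq0 mxrank_ker subn_eq0 -ltnNge ltnS.
  exact: rank_leq_col.
have /rowV0Pn[v vk vn0] := kn0.
have vM : v *m M = 0 by apply/sub_kermxP.
exists (fun i => if insub i is Some j then v ord0 j else 0); split.
  rewrite lt_def sumr_ge0 ?andbT => [|i _]; last exact: sqr_ge0.
  apply: contra vn0; rewrite psumr_eq0 => [/allP h|i _]; last exact: sqr_ge0.
  apply/eqP/rowP => j; have := h j; rewrite mem_index_enum => /(_ isT) /=.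
  by rewrite valK sqrf_eq0 mxE => /eqP.
move=> a am; have := congr1 (fun B : 'rV_m => B ord0 (Ordinal am)) vM.
rewrite !mxE /= => e; rewrite -[RHS]e; apply: eq_bigr => i _.
by rewrite valK mxE.
Qed.

End Limits.

(** ** Expansion along eigenvectors *)

Section Expansion.
Context {R : realType} {V : lmodType R}.
Variables (H : set V) (b k : V -> V -> R) (B : R) (psi : nat -> V) (w : nat -> R).
Hypotheses (S : semi_inner H b) (K : semi_inner H k) (Hc : complete_form H b).
Hypothesis B_ge0 : 0 <= B.
Hypothesis kB : forall f, H f -> k f f <= B * b f f.
Hypothesis kc : compact_form H b k.
Hypothesis Hpsi : forall l, H (psi l).
Hypothesis one : orthonormal b psi.
Hypothesis eig : forall l f, H f -> k (psi l) f = w l * b (psi l) f.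

Definition coords_residual N f := f - \sum_(i < N) b f (psi i) *: psi i.

Let Hres N f : H f -> H (coords_residual N f).
Proof.
by move=> Hf; apply: (siB S) => //; apply: (Hcomb S (fun i _ => Hpsi i) (fun i => b f (psi i))).
Qed.

Let psi1 N i j : (i < N)%N -> (j < N)%N -> b (psi i) (psi j) = (i == j)%:R.
Proof. by move=> _ _; apply: one. Qed.

Lemma form_residual N f : H f ->
  k (coords_residual N f) (coords_residual N f) =
  k f f - \sum_(i < N) w i * b f (psi i) ^+ 2.
Proof.
move=> Hf; have Hs : H (\sum_(i < N) b f (psi i) *: psi i).
  by apply: (Hcomb S (fun i _ => Hpsi i) (fun i => b f (psi i))).
have kps i : k f (psi i) = w i * b f (psi i).
  by rewrite (si_sym K) // eig // (si_sym S).
have kss : forall f', H f' -> k (\sum_(i < N) b f (psi i) *: psi i) f' =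
    \sum_(i < N) w i * b f (psi i) * b f' (psi i).
  move=> f' Hf'; rewrite (form_suml K) //; last by move=> i _; apply: (siZ S).
  by apply: eq_bigr => i _; rewrite (formZl K) // eig // (si_sym S Hf') //; ring.
rewrite /coords_residual (form_sqB K) // (si_sym K Hf Hs) !kss //.
have -> : \sum_(i < N) w i * b f (psi i) * b (\sum_(i0 < N) b f (psi i0) *: psi i0) (psi i)
   = \sum_(i < N) w i * b f (psi i) ^+ 2.
  apply: eq_bigr => i _.
  by rewrite (ortho_coord S (fun i _ => Hpsi i) (@psi1 N) (fun i => b f (psi i))) //; ring.
under eq_bigr do rewrite -mulrA -expr2.
ring.
Qed.

Lemma residual_sqnorm N f : H f ->
  b (coords_residual N f) (coords_residual N f) =
  b f f - \sum_(i < N) b f (psi i) ^+ 2.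
Proof. by move=> Hf; rewrite /coords_residual (ortho_residual S _ (@psi1 N)). Qed.

Hypothesis exhaustive : forall f c, H f -> (forall l, b f (psi l) = 0) -> c != 0 ->
  (forall h, H h -> (forall l, b h (psi l) = 0) -> k f h = c * b f h) -> b f f = 0.

Let H1 : set V := [set f | H f /\ forall l, b f (psi l) = 0].

Let H1lin c f g : H1 f -> H1 g -> H1 (c *: f + g).
Proof.
move=> [Hf f0] [Hg g0]; split; first exact: (si_lin S).
by move=> l; rewrite (si_linl S) // f0 g0 mulr0 addr0.
Qed.

Let H1c : complete_form H1 b.
Proof.
move=> u Hu uC; have [|f Hf uf] := Hc _ uC; first by move=> n; case: (Hu n).
exists f => //; split=> // l; apply/eqP; rewrite -sqrf_eq0 eq_le sqr_ge0 andbT.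
apply/ler_addgt0Pr => e e0; rewrite add0r.
have [N /(_ N (leqnn N)) NP] := uf e e0.
have [HuN uN0] := Hu N.
have -> : b f (psi l) = b (f - u N) (psi l) by rewrite (formBl S) // uN0 subr0.
apply: le_trans (form_CS S _ (Hpsi l)) _; first exact: (siB S).
by rewrite one eqxx mulr1 ltW.
Qed.

(** Outside the span of the listed eigenvectors a compact form vanishes, since
    otherwise its largest Rayleigh quotient there would be a further eigenvalue. *)
Lemma form_orthogonal_null f : H f -> (forall l, b f (psi l) = 0) -> k f f = 0.
Proof.
move=> Hf f0; apply/eqP; rewrite eq_le (si_ge0 K Hf) andbT leNgt; apply/negP => kf.
have H1H : H1 `<=` H by move=> g [].
have H10 : H1 0 by split; [exact: (si_0 S) | move=> l; rewrite (form0l S)].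
have Hf1 : H1 f by [].
have [g [mu [[Hg g0] gg mu0 gE]]] :=
  top_eigenvector S K H1H H10 H1lin H1c B_ge0 kB kc Hf1 kf.
have := exhaustive Hg g0 (lt0r_neq0 mu0) (fun h Hh h0 => gE h (conj Hh h0)).
by move=> gg0; rewrite gg0 ltxx in gg.
Qed.

(** The residuals are Cauchy because the sums of the squared coordinates converge. *)
Lemma orthogonal_part f : H f -> exists r, [/\ H r, forall l, b r (psi l) = 0 &
  (fun N => b (coords_residual N f - r) (coords_residual N f - r)) @ \oo --> (0 : R)].
Proof.
move=> Hf; pose s N := \sum_(i < N) b f (psi i) ^+ 2.
have s_nd : nondecreasing_seq s.
  apply/nondecreasing_seqP => N; rewrite /s big_ord_recr /= lerDl; exact: sqr_ge0.
have s_ub : has_ubound (range s).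
  exists (b f f) => _ [N _ <-]; exact: (bessel S (fun i _ => Hpsi i) (@psi1 N)).
have s_cvg := nondecreasing_is_cvgn s_nd s_ub.
have incr m n : (m <= n)%N -> b (coords_residual m f - coords_residual n f)
    (coords_residual m f - coords_residual n f) = s n - s m.
  move=> mn.
  have E : coords_residual m f - coords_residual n f =
     \sum_(i < n) (if (m <= i)%N then b f (psi i) else 0) *: psi i.
    rewrite /coords_residual opprB addrC addrA subrK.
    rewrite -!(big_mkord xpredT (fun i => b f (psi i) *: psi i)).
    rewrite -(big_mkord xpredT (fun i => (if (m <= i)%N then b f (psi i) else 0) *: psi i)).
    rewrite (big_cat_nat _ mn) //= [in RHS](big_cat_nat _ mn) //= addrC addrA addNr add0r.
    have -> : \sum_(0 <= i < m) (if (m <= i)%N then b f (psi i) else 0) *: psi i = 0.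
      by rewrite big_nat_cond big1 // => i /andP[/andP[_ im] _]; rewrite leqNgt im /= scale0r.
    rewrite add0r.
    by apply: eq_big_nat => i /andP[-> _].
  rewrite E (ortho_sqnorm S (fun i _ => Hpsi i) (@psi1 n)
    (fun i => if (m <= i)%N then b f (psi i) else 0)) /s.
  rewrite -!(big_mkord xpredT (fun i => b f (psi i) ^+ 2)).
  rewrite -(big_mkord xpredT (fun i => (if (m <= i)%N then b f (psi i) else 0) ^+ 2)).
  rewrite [in LHS](big_cat_nat _ mn) //= [in RHS](big_cat_nat _ mn) //= [RHS]addrC addrA addNr add0r.
  have -> : \sum_(0 <= i < m) (if (m <= i)%N then b f (psi i) else 0) ^+ 2 = 0.
    by rewrite big_nat_cond big1 // => i /andP[/andP[_ im] _]; rewrite leqNgt im /= expr0n.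
  rewrite add0r.
  by apply: eq_big_nat => i /andP[-> _].
have symB x y : H x -> H y -> b (x - y) (x - y) = b (y - x) (y - x).
  by move=> Hx Hy; rewrite !(form_sqB S) // (si_sym S Hx Hy); ring.
have [e e0|r Hr rP] := Hc (fun N => Hres N Hf).
  have /cvgrPdist_lt/(_ _ (divr_gt0 e0 (ltr0n _ 2)))[N _ NP] := s_cvg.
  exists N => m n Nm Nn; wlog mn : m n Nm Nn / (m <= n)%N => [hw|].
    case: (leqP m n) => [mn|/ltnW nm]; first exact: hw.
    by rewrite symB; [exact: hw | exact: Hres | exact: Hres].
  rewrite incr //; have /= := NP m Nm; have /= := NP n Nn.
  by rewrite !ltr_norml => /andP[? ?] /andP[? ?]; lra.
exists r; split=> //.
  move=> l; apply/eqP; rewrite -sqrf_eq0 eq_le sqr_ge0 andbT.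
  apply/ler_addgt0Pr => e e0; rewrite add0r.
  have [N NP] := rP e e0; pose M := maxn N l.+1.
  have lt := NP M (leq_maxl _ _).
  have c0 : b (coords_residual M f) (psi l) = 0.
    apply: (ortho_residualP S (fun i _ => Hpsi i) (@psi1 M)) => //.
    exact: leq_maxr.
  have -> : b r (psi l) = b (r - coords_residual M f) (psi l).
    by rewrite (formBl S) ?c0 ?subr0 //; exact: Hres.
  apply: le_trans (form_CS S _ (Hpsi l)) _; first by apply: (siB S) => //; exact: Hres.
  by rewrite one eqxx mulr1 ltW.
apply/cvgrPdist_lt => e e0; have [N NP] := rP e e0.
exists N => // n Nn /=; rewrite sub0r normrN ger0_norm.
  by rewrite symB //; [exact: NP | exact: Hres].
by apply: (si_ge0 S); apply: (siB S) => //; exact: Hres.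
Qed.

(** The residuals converge to the orthogonal part, on which the form vanishes. *)
Lemma form_residual_cvg f : H f ->
  (fun N => k (coords_residual N f) (coords_residual N f)) @ \oo --> (0 : R).
Proof.
move=> Hf; have [r [Hr r0 rP]] := orthogonal_part Hf.
apply: (cvg0_le _ (cvg0_Ml (2 * B) rP)) => N; rewrite (si_ge0 K) /=; last exact: Hres.
have Hd : H (coords_residual N f - r) by apply: (siB S) => //; exact: Hres.
rewrite -{1 2}(subrK r (coords_residual N f)).
apply: le_trans (form_sqD_le K Hd Hr) _.
by rewrite (form_orthogonal_null Hr r0) mulr0 addr0 -mulrA ler_pM2l // kB.
Qed.

End Expansion.

(** * Perturbation of eigenpairs *)

Section Perturbation.
Context {R : realType} {V : lmodType R}.
Variables (H : set V) (b : V -> V -> R).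
Hypothesis S : semi_inner H b.
Variables (n : nat) (x : 'I_n -> V).
Hypothesis Hx : forall t, H (x t).

Definition sample_form f g : R := n%:R^-1 * \sum_(t < n) b (x t) f * b (x t) g.
Notation kh := sample_form.

Lemma sample_formP : semi_inner H kh.
Proof.
split; [exact: (si_0 S) | exact: (si_lin S) | | |].
- by move=> f g Hf Hg; congr (_ * _); apply: eq_bigr => t _; rewrite mulrC.
- move=> c f g h Hf Hg Hh; rewrite /kh mulrCA -mulrDr; congr (_ * _).
  rewrite mulr_sumr -big_split /=; apply: eq_bigr => t _.
  by rewrite (formDr S) ?(formZr S) //; [ring | exact: (siZ S)].
- move=> f Hf; rewrite mulr_ge0 ?invr_ge0 // sumr_ge0 // => t _.
  by rewrite -expr2 sqr_ge0.
Qed.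
Let Kh := sample_formP.

Lemma sample_form_le f : H f ->
  kh f f <= (n%:R^-1 * \sum_(t < n) b (x t) (x t)) * b f f.
Proof.
move=> Hf; rewrite -mulrA ler_wpM2l ?invr_ge0 // mulr_suml.
by apply: ler_sum => t _; rewrite -expr2 (form_CS S).
Qed.

Variables (psi psih : nat -> V) (w wh : nat -> R).
Hypotheses (Hpsi : forall l, H (psi l)) (one : orthonormal b psi).
Hypotheses (Hpsih : forall l, H (psih l)) (oneh : orthonormal b psih).
Hypotheses (w_dec : forall l, w l.+1 <= w l) (w_gt0 : forall l, 0 < w l).
Hypothesis wh_dec : forall l, wh l.+1 <= wh l.
Hypothesis eigh : forall l f, H f -> kh (psih l) f = wh l * b (psih l) f.
Hypothesis kh_expansion : forall f, H f ->
  (fun N => kh (coords_residual b psih N f) (coords_residual b psih N f)) @ \oo --> (0 : R).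
Hypothesis x_span : forall t,
  (fun N => b (coords_residual b psi N (x t)) (coords_residual b psi N (x t))) @ \oo --> (0 : R).

Definition gram_error a c : R :=
  n%:R^-1 * (\sum_(t < n) b (x t) (psi a) * b (x t) (psi c)) - w a * (a == c)%:R.
Notation D := gram_error.

Variable delta : R.
Hypothesis delta_ge0 : 0 <= delta.
Hypothesis D_le : forall N, \sum_(a < N) \sum_(c < N) D a c ^+ 2 <= delta ^+ 2.

Let one' N i j : (i < N)%N -> (j < N)%N -> b (psi i) (psi j) = (i == j)%:R.
Proof. by move=> _ _; apply: one. Qed.
Let oneh' N i j : (i < N)%N -> (j < N)%N -> b (psih i) (psih j) = (i == j)%:R.
Proof. by move=> _ _; apply: oneh. Qed.
Let Hcomb' (N : nat) (c : nat -> R) : H (\sum_(i < N) c i *: psi i).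
Proof. exact: (Hcomb S (fun i _ => Hpsi i)). Qed.
Let Hcombh (N : nat) (c : nat -> R) : H (\sum_(i < N) c i *: psih i).
Proof. exact: (Hcomb S (fun i _ => Hpsih i)). Qed.
Let Hres N f : H f -> H (coords_residual b psi N f).
Proof. by move=> Hf; apply: (siB S) => //; exact: (Hcomb' N (fun i => b f (psi i))). Qed.
Let Hresh N f : H f -> H (coords_residual b psih N f).
Proof. by move=> Hf; apply: (siB S) => //; exact: (Hcombh N (fun i => b f (psih i))). Qed.

Lemma sample_form_comb N (c : nat -> R) :
  kh (\sum_(i < N) c i *: psi i) (\sum_(i < N) c i *: psi i) =
  \sum_(i < N) w i * c i ^+ 2 + \sum_(i < N) \sum_(j < N) c i * c j * D i j.
Proof.
rewrite (form_suml Kh) //; last by move=> i _; apply: (siZ S).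
rewrite -big_split /=; apply: eq_bigr => i _.
rewrite (form_sumr Kh) //; [|by move=> j _; apply: (siZ S)|by apply: (siZ S)].
transitivity (\sum_(j < N) (c i * c j * D i j + w i * c i * (c j * (i == j)%:R))).
  apply: eq_bigr => j _; rewrite (formZl Kh) ?(formZr Kh) //; last exact: (siZ S).
  by rewrite /D /kh -(inj_eq val_inj); ring.
rewrite big_split /= addrC; congr (_ + _).
rewrite -mulr_sumr (bigD1 i) //= eqxx mulr1 big1 ?addr0; first by ring.
by move=> j ij; rewrite eq_sym (negPf ij) mulr0.
Qed.

Lemma gram_error_quad_le N (c : nat -> R) :
  `|\sum_(i < N) \sum_(j < N) c i * c j * D i j| <= delta * \sum_(i < N) c i ^+ 2.
Proof.
have s0 : 0 <= \sum_(i < N) c i ^+ 2 by apply: sumr_ge0 => i _; apply: sqr_ge0.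
rewrite -ler_sqr ?nnegrE ?mulr_ge0 // real_normK ?num_real // exprMn.
rewrite pair_bigA /=.
apply: le_trans (sum_CS (fun ij : 'I_N * 'I_N => c ij.1 * c ij.2) (fun ij => D ij.1 ij.2)) _.
rewrite mulrC; apply: ler_pM.
- by apply: sumr_ge0 => i _; apply: sqr_ge0.
- by apply: sumr_ge0 => i _; apply: sqr_ge0.
- by rewrite -(pair_bigA _ (fun i j : 'I_N => D i j ^+ 2)); apply: D_le.
- rewrite expr2 mulr_suml -(pair_bigA _ (fun i j : 'I_N => (c i * c j) ^+ 2)) /=.
  apply: ler_sum => i _; rewrite mulr_sumr; apply: ler_sum => j _.
  by rewrite exprMn.
Qed.

(** The sample form only sees the span of [psi], because the data lie in its
    closure; so it suffices to bound it on finite combinations. *)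
Lemma kh_le_of_proj f U : H f -> 0 <= U ->
  (forall N, kh (\sum_(i < N) b f (psi i) *: psi i) (\sum_(i < N) b f (psi i) *: psi i) <= U) ->
  kh f f <= U.
Proof.
move=> Hf U0 hU.
have khr N : kh (coords_residual b psi N f) (coords_residual b psi N f) <=
    b f f * (n%:R^-1 * \sum_(t < n) b (coords_residual b psi N (x t)) (coords_residual b psi N (x t))).
  rewrite mulrCA ler_wpM2l ?invr_ge0 // mulr_sumr; apply: ler_sum => t _.
  have -> : b (x t) (coords_residual b psi N f) = b (coords_residual b psi N (x t)) f.
    rewrite (formBr S) // ?(formBl S) //; try exact: (Hcomb' N (fun i => b _ (psi i))).
    rewrite (form_sumr S) ?(form_suml S) //; try by move=> i _; apply: (siZ S).
    congr (_ - _); apply: eq_bigr => i _.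
    by rewrite (formZr S) ?(formZl S) // (si_sym S _ Hf) // mulrC.
  by rewrite -expr2 mulrC (form_CS S) //; exact: Hres.
rewrite -(@ler_sqrt _ _ U) //; apply: (le_of_cvg0 (M := 0) (cvg0_sqrt (cvg0_Ml (b f f)
  (cvg0_Ml n%:R^-1 (cvg0_sum (index_enum _) x_span))))) => N _ /=.
have e : f = \sum_(i < N) b f (psi i) *: psi i + coords_residual b psi N f.
  by rewrite addrC subrK.
rewrite [X in Num.sqrt (kh X X)]e.
apply: le_trans (snorm_triangle Kh (Hcomb' N (fun i => b f (psi i))) (Hres N Hf)) _.
apply: lerD; first by rewrite /snorm ler_sqrt.
rewrite /snorm ler_sqrt ?khr // mulr_ge0 ?(si_ge0 S) // mulr_ge0 ?invr_ge0 //.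
by apply: sumr_ge0 => t _; apply: (si_ge0 S); exact: Hres.
Qed.

Lemma sample_spectrum_ge0 m : 0 <= wh m.
Proof. by have := si_ge0 Kh (Hpsih m); rewrite eigh // oneh eqxx mulr1. Qed.

Lemma sample_form_sample_comb N (c : nat -> R) :
  kh (\sum_(i < N) c i *: psih i) (\sum_(i < N) c i *: psih i) =
  \sum_(i < N) wh i * c i ^+ 2.
Proof.
rewrite (form_suml Kh) //; last by move=> i _; apply: (siZ S).
apply: eq_bigr => i _; rewrite (formZl Kh) // eigh // (si_sym S) //.
by rewrite (ortho_coord S (fun i _ => Hpsih i) (@oneh' N) c) //; ring.
Qed.

(** Courant-Fischer: a combination of the first [m + 1] sample eigenvectors that is
    orthogonal to the first [m] population ones compares the two forms. *)
Lemma weyl_upper m : wh m <= w m + delta.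
Proof.
have [c [c0 cA]] := homogeneous_solution m (fun i a => b (psih i) (psi a)).
pose f := \sum_(i < m.+1) c i *: psih i.
have Hf : H f := Hcombh _ _.
have ff : b f f = \sum_(i < m.+1) c i ^+ 2 := ortho_sqnorm S (fun i _ => Hpsih i) (@oneh' m.+1) c.
have f0 a : (a < m)%N -> b f (psi a) = 0.
  move=> am; rewrite /f (form_suml S) //; last by move=> i _; apply: (siZ S).
  by rewrite -[RHS](cA a am); apply: eq_bigr => i _; rewrite (formZl S).
have lo : wh m * b f f <= kh f f.
  rewrite /f sample_form_sample_comb -/f ff mulr_sumr; apply: ler_sum => i _.
  by rewrite ler_wpM2r ?sqr_ge0 // (nonincr_le wh_dec) // -ltnS.
have U0 : 0 <= (w m + delta) * b f f.
  by rewrite mulr_ge0 ?(si_ge0 S) // addr_ge0 // ltW.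
have hi : kh f f <= (w m + delta) * b f f.
  apply: kh_le_of_proj => // N; rewrite (sample_form_comb N (fun i => b f (psi i))).
  have bes := bessel S (fun i _ => Hpsi i) (@one' N) Hf.
  rewrite mulrDl; apply: lerD.
    apply: (@le_trans _ _ (w m * \sum_(i < N) b f (psi i) ^+ 2)); last by rewrite ler_pM2l.
    rewrite mulr_sumr; apply: ler_sum => i _; case: (ltnP i m) => im.
      by rewrite f0 // expr0n !mulr0.
    by rewrite ler_wpM2r ?sqr_ge0 // (nonincr_le w_dec).
  apply: le_trans (ler_norm _) (le_trans (gram_error_quad_le N (fun i => b f (psi i))) _).
  by rewrite ler_wpM2l.
by have := le_trans lo hi; rewrite ler_pM2r // ff.
Qed.

(** The argument of [weyl_upper] with the two families exchanged. *)
Lemma weyl_lower m : w m - delta <= wh m.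
Proof.
have [c [c0 cA]] := homogeneous_solution m (fun i a => b (psi i) (psih a)).
pose f := \sum_(i < m.+1) c i *: psi i.
have Hf : H f := Hcomb' _ _.
have ff : b f f = \sum_(i < m.+1) c i ^+ 2 := ortho_sqnorm S (fun i _ => Hpsi i) (@one' m.+1) c.
have f0 a : (a < m)%N -> b f (psih a) = 0.
  move=> am; rewrite /f (form_suml S) //; last by move=> i _; apply: (siZ S).
  by rewrite -[RHS](cA a am); apply: eq_bigr => i _; rewrite (formZl S).
have lo : (w m - delta) * b f f <= kh f f.
  rewrite /f sample_form_comb -/f ff mulrBl; apply: lerD.
    rewrite mulr_sumr; apply: ler_sum => i _.
    by rewrite ler_wpM2r ?sqr_ge0 // (nonincr_le w_dec) // -ltnS.
  by have := gram_error_quad_le m.+1 c; rewrite ler_norml => /andP[].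
have hi : kh f f <= wh m * b f f.
  apply: (le_of_cvg0 (M := 0) (kh_expansion Hf)) => N _.
  rewrite (form_residual S Kh Hpsih oneh eigh) // addrC -lerBlDl opprB addrC subrK.
  have bes := bessel S (fun i _ => Hpsih i) (@oneh' N) Hf.
  apply: (@le_trans _ _ (wh m * \sum_(i < N) b f (psih i) ^+ 2)).
    rewrite mulr_sumr; apply: ler_sum => i _; case: (ltnP i m) => im.
      by rewrite f0 // expr0n !mulr0.
    by rewrite ler_wpM2r ?sqr_ge0 // (nonincr_le wh_dec).
  by rewrite ler_wpM2l // sample_spectrum_ge0.
by have := le_trans lo hi; rewrite ler_pM2r // ff.
Qed.

(** The difference of the sample and the population operators, applied to [psi l]. *)
Definition defect l := n%:R^-1 *: (\sum_(t < n) b (x t) (psi l) *: x t) - w l *: psi l.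

Lemma Hdefect l : H (defect l).
Proof.
apply: (siB S); last exact: (siZ S).
by apply: (siZ S); apply: (si_sum S) => t _; apply: (siZ S).
Qed.

Lemma defectE l f : H f -> b (defect l) f = kh (psi l) f - w l * b (psi l) f.
Proof.
move=> Hf; have Hs : H (\sum_(t < n) b (x t) (psi l) *: x t).
  by apply: (si_sum S) => t _; apply: (siZ S).
rewrite (formBl S) ?(formZl S) //; try exact: (siZ S).
rewrite (form_suml S) //; last by move=> t _; apply: (siZ S).
by congr (_ * _ - _); apply: eq_bigr => t _; rewrite (formZl S).
Qed.

Lemma defect_psi l a : b (defect l) (psi a) = D l a.
Proof. by rewrite defectE // one. Qed.

Lemma defect_psih l m : b (defect l) (psih m) = (wh m - w l) * b (psi l) (psih m).
Proof. by rewrite defectE // (si_sym Kh) // eigh // (si_sym S (Hpsih m)) // mulrBl. Qed.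

(** The coordinates of the defects along [psi] are the entries of the error matrix, and
    nothing is lost outside the span of [psi], where the data have no component. *)
Lemma sum_defect_le L : \sum_(l < L) b (defect l) (defect l) <= delta ^+ 2.
Proof.
pose u l t N := `|b (x t) (psi l)| * snorm b (defect l) *
   snorm b (coords_residual b psi N (x t)).
have u0 l : (fun N => n%:R^-1 * \sum_(t < n) u l t N) @ \oo --> (0 : R).
  apply: cvg0_Ml; apply: cvg0_sum => t; apply: cvg0_Ml; exact: cvg0_sqrt.
apply: (le_of_cvg0 (M := L) (cvg0_sum (index_enum 'I_L) (fun l => u0 l))) => N LN.
apply: (@le_trans _ _ (\sum_(l < L) \sum_(a < N) D l a ^+ 2 +
   \sum_(l < L) n%:R^-1 * \sum_(t < n) u l t N)); last first.
  rewrite lerD2r; apply: le_trans (D_le N).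
  rewrite -!(big_mkord xpredT (fun l => \sum_(a < N) D l a ^+ 2)).
  rewrite [leRHS](big_cat_nat _ LN) //= lerDl.
  by apply: sumr_ge0 => l _; apply: sumr_ge0 => a _; apply: sqr_ge0.
rewrite -big_split /=; apply: ler_sum => l _.
set h := defect l; have Hh : H h := Hdefect l.
have -> : \sum_(a < N) D l a ^+ 2 = b h (\sum_(a < N) b h (psi a) *: psi a).
  rewrite (form_sumr S) //; last by move=> i _; apply: (siZ S).
  by apply: eq_bigr => a _; rewrite (formZr S) // defect_psi.
have Hr := Hres N Hh; have Hp := Hcomb' N (fun a => b h (psi a)).
rewrite -lerBlDl -(formBr S) //.
rewrite -/(coords_residual b psi N h) {1}/h defectE //.
have -> : b (psi l) (coords_residual b psi N h) = 0.
  rewrite (si_sym S) // (ortho_residualP S (fun i _ => Hpsi i) (@one' N)) //.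
  exact: leq_trans (ltn_ord l) LN.
rewrite mulr0 subr0 ler_wpM2l ?invr_ge0 //; apply: ler_sum => t _.
have -> : b (x t) (coords_residual b psi N h) = b (coords_residual b psi N (x t)) h.
  rewrite (formBr S) // ?(formBl S) //; try exact: (Hcomb' N (fun i => b _ (psi i))).
  rewrite (form_sumr S) ?(form_suml S) //; try by move=> i _; apply: (siZ S).
  congr (_ - _); apply: eq_bigr => i _.
  by rewrite (formZr S) ?(formZl S) // (si_sym S _ Hh) // mulrC.
apply: le_trans (ler_norm _) _; rewrite normrM /u -mulrA ler_wpM2l //.
rewrite mulrC; apply: (form_CS_norm S) => //; exact: Hres.
Qed.

Lemma defect_le l : b (defect l) (defect l) <= delta ^+ 2.
Proof.
apply: le_trans (sum_defect_le l.+1); rewrite big_ord_recr /= lerDr.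
by apply: sumr_ge0 => i _; apply: (si_ge0 S); exact: Hdefect.
Qed.

(** The component of [psi l] outside the sample eigenvectors is controlled by the
    residual equation, even if the latter do not span [H]; the sign convention
    turns [1 - c ^+ 2] into a distance. *)
Lemma eigenvector_error l g : 0 < g -> delta <= g / 2 ->
  g <= w l - w l.+1 -> ((0 < l)%N -> g <= w l.-1 - w l) ->
  0 <= b (psih l) (psi l) ->
  b (psih l - psi l) (psih l - psi l) <= 10 * delta ^+ 2 / g ^+ 2.
Proof.
move=> g0 dg gap1 gap0 sgn.
have gn0 : g != 0 by rewrite gt_eqF.
(* by Weyl's inequalities the other sample eigenvalues keep half of the spacing *)
have sep m : m != l -> g / 2 <= `|wh m - w l|.
  rewrite neq_lt => /orP[|] ml.
    have lp : (0 < l)%N by apply: leq_ltn_trans ml.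
    have : w l.-1 <= w m.
      by apply: (nonincr_le w_dec); rewrite -ltnS prednK.
    have := weyl_lower m; have := gap0 lp => ? ? ?.
    by apply: le_trans (ler_norm _); lra.
  have : wh m <= wh l.+1 by apply: (nonincr_le wh_dec).
  have := weyl_upper l.+1 => ? ?.
  by rewrite -normrN; apply: le_trans (ler_norm _); lra.
set c := b (psi l) (psih l).
have gw : g <= w l by have := w_gt0 l.+1 => ?; lra.
pose h := defect l; have Hh : H h := Hdefect l.
have hd : b h h <= delta ^+ 2 := defect_le l.
have key : 1 - c ^+ 2 <= 5 * delta ^+ 2 / g ^+ 2.
  apply: (le_of_cvg0 (M := l.+1) (cvg0_Ml (2 / w l) (kh_expansion (Hpsi l)))) => N lN.
  pose r := coords_residual b psih N (psi l).
  have Hr : H r := Hresh N (Hpsi l).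
  have rE : b r r = 1 - \sum_(m < N) b (psi l) (psih m) ^+ 2.
    by rewrite /r (residual_sqnorm S Hpsih oneh) // one eqxx.
  have rpsi : b (psi l) r = b r r.
    rewrite rE (formBr S) //; last exact: (Hcombh N (fun m => b (psi l) (psih m))).
    rewrite one eqxx (form_sumr S) //; last by move=> i _; apply: (siZ S).
    by congr (_ - _); apply: eq_bigr => i _; rewrite (formZr S) ?expr2.
  have khr : kh (psi l) r = kh r r.
    have -> : psi l = \sum_(m < N) b (psi l) (psih m) *: psih m + r by rewrite addrC subrK.
    rewrite (formDl Kh) //; last exact: (Hcombh N (fun m => b (psi l) (psih m))).
    rewrite (form_suml Kh) //; last by move=> i _; apply: (siZ S).
    rewrite big1 ?add0r // => i _; rewrite (formZl Kh) // eigh //.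
    have r0 : b r (psih i) = 0.
      exact: (ortho_residualP S (fun i _ => Hpsih i) (@oneh' N)).
    by rewrite (si_sym S (Hpsih i) Hr) r0 !mulr0.
  have hr : b h r = kh r r - w l * b r r by rewrite defectE // rpsi khr.
  have wl0 := w_gt0 l.
  have CS := form_CS S Hh Hr.
  have rr0 := si_ge0 S Hr.
  have q0 := si_ge0 Kh Hr.
  (* the residual equation tested with [r] itself *)
  have r_le : b r r <= 2 / w l * kh r r + b h h / w l ^+ 2.
    rewrite -(ler_pM2l (exprn_gt0 2 wl0)).
    have -> : w l ^+ 2 * (2 / w l * kh r r + b h h / w l ^+ 2) = 2 * w l * kh r r + b h h.
      by field; rewrite gt_eqF.
    have : - (2 * w l * b h r) <= w l ^+ 2 * b r r + b h h.
      have := si_ge0 S (siD S (siZ S (w l) Hr) Hh).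
      rewrite (form_sqD S) ?(form_sqZ S) ?(formZl S) // ?(si_sym S Hr Hh) //; last exact: (siZ S).
      by move=> ?; lra.
    by rewrite hr => ?; nra.
  have sum_le : \sum_(m < N | m != l :> nat) b (psi l) (psih m) ^+ 2 <= 4 / g ^+ 2 * b h h.
    apply: (@le_trans _ _ (4 / g ^+ 2 * \sum_(m < N) b h (psih m) ^+ 2)); last first.
      rewrite ler_wpM2l ?divr_ge0 ?sqr_ge0 //.
      exact: (bessel S (fun i _ => Hpsih i) (@oneh' N)).
    rewrite mulr_sumr big_mkcond /=; apply: ler_sum => m _; case: ifP => [ml|_].
      have -> : b h (psih m) = (wh m - w l) * b (psi l) (psih m) := defect_psih l m.
      rewrite exprMn mulrA -[leLHS]mul1r; apply: ler_wpM2r; first exact: sqr_ge0.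
      have : (g / 2) ^+ 2 <= (wh m - w l) ^+ 2.
        rewrite -[leRHS]real_normK ?num_real //; apply: lerXn2r; rewrite ?nnegrE ?sep //.
        by rewrite divr_ge0 // ltW.
      move=> hh; rewrite -[4 / _]/(4 * _) mulrC mulrA ler_pdivlMr ?exprn_gt0 // mul1r.
      by move: hh; rewrite exprMn exprVn => hh; lra.
    by rewrite mulr_ge0 ?sqr_ge0 // divr_ge0 ?sqr_ge0.
  have split_sum : \sum_(m < N) b (psi l) (psih m) ^+ 2 =
      c ^+ 2 + \sum_(m < N | m != l :> nat) b (psi l) (psih m) ^+ 2.
    by rewrite (bigD1 (Ordinal lN)).
  have wg : b h h / w l ^+ 2 <= delta ^+ 2 / g ^+ 2.
    rewrite ler_pM ?(si_ge0 S) ?invr_ge0 ?sqr_ge0 // lef_pV2 ?posrE ?exprn_gt0 //.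
    by apply: lerXn2r; rewrite ?nnegrE // ltW.
  have hg : 4 / g ^+ 2 * b h h <= 4 / g ^+ 2 * delta ^+ 2.
    by rewrite ler_wpM2l // divr_ge0 // sqr_ge0.
  have -> : 5 * delta ^+ 2 / g ^+ 2 = delta ^+ 2 / g ^+ 2 + 4 / g ^+ 2 * delta ^+ 2 by field.
  by move: rE r_le; rewrite split_sum /r => ? ?; lra.
have c0 : 0 <= c by rewrite /c (si_sym S).
have c1 : c <= 1.
  rewrite -(@ler_pXn2r _ 2) ?nnegrE // expr1n.
  by have := form_CS S (Hpsi l) (Hpsih l); rewrite one oneh !eqxx mulr1.
rewrite (form_sqB S) // one oneh !eqxx (si_sym S) // -/c.
have : c ^+ 2 <= c by rewrite expr2 -[leRHS]mulr1 ler_wpM2l.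
have -> : 10 * delta ^+ 2 / g ^+ 2 = 2 * (5 * delta ^+ 2 / g ^+ 2) by ring.
rewrite (_ : true%:R = 1 :> R) //.
by move=> ?; lra.
Qed.

Section Projection.
Variables (q : nat) (beta : V) (a : nat -> R) (g T T1 T2 : R).
Hypotheses (g_gt0 : 0 < g) (delta_g : delta <= g / 2).
Hypothesis gap : forall l, (l < q)%N ->
  g <= w l - w l.+1 /\ ((0 < l)%N -> g <= w l.-1 - w l).
Hypothesis sgn : forall l, (l < q)%N -> 0 <= b (psih l) (psi l).
Hypothesis Hbeta : H beta.
Hypothesis beta_cvg : (fun L => b (beta - \sum_(l < L) a l *: psi l)
  (beta - \sum_(l < L) a l *: psi l)) @ \oo --> (0 : R).
Hypothesis T_ge : forall L, \sum_(l < L) a l ^+ 2 / w l <= T.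
Hypothesis T1_ge : \sum_(l < q) Num.sqrt (w l) * `|a l| <= T1.
Hypothesis T2_ge : forall L, (q <= L)%N -> \sum_(q <= l < L) w l * a l ^+ 2 <= T2.
Notation s l := (Num.sqrt (w l)).
Notation sh l := (Num.sqrt (wh l)).

Definition estimation_residual := beta -
  \sum_(l < q) (s l / sh l * a l) *: psih l.

Lemma sample_spectrum_gt0 l : (l < q)%N -> 0 < wh l.
Proof.
move=> lq; have [g1 _] := gap lq; have := weyl_lower l; have := w_gt0 l.+1.
by move: delta_g g_gt0 => ? ? ? ?; lra.
Qed.

(** The square roots of the two operators differ by a Sylvester equation:
    [(sh m - s l) * <psi l, psih m> = <defect l, psih m> / (sh m + s l)]; dividing
    by [s l] is harmless because the coefficients of [beta] decay faster. *)
Lemma projection_error :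
  snorm kh estimation_residual <=
  2 * (delta * Num.sqrt T + 4 * delta / g * T1 + Num.sqrt T2).
Proof.
have sgt l : 0 < s l by rewrite sqrtr_gt0.
have sge l : 0 <= sh l by exact: sqrtr_ge0.
have sq l : s l ^+ 2 = w l by rewrite sqr_sqrtr // ltW.
have shq l : sh l ^+ 2 = wh l by rewrite sqr_sqrtr // sample_spectrum_ge0.
have T0 : 0 <= T.
  apply: le_trans (T_ge 0); rewrite big_ord0 //.
have T20 : 0 <= T2 by apply: le_trans (T2_ge (leqnn q)); rewrite big_geq.
pose bL L := \sum_(l < L) a l *: psi l.
pose ph := \sum_(l < q) (s l / sh l * a l) *: psih l.
have Hph : H ph := Hcombh q (fun l => s l / sh l * a l).
have HbL L : H (bL L) := Hcomb' L a.
pose Bx := n%:R^-1 * \sum_(t < n) b (x t) (x t).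
have Bx0 : 0 <= Bx.
  by rewrite mulr_ge0 ?invr_ge0 // sumr_ge0 // => t _; apply: (si_ge0 S).
have sdelta l : (l < q)%N -> snorm b (psi l - psih l) <= 4 * delta / g.
  move=> lq; have [g1 g2] := gap lq.
  have := eigenvector_error g_gt0 delta_g g1 g2 (sgn lq) => h.
  have dg0 : 0 <= 4 * delta / g by rewrite divr_ge0 ?mulr_ge0 // ltW.
  rewrite -ler_sqr ?nnegrE ?snorm_ge0 //.
  rewrite (snorm_sq S) //; last exact: (siB S).
  have -> : b (psi l - psih l) (psi l - psih l) = b (psih l - psi l) (psih l - psi l).
    by rewrite !(form_sqB S) // (si_sym S (Hpsi l) (Hpsih l)); ring.
  apply: le_trans h _; rewrite exprMn exprVn ler_wpM2r ?invr_ge0 ?sqr_ge0 //.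
  by rewrite exprMn ler_wpM2r ?sqr_ge0 //; lra.
have main L : (q <= L)%N -> kh (bL L - ph) (bL L - ph) <=
    2 * (delta ^+ 2 * T) + 2 * (4 * delta / g * T1 + Num.sqrt T2) ^+ 2.
  move=> qL; have Hv : H (bL L - ph) by apply: (siB S).
  pose z := \sum_(l < L) (a l * s l) *: psi l - \sum_(l < q) (a l * s l) *: psih l.
  have Hz1 : H (\sum_(l < L) (a l * s l) *: psi l) := Hcomb' L (fun l => a l * s l).
  have Hz2 : H (\sum_(l < q) (a l * s l) *: psih l) := Hcombh q (fun l => a l * s l).
  have Hz : H z by apply: (siB S).
  have zn : snorm b z <= 4 * delta / g * T1 + Num.sqrt T2.
    have -> : z = \sum_(l < q) (a l * s l) *: (psi l - psih l) +
        \sum_(l < L) (if (q <= l)%N then a l * s l else 0) *: psi l.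
      rewrite /z -!(big_mkord xpredT (fun l => (a l * s l) *: psi l)).
      rewrite (big_cat_nat _ qL) //= -addrA [X in _ + X]addrC addrA; congr (_ + _).
        rewrite big_mkord -sumrB; apply: eq_bigr => l _; by rewrite scalerBr.
      rewrite -(big_mkord xpredT (fun l => (if (q <= l)%N then a l * s l else 0) *: psi l)).
      rewrite [RHS](big_cat_nat _ qL) //=.
      have -> : \sum_(0 <= l < q) (if (q <= l)%N then a l * s l else 0) *: psi l = 0.
        by rewrite big_nat_cond big1 // => l /andP[/andP[_ lq] _]; rewrite leqNgt lq scale0r.
      by rewrite add0r; apply: eq_big_nat => l /andP[-> _].
    apply: le_trans (snorm_triangle S _ (Hcomb' L (fun l => if (q <= l)%N then a l * s l else 0))) _.
      by apply: (si_sum S) => l _; apply: (siZ S); apply: (siB S).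
    apply: lerD.
      apply: le_trans (snorm_sum S _ _) _ => [l _|].
        by apply: (siZ S); apply: (siB S).
      apply: (@le_trans _ _ (4 * delta / g * \sum_(l < q) s l * `|a l|)).
        rewrite mulr_sumr; apply: ler_sum => l _; rewrite (snormZ S); last exact: (siB S).
        rewrite normrM (ger0_norm (ltW (sgt l))) mulrC [X in _ * X]mulrC.
        by rewrite ler_wpM2r ?sdelta // mulr_ge0 // ltW.
      by rewrite ler_wpM2l // divr_ge0 ?mulr_ge0 // ltW.
    rewrite /snorm ler_sqrt //.
    rewrite (ortho_sqnorm S (fun i _ => Hpsi i) (@one' L) (fun l => if (q <= l)%N then a l * s l else 0)).
    apply: le_trans (T2_ge qL).
    rewrite -(big_mkord xpredT (fun l => (if (q <= l)%N then a l * s l else 0) ^+ 2)).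
    rewrite (big_cat_nat _ qL) //=.
    have -> : \sum_(0 <= l < q) (if (q <= l)%N then a l * s l else 0) ^+ 2 = 0.
      by rewrite big_nat_cond big1 // => l /andP[/andP[_ lq] _]; rewrite leqNgt lq /= expr0n.
    rewrite add0r big_nat_cond [leRHS]big_nat_cond; apply: ler_sum => l /andP[/andP[ql _] _].
    by rewrite ql exprMn sq mulrC.
  apply: (le_of_cvg0 (M := q) (kh_expansion Hv)) => N qN.
  rewrite (form_residual S Kh Hpsih oneh eigh) // -lerBlDr opprB addrC subrK.
  (* the Sylvester equation, in the coordinates of the sample eigenvectors *)
  have wm (m : 'I_N) : wh m * b (bL L - ph) (psih m) ^+ 2 =
     (\sum_(l < L) a l * (b (defect l) (psih m) / (sh m + s l)) + b z (psih m)) ^+ 2.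
    rewrite -{1}shq -exprMn; congr (_ ^+ 2).
    rewrite (formBl S) // mulrBr.
    have -> : sh m * b ph (psih m) = b (\sum_(l < q) (a l * s l) *: psih l) (psih m).
      rewrite !(form_suml S) //; try by move=> l _; apply: (siZ S).
      rewrite mulr_sumr; apply: eq_bigr => l _; rewrite !(formZl S) // oneh.
      case: eqP => [<-|_]; last by rewrite !mulr0.
      rewrite !mulr1; have shn0 : sh l != 0 by rewrite gt_eqF // sqrtr_gt0 sample_spectrum_gt0.
      by field.
    rewrite /z (formBl S) // addrA; congr (_ - _).
    rewrite !(form_suml S) //; try by move=> l _; apply: (siZ S).
    rewrite mulr_sumr -big_split /=; apply: eq_bigr => l _.
    rewrite !(formZl S) // defect_psih.
    rewrite (_ : wh m - w l = sh m ^+ 2 - s l ^+ 2); last by rewrite shq sq.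
    have n0 : sh m + s l != 0 by rewrite gt_eqF // ltr_wpDl.
    by field.
  under eq_bigr => m _ do rewrite wm.
  apply: (@le_trans _ _ (\sum_(m < N) (2 * (\sum_(l < L) a l * (b (defect l) (psih m) / (sh m + s l))) ^+ 2
     + 2 * b z (psih m) ^+ 2))).
    apply: ler_sum => m _; set A := \sum_(_ < _) _; set C := b z _.
    by have := sqr_ge0 (A - C) => ?; nra.
  rewrite big_split /= -!mulr_sumr; apply: lerD; rewrite ler_pM2l //; last first.
    apply: le_trans (bessel S (fun i _ => Hpsih i) (@oneh' N) Hz) _.
    rewrite -(snorm_sq S) //; apply: lerXn2r; rewrite ?nnegrE ?snorm_ge0 //.
    exact: le_trans (snorm_ge0 _ _) zn.
  apply: (@le_trans _ _ (\sum_(m < N) T * \sum_(l < L) b (defect l) (psih m) ^+ 2)).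
    apply: ler_sum => m _.
    apply: (@le_trans _ _ ((\sum_(l < L) `|a l| / s l * `|b (defect l) (psih m)|) ^+ 2)).
      rewrite -[leLHS]real_normK ?num_real //; apply: lerXn2r; rewrite ?nnegrE //.
        by apply: sumr_ge0 => l _; rewrite mulr_ge0 // divr_ge0 // ltW.
      apply: le_trans (ler_norm_sum _ _ _) _; apply: ler_sum => l _.
      rewrite !normrM normfV -mulrA ler_wpM2l // mulrC ler_wpM2r //.
      have p0 : 0 < sh m + s l by rewrite ltr_wpDl.
      by rewrite (ger0_norm (ltW p0)) lef_pV2 ?posrE // lerDr.
    apply: le_trans (sum_CS (fun l : 'I_L => `|a l| / s l) (fun l => `|b (defect l) (psih m)|)) _.
    under [X in _ * X <= _]eq_bigr do rewrite real_normK ?num_real //.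
    rewrite ler_wpM2r ?sumr_ge0 // => [l _|]; first exact: sqr_ge0.
    apply: le_trans (T_ge L); apply: ler_sum => l _.
    by rewrite exprMn real_normK ?num_real // exprVn sq.
  rewrite -mulr_sumr [delta ^+ 2 * T]mulrC ler_wpM2l //.
  rewrite exchange_big /=; apply: le_trans (sum_defect_le L); apply: ler_sum => l _.
  exact: (bessel S (fun i _ => Hpsih i) (@oneh' N) (Hdefect l)).
have T10 : 0 <= T1 by apply: le_trans T1_ge; apply: sumr_ge0 => l _; rewrite mulr_ge0 // ltW.
have P0 : 0 <= 4 * delta / g * T1 + Num.sqrt T2.
  by rewrite addr_ge0 ?sqrtr_ge0 // mulr_ge0 // divr_ge0 ?mulr_ge0 // ltW.
have Q0 : 0 <= delta * Num.sqrt T by rewrite mulr_ge0 // sqrtr_ge0.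
apply: (le_of_cvg0 (M := q) (cvg0_sqrt (cvg0_Ml Bx beta_cvg))) => L qL.
have Hd : H (beta - bL L) by apply: (siB S).
have -> : estimation_residual = (bL L - ph) + (beta - bL L).
  by rewrite [RHS]addrC addrA subrK.
apply: le_trans (snorm_triangle Kh (siB S (HbL L) Hph) Hd) _.
apply: lerD; last first.
  by rewrite /snorm ler_sqrt ?sample_form_le // mulr_ge0 // (si_ge0 S).
rewrite -ler_sqr ?nnegrE ?snorm_ge0 ?mulr_ge0 //; last first.
  by rewrite -addrA addr_ge0.
rewrite (snorm_sq Kh); last exact: (siB S).
apply: le_trans (main L qL) _.
set P := 4 * delta / g * T1 + Num.sqrt T2.
rewrite -addrA -/P; set Q := delta * _.
have -> : delta ^+ 2 * T = Q ^+ 2 by rewrite /Q exprMn sqr_sqrtr.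
by have := mulr_ge0 Q0 P0; rewrite -/P -/Q => ?; nra.
Qed.

End Projection.
End Perturbation.

(** * Square-integrable functions *)

Lemma limn_einf_ge0 (R : realType) (u : nat -> \bar R) :
  (forall k, 0 <= u k)%E -> (0 <= limn_einf u)%E.
Proof.
move=> u0; rewrite limn_einf_lim; apply: lime_ge; first exact: is_cvg_einfs.
near=> n; rewrite /einfs; apply: le_ereal_inf_tmp => _ [k _ <-]; exact: u0.
Unshelve. all: by end_near. Qed.

Lemma limn_einf_le (R : realType) (u : nat -> \bar R) e :
  (forall k, u k <= e)%E -> (limn_einf u <= e)%E.
Proof.
move=> ue; rewrite limn_einf_lim; apply: lime_le; first exact: is_cvg_einfs.
near=> n; apply: le_trans (ue n); apply: ereal_inf_lbound; exists n => //=.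
Unshelve. all: by end_near. Qed.

Lemma measurable_limn_einf (R : realType) d (T : measurableType d) (D : set T)
    (f : nat -> T -> \bar R) : (forall n, measurable_fun D (f n)) ->
  measurable_fun D (fun x => limn_einf (f ^~ x)).
Proof.
move=> mf; rewrite (_ : (fun x => _) = -%E \o (fun x => limn_esup (fun n => - f n x)%E)).
  apply: measurableT_comp => //; apply: measurable_fun_limn_esup => n.
  exact: measurableT_comp.
by apply/funext => x /=; rewrite (limn_esupN (f ^~ x)) oppeK.
Qed.

Section L2space.
Context {R : realType} {dT : measure_display} {T : measurableType dT}.
Variable mu : {measure set T -> \bar R}.
Variable D : set T.
Hypothesis mD : measurable D.

Definition L2m : set (T -> R^o) :=
  [set f : T -> R | measurable_fun D f /\ mu.-integrable D (fun x => (f x ^+ 2)%:E)].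

Definition ipm (f g : T -> R) : R := \int[mu]_(x in D) (f x * g x).

Lemma L2m_mul f g : L2m f -> L2m g -> mu.-integrable D (EFin \o (fun x => (f x * g x)%R)).
Proof.
move=> [mf f2] [mg g2]; apply: (le_integrable mD _ _ (integrableD mD f2 g2)).
  by apply/measurable_EFinP; apply: measurable_funM.
move=> x _ /=; rewrite lee_fin [leRHS]ger0_norm; last by rewrite addr_ge0 ?sqr_ge0.
rewrite ler_norml; apply/andP; split.
  by have := sqr_ge0 (f x + g x) => ?; have := sqr_ge0 (f x) => ?; have := sqr_ge0 (g x) => ?; nra.
by have := sqr_ge0 (f x - g x) => ?; have := sqr_ge0 (f x) => ?; have := sqr_ge0 (g x) => ?; nra.
Qed.

Lemma L2mP (f : T -> R) : measurable_fun D f -> (\int[mu]_(x in D) (f x ^+ 2)%:E < +oo)%E -> L2m f.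
Proof.
move=> mf lt; split=> //; apply/integrableP; split.
  by apply/measurable_EFinP; apply: measurable_funX.
by under eq_integral => x _ do rewrite gee0_abs ?lee_fin ?sqr_ge0 //.
Qed.

Lemma L2m_si : semi_inner L2m ipm.
Proof.
have lin (c : R) f g : L2m f -> L2m g -> L2m (fun x => c * f x + g x)%R.
  move=> Lf Lg; have [mf f2] := Lf; have [mg g2] := Lg; split.
    by apply: measurable_funD => //; apply: measurable_funM.
  have := integrableD mD (integrableD mD (integrableZl mD (c ^+ 2)%R f2)
    (integrableZl mD (2 * c)%R (L2m_mul Lf Lg))) g2.
  apply: eq_integrable => // x _ /=; rewrite -!EFinM -!EFinD; congr EFin; ring.
split.
- split; first exact: measurable_cst.
  rewrite (_ : (fun x => _) = cst 0%E); first exact: integrable0.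
  by apply/funext => x /=; rewrite expr0n.
- by move=> c f g Lf Lg; exact: lin.
- by move=> f g _ _; apply: eq_Rintegral => x _; rewrite mulrC.
- move=> c f g h Lf Lg Lh.
  rewrite /ipm -RintegralZl //; last exact: L2m_mul.
  rewrite -RintegralD //; [|by apply: (integrableZl mD c (L2m_mul Lf Lh))|exact: L2m_mul].
  by apply: eq_Rintegral => x _ /=; rewrite mulrDl -mulrA.
- by move=> f _; apply: Rintegral_ge0 => x _; rewrite -expr2 sqr_ge0.
Qed.

Lemma ipm_sqE f : L2m f -> (ipm f f)%:E = (\int[mu]_(x in D) (f x ^+ 2)%:E)%E.
Proof.
move=> [mf f2]; rewrite /ipm /Rintegral fineK; first by apply: eq_integral.
by apply: integrable_fin_num.
Qed.

Lemma ipm_sq0_ae f : L2m f -> ipm f f = 0 -> {ae mu, forall x, D x -> f x = 0}.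
Proof.
move=> Lf f0; have := ipm_sqE Lf; rewrite f0 => /esym I0.
have mf2 : measurable_fun D (fun x => (f x ^+ 2)%:E).
  by apply/measurable_EFinP; apply: measurable_funX; case: Lf.
have [h _] := ae_eq_integral_abs mu mD mf2.
have : ae_eq mu D (fun x => (f x ^+ 2)%:E) (cst 0%E).
  apply: h; rewrite -[RHS]I0; apply: eq_integral => x _.
  by rewrite gee0_abs // lee_fin sqr_ge0.
by apply: filterS => x /= h' Dx; have := h' Dx => -[] /eqP; rewrite sqrf_eq0 => /eqP.
Qed.

(** Weighting the squared increments by [4 ^ k] leaves a convergent sum, so that
    almost everywhere the increments are dominated by a multiple of [2 ^ (- k)]. *)
Lemma ae_cauchy (u : nat -> T -> R) : (forall n, L2m (u n)) ->
  (forall k, ipm (fun x => u k.+1 x - u k x) (fun x => u k.+1 x - u k x) <= 16^-1 ^+ k) ->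
  {ae mu, forall x, D x -> cvgn (u ^~ x)}.
Proof.
move=> Lu uk; pose d k x := u k.+1 x - u k x.
have Ld k : L2m (d k) := siB L2m_si (Lu k.+1) (Lu k).
pose F k x : \bar R := (4 ^+ k * d k x ^+ 2)%:E.
have mF k : measurable_fun D (F k).
  by apply/measurable_EFinP; apply: measurable_funM => //; apply: measurable_funX; case: (Ld k).
have F0 k x : D x -> (0 <= F k x)%E by move=> _; rewrite lee_fin mulr_ge0 ?sqr_ge0 ?exprn_ge0.
have IF k : (\int[mu]_(x in D) F k x <= (4^-1 ^+ k)%:E)%E.
  have -> : (\int[mu]_(x in D) F k x = (4 ^+ k)%:E * \int[mu]_(x in D) (d k x ^+ 2)%:E)%E.
    rewrite -ge0_integralZl_EFin //.
    - by move=> x _; rewrite lee_fin sqr_ge0.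
    - by apply/measurable_EFinP; apply: measurable_funX; case: (Ld k).
  rewrite -(ipm_sqE (Ld k)) -EFinM lee_fin.
  apply: le_trans (ler_wpM2l _ (uk k)) _; first by rewrite exprn_ge0.
  rewrite -exprMn; have -> : 4 * 16^-1 = 4^-1 :> R by field.
  by [].
pose S x := (\sum_(0 <= k <oo) F k x)%E.
have mS : measurable_fun D S.
  by apply: (ge0_emeasurable_sum (P := xpredT)) => // k x Dx _; apply: F0.
have IS : (\int[mu]_(x in D) S x < +oo)%E.
  rewrite (integral_nneseries mu mD mF F0).
  apply: (@le_lt_trans _ _ (\sum_(0 <= k <oo) (4^-1 ^+ k)%:E)%E).
    apply: lee_nneseries => [k _ _|k _]; last exact: IF.
    by apply: integral_ge0 => x Dx; apply: F0.
  have := @cvg_geometric_series R 1 4^-1 _.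
  rewrite ger0_norm ?invr_ge0 // => /(_ ltac:(lra)) cg.
  rewrite (_ : (fun n => _) = EFin \o series (geometric 1 (4^-1 : R))); last first.
    apply/funext => n /=; rewrite /series /= sumEFin; congr EFin.
    by apply: eq_bigr => i _; rewrite /geometric /= mul1r.
  rewrite EFin_lim; first by rewrite ltry.
  by apply/cvg_ex; eexists; exact: cg.
have Sint : mu.-integrable D S.
  apply/integrableP; split=> //.
  rewrite (_ : \int[mu]_(x in D) _ = \int[mu]_(x in D) S x)%E //.
  apply: eq_integral => x; rewrite inE => Dx; rewrite gee0_abs //.
  by apply: nneseries_ge0 => k _ _; apply: F0.
have := integrable_ae mD Sint; apply: filterS => x Sx Dx.
have {}Sx := Sx Dx.
have S0 : (0 <= S x)%E by apply: nneseries_ge0 => k _ _; apply: F0.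
pose C := Num.sqrt (fine (S x)).
have dC k : `|d k x| <= C * 2^-1 ^+ k.
  have h1 : 4 ^+ k * d k x ^+ 2 <= fine (S x).
    rewrite -lee_fin fineK //.
    have := @nneseries_lim_ge R (fun k => F k x) xpredT 0%N k.+1 _.
    rewrite big_mkcond /= big_nat_recr //= => h.
    apply: le_trans (h _) => [|i _ _]; last exact: F0.
    by rewrite leeDr // sume_ge0 // => i _; apply: F0.
  rewrite -ler_sqr ?nnegrE ?mulr_ge0 ?sqrtr_ge0 ?exprn_ge0 // real_normK ?num_real //.
  rewrite exprMn sqr_sqrtr ?fine_ge0 // -exprM mulnC exprM.
  have -> : 2^-1 ^+ 2 = 4^-1 :> R by field.
  by rewrite exprVn ler_pdivlMr ?exprn_gt0 // mulrC.
have cd : cvgn (series (fun k => d k x)).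
  apply: normed_cvg.
  apply: (@series_le_cvg _ _ (fun k => C * 2^-1 ^+ k)) => //.
  - by move=> k /=.
  - by move=> k; rewrite mulr_ge0 ?sqrtr_ge0 ?exprn_ge0.
  - rewrite (_ : (fun k => _) = geometric C 2^-1) //.
    by apply: is_cvg_geometric_series; rewrite ger0_norm ?invr_ge0 //; lra.
have -> : u ^~ x = (fun n => u 0%N x + series (fun k => d k x) n).
  apply/funext => n; rewrite /series /= (@telescope_sumr _ 0 n (fun k => u k x)) //.
  by rewrite addrC subrK.
by apply: is_cvgD => //; exact: is_cvg_cst.
Qed.

(** Riesz-Fischer. The limit is taken along a rapidly converging subsequence, as
    an upper limit so that it is measurable without completing the measure. *)
Lemma L2m_complete : complete_form L2m ipm.
Proof.
move=> u Lu uC.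
have Cg k : exists N, forall m n, (N <= m)%N -> (N <= n)%N ->
    ipm (u m - u n) (u m - u n) < 16^-1 ^+ k by apply: uC; rewrite exprn_gt0.
have [g gP] := choice Cg.
pose h k := (\sum_(i < k.+1) (g i).+1)%N.
have hg k : (g k <= h k)%N by rewrite /h big_ord_recr /= ltnW // ltn_addl.
have kh k : (k <= h k)%N.
  elim: k => // k IH; rewrite /h big_ord_recr /= -/(h k) addnS ltnS.
  exact: leq_trans IH (leq_addr _ _).
have hh k : (h k <= h k.+1)%N by rewrite /h [leqRHS]big_ord_recr /= leq_addr.
have hmono m n : (m <= n)%N -> (h m <= h n)%N.
  by move/subnK <-; elim: (n - m)%N => // i IH; rewrite addSn; apply: leq_trans IH (hh _).
pose v k := u (h k).
have Lv k : L2m (v k) := Lu (h k).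
have vc : {ae mu, forall x, D x -> cvgn (v ^~ x)}.
  apply: ae_cauchy => // k; apply: ltW; apply: gP; [|exact: hg].
  exact: leq_trans (hg k) (hh k).
pose f x := fine (limn_esup (fun k => (v k x)%:E)).
have mf : measurable_fun D f.
  apply: (measurableT_comp (f := fine)); first exact: fine_measurable.
  by apply: measurable_fun_limn_esup => k; apply/measurable_EFinP; case: (Lv k).
have vf : {ae mu, forall x, D x -> (fun k => v k x) @ \oo --> f x}.
  apply: filterS vc => x cx Dx; have {}cx := cx Dx.
  have : (fun k => (v k x)%:E) @ \oo --> (limn (v ^~ x))%:E by apply/cvg_EFin; [near=> k|].
  by rewrite /f => /cvg_limn_einf_sup [_ ->].
have key N e : 0 < e -> (forall m n, (N <= m)%N -> (N <= n)%N -> ipm (u m - u n) (u m - u n) < e) ->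
   forall n, (N <= n)%N -> (\int[mu]_(x in D) ((f x - u n x) ^+ 2)%:E <= e%:E)%E.
  move=> e0 NP n Nn.
  have mw k : measurable_fun D (fun x => ((v (k + N)%N x - u n x) ^+ 2)%:E).
    apply/measurable_EFinP; apply: measurable_funX.
    by apply: measurable_funB; [case: (Lv (k + N)%N)|case: (Lu n)].
  apply: le_trans (_ : _ <= \int[mu]_(x in D) limn_einf (fun k => ((v (k + N)%N x - u n x) ^+ 2)%:E))%E _.
    apply: ae_ge0_le_integral => //.
    - by move=> x _; rewrite lee_fin sqr_ge0.
    - by apply/measurable_EFinP; apply: measurable_funX; apply: measurable_funB => //; case: (Lu n).
    - by move=> x _; apply: limn_einf_ge0 => k; rewrite lee_fin sqr_ge0.
    - exact: measurable_limn_einf.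
    - apply: filterS vf => x cx Dx; have {}cx := cx Dx.
      have : (fun k => ((v (k + N)%N x - u n x) ^+ 2)%:E) @ \oo --> ((f x - u n x) ^+ 2)%:E.
        apply: cvg_EFin; first by near=> k.
        have cN : (fun k => v (k + N)%N x) @ \oo --> f x by rewrite (cvg_shiftn N (v ^~ x)).
        under eq_fun do rewrite /= expr2; rewrite expr2.
        by apply: cvgM; apply: cvgB => //; exact: cvg_cst.
      by move=> /cvg_limn_einf_sup [-> _].
  apply: le_trans (fatou mu mD mw _) _ => [k x _|]; first by rewrite lee_fin sqr_ge0.
  have le k : (\int[mu]_(x in D) ((v (k + N)%N x - u n x) ^+ 2)%:E <= e%:E)%E.
    have Ld : L2m (v (k + N)%N - u n) by apply: (siB L2m_si).
    rewrite -(ipm_sqE Ld) lee_fin ltW //; apply: NP => //.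
    exact: leq_trans (leq_addl k N) (kh _).
  exact: limn_einf_le.
have Lf : L2m f.
  have [N NP] := uC 1 ltr01.
  have Ld : L2m (f - u N).
    apply: L2mP; first by apply: measurable_funB => //; case: (Lu N).
    exact: le_lt_trans (key N 1 ltr01 NP N (leqnn N)) (ltry _).
  by rewrite -(subrK (u N) f); exact: (siD L2m_si).
exists f => // e e0; have [N NP] := uC (e / 2) (divr_gt0 e0 (ltr0n _ 2)).
exists N => n Nn; have Ld : L2m (f - u n) by apply: (siB L2m_si).
rewrite -lte_fin (ipm_sqE Ld); apply: le_lt_trans (key N _ (divr_gt0 e0 (ltr0n _ 2)) NP n Nn) _.
by rewrite lte_fin; lra.
Unshelve. all: by end_near. Qed.

End L2space.

(** * Functions of two variables *)

Section ProductL2.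
Context {R : realType} {d1 d2 : measure_display}
  {T1 : measurableType d1} {T2 : measurableType d2}.
Variables (m1 : {sigma_finite_measure set T1 -> \bar R})
  (m2 : {sigma_finite_measure set T2 -> \bar R}).

Lemma measurable_parameter_integral (F : T1 * T2 -> R) : measurable_fun setT F ->
  measurable_fun setT (fun x => \int[m2]_y (F (x, y))%:E)%E.
Proof.
move=> mF; under eq_fun do rewrite integralE.
apply: emeasurable_funB.
- rewrite (_ : (fun x => _) = fubini_F m2 ((EFin \o F)^\+)%E).
    apply: measurable_fun_fubini_tonelli_F; last by move=> x; exact: funepos_ge0.
    by apply: measurable_funepos; apply/measurable_EFinP.
  by apply/funext => x; apply: eq_integral => y _; rewrite unlock.
- rewrite (_ : (fun x => _) = fubini_F m2 ((EFin \o F)^\-)%E).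
    apply: measurable_fun_fubini_tonelli_F; last by move=> x; exact: funeneg_ge0.
    by apply: measurable_funeneg; apply/measurable_EFinP.
  by apply/funext => x; apply: eq_integral => y _; rewrite unlock.
Qed.

Variables (D1 : set T1) (D2 : set T2).
Hypotheses (mD1 : measurable D1) (mD2 : measurable D2).

Lemma measurable_rectangle : measurable (D1 `*` D2).
Proof. exact: measurableX. Qed.
Let mD := measurable_rectangle.

Lemma in_rectangle x y : D1 x -> ((x, y) \in D1 `*` D2) = (y \in D2).
Proof. by move=> Dx; apply/idP/idP; rewrite !inE /=; [case | split]. Qed.

Lemma patch_rectangle (F : T1 * T2 -> R) x : D1 x ->
  (fun y => (F \_ (D1 `*` D2)) (x, y)) = (fun y => F (x, y)) \_ D2.
Proof.
by move=> Dx; apply/funext => y; rewrite /patch in_rectangle. Qed.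

Lemma measurable_section_integral (F : T1 * T2 -> R) : measurable_fun (D1 `*` D2) F ->
  measurable_fun D1 (fun x => \int[m2]_(y in D2) F (x, y)).
Proof.
move=> /(measurable_restrictT F mD)/measurable_parameter_integral mI.
apply: (eq_measurable_fun (fun x => fine (\int[m2]_y ((F \_ (D1 `*` D2)) (x, y))%:E)%E)).
  move=> x; rewrite inE => Dx; rewrite (Rintegral_mkcond m2 D2) /Rintegral.
  by congr fine; apply: eq_integral => y _; rewrite -(patch_rectangle F Dx).
apply: measurable_funTS; apply: (measurableT_comp (f := fine)) => //.
Qed.

Lemma measurable_section (F : T1 * T2 -> R) x : D1 x -> measurable_fun (D1 `*` D2) F ->
  measurable_fun D2 (fun y => F (x, y)).
Proof.
move=> Dx /(measurable_restrictT F mD) mF; apply/(measurable_restrictT _ mD2).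
rewrite -patch_rectangle //.
by apply: (measurableT_comp mF); exact: pair1_measurable.
Qed.

Lemma tonelli_rectangle (F : T1 * T2 -> R) : measurable_fun (D1 `*` D2) F ->
  (forall z, 0 <= F z) ->
  (\int[m1 \x m2]_(z in D1 `*` D2) (F z)%:E =
   \int[m1]_(x in D1) \int[m2]_(y in D2) (F (x, y))%:E)%E.
Proof.
move=> /(measurable_restrictT F mD) mF F0.
rewrite integral_mkcond [RHS]integral_mkcond.
have -> : ((fun z => (F z)%:E) \_ (D1 `*` D2)) = EFin \o (F \_ (D1 `*` D2)).
  by rewrite restrict_EFin.
rewrite fubini_tonelli1; last 2 first.
- exact/measurable_EFinP.
- by move=> z /=; rewrite lee_fin /patch; case: ifP.
apply: eq_integral => x _; rewrite /fubini_F /patch; case: ifPn => [|]; rewrite ?inE ?notin_setE => Dx.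
  rewrite [RHS]integral_mkcond; apply: eq_integral => y _ /=.
  by rewrite in_rectangle // /patch; case: ifP.
rewrite integral0_eq // => y _ /=; case: ifPn => //; rewrite inE => -[] //.
Qed.

Lemma tonelli_rectangle_swap (F : T1 * T2 -> R) : measurable_fun (D1 `*` D2) F ->
  (forall z, 0 <= F z) ->
  (\int[m1 \x m2]_(z in D1 `*` D2) (F z)%:E =
   \int[m2]_(y in D2) \int[m1]_(x in D1) (F (x, y))%:E)%E.
Proof.
move=> /(measurable_restrictT F mD) mF F0.
rewrite integral_mkcond [RHS]integral_mkcond.
have -> : ((fun z => (F z)%:E) \_ (D1 `*` D2)) = EFin \o (F \_ (D1 `*` D2)).
  by rewrite restrict_EFin.
rewrite fubini_tonelli2; last 2 first.
- exact/measurable_EFinP.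
- by move=> z /=; rewrite lee_fin /patch; case: ifP.
apply: eq_integral => y _; rewrite /fubini_G /patch; case: ifPn => [|]; rewrite ?inE ?notin_setE => Dy.
  rewrite [RHS]integral_mkcond; apply: eq_integral => x _ /=; rewrite /patch.
  case: ifPn; case: ifPn => //; rewrite ?inE ?notin_setE.
    by move=> nD [].
  by move=> Dx []; split.
rewrite integral0_eq // => x _ /=; case: ifPn => //; rewrite inE => -[] //.
Qed.

Notation L2P := (L2m (m1 \x m2)%E (D1 `*` D2)).
Notation ipP := (ipm (m1 \x m2)%E (D1 `*` D2)).

Lemma L2_tensor f g : L2m m1 D1 f -> L2m m2 D2 g -> L2P (fun z => f z.1 * g z.2 : R).
Proof.
move=> Lf Lg; have [mf f2] := Lf; have [mg g2] := Lg.
have m : measurable_fun (D1 `*` D2) (fun z => f z.1 * g z.2 : R).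
  apply: measurable_funM.
  - apply/(measurable_restrictT _ mD).
    rewrite (_ : _ \_ _ = (fun z => (f \_ D1) z.1 * (\1_D2 z.2))).
      apply: measurable_funM; last by apply: measurableT_comp.
      by apply: measurableT_comp => //; apply/(measurable_restrictT _ mD1).
    apply/funext => -[x y]; rewrite /patch /= indicE /=.
    case: ifPn; rewrite ?inE ?notin_setE /=.
      by move=> [Dx Dy]; rewrite ifT ?inE // mem_set // mulr1.
    case: ifPn; rewrite ?inE ?notin_setE => Dx nD; last by rewrite mul0r.
    by case: (boolP (y \in D2)); rewrite ?inE ?mulr0 // => Dy; case: nD.
  - apply/(measurable_restrictT _ mD).
    rewrite (_ : _ \_ _ = (fun z => (\1_D1 z.1) * (g \_ D2) z.2)).
      apply: measurable_funM; first by apply: measurableT_comp.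
      by apply: measurableT_comp => //; apply/(measurable_restrictT _ mD2).
    apply/funext => -[x y]; rewrite /patch /= indicE /=.
    case: ifPn; rewrite ?inE ?notin_setE /=.
      by move=> [Dx Dy]; rewrite [in RHS]ifT ?inE // mem_set // mul1r.
    case: ifPn; rewrite ?inE ?notin_setE => Dy nD; last by rewrite mulr0.
    by case: (boolP (x \in D1)); rewrite ?inE ?mul0r // => Dx; case: nD.
apply: L2mP => //.
rewrite (@tonelli_rectangle (fun z => (f z.1 * g z.2) ^+ 2)) //; last 2 first.
- exact: measurable_funX.
- by move=> z; exact: sqr_ge0.
rewrite (_ : \int[m1]_(x in D1) _ = \int[m1]_(x in D1) ((ipm m2 D2 g g)%:E * (f x ^+ 2)%:E))%E.
  rewrite ge0_integralZl_EFin //; last 3 first.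
  - by move=> x _; rewrite lee_fin sqr_ge0.
  - by apply/measurable_EFinP; exact: measurable_funX.
  - exact: (si_ge0 (L2m_si m2 mD2) Lg).
  by rewrite -(ipm_sqE mD1 Lf) -EFinM ltry.
apply: eq_integral => x _; rewrite (ipm_sqE mD2 Lg) muleC.
rewrite -ge0_integralZl_EFin //; last 3 first.
- by move=> y _; rewrite lee_fin sqr_ge0.
- by apply/measurable_EFinP; exact: measurable_funX.
- exact: sqr_ge0.
by apply: eq_integral => y _; rewrite exprMn EFinM.
Qed.

Lemma L2_section_ae F : L2P F ->
  {ae m1, forall x, D1 x -> L2m m2 D2 (fun y => F (x, y))}.
Proof.
move=> [mF F2]; have mF2 : measurable_fun (D1 `*` D2) (fun z => F z ^+ 2) by exact: measurable_funX.
have lt := integrable_lty mD F2.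
rewrite tonelli_rectangle // in lt; last by move=> z; exact: sqr_ge0.
pose G x := (\int[m2]_(y in D2) (F (x, y) ^+ 2)%:E)%E.
have mG : measurable_fun D1 G.
  have := (measurable_parameter_integral (proj1 (measurable_restrictT _ mD) mF2)).
  move=> /(measurable_funTS (D := D1)); apply: eq_measurable_fun => x; rewrite inE => Dx.
  rewrite /G [RHS]integral_mkcond; apply: eq_integral => y _.
  by rewrite /patch in_rectangle //; case: ifP.
have iG : m1.-integrable D1 G.
  apply/integrableP; split=> //.
  rewrite (_ : \int[m1]_(x in D1) _ = \int[m1]_(x in D1) G x)%E //.
  apply: eq_integral => x _; rewrite gee0_abs //.
  by apply: integral_ge0 => y _; rewrite lee_fin sqr_ge0.
apply: filterS (integrable_ae mD1 iG) => x Gx Dx; have {}Gx := Gx Dx.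
apply: L2mP; first exact: measurable_section.
by move: Gx; rewrite ge0_fin_numE //; apply: integral_ge0 => y _; rewrite lee_fin sqr_ge0.
Qed.

Lemma fubini_tensor F f g : L2P F -> L2m m1 D1 f -> L2m m2 D2 g ->
  ipP F (fun z => f z.1 * g z.2) =
  ipm m1 D1 f (fun x => ipm m2 D2 (fun y => F (x, y)) g).
Proof.
move=> LF Lf Lg; have Lfg := L2_tensor Lf Lg.
have /= int := L2m_mul mD LF Lfg.
pose K := (fun z => F z * (f z.1 * g z.2)) \_ (D1 `*` D2).
have iK : (m1 \x m2)%E.-integrable setT (EFin \o K).
  by rewrite /K -restrict_EFin; exact: (proj1 (integrable_mkcond _ mD) int).
rewrite /ipm Rintegral_mkcond /Rintegral -/K.
rewrite -(integral12_prod_meas1 iK) [in RHS]integral_mkcond; congr fine.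
have mFg : measurable_fun (D1 `*` D2) (fun z => F z * g z.2).
  apply: measurable_funM; first by case: LF.
  have [mg _] := Lg; apply/(measurable_restrictT _ mD).
  rewrite (_ : _ \_ _ = (fun z => (\1_D1 z.1) * (g \_ D2) z.2)).
    apply: measurable_funM; first by apply: measurableT_comp.
    by apply: measurableT_comp => //; apply/(measurable_restrictT _ mD2).
  apply/funext => -[x y]; rewrite /patch /= indicE /=.
  case: ifPn; rewrite ?inE ?notin_setE /=.
    by move=> [Dx Dy]; rewrite [in RHS]ifT ?inE // mem_set // mul1r.
  case: ifPn; rewrite ?inE ?notin_setE => Dy nD; last by rewrite mulr0.
  by case: (boolP (x \in D1)); rewrite ?inE ?mul0r // => Dx; case: nD.
have mG := measurable_section_integral mFg.
apply: ae_eq_integral => //.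
- exact: (measurable_fubini_F iK).
- apply/(measurable_restrictT _ mD1)/measurable_EFinP.
  by apply: measurable_funM => //; case: Lf.
have ae := L2_section_ae LF.
apply: filterS ae => x LFx _; rewrite /fubini_F /patch.
case: ifPn; rewrite ?inE ?notin_setE => Dx; last first.
  by rewrite integral0_eq // => y _ /=; rewrite /K /patch; case: ifPn => //; rewrite inE => -[].
have {}LFx := LFx Dx; have i1 := L2m_mul mD2 LFx Lg.
rewrite EFinM fineK; last exact: integrable_fin_num.
rewrite -integralZl // [RHS]integral_mkcond; apply: eq_integral => y _ /=.
rewrite /K /patch in_rectangle //.
by case: ifP => // _; rewrite -EFinM; congr EFin; ring.
Qed.

End ProductL2.

(** ** Exchanging the order of integration *)

Section SwapL2.
Context {R : realType} {d1 d2 : measure_display}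
  {T1 : measurableType d1} {T2 : measurableType d2}.
Variables (m1 : {sigma_finite_measure set T1 -> \bar R})
  (m2 : {sigma_finite_measure set T2 -> \bar R}).
Variables (D1 : set T1) (D2 : set T2).
Hypotheses (mD1 : measurable D1) (mD2 : measurable D2).
Notation L2P := (L2m (m1 \x m2)%E (D1 `*` D2)).
Notation L2S := (L2m (m2 \x m1)%E (D2 `*` D1)).

Lemma measurable_swap_rectangle (F : T1 * T2 -> R) : measurable_fun (D1 `*` D2) F ->
  measurable_fun (D2 `*` D1) (fun z => F (z.2, z.1)).
Proof.
have mD := measurable_rectangle mD1 mD2; have mD' := measurable_rectangle mD2 mD1.
move=> /(measurable_restrictT F mD) mF; apply/(measurable_restrictT _ mD').
rewrite (_ : _ \_ _ = (F \_ (D1 `*` D2)) \o (fun z => (z.2, z.1))).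
  by apply: (measurableT_comp mF); apply: measurable_fun_pair.
apply/funext => -[y x]; rewrite /patch /=.
case: ifPn; case: ifPn => //; rewrite ?inE ?notin_setE /=.
  by move=> n [? ?]; case: n.
by move=> [? ?] n; case: n.
Qed.

Lemma L2_swap F : L2P F -> L2S (fun z => F (z.2, z.1)).
Proof.
move=> [mF F2]; apply: L2mP; first exact: measurable_swap_rectangle.
have := integrable_lty (measurable_rectangle mD1 mD2) F2.
have mF2 : measurable_fun (D1 `*` D2) (fun z => F z ^+ 2) by exact: measurable_funX.
rewrite (tonelli_rectangle_swap m1 m2 mD1 mD2 mF2) => [|z]; last exact: sqr_ge0.
rewrite (tonelli_rectangle m2 m1 mD2 mD1 (measurable_swap_rectangle mF2)) // => z; exact: sqr_ge0.
Qed.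

Lemma fubini_swap F f g : L2P F -> L2m m1 D1 f -> L2m m2 D2 g ->
  ipm m1 D1 f (fun x => ipm m2 D2 (fun y => F (x, y)) g) =
  ipm m2 D2 g (fun y => ipm m1 D1 (fun x => F (x, y)) f).
Proof.
move=> LF Lf Lg; have mD := measurable_rectangle mD1 mD2.
have mD' := measurable_rectangle mD2 mD1.
rewrite -(fubini_tensor mD1 mD2 LF Lf Lg) -(fubini_tensor mD2 mD1 (L2_swap LF) Lg Lf).
have i1 := L2m_mul mD LF (L2_tensor mD1 mD2 Lf Lg).
have i2 := L2m_mul mD' (L2_swap LF) (L2_tensor mD2 mD1 Lg Lf).
pose K := (fun z => F z * (f z.1 * g z.2)) \_ (D1 `*` D2).
pose K' := (fun z => F (z.2, z.1) * (g z.1 * f z.2)) \_ (D2 `*` D1).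
have iK : (m1 \x m2)%E.-integrable setT (EFin \o K).
  by rewrite /K -restrict_EFin; exact: (proj1 (integrable_mkcond _ mD) i1).
have iK' : (m2 \x m1)%E.-integrable setT (EFin \o K').
  by rewrite /K' -restrict_EFin; exact: (proj1 (integrable_mkcond _ mD') i2).
rewrite /ipm Rintegral_mkcond [in RHS]Rintegral_mkcond /Rintegral -/K -/K'; congr fine.
rewrite -(integral12_prod_meas1 iK) -(integral12_prod_meas1 iK') (Fubini iK).
apply: eq_integral => y _; apply: eq_integral => x _ /=.
rewrite /K /K' /patch; case: ifPn; case: ifPn => //; rewrite ?inE ?notin_setE /=.
- by move=> _ _; congr EFin; ring.
- by move=> n [? ?]; case: n.
- by move=> [? ?] n; case: n.
Qed.

(** Cauchy-Schwarz in the inner variable. The same bound serves Hilbert-Schmidt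
    operators and the scores of a random function. *)
Lemma L2_section_integral F g : L2P F -> L2m m2 D2 g ->
  L2m m1 D1 (fun x => ipm m2 D2 (fun y => F (x, y)) g) /\
  ipm m1 D1 (fun x => ipm m2 D2 (fun y => F (x, y)) g)
    (fun x => ipm m2 D2 (fun y => F (x, y)) g) <=
  ipm (m1 \x m2)%E (D1 `*` D2) F F * ipm m2 D2 g g.
Proof.
move=> LF Lg; have mD := measurable_rectangle mD1 mD2.
have [mF F2] := LF; have [mg g2] := Lg.
have S2 := L2m_si m2 mD2.
have mG : measurable_fun D1 (fun x => ipm m2 D2 (fun y => F (x, y)) g).
  apply: (measurable_section_integral m2 mD1 mD2 (F := fun z => F z * g z.2)).
  apply: measurable_funM => //.
  apply/(measurable_restrictT _ mD).
  rewrite (_ : _ \_ _ = (fun z => (\1_D1 z.1) * (g \_ D2) z.2)).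
    apply: measurable_funM; first by apply: measurableT_comp.
    by apply: measurableT_comp => //; apply/(measurable_restrictT _ mD2).
  apply/funext => -[x y]; rewrite /patch /= indicE /=.
  case: ifPn; rewrite ?inE ?notin_setE /=.
    by move=> [Dx Dy]; rewrite [in RHS]ifT ?inE // mem_set // mul1r.
  case: ifPn; rewrite ?inE ?notin_setE => Dy nD; last by rewrite mulr0.
  by case: (boolP (x \in D1)); rewrite ?inE ?mul0r // => Dx; case: nD.
have le : (\int[m1]_(x in D1) ((ipm m2 D2 (fun y => F (x, y)) g) ^+ 2)%:E <=
   (ipm (m1 \x m2)%E (D1 `*` D2) F F * ipm m2 D2 g g)%:E)%E.
  rewrite EFinM (ipm_sqE mD LF).
  rewrite (tonelli_rectangle m1 m2 mD1 mD2 (measurable_funX 2 mF)) => [|z]; last exact: sqr_ge0.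
  have mN : measurable_fun D1 (fun x => \int[m2]_(y in D2) (F (x, y) ^+ 2)%:E)%E.
    have := (measurable_parameter_integral m2 (proj1 (measurable_restrictT _ mD) (measurable_funX 2 mF))).
    move=> /(measurable_funTS (D := D1)); apply: eq_measurable_fun => x; rewrite inE => Dx.
    rewrite [RHS]integral_mkcond; apply: eq_integral => y _.
    by rewrite /patch in_rectangle //; case: ifP.
  have N0 x : (0 <= \int[m2]_(y in D2) (F (x, y) ^+ 2)%:E)%E.
    by apply: integral_ge0 => y _; rewrite lee_fin sqr_ge0.
  rewrite muleC -ge0_integralZl_EFin //; last exact: (si_ge0 S2).
  apply: ae_ge0_le_integral => //.
  - by move=> x _; rewrite lee_fin sqr_ge0.
  - by apply/measurable_EFinP; exact: measurable_funX.
  - by move=> x _; rewrite mule_ge0 // lee_fin (si_ge0 S2).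
  - exact: measurable_funeM.
  apply: filterS (L2_section_ae mD1 mD2 LF) => x Lx Dx; have {}Lx := Lx Dx.
  rewrite -(ipm_sqE mD2 Lx) -EFinM lee_fin mulrC; exact: (form_CS S2).
have LG : L2m m1 D1 (fun x => ipm m2 D2 (fun y => F (x, y)) g).
  by apply: L2mP => //; apply: le_lt_trans le (ltry _).
by split=> //; rewrite -lee_fin (ipm_sqE mD1 LG).
Qed.

End SwapL2.

(** ** Null sets, means and covariances *)

Section AlmostEverywhere.
Context {R : realType} {dT : measure_display} {T : measurableType dT}.
Variables (mu : {measure set T -> \bar R}) (D : set T).
Hypothesis mD : measurable D.

Lemma L2m_ae f g : L2m mu D f -> measurable_fun D g ->
  {ae mu, forall x, D x -> g x = f x} -> L2m mu D g.
Proof.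
move=> Lf mg fg; apply: L2mP => //.
rewrite (_ : (\int[mu]_(x in D) _)%E = (\int[mu]_(x in D) (f x ^+ 2)%:E)%E).
  by case: Lf => _; exact: integrable_lty.
apply: ae_eq_integral => //.
- by apply/measurable_EFinP; apply: measurable_funX.
- by apply/measurable_EFinP; apply: measurable_funX; case: Lf.
- by apply: filterS fg => x fg Dx; rewrite /= fg.
Qed.

Lemma ipm_ae f f' h : L2m mu D f -> L2m mu D f' -> L2m mu D h ->
  {ae mu, forall x, D x -> f x = f' x} -> ipm mu D f h = ipm mu D f' h.
Proof.
move=> Lf Lf' Lh ff; rewrite /ipm /Rintegral; congr fine; apply: ae_eq_integral => //.
- by case/integrableP: (L2m_mul mD Lf Lh).
- by case/integrableP: (L2m_mul mD Lf' Lh).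
- by apply: filterS ff => x ff Dx; rewrite /= ff.
Qed.

End AlmostEverywhere.

Section Covariance.
Context {R : realType} {dsp : measure_display} {Om : measurableType dsp}.
Variable P : probability Om R.
Notation ipP := (ipm P setT).
Notation L2P := (L2m P setT).

Lemma L2m_one : L2P (cst 1).
Proof.
split; first exact: measurable_cst.
rewrite (_ : (fun x => _) = EFin \o cst 1); first exact: finite_measure_integrable_cst.
by apply/funext => w /=; rewrite expr1n.
Qed.

Definition mean (V : Om -> R) : R := ipP V (cst 1).

Lemma meanE V : mean V = fine ('E_P[V])%E.
Proof. by rewrite unlock /mean /ipm /Rintegral; congr fine; apply: eq_integral => w _; rewrite mulr1. Qed.

Lemma ipm11 : ipP (cst 1) (cst 1) = 1.
Proof.
rewrite /ipm /Rintegral (_ : (fun x => _) = cst 1%E).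
  by rewrite integral_cst //= mul1e probability_setT.
by apply/funext => w /=; rewrite mulr1.
Qed.

Lemma covE V W : L2P V -> L2P W -> cov P V W = ipP V W - mean V * mean W.
Proof.
move=> LV LW; have S := L2m_si P measurableT.
rewrite /cov covariance.unlock -(meanE V) -(meanE W) expectation.unlock.
have -> : fine (\int[P]_w (((V \- cst (mean V)) * (W \- cst (mean W)))%R w)%:E)%E =
   ipP (V - mean V *: (cst 1 : Om -> R^o)) (W - mean W *: (cst 1 : Om -> R^o)).
  have e (c : R) : c *: (cst 1 : Om -> R^o) = cst c.
    by apply/funext => w; exact: mulr1.
  by rewrite !e.
have L1 := L2m_one.
have Z c : L2P (c *: (cst 1 : Om -> R^o)) := siZ S c L1.
rewrite (formBl S) ?(formBr S) ?(formZl S) ?(formZr S) //; try by [exact: (siB S)|exact: (Z _)].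
by rewrite ipm11 /mean (si_sym S LV L1) (si_sym S LW L1); ring.
Qed.

End Covariance.

Lemma ae_imp {R : realType} {d} {T : measurableType d} (mu : {measure set T -> \bar R})
  (A B : T -> Prop) : {ae mu, forall x, A x} -> (forall x, A x -> B x) -> {ae mu, forall x, B x}.
Proof. by move=> h AB; apply: filterS h. Qed.

(** * Random functions and covariance operators *)

Section Functional.
Context {R : realType} {dsp : measure_display} {Om : measurableType dsp}.
Variable P : probability Om R.
Variable U : set R.
Hypothesis mU : measurable (U : set (measurableTypeR R)).
Notation leb := (@lebesgue_measure R).
Notation L2P := (L2m P setT).
Notation ipP := (ipm P setT).
Notation L2OU := (L2m (P \x leb)%E (setT `*` U)).
Notation ipOU := (ipm (P \x leb)%E (setT `*` U)).
Notation unc V := (fun z : Om * R => V z.1 z.2).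

Lemma L2_semi_inner : semi_inner (L2 U : set (R -> R^o)) (ip U).
Proof. exact: (L2m_si leb mU). Qed.

Lemma L2U_complete : complete_form (L2 U : set (R -> R^o)) (ip U).
Proof. exact: (L2m_complete (mu := leb) mU). Qed.

Let mTU : measurable ([set: Om] `*` (U : set (measurableTypeR R))).
Proof. exact: measurableX. Qed.

Lemma random_L2 (V : Om -> R -> R) :
  measurable_fun (setT `*` U) (unc V) -> (forall w, L2 U (V w)) ->
  (\int[P]_w (ip U (V w) (V w))%:E < +oo)%E ->
  L2OU (unc V) /\ ((ipOU (unc V) (unc V))%:E = \int[P]_w (ip U (V w) (V w))%:E)%E.
Proof.
move=> mV LV lt.
have E : (\int[P \x leb]_(z in setT `*` U) (V z.1 z.2 ^+ 2)%:E = \int[P]_w (ip U (V w) (V w))%:E)%E.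
  rewrite (tonelli_rectangle P leb measurableT mU (measurable_funX 2 mV)) => [|z]; last exact: sqr_ge0.
  by apply: eq_integral => w _; rewrite -(ipm_sqE mU (LV w)).
have L : L2OU (unc V) by apply: L2mP => //; rewrite E.
by split=> //; rewrite (ipm_sqE mTU L).
Qed.

Lemma ip_L2P V f : L2OU (unc V) -> L2 U f ->
  L2P (fun w => ip U f (V w)) /\
  ipP (fun w => ip U f (V w)) (fun w => ip U f (V w)) <= ipOU (unc V) (unc V) * ip U f f.
Proof.
move=> LV Lf; have e : (fun w => ip U f (V w)) = (fun w => ipm leb U (fun u => V w u) f).
  by apply/funext => w; apply: eq_Rintegral => u _; rewrite mulrC.
by rewrite e; apply: (L2_section_integral measurableT mU LV Lf).
Qed.

Lemma moment_L2 V (h : Om -> R) : L2OU (unc V) -> L2P h ->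
  L2 U (fun u => ipP (V ^~ u) h).
Proof.
move=> LV Lh; have [] := L2_section_integral mU measurableT (L2_swap measurableT mU LV) Lh.
by [].
Qed.

Lemma moment_ip V (h : Om -> R) f : L2OU (unc V) -> L2P h -> L2 U f ->
  ip U f (fun u => ipP (V ^~ u) h) = ipP h (fun w => ip U f (V w)).
Proof.
move=> LV Lh Lf; have := fubini_swap measurableT mU LV Lh Lf.
have -> : (fun x => ipm leb U (fun y => V x y) f) = (fun w => ip U f (V w)).
  by apply/funext => w; apply: eq_Rintegral => u _; rewrite mulrC.
by move=> ->.
Qed.

Lemma section_L2P_ae V : L2OU (unc V) -> {ae leb, forall u, U u -> L2P (V ^~ u)}.
Proof. by move=> LV; apply: (L2_section_ae mU measurableT (L2_swap measurableT mU LV)). Qed.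

Lemma measurable_mean V : measurable_fun (setT `*` U) (unc V) ->
  measurable_fun U (fun u => mean P (V ^~ u)).
Proof.
move=> mV; apply: (measurable_section_integral P mU measurableT
  (F := fun z => V z.2 z.1 * cst 1 z.2)).
by apply: measurable_funM => //; apply: (measurable_swap_rectangle measurableT mU mV).
Qed.

Lemma measurable_cov_fun V : measurable_fun (setT `*` U) (unc V) ->
  measurable_fun (U `*` U) (fun z => cov_fun P V V z.1 z.2).
Proof.
move=> mV; have mUU : measurable (U `*` U : set (measurableTypeR R * measurableTypeR R)).
  exact: measurableX.
have mUUT : measurable ((U `*` U) `*` [set: Om] :
    set ((measurableTypeR R * measurableTypeR R) * Om)) by exact: measurableX.
have mm := measurable_mean mV.
pose F (z : (R * R) * Om) := (V z.2 z.1.1 - mean P (V ^~ z.1.1)) * (V z.2 z.1.2 - mean P (V ^~ z.1.2)).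
apply: (eq_measurable_fun (fun x => \int[P]_(w in setT) F (x, w))).
  move=> [u v] _ /=; rewrite /cov_fun /cov covariance.unlock -!(meanE P (V ^~ _)).
  by rewrite expectation.unlock.
apply: (measurable_section_integral P (F := F) mUU measurableT).
have m1 : measurable_fun ((U `*` U) `*` [set: Om]) (fun z : (R * R) * Om => V z.2 z.1.1 - mean P (V ^~ z.1.1)).
  apply: measurable_funB.
    apply: (measurable_comp (F := setT `*` U) (f := unc V) (g := fun z : (R * R) * Om => (z.2, z.1.1))) => //.
      by move=> _ [[[u v] w] [[Uu Uv] _] <-].
    apply: measurable_funTS; apply: measurable_fun_pair; first exact: measurable_snd.
    by apply: measurableT_comp.
  apply: (measurable_comp (F := U) (f := fun u => mean P (V ^~ u)) (g := fun z : (R * R) * Om => z.1.1)) => //.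
    by move=> _ [[[u v] w] [[Uu Uv] _] <-].
  by apply: measurable_funTS; apply: measurableT_comp.
have m2 : measurable_fun ((U `*` U) `*` [set: Om]) (fun z : (R * R) * Om => V z.2 z.1.2 - mean P (V ^~ z.1.2)).
  apply: measurable_funB.
    apply: (measurable_comp (F := setT `*` U) (f := unc V) (g := fun z : (R * R) * Om => (z.2, z.1.2))) => //.
      by move=> _ [[[u v] w] [[Uu Uv] _] <-].
    apply: measurable_funTS; apply: measurable_fun_pair; first exact: measurable_snd.
    by apply: measurableT_comp.
  apply: (measurable_comp (F := U) (f := fun u => mean P (V ^~ u)) (g := fun z : (R * R) * Om => z.1.2)) => //.
    by move=> _ [[[u v] w] [[Uu Uv] _] <-].
  by apply: measurable_funTS; apply: measurableT_comp.
exact: measurable_funM.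
Qed.

Lemma measurable_kop K f : measurable_fun (U `*` U) (fun z : R * R => K z.1 z.2) ->
  L2 U f -> measurable_fun U (kop U K f).
Proof.
move=> mK [mf _].
apply: (measurable_section_integral leb mU mU (F := fun z => K z.1 z.2 * f z.2)).
apply: measurable_funM => //.
apply: (measurable_comp (F := U) (f := f) (g := snd)) => //.
  by move=> _ [[w u] [_ Uu] <-].
exact: (measurable_funTS measurable_snd).
Qed.

Lemma cov_section_ae V : L2OU (unc V) ->
  {ae leb, forall u, U u -> L2P (V ^~ u) /\ L2 U (cov_fun P V V u)}.
Proof.
move=> LV; have mV : measurable_fun (setT `*` U) (unc V) by case: LV.
have S := L2m_si P measurableT; have L1 := L2m_one P.
have Lm : L2 U (fun u => mean P (V ^~ u)) := moment_L2 LV L1.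
apply: (ae_imp (section_L2P_ae LV)) => u Lu Uu; have {}Lu := Lu Uu; split=> //.
have Lk : L2 U (fun v => ipP (V ^~ v) (V ^~ u)) := moment_L2 LV Lu.
have Lc' : L2 U (fun v => ipP (V ^~ v) (V ^~ u) + (- mean P (V ^~ u)) * mean P (V ^~ v)).
  exact: (siD L2_semi_inner Lk (siZ L2_semi_inner (- mean P (V ^~ u)) Lm)).
apply: (L2m_ae mU Lc').
  by have := measurable_section mU mU Uu (measurable_cov_fun mV).
apply: (ae_imp (section_L2P_ae LV)) => v Lv Uv; have {}Lv := Lv Uv.
by rewrite /cov_fun covE // (si_sym S) // mulNr.
Qed.

Lemma kop_cov_ae V f : L2OU (unc V) -> L2 U f ->
  {ae leb, forall u, U u -> kop U (cov_fun P V V) f u =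
    ipP (V ^~ u) (fun w => ip U f (V w) - mean P (fun w => ip U f (V w)))}.
Proof.
move=> LV Lf; have mV : measurable_fun (setT `*` U) (unc V) by case: LV.
have [Lh _] := ip_L2P LV Lf; have S := L2m_si P measurableT.
pose h w := ip U f (V w).
have L1 := L2m_one P.
have Lm : L2 U (fun u => mean P (V ^~ u)) := moment_L2 LV L1.
apply: (ae_imp (cov_section_ae LV)) => u Lu Uu; have {Lu} [Lu Lc] := Lu Uu.
have -> : kop U (cov_fun P V V) f u =
   ip U f (fun v => ipP (V ^~ v) (V ^~ u)) - mean P (V ^~ u) * ip U f (fun v => mean P (V ^~ v)).
  have Lk : L2 U (fun v => ipP (V ^~ v) (V ^~ u)) := moment_L2 LV Lu.
  have -> : kop U (cov_fun P V V) f u = ipm leb U (cov_fun P V V u) f by [].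
  have Lz := siZ L2_semi_inner (mean P (V ^~ u)) Lm.
  rewrite (ipm_ae mU Lc (siB L2_semi_inner Lk Lz) Lf).
    rewrite -[X in X = _]/(ip U (_ - _) f) (formBl L2_semi_inner) // (formZl L2_semi_inner) //.
    by rewrite (si_sym L2_semi_inner Lk Lf) (si_sym L2_semi_inner Lm Lf).
  apply: (ae_imp (section_L2P_ae LV)) => v Lv Uv; have {}Lv := Lv Uv.
  by rewrite /cov_fun covE // (si_sym S).
rewrite (moment_ip LV Lu Lf) (moment_ip LV L1 Lf).
have -> : (fun w => ip U f (V w) - mean P (fun w => ip U f (V w))) = h - (mean P h *: (cst 1 : Om -> R^o)).
  by apply/funext => w; rewrite -[in LHS](mulr1 (mean P _)).
rewrite (formBr S) //; last exact: (siZ S).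
by rewrite (formZr S) // /mean (si_sym S L1 Lh); congr (_ - _); rewrite mulrC.
Qed.

Lemma kop_cov_L2 V f : L2OU (unc V) -> L2 U f -> L2 U (kop U (cov_fun P V V) f).
Proof.
move=> LV Lf; have [Lh _] := ip_L2P LV Lf; have S := L2m_si P measurableT.
have Lh' : L2P (fun w => ip U f (V w) - mean P (fun w => ip U f (V w))).
  have := siB S Lh (siZ S (mean P (fun w => ip U f (V w))) (L2m_one P)).
  by congr (L2m _ _ _); apply/funext => w; rewrite -[in RHS](mulr1 (mean P _)).
apply: (L2m_ae mU (moment_L2 LV Lh')).
  by apply: measurable_kop => //; apply: measurable_cov_fun; case: LV.
exact: kop_cov_ae.
Qed.

(** Fubini identifies the covariance operator through its weak form. *)
Lemma kop_cov V f g : L2OU (unc V) -> L2 U f -> L2 U g ->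
  ip U g (kop U (cov_fun P V V) f) =
  ipP (fun w => ip U g (V w)) (fun w => ip U f (V w)) -
  mean P (fun w => ip U g (V w)) * mean P (fun w => ip U f (V w)).
Proof.
move=> LV Lf Lg; have S := L2m_si P measurableT.
have [Lhf _] := ip_L2P LV Lf; have [Lhg _] := ip_L2P LV Lg.
have e : (fun w => ip U f (V w) - mean P (fun w => ip U f (V w))) =
    (fun w => ip U f (V w)) - (mean P (fun w => ip U f (V w)) *: (cst 1 : Om -> R^o)).
  by apply/funext => w; rewrite -[in LHS](mulr1 (mean P _)).
have Lh' : L2P (fun w => ip U f (V w) - mean P (fun w => ip U f (V w))).
  by rewrite e; apply: (siB S) => //; apply: (siZ S); exact: L2m_one.
rewrite (si_sym L2_semi_inner) //; last exact: kop_cov_L2.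
rewrite (_ : ip U _ g = ip U (fun u => ipP (V ^~ u) (fun w => ip U f (V w) - mean P (fun w => ip U f (V w)))) g); last first.
  apply: (ipm_ae mU _ _ Lg); [exact: kop_cov_L2 | exact: moment_L2 | exact: kop_cov_ae].
rewrite (si_sym L2_semi_inner) //; last exact: moment_L2.
rewrite moment_ip // e (si_sym S) //; last by rewrite -e.
have L1 := L2m_one P; have LZ := siZ S (mean P (fun w => ip U f (V w))) L1.
rewrite (formBr S Lhf LZ Lhg) (formZr S _ L1 Lhg).
congr (_ - _); exact: mulrC.
Qed.

(** ** Hilbert-Schmidt kernels *)

Lemma kernel_semi_inner : semi_inner (L2m (leb \x leb)%E (U `*` U)) (ipm (leb \x leb)%E (U `*` U)).
Proof. exact: (L2m_si _ (measurable_rectangle mU mU)). Qed.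

Lemma HSnormE K : L2_kernel U K ->
  HSnorm U K = snorm (ipm (leb \x leb)%E (U `*` U)) (fun z : R * R => K z.1 z.2).
Proof. by []. Qed.

Lemma kop_L2 K f : L2_kernel U K -> L2 U f ->
  L2 U (kop U K f) /\ nrm U (kop U K f) <= HSnorm U K * nrm U f.
Proof.
move=> LK Lf; have [Lk le] := L2_section_integral mU mU LK Lf; split=> //.
rewrite /nrm /HSnorm -sqrtrM; last by apply: Rintegral_ge0 => z _; exact: sqr_ge0.
rewrite ler_sqrt; first exact: le.
apply: mulr_ge0; last exact: (si_ge0 L2_semi_inner).
by apply: Rintegral_ge0 => z _; exact: sqr_ge0.
Qed.

Lemma kop_sub_ae K K' f : L2_kernel U K -> L2_kernel U K' -> L2 U f ->
  {ae leb, forall u, U u -> kop U (fun u v => K u v - K' u v) f u = kop U K f u - kop U K' f u}.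
Proof.
move=> LK LK' Lf; have := L2_section_ae mU mU LK; have := L2_section_ae mU mU LK'.
apply: filterS2 => u Lu' Lu Uu; have {}Lu := Lu Uu; have {}Lu' := Lu' Uu.
exact: (formBl L2_semi_inner Lu Lu' Lf).
Qed.

End Functional.

(** ** Orthogonal parts *)

Section OrthogonalPart.
Context {R : realType} {V : lmodType R}.
Variables (H : set V) (b : V -> V -> R) (psi : nat -> V).
Hypothesis S : semi_inner H b.
Hypothesis Hpsi : forall l, H (psi l).
Notation res := (coords_residual b psi).

Lemma Hresidual N f : H f -> H (res N f).
Proof.
by move=> Hf; apply: (siB S) => //; apply: (Hcomb S (fun i _ => Hpsi i) (fun i => b f (psi i))).
Qed.

Lemma residual_sym N f g : H f -> H g -> b (res N f) g = b f (res N g).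
Proof.
move=> Hf Hg; have HP h := Hcomb S (fun i (_ : (i < N)%N) => Hpsi i) (fun i => b h (psi i)).
rewrite (formBl S) // (formBr S) //; congr (_ - _).
rewrite (form_suml S) ?(form_sumr S) //; try by move=> i _; apply: (siZ S).
by apply: eq_bigr => i _; rewrite (formZl S) // (formZr S) // (si_sym S Hg) // mulrC.
Qed.

Lemma cvg_form (u : nat -> V) r h : (forall n, H (u n)) -> H r -> H h ->
  (fun n => b (u n - r) (u n - r)) @ \oo --> (0 : R) -> (fun n => b (u n) h) @ \oo --> b r h.
Proof.
move=> Hu Hr Hh ur.
have : (fun n => Num.sqrt (b h h) * Num.sqrt (b (u n - r) (u n - r))) @ \oo --> (0 : R).
  by apply: cvg0_Ml; exact: cvg0_sqrt.
move=> c0; apply/cvgrPdist_lt => e e0.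
have /cvgrPdist_lt/(_ _ e0)[N _ NP] := c0; exists N => // n Nn.
have /= := NP n Nn; rewrite sub0r normrN; apply: le_lt_trans.
rewrite -(formBl S) //.
rewrite -normrN -(formNl S) // ?opprB; last exact: (siB S).
apply: le_trans (form_CS_norm S (siB S (Hu n) Hr) Hh) _.
by rewrite mulrC ler_norm.
Qed.

Lemma orthogonal_part_sym f g rf rg : H f -> H g -> H rf -> H rg ->
  (fun N => b (res N f - rf) (res N f - rf)) @ \oo --> (0 : R) ->
  (fun N => b (res N g - rg) (res N g - rg)) @ \oo --> (0 : R) ->
  b rf g = b f rg.
Proof.
move=> Hf Hg Hrf Hrg cf cg.
have c1 := cvg_form (fun n => Hresidual n Hf) Hrf Hg cf.
have c2 := cvg_form (fun n => Hresidual n Hg) Hrg Hf cg.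
have E : (fun n => b (res n f) g) = (fun n => b (res n g) f).
  by apply/funext => n; rewrite (residual_sym _ Hf Hg) (si_sym S Hf (Hresidual _ Hg)).
rewrite (si_sym S Hf Hrg) -(cvg_lim (@Rhausdorff R) c1) E.
exact: (cvg_lim (@Rhausdorff R) c2).
Qed.

(** The part of [f] orthogonal to all [psi l] is the closest to zero among the
    parts orthogonal to them, so it is bounded by the distance to any [g] whose own
    orthogonal part does not see [f]. *)
Lemma orthogonal_part_le f g rf : H f -> H g -> H rf ->
  (forall l, b rf (psi l) = 0) ->
  (fun N => b (res N f - rf) (res N f - rf)) @ \oo --> (0 : R) ->
  b rf g = 0 -> b rf rf <= b (f - g) (f - g).
Proof.
move=> Hf Hg Hrf r0 cf rg0.
have e : b rf rf = b rf (f - g).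
  rewrite (formBr S) // rg0 subr0.
  have c := cvg_form (fun n => Hresidual n Hf) Hrf Hrf cf.
  rewrite -(cvg_lim (@Rhausdorff R) c) (_ : (fun n => _) = fun=> b rf f).
    exact: lim_cst.
  apply/funext => N; rewrite (si_sym S) //; last exact: Hresidual.
  rewrite (formBr S) //; last exact: (Hcomb S (fun i _ => Hpsi i) (fun i => b f (psi i))).
  rewrite (form_sumr S) //; last by move=> i _; apply: (siZ S).
  by rewrite big1 ?subr0 // => i _; rewrite (formZr S) // r0 mulr0.
have := form_CS S Hrf (siB S Hf Hg); rewrite -e expr2.
have [->|n0] := eqVneq (b rf rf) 0; first by move=> _; apply: (si_ge0 S); apply: (siB S).
by rewrite ler_pM2l // lt_def n0 (si_ge0 S).
Qed.

End OrthogonalPart.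

(** * Hilbert subspaces of functions *)

Section HilbertSubspace.
Context {R : realType}.
Variables (lo hi : R) (H : set (R -> R)).
Let U : set R := `[lo, hi]%classic.
Hypothesis HH : hilbert_subspace U H.
Notation leb := (@lebesgue_measure R).

Lemma mU_itv : measurable (U : set (measurableTypeR R)).
Proof. exact: measurable_itv. Qed.

Lemma H_L2 f : H f -> L2 U f. Proof. by case: HH => h _ _ _ /h. Qed.

Lemma H_semi_inner : semi_inner (H : set (R -> R^o)) (ip U).
Proof.
case: HH => h1 h2 h3 h4.
apply: (semi_inner_sub (L2_semi_inner mU_itv)) => //.
Qed.

Lemma H_complete : complete_form (H : set (R -> R^o)) (ip U).
Proof.
move=> u Hu uC; have [|f Lf uf] := L2U_complete mU_itv _ uC.
  by move=> n; apply: H_L2.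
exists f => //; case: HH => h1 h2 h3 h4; apply: (h4 u) => //.
apply: cvg0_sqrt; apply/cvgrPdist_lt => e e0; have [N NP] := uf e e0.
exists N => // n Nn /=; rewrite sub0r normrN ger0_norm; first exact: NP.
apply: (si_ge0 (L2_semi_inner mU_itv)); apply: (siB (L2_semi_inner mU_itv)) => //; exact: H_L2.
Qed.

(** ** Finite-rank kernels *)

Definition tensor m (f g : 'I_m -> R -> R) (u v : R) := \sum_(i < m) f i u * g i v.

Lemma tensor_L2 m (f g : 'I_m -> R -> R) : (forall i, L2 U (f i)) -> (forall i, L2 U (g i)) ->
  L2_kernel U (tensor f g).
Proof.
move=> Lf Lg.
have e : (fun z : R * R => tensor f g z.1 z.2) =
    \sum_(i < m) ((fun z : R * R => f i z.1 * g i z.2) : R * R -> R^o).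
  by apply/funext => z; rewrite /tensor fct_sumE.
suff : L2m (leb \x leb)%E (U `*` U) (fun z : R * R => tensor f g z.1 z.2) by [].
rewrite e; apply: (si_sum (kernel_semi_inner mU_itv)) => i _.
by apply: (L2_tensor mU_itv mU_itv); [exact: Lf | exact: Lg].
Qed.

Lemma kop_tensor m (f g : 'I_m -> R -> R) x : (forall i, L2 U (g i)) -> L2 U x ->
  kop U (tensor f g) x = fun u => \sum_(i < m) f i u * ip U (g i) x.
Proof.
move=> Lg Lx; apply/funext => u.
have e : tensor f g u = \sum_(i < m) (f i u *: (g i : R -> R^o)).
  by apply/funext => v; rewrite /tensor fct_sumE.
have S := L2_semi_inner mU_itv.
rewrite -[LHS]/(ip U (tensor f g u) x) e (form_suml S) //; last by move=> i _; apply: (siZ S); exact: Lg.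
by apply: eq_bigr => i _; rewrite (formZl S).
Qed.

Lemma nrm_ae (f g : R -> R) : L2 U f -> L2 U g ->
  {ae leb, forall u, U u -> f u = g u} -> nrm U f = nrm U g.
Proof.
move=> Lf Lg fg; rewrite /nrm; congr Num.sqrt.
have S := L2_semi_inner mU_itv.
rewrite -[LHS]/(ipm leb U f f) (ipm_ae mU_itv Lf Lg Lf fg).
rewrite -[LHS]/(ip U g f) (si_sym S Lg Lf).
exact: (ipm_ae mU_itv Lf Lg Lg fg).
Qed.

(** Bessel's inequality in the first variable. Scores along a whole orthonormal
    family are thereby bounded at once by a Hilbert-Schmidt norm. *)
Lemma tensor_bessel m (f g : 'I_m -> R -> R) (e : nat -> R -> R) L :
  (forall i, L2 U (f i)) -> (forall i, L2 U (g i)) -> (forall a, L2 U (e a)) ->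
  (forall a c, ip U (e a) (e c) = (a == c)%:R) ->
  \sum_(a < L) nrm U (fun v => \sum_(i < m) ip U (f i) (e a) * g i v) ^+ 2 <=
  HSnorm U (tensor f g) ^+ 2.
Proof.
move=> Lf Lg Le one; have S := L2_semi_inner mU_itv.
have LT := tensor_L2 Lf Lg.
pose y a v := \sum_(i < m) ip U (f i) (e a) * g i v.
have Ly a : L2 U (y a).
  have -> : y a = \sum_(i < m) (ip U (f i) (e a) *: (g i : R -> R^o)).
    by apply/funext => v; rewrite fct_sumE.
  by apply: (si_sum S) => i _; apply: (siZ S); exact: Lg.
have yE a v : y a v = ip U (fun u => tensor f g u v) (e a).
  have -> : (fun u => tensor f g u v) = \sum_(i < m) (g i v *: (f i : R -> R^o)).
    by apply/funext => u; rewrite /tensor fct_sumE; apply: eq_bigr => i _; rewrite mulrC.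
  rewrite (form_suml S) //; last by move=> i _; apply: (siZ S); exact: Lf.
  by apply: eq_bigr => i _; rewrite (formZl S (g i v) (Lf i) (Le a)) mulrC.
have Lc v : L2 U (fun u => tensor f g u v).
  have -> : (fun u => tensor f g u v) = \sum_(i < m) (g i v *: (f i : R -> R^o)).
    by apply/funext => u; rewrite /tensor fct_sumE; apply: eq_bigr => i _; rewrite mulrC.
  by apply: (si_sum S) => i _; apply: (siZ S); exact: Lf.
have HSE : (HSnorm U (tensor f g) ^+ 2)%:E =
    (\int[leb]_(v in U) (ip U (fun u => tensor f g u v) (fun u => tensor f g u v))%:E)%E.
  rewrite sqr_sqrtr; last by apply: Rintegral_ge0 => z _; exact: sqr_ge0.
  have -> : \int[(leb \x leb)%E]_(z in U `*` U) (tensor f g z.1 z.2 ^+ 2) =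
      ipm (leb \x leb)%E (U `*` U) (fun z => tensor f g z.1 z.2) (fun z => tensor f g z.1 z.2) by [].
  rewrite (ipm_sqE (measurable_rectangle mU_itv mU_itv) LT).
  rewrite (tonelli_rectangle_swap leb leb mU_itv mU_itv (measurable_funX 2 (proj1 LT))) => [|z]; last exact: sqr_ge0.
  by apply: eq_integral => v _; rewrite -(ipm_sqE mU_itv (Lc v)).
rewrite -lee_fin HSE -sumEFin.
have -> : (\sum_(a < L) (nrm U (y a) ^+ 2)%:E)%E = (\int[leb]_(v in U) (\sum_(a < L) (y a v ^+ 2)%:E))%E.
  rewrite ge0_integral_sum //.
  - apply: eq_bigr => a _; rewrite -(ipm_sqE mU_itv (Ly a)).
    by congr EFin; exact: (snorm_sq S (Ly a)).
  - exact: mU_itv.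
  - by move=> a; apply/measurable_EFinP; apply: measurable_funX; case: (Ly a).
  - by move=> a v _; rewrite lee_fin sqr_ge0.
apply: ge0_le_integral => //.
- exact: mU_itv.
- by move=> v _; rewrite sume_ge0 // => a _; rewrite lee_fin sqr_ge0.
- by apply: emeasurable_sum => a; apply/measurable_EFinP; apply: measurable_funX; case: (Ly a).
- apply/measurable_EFinP.
  have := measurable_section_integral leb mU_itv mU_itv (measurable_swap_rectangle mU_itv mU_itv (measurable_funX 2 (proj1 LT))).
  by under [X in _ -> measurable_fun _ X]eq_fun do rewrite /ip; under [X in _ -> measurable_fun _ X]eq_fun do under eq_Rintegral do rewrite -expr2.
- move=> v _; rewrite sumEFin lee_fin.
  under eq_bigr do rewrite yE.
  apply: (bessel S (fun i (_ : (i < L)%N) => Le i)) => //; exact: Lc.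
Qed.

End HilbertSubspace.

(** * Functional linear processes *)

Lemma ecvg0_lt {R : realType} (u : nat -> \bar R) (e : R) :
  u @ \oo --> 0%E -> 0 < e -> exists N, forall n, (N <= n)%N -> (u n < e%:E)%E.
Proof.
move=> /fine_cvgP[[N1 _ fin]] /cvgrPdist_lt h e0; have [N2 _ NP] := h e e0.
exists (maxn N1 N2) => n; rewrite geq_max => /andP[n1 n2].
have := NP n n2; rewrite /= sub0r normrN => lt; rewrite -(fineK (fin n n1)) lte_fin.
exact: le_lt_trans (ler_norm _) lt.
Qed.

Lemma ecvg0_lt_seq {R : realType} (I : eqType) (ts : seq I) (u : I -> nat -> \bar R) (e : R) :
  (forall t, u t @ \oo --> 0%E) -> 0 < e ->
  exists N, forall t, t \in ts -> (u t N < e%:E)%E.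
Proof.
move=> h e0; suff [N NP] : exists N, forall n, (N <= n)%N -> forall t, t \in ts -> (u t n < e%:E)%E.
  by exists N => t tt; apply: (NP N).
elim: ts => [|t ts [N IH]]; first by exists 0%N.
have [M MP] := ecvg0_lt (h t) e0.
exists (maxn N M) => n; rewrite geq_max => /andP[nN nM] s; rewrite inE => /orP[/eqP ->|st].
  exact: MP.
exact: IH.
Qed.

Section LinearProcess.
Context {R : realType} {dsp : measure_display} {Om : measurableType dsp}.
Variable P : probability Om R.
Variables (lo hi : R) (H : set (R -> R)).
Local Notation U := (`[lo, hi]%classic : set R).
Hypothesis HH : hilbert_subspace U H.
Variables (aX : R) (p : nat) (A : nat -> 'I_p -> 'I_p -> R -> R -> R)
  (eps X : int -> 'I_p -> Om -> R -> R).
Hypothesis flp : functional_linear_process P U H aX A eps X.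
Notation leb := (@lebesgue_measure R).
Notation L2P := (L2m P setT).
Notation ipP := (ipm P setT).
Notation L2OU := (L2m (P \x leb)%E (setT `*` U)).
Notation ipOU := (ipm (P \x leb)%E (setT `*` U)).
Notation unc V := (fun z : Om * R => V z.1 z.2).

Let mU : measurable (U : set (measurableTypeR R)) := mU_itv lo hi.
Let mTU : measurable ([set: Om] `*` (U : set (measurableTypeR R))).
Proof. exact: measurableX. Qed.
Let S := L2_semi_inner mU.
Let HL f : H f -> L2 U f := @H_L2 _ _ _ _ HH f.

Lemma eps_H t j w : H (eps t j w).
Proof. by have [_ h] := sgp_random (flp_subgauss flp t j); exact: h. Qed.

Lemma eps_meas t j : measurable_fun (setT `*` U) (unc (eps t j)).
Proof. by have [h _] := sgp_random (flp_subgauss flp t j). Qed.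

Lemma X_H t j w : H (X t j w).
Proof. by have [_ h] := flp_random flp t j; exact: h. Qed.

Lemma X_meas t j : measurable_fun (setT `*` U) (unc (X t j)).
Proof. by have [h _] := flp_random flp t j. Qed.

Lemma eps_L2 t j : L2OU (unc (eps t j)) /\
  ((ipOU (unc (eps t j)) (unc (eps t j)))%:E = \int[P]_w (ip U (eps t j w) (eps t j w))%:E)%E.
Proof.
apply: (random_L2 mU (eps_meas t j)); first by move=> w; apply: HL; exact: eps_H.
exact: sgp_square (flp_subgauss flp t j).
Qed.

(** A finite-lag, finite-rank version of the process: its scores are finite sums of
    scores of the innovations, which have exponential moments. *)
Definition approximant N (m : nat -> 'I_p -> nat) (f g : forall l i, 'I_(m l i) -> R -> R)
    (t : int) (w : Om) (u : R) : R :=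
  \sum_(l < N) \sum_(i < p) \sum_(r < m l i) f l i r u * ip U (g l i r) (eps (t - (l : nat)%:Z) i w).

Section Approximant.
Variables (N : nat) (m : nat -> 'I_p -> nat) (f g : forall l i, 'I_(m l i) -> R -> R).
Hypotheses (Hf : forall l i r, H (@f l i r)) (Hg : forall l i r, H (@g l i r)).
Notation XN := (approximant N f g).

Lemma approximant_H t w : H (XN t w).
Proof.
have -> : XN t w = \sum_(l < N) \sum_(i < p) \sum_(r < m l i)
   (ip U (@g l i r) (eps (t - (l : nat)%:Z) i w) *: (@f l i r : R -> R^o)).
  apply/funext => u; rewrite /approximant fct_sumE; apply: eq_bigr => l _.
  rewrite fct_sumE; apply: eq_bigr => i _; rewrite fct_sumE; apply: eq_bigr => r _.
  by rewrite mulrC.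
have SHH := H_semi_inner HH.
apply: (si_sum SHH) => l _; apply: (si_sum SHH) => i _; apply: (si_sum SHH) => r _.
by apply: (siZ SHH); exact: Hf.
Qed.

Lemma approximant_L2 t : L2OU (unc (XN t)).
Proof.
have SOU : semi_inner L2OU ipOU := L2m_si _ mTU.
have -> : unc (XN t) = \sum_(l < N) \sum_(i < p) \sum_(r < m l i)
   ((fun z => ip U (@g l i r) (eps (t - (l : nat)%:Z) i z.1) * @f l i r z.2) : Om * R -> R^o).
  apply/funext => z; rewrite /approximant fct_sumE; apply: eq_bigr => l _.
  rewrite fct_sumE; apply: eq_bigr => i _; rewrite fct_sumE; apply: eq_bigr => r _.
  by rewrite mulrC.
apply: (si_sum SOU) => l _; apply: (si_sum SOU) => i _; apply: (si_sum SOU) => r _.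
apply: (L2_tensor measurableT mU (f := fun w => ip U (@g l i r) (eps (t - (l : nat)%:Z) i w)) (g := @f l i r)).
  2: by apply: HL; exact: Hf.
by have [] := ip_L2P mU (proj1 (eps_L2 (t - (l : nat)%:Z) i)) (HL (@Hg l i r)).
Qed.

Lemma ip_approximant t w x : L2 U x -> ip U x (XN t w) =
  \sum_(l < N) \sum_(i < p) ip U (fun v => \sum_(r < m l i) ip U (@f l i r) x * @g l i r v)
    (eps (t - (l : nat)%:Z) i w).
Proof.
move=> Lx.
have -> : XN t w = \sum_(l < N) \sum_(i < p) \sum_(r < m l i)
   (ip U (@g l i r) (eps (t - (l : nat)%:Z) i w) *: (@f l i r : R -> R^o)).
  apply/funext => u; rewrite /approximant fct_sumE; apply: eq_bigr => l _.
  rewrite fct_sumE; apply: eq_bigr => i _; rewrite fct_sumE; apply: eq_bigr => r _.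
  by rewrite mulrC.
have L3 l i r c : L2 U (c *: (@f l i r : R -> R^o)) by apply: (siZ S); apply: HL; exact: Hf.
have L2' l i c : L2 U (\sum_(r < m l i) (c r *: (@f l i r : R -> R^o))).
  by apply: (si_sum S) => r _; apply: L3.
have L1 l c : L2 U (\sum_(i < p) \sum_(r < m l i) (c i r *: (@f l i r : R -> R^o))).
  by apply: (si_sum S) => i _; apply: (L2' l i (c i)).
rewrite (form_sumr S) //; try by move=> l _; apply: (L1 l (fun i r => ip U (@g l i r) (eps (t - (l : nat)%:Z) i w))).
apply: eq_bigr => l _; rewrite (form_sumr S) //; try by
  move=> i _; apply: (L2' l i (fun r => ip U (@g l i r) (eps (t - (l : nat)%:Z) i w))).
apply: eq_bigr => i _; rewrite (form_sumr S) //.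
have He : L2 U (eps (t - (l : nat)%:Z) i w) := HL (eps_H _ _ _).
have -> : (fun v => \sum_(r < m l i) ip U (@f l i r) x * @g l i r v) =
    \sum_(r < m l i) (ip U (@f l i r) x *: (@g l i r : R -> R^o)).
  by apply/funext => v; rewrite fct_sumE.
rewrite (form_suml S) //; last by move=> r _; apply: (siZ S); apply: HL; exact: Hg.
apply: eq_bigr => r _.
have Lf := HL (@Hf l i r); have Lg := HL (@Hg l i r).
rewrite (formZr S _ Lf Lx) (formZl S _ Lg He) mulrC (si_sym S Lx Lf).
by congr (_ * _).
Qed.

End Approximant.

Lemma kmx_op_L2 l t j w : L2 U (kmx_op U (A l) (fun i => eps t i w) j).
Proof.
have -> : kmx_op U (A l) (fun i => eps t i w) j =
    \sum_(i < p) (kop U (A l j i) (eps t i w) : R -> R^o).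
  by apply/funext => u; rewrite fct_sumE.
apply: (si_sum S) => i _; have [LK _] := flp_kernel flp l j i.
by have [] := kop_L2 mU LK (HL (eps_H t i w)).
Qed.

Lemma measurable_kmx_op l t j :
  measurable_fun (setT `*` U) (fun z : Om * R => kmx_op U (A l) (fun i => eps t i z.1) j z.2).
Proof.
rewrite /kmx_op; apply: measurable_sum => i.
have [[mK _] _] := flp_kernel flp l j i.
apply: (measurable_section_integral leb mTU mU (F := fun z : (Om * R) * R => A l j i z.1.2 z.2 * eps t i z.1.1 z.2)).
apply: measurable_funM.
  apply: (measurable_comp (F := U `*` U) (f := fun z : R * R => A l j i z.1 z.2) (g := fun z : (Om * R) * R => (z.1.2, z.2))) => //.
  - exact: (measurable_rectangle mU mU).
  - by move=> _ [[[w u] v] [[_ Uu] Uv] <-].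
  - apply: measurable_funTS; apply: measurable_fun_pair; last exact: measurable_snd.
    by apply: measurableT_comp.
apply: (measurable_comp (F := setT `*` U) (f := unc (eps t i)) (g := fun z : (Om * R) * R => (z.1.1, z.2))) => //.
- by move=> _ [[[w u] v] [[_ Uu] Uv] <-].
- exact: eps_meas.
- apply: measurable_funTS; apply: measurable_fun_pair; last exact: measurable_snd.
  by apply: measurableT_comp.
Qed.

Lemma approximation_pointwise N (m : nat -> 'I_p -> nat) (f g : forall l i, 'I_(m l i) -> R -> R)
    (eta : R) t j w :
  (forall l i r, H (@f l i r)) -> (forall l i r, H (@g l i r)) -> 0 <= eta ->
  (forall l i, HSnorm U (fun u v => A l j i u v - tensor (@f l i) (@g l i) u v) <= eta) ->
  nrm U (fun u => X t j w u - approximant N f g t w u) ^+ 2 <=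
  2 * nrm U (fun u => X t j w u - \sum_(l < N) kmx_op U (A l) (fun i => eps (t - (l : nat)%:Z) i w) j u) ^+ 2
  + 2 * (eta ^+ 2 * (N%:R * p%:R) * \sum_(l < N) \sum_(i < p) ip U (eps (t - (l : nat)%:Z) i w) (eps (t - (l : nat)%:Z) i w)).
Proof.
move=> Hf Hg eta0 close.
have LX := HL (X_H t j w).
pose Sk : R -> R^o := \sum_(l < N) (kmx_op U (A l) (fun i => eps (t - (l : nat)%:Z) i w) j : R -> R^o).
have LSk : L2 U Sk by apply: (si_sum S) => l _; exact: kmx_op_L2.
have LXN := HL (@approximant_H N m f g Hf t w).
have eSk : (fun u => X t j w u - \sum_(l < N) kmx_op U (A l) (fun i => eps (t - (l : nat)%:Z) i w) j u) =
   (X t j w : R -> R^o) - Sk.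
  by apply/funext => u; rewrite /Sk; congr (_ - _); rewrite fct_sumE.
have eD : (fun u => X t j w u - approximant N f g t w u) = ((X t j w : R -> R^o) - Sk) + (Sk - (approximant N f g t w : R -> R^o)).
  by rewrite addrA subrK.
rewrite eSk eD.
have L1 : L2 U ((X t j w : R -> R^o) - Sk) := siB S LX LSk.
have L2' : L2 U (Sk - (approximant N f g t w : R -> R^o)) := siB S LSk LXN.
rewrite -[nrm U _]/(snorm (ip U) _) -[nrm U _]/(snorm (ip U) _).
rewrite (snorm_sq S (siD S L1 L2')) (snorm_sq S L1).
apply: le_trans (form_sqD_le S L1 L2') _; rewrite lerD2l ler_pM2l //.
rewrite -(snorm_sq S L2').
pose d l i : R -> R^o := (kop U (A l j i) (eps (t - (l : nat)%:Z) i w) : R -> R^o) -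
   (kop U (tensor (@f l i) (@g l i)) (eps (t - (l : nat)%:Z) i w) : R -> R^o).
have LT l i : L2_kernel U (tensor (@f l i) (@g l i)).
  by apply: tensor_L2 => r; apply: HL; [exact: Hf | exact: Hg].
have LA l i : L2_kernel U (A l j i) by have [] := flp_kernel flp l j i.
have Le s i : L2 U (eps s i w) := HL (eps_H s i w).
have Ld l i : L2 U (d l i).
  by apply: (siB S); [have [] := kop_L2 mU (LA l i) (Le (t - (l : nat)%:Z) i)
                     | have [] := kop_L2 mU (LT l i) (Le (t - (l : nat)%:Z) i)].
have -> : Sk - (approximant N f g t w : R -> R^o) = \sum_(l < N) \sum_(i < p) d l i.
  apply/funext => u; rewrite /Sk fct_sumE.
  transitivity (\sum_(l < N) kmx_op U (A l) (fun i => eps (t - (l : nat)%:Z) i w) j u - approximant N f g t w u).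
    by congr (_ - _); rewrite fct_sumE.
  rewrite /approximant -sumrB fct_sumE; apply: eq_bigr => l _; rewrite fct_sumE /kmx_op -sumrB.
  apply: eq_bigr => i _; congr (_ - _).
  by rewrite kop_tensor // => r; apply: HL; exact: Hg.
have dn (l : 'I_N) (i : 'I_p) : snorm (ip U) (d l i) <= eta * nrm U (eps (t - (l : nat)%:Z) i w).
  have LD : L2_kernel U (fun u v => A l j i u v - tensor (@f l i) (@g l i) u v).
    exact: (siB (kernel_semi_inner mU) (LA l i) (LT l i)).
  have [Lk le] := kop_L2 mU LD (Le (t - (l : nat)%:Z) i).
  rewrite -[X in X <= _]/(nrm U (d l i)).
  rewrite -(nrm_ae Lk (Ld l i) (kop_sub_ae mU (LA l i) (LT l i) (Le (t - (l : nat)%:Z) i))).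
  by apply: le_trans le _; rewrite ler_wpM2r ?sqrtr_ge0.
have key : snorm (ip U) (\sum_(l < N) \sum_(i < p) d l i) <=
    \sum_(li : 'I_N * 'I_p) eta * nrm U (eps (t - (li.1 : nat)%:Z) li.2 w).
  rewrite -(pair_bigA _ (fun (l : 'I_N) (i : 'I_p) => eta * nrm U (eps (t - (l : nat)%:Z) i w))) /=.
  apply: le_trans (snorm_sum S _ _) _ => [l _|]; first by apply: (si_sum S) => i _; exact: Ld.
  apply: ler_sum => l _; apply: le_trans (snorm_sum S _ _) _ => [i _|]; first exact: Ld.
  by apply: ler_sum => i _; exact: dn.
apply: (@le_trans _ _ ((\sum_(li : 'I_N * 'I_p) eta * nrm U (eps (t - (li.1 : nat)%:Z) li.2 w)) ^+ 2)).
  apply: lerXn2r key; rewrite nnegrE ?snorm_ge0 //.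
  by apply: sumr_ge0 => li _; rewrite mulr_ge0 ?sqrtr_ge0.
apply: le_trans (sum_CS _ _) _.
rewrite (_ : \sum_(i : 'I_N * 'I_p) eta ^+ 2 = eta ^+ 2 * (N%:R * p%:R)); last first.
  by rewrite sumr_const card_prod !card_ord -natrM mulr_natr.
rewrite ler_wpM2l ?mulr_ge0 ?sqr_ge0 //.
rewrite (pair_bigA _ (fun (l : 'I_N) (i : 'I_p) => ip U (eps (t - (l : nat)%:Z) i w) (eps (t - (l : nat)%:Z) i w))) /=.
by apply: ler_sum => li _; rewrite -(snorm_sq S).
Qed.

Lemma measurable_sqnorm (Q : Om -> R -> R) : measurable_fun (setT `*` U) (unc Q) ->
  measurable_fun setT (fun w => ip U (Q w) (Q w)).
Proof.
move=> mQ; apply: (measurable_section_integral leb measurableT mU (F := fun z => Q z.1 z.2 * Q z.1 z.2)).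
exact: measurable_funM.
Qed.

(** The lags are cut by the mean square convergence of the series, the kernels by the
    definition of the tensor space; the kernel error is small compared with the number
    of kernels, whence the [+ 1] in the sum of the norms. *)
Lemma approximation j (ts : seq int) (e : R) : 0 < e ->
  exists N (m : nat -> 'I_p -> nat) (f g : forall l i, 'I_(m l i) -> R -> R),
  [/\ forall l i r, H (f l i r), forall l i r, H (g l i r),
      \sum_(l < N) \sum_(i < p) HSnorm U (tensor (f l i) (g l i)) <=
      \sum_(l < N) \sum_(i < p) HSnorm U (A l j i) + 1 &
      forall t, t \in ts ->
        L2OU (fun z => X t j z.1 z.2 - approximant N f g t z.1 z.2) /\
        ipOU (fun z => X t j z.1 z.2 - approximant N f g t z.1 z.2)
          (fun z => X t j z.1 z.2 - approximant N f g t z.1 z.2) <= e].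
Proof.
move=> e0.
have [N NP] := ecvg0_lt_seq ts (fun t => flp_series flp t j) (divr_gt0 e0 (ltr0n _ 4)).
pose E s i := ipOU (unc (eps s i)) (unc (eps s i)).
have E0 s i : 0 <= E s i by apply: (si_ge0 (L2m_si _ mTU)); have [] := eps_L2 s i.
pose Et t := \sum_(l < N) \sum_(i < p) E (t - (l : nat)%:Z) i.
have Et0 t : 0 <= Et t by apply: sumr_ge0 => l _; apply: sumr_ge0.
pose Es := \sum_(t <- ts) Et t.
have Es0 : 0 <= Es by apply: sumr_ge0.
pose K := 4 * (N%:R * p%:R) * Es / e + N%:R * p%:R + 1.
have Np0 : 0 <= N%:R * p%:R :> R by rewrite mulr_ge0.
have q0 : 0 <= 4 * (N%:R * p%:R) * Es / e by rewrite divr_ge0 ?mulr_ge0 // ltW.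
have K1 : 1 <= K by rewrite lerDr addr_ge0.
have K0 : 0 < K := lt_le_trans ltr01 K1.
pose eta := K^-1.
have eta0 : 0 < eta by rewrite invr_gt0.
have tk l i : exists m (f g : 'I_m -> R -> R), (forall r, H (f r) /\ H (g r)) /\
    HSnorm U (fun u v => A l j i u v - \sum_(r < m) f r u * g r v) < eta.
  by have [_ h] := flp_kernel flp l j i; exact: h.
pose m l i := sval (cid (tk l i)).
have fk l i : exists (f g : 'I_(m l i) -> R -> R), (forall r, H (f r) /\ H (g r)) /\
    HSnorm U (fun u v => A l j i u v - \sum_(r < m l i) f r u * g r v) < eta.
  exact: svalP (cid (tk l i)).
pose f l i := sval (cid (fk l i)).
have gk l i : exists (g : 'I_(m l i) -> R -> R), (forall r, H (f l i r) /\ H (g r)) /\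
    HSnorm U (fun u v => A l j i u v - \sum_(r < m l i) f l i r u * g r v) < eta.
  exact: svalP (cid (fk l i)).
pose g l i := sval (cid (gk l i)).
have fg l i : (forall r, H (f l i r) /\ H (g l i r)) /\
    HSnorm U (fun u v => A l j i u v - \sum_(r < m l i) f l i r u * g l i r v) < eta.
  exact: svalP (cid (gk l i)).
have Hf l i r : H (f l i r) by have [h _] := fg l i; case: (h r).
have Hg l i r : H (g l i r) by have [h _] := fg l i; case: (h r).
have close l i : HSnorm U (fun u v => A l j i u v - tensor (f l i) (g l i) u v) <= eta.
  by have [_ /ltW] := fg l i.
exists N, m, f, g; split=> //.
  apply: (@le_trans _ _ (\sum_(l < N) \sum_(i < p) (HSnorm U (A l j i) + eta))).
    apply: ler_sum => l _; apply: ler_sum => i _.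
    have LA : L2_kernel U (A l j i) by have [] := flp_kernel flp l j i.
    have LT : L2_kernel U (tensor (f l i) (g l i)) by apply: tensor_L2 => r; exact: HL.
    have SK := kernel_semi_inner mU.
    apply: le_trans (lerD (lexx _) (close l i)).
    have LD := siB SK LA LT.
    have := snorm_triangle SK LA (siN SK LD).
    have -> : snorm (ipm (leb \x leb)%E (U `*` U)) (- ((fun z : R * R => A l j i z.1 z.2) -
       (fun z : R * R => tensor (f l i) (g l i) z.1 z.2))) =
       HSnorm U (fun u v => A l j i u v - tensor (f l i) (g l i) u v).
      rewrite -scaleN1r (snormZ SK _ LD) normrN1 mul1r; by [].
    by rewrite opprB addrC subrK.
  rewrite -[leRHS]addr0; under eq_bigr do rewrite big_split /=.
  rewrite big_split /= addr0 lerD2l sumr_const card_ord sumr_const card_ord.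
  have -> : eta *+ p *+ N = N%:R * p%:R / K.
    by rewrite -[eta *+ p]mulr_natr -[(_ * _) *+ N]mulr_natr /eta; ring.
  by rewrite ler_pdivrMr // mul1r /K; lra.
move=> t tts.
have LXN := @approximant_L2 N m f g Hf Hg t.
pose D w : R -> R := fun u => X t j w u - approximant N f g t w u.
have mD : measurable_fun (setT `*` U) (unc D).
  by apply: measurable_funB; [exact: X_meas | case: LXN].
have LD w : L2 U (D w).
  exact: (siB S (HL (X_H t j w)) (HL (@approximant_H N m f g Hf t w))).
pose Q w : R -> R := fun u => X t j w u - \sum_(l < N) kmx_op U (A l) (fun i => eps (t - (l : nat)%:Z) i w) j u.
have mQ : measurable_fun (setT `*` U) (unc Q).
  apply: measurable_funB; first exact: X_meas.
  by apply: measurable_sum => l; exact: measurable_kmx_op.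
have QE w : nrm U (Q w) ^+ 2 = ip U (Q w) (Q w).
  by rewrite sqr_sqrtr //; apply: Rintegral_ge0 => u _; rewrite -expr2 sqr_ge0.
pose c := 2 * (eta ^+ 2 * (N%:R * p%:R)).
have c0 : 0 <= c by rewrite /c mulr_ge0 // mulr_ge0 // sqr_ge0.
pose Sg w := \sum_(l < N) \sum_(i < p) ip U (eps (t - (l : nat)%:Z) i w) (eps (t - (l : nat)%:Z) i w).
have ip0 w l i : 0 <= ip U (eps (t - l) i w) (eps (t - l) i w).
  by apply: (si_ge0 S); apply: HL; exact: eps_H.
have mSg : measurable_fun setT Sg.
  apply: measurable_sum => l; apply: measurable_sum => i; apply: measurable_sqnorm; exact: eps_meas.
have Sg0 w : 0 <= Sg w by apply: sumr_ge0 => l _; apply: sumr_ge0.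
have ISg : (\int[P]_w (Sg w)%:E = (Et t)%:E)%E.
  rewrite /Sg /Et; under eq_integral do rewrite -sumEFin.
  rewrite ge0_integral_sum //; last 2 first.
  - move=> l; apply/measurable_EFinP; apply: measurable_sum => i; apply: measurable_sqnorm; exact: eps_meas.
  - by move=> l w _; rewrite lee_fin sumr_ge0.
  rewrite -sumEFin; apply: eq_bigr => l _; under eq_integral do rewrite -sumEFin.
  rewrite ge0_integral_sum //; last 2 first.
  - move=> i; apply/measurable_EFinP; apply: measurable_sqnorm; exact: eps_meas.
  - by move=> i w _; rewrite lee_fin.
  by rewrite -sumEFin; apply: eq_bigr => i _; have [_ <-] := eps_L2 (t - (l : nat)%:Z) i.
have EtEs : Et t <= Es.
  by rewrite /Es (big_rem t) //= lerDl; apply: sumr_ge0.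
have bound : (\int[P]_w (ip U (D w) (D w))%:E <= e%:E)%E.
  apply: (@le_trans _ _ (\int[P]_w ((2 * nrm U (Q w) ^+ 2)%:E + (c * Sg w)%:E))%E).
    apply: ge0_le_integral => //.
    - by move=> w _; rewrite lee_fin (si_ge0 S).
    - by apply/measurable_EFinP; exact: measurable_sqnorm.
    - apply: emeasurable_funD; apply/measurable_EFinP; apply: measurable_funM => //.
      by under eq_fun do rewrite QE; exact: measurable_sqnorm.
    - move=> w _; rewrite -EFinD lee_fin -(snorm_sq S (LD w)).
      have := @approximation_pointwise N m f g eta t j w Hf Hg (ltW eta0) close.
      by rewrite /c /Sg; move=> h; apply: le_trans h _; rewrite lerD2l mulrA.
  have mq : measurable_fun setT (fun w => nrm U (Q w) ^+ 2).
    by under eq_fun do rewrite QE; exact: measurable_sqnorm.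
  rewrite ge0_integralD //; last 4 first.
  - by move=> w _; rewrite lee_fin mulr_ge0 ?sqr_ge0.
  - by apply/measurable_EFinP; apply: measurable_funM.
  - by move=> w _; rewrite lee_fin mulr_ge0.
  - by apply/measurable_EFinP; apply: measurable_funM.
  under eq_integral do rewrite EFinM.
  rewrite ge0_integralZl_EFin //; last 2 first.
  - by move=> w _; rewrite lee_fin sqr_ge0.
  - exact/measurable_EFinP.
  under [X in (_ + X)%E]eq_integral do rewrite EFinM.
  rewrite ge0_integralZl_EFin //; last 2 first.
  - by move=> w _; rewrite lee_fin.
  - exact/measurable_EFinP.
  rewrite ISg.
  apply: (@le_trans _ _ (2%:E * (e / 4)%:E + c%:E * (Et t)%:E)%E).
    rewrite leeD2r //; apply: lee_wpmul2l => //; apply: ltW; exact: (NP t tts).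
  rewrite -!EFinM -EFinD lee_fin.
  have : c * Et t <= e / 2.
    apply: (@le_trans _ _ (2 * (eta * (N%:R * p%:R)) * Es)).
      rewrite /c; apply: ler_pM => //.
      rewrite ler_pM2l // ler_wpM2r // expr2 -[leRHS]mulr1 ler_wpM2l ?(ltW eta0) //.
      by rewrite invf_le1.
    have -> : 2 * (eta * (N%:R * p%:R)) * Es = (4 * (N%:R * p%:R) * Es / e) * eta * (e / 2).
      by field; rewrite gt_eqF.
    rewrite ler_piMl ?divr_ge0 ?(ltW e0) //.
    by rewrite ler_pdivrMr // mul1r /K; lra.
  by move=> ?; lra.
have lt : (\int[P]_w (ip U (D w) (D w))%:E < +oo)%E := le_lt_trans bound (ltry _).
have [LDD ID] := random_L2 mU mD LD lt.
by split=> //; rewrite -lee_fin ID.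
Qed.

Lemma X_L2 t j : L2OU (unc (X t j)).
Proof.
have [N [m [f [g [Hf Hg _ h]]]]] := approximation j [:: t] ltr01.
have [|LD _] := h t; first by rewrite inE.
have SOU : semi_inner L2OU ipOU := L2m_si _ mTU.
have -> : unc (X t j) = ((fun z => X t j z.1 z.2 - approximant N f g t z.1 z.2) : Om * R -> R^o) +
   (unc (approximant N f g t) : Om * R -> R^o).
  by apply/funext => z; rewrite [RHS]/= /GRing.add /= subrK.
by apply: (siD SOU LD); exact: approximant_L2.
Qed.

End LinearProcess.

(** * Eigenfunctions of the covariance operator *)

Lemma einfs_le {R : realType} (u : nat -> \bar R) k : (einfs u 0%N <= u k)%E.
Proof. by apply: ereal_inf_lbound; exists k. Qed.

Lemma le_einfs {R : realType} (u : nat -> \bar R) c : (forall k, c <= u k)%E -> (c <= einfs u 0%N)%E.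
Proof. by move=> h; apply: le_ereal_inf_tmp => _ [k _ <-]. Qed.

Lemma ae_imp2 {R : realType} {d} {T : measurableType d} (mu : {measure set T -> \bar R}) (A B C : T -> Prop) :
  {ae mu, forall x, A x} -> {ae mu, forall x, B x} -> (forall x, A x -> B x -> C x) -> {ae mu, forall x, C x}.
Proof. by move=> a b h; apply: filterS2 a b => x; exact: h. Qed.

Section Spectral.
Context {R : realType} {dsp : measure_display} {Om : measurableType dsp}.
Variable P : probability Om R.
Variables (lo hi : R) (H : set (R -> R)).
Local Notation U := (`[lo, hi]%classic : set R).
Hypothesis HH : hilbert_subspace U H.
Variables (aX : R) (p : nat) (A : nat -> 'I_p -> 'I_p -> R -> R -> R)
  (eps X : int -> 'I_p -> Om -> R -> R).
Hypothesis flp : functional_linear_process P U H aX A eps X.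
Notation leb := (@lebesgue_measure R).
Notation L2P := (L2m P setT).
Notation ipP := (ipm P setT).
Notation L2OU := (L2m (P \x leb)%E (setT `*` U)).
Notation ipOU := (ipm (P \x leb)%E (setT `*` U)).
Notation unc V := (fun z : Om * R => V z.1 z.2).
Notation apx := (approximant lo hi eps).

Let mU : measurable (U : set (measurableTypeR R)) := mU_itv lo hi.
Let mTU : measurable ([set: Om] `*` (U : set (measurableTypeR R))).
Proof. exact: measurableX. Qed.
Let S := L2_semi_inner mU.
Let SHH := H_semi_inner HH.
Let SP : semi_inner L2P ipP := L2m_si P measurableT.
Let SOU : semi_inner L2OU ipOU := L2m_si _ mTU.
Let HL f : H f -> L2 U f := @H_L2 _ _ _ _ HH f.
Let LX t j : L2OU (unc (X t j)) := X_L2 HH flp t j.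

Lemma ip_random_L2 (V : Om -> R -> R) f : L2OU (unc V) -> L2 U f -> L2P (fun w => ip U f (V w)).
Proof. by move=> LV Lf; have [] := ip_L2P mU LV Lf. Qed.

Lemma mean_sq_le (V : Om -> R) : L2P V -> mean P V ^+ 2 <= ipP V V.
Proof.
move=> LV; apply: le_trans (form_CS SP LV (L2m_one P)) _.
by rewrite ipm11 mulr1.
Qed.

Lemma eps_mean t i x : H x -> mean P (fun w => ip U x (eps t i w)) = 0.
Proof. by move=> Hx; rewrite meanE (sgp_mean (flp_subgauss flp t i) Hx). Qed.

(** The approximants are centred. *)
Lemma X_mean t j x : L2 U x -> mean P (fun w => ip U x (X t j w)) = 0.
Proof.
move=> Lx; apply/eqP; rewrite -sqrf_eq0 eq_le sqr_ge0 andbT.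
have x0 : 0 <= ip U x x := si_ge0 S Lx.
apply/ler_addgt0Pr => e e0; rewrite add0r.
have e1 : 0 < e / (ip U x x + 1) by rewrite divr_gt0 // ltr_wpDl.
have [N [m [f [g [Hf Hg _ h]]]]] := approximation HH flp j [:: t] e1.
have [|LD De] := h t; first by rewrite inE.
set D := (fun z : Om * R => _) in LD De.
have LN := @approximant_L2 _ _ _ P _ _ _ HH _ _ _ _ _ flp N m f g Hf Hg t.
have LDx : L2P (fun w => ip U x (fun u => D (w, u))) := ip_random_L2 LD Lx.
have LNx : L2P (fun w => ip U x (apx N f g t w)) := ip_random_L2 LN Lx.
have mN : mean P (fun w => ip U x (apx N f g t w)) = 0.
  pose y l i : R -> R^o := \sum_(r < m l i) (ip U (f l i r) x *: (g l i r : R -> R^o)).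
  have Hy l i : H (y l i) by apply: (si_sum SHH) => r _; apply: (siZ SHH); exact: Hg.
  have -> : (fun w => ip U x (apx N f g t w)) =
     \sum_(l < N) \sum_(i < p) ((fun w => ip U (y l i) (eps (t - (l : nat)%:Z) i w)) : Om -> R^o).
    apply/funext => w; rewrite (@ip_approximant _ _ _ P _ _ _ HH _ _ _ _ _ flp N m f g Hf Hg) // fct_sumE.
    apply: eq_bigr => l _; rewrite fct_sumE; apply: eq_bigr => i _; congr (ip U _ _).
    by apply/funext => v; rewrite /y fct_sumE.
  have Ly l i : L2P (fun w => ip U (y l i) (eps (t - (l : nat)%:Z) i w)).
    by apply: ip_random_L2; [have [] := eps_L2 HH flp (t - (l : nat)%:Z) i | exact: HL].
  have L1 := L2m_one P.
  rewrite /mean (form_suml SP) //; last by move=> l _; apply: (si_sum SP) => i _; exact: Ly.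
  rewrite big1 // => l _; rewrite (form_suml SP) //; try by move=> i _; exact: Ly.
  by rewrite big1 // => i _; exact: eps_mean.
have -> : mean P (fun w => ip U x (X t j w)) = mean P (fun w => ip U x (fun u => D (w, u))).
  have -> : (fun w => ip U x (X t j w)) = ((fun w => ip U x (fun u => D (w, u))) : Om -> R^o) +
     ((fun w => ip U x (apx N f g t w)) : Om -> R^o).
    apply/funext => w.
    have LNw : L2 U (apx N f g t w) by apply: HL; apply: approximant_H.
    have LXw := HL (X_H flp t j w).
    have -> : (X t j w) = ((fun u => D (w, u)) : R -> R^o) + (apx N f g t w : R -> R^o).
      by rewrite [X in _ = X + _](_ : _ = (X t j w : R -> R^o) - (apx N f g t w : R -> R^o)) // subrK.
    by rewrite (formDr S (siB S LXw LNw) LNw Lx).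
  by rewrite {1}/mean (formDl SP LDx LNx (L2m_one P)) -[ipP (fun w => ip U x (apx _ _ _ _ _)) _]/(mean P _) mN addr0.
apply: le_trans (mean_sq_le LDx) _.
have [_ le] := ip_L2P mU (V := fun w u => D (w, u)) LD Lx.
apply: le_trans le _; apply: (@le_trans _ _ (e / (ip U x x + 1) * (ip U x x + 1))).
  by rewrite ler_pM ?(si_ge0 SOU LD) // lerDl.
by rewrite divfK // gt_eqF // ltr_wpDl.
Qed.

(** The quadratic form of the covariance operator, the scores being centred. *)
Definition covform t j (f g : R -> R) : R :=
  ipP (fun w => ip U f (X t j w)) (fun w => ip U g (X t j w)).

Lemma covformP t j : semi_inner (H : set (R -> R^o)) (covform t j).
Proof.
have Li f : H f -> L2P (fun w => ip U f (X t j w)).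
  by move=> Hf; apply: ip_random_L2; [exact: LX | exact: HL].
split; [exact: (si_0 SHH) | exact: (si_lin SHH) | | |].
- by move=> f g Hf Hg; apply: (si_sym SP); exact: Li.
- move=> c f g h Hf Hg Hh; rewrite /covform.
  have -> : (fun w => ip U (c *: (f : R -> R^o) + g) (X t j w)) =
     c *: ((fun w => ip U f (X t j w)) : Om -> R^o) + (fun w => ip U g (X t j w)).
    by apply/funext => w; rewrite (si_linl S) //; apply: HL => //; exact: (X_H flp).
  by rewrite (si_linl SP) //; exact: Li.
- by move=> f Hf; apply: (si_ge0 SP); exact: Li.
Qed.

Lemma covform_le t j f : H f -> covform t j f f <= ipOU (unc (X t j)) (unc (X t j)) * ip U f f.
Proof. by move=> Hf; have [_] := ip_L2P mU (LX t j) (HL Hf). Qed.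

Lemma approximant_orth N (m : nat -> 'I_p -> nat) (f g : forall l i, 'I_(m l i) -> R -> R) t w x :
  (forall l i r, H (f l i r)) -> (forall l i r, H (g l i r)) -> L2 U x ->
  (forall (l : 'I_N) i r, ip U x (f l i r) = 0) -> ip U x (apx N f g t w) = 0.
Proof.
move=> Hf Hg Lx x0.
rewrite (@ip_approximant _ _ _ P _ _ _ HH _ _ _ _ _ flp N m f g Hf Hg) //.
rewrite big1 // => l _; rewrite big1 // => i _.
rewrite (_ : (fun v => _) = (0 : R -> R^o)).
  by rewrite (form0l S) //; apply: HL; exact: (eps_H flp).
apply/funext => v; rewrite big1 // => r _.
by rewrite (si_sym S) ?x0 ?mul0r //; apply: HL; exact: Hf.
Qed.

Lemma ip_sub_approximant N (m : nat -> 'I_p -> nat) (f g : forall l i, 'I_(m l i) -> R -> R) t j w x :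
  (forall l i r, H (f l i r)) -> L2 U x ->
  ip U x (fun u => X t j w u - apx N f g t w u) =
  ip U x (X t j w) - ip U x (apx N f g t w).
Proof.
move=> Hf Lx; apply: (formBr S _ _ Lx); first by apply: HL; exact: (X_H flp).
by apply: HL; apply: approximant_H.
Qed.

(** Orthogonally to the functions [f l i r] of an approximant, a score only sees the
    approximation error. *)
Lemma covform_compact t j : compact_form (H : set (R -> R^o)) (ip U) (covform t j).
Proof.
move=> e e0; have [N [m [f [g [Hf Hg _ h]]]]] := approximation HH flp j [:: t] e0.
have [|LD De] := h t; first by rewrite inE.
exists [seq f (tag (lir : {l : 'I_N & {i : 'I_p & 'I_(m l i)}})) (tag (tagged lir)) (tagged (tagged lir))
  | lir <- enum {: {l : 'I_N & {i : 'I_p & 'I_(m l i)}}}].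
  by move=> _ /mapP[lir _ ->]; exact: Hf.
move=> x Hx x0.
have xf (l : 'I_N) i r : ip U x (f l i r) = 0.
  apply: x0; apply/mapP; exists (Tagged (fun l : 'I_N => {i : 'I_p & 'I_(m l i)}) (Tagged (fun i => 'I_(m l i)) r)) => //.
  by rewrite mem_enum.
have [_ le] := ip_L2P mU (V := fun w u => X t j w u - apx N f g t w u) LD (HL Hx).
apply: (@le_trans _ _ (ipOU (fun z => X t j z.1 z.2 - apx N f g t z.1 z.2)
  (fun z => X t j z.1 z.2 - apx N f g t z.1 z.2) * ip U x x)); last first.
  by rewrite ler_wpM2r // (si_ge0 SHH).
apply: le_trans le; rewrite /covform.
rewrite (_ : (fun w => ip U x (X t j w)) =
  (fun w => ip U x (fun u => X t j w u - apx N f g t w u))) //.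
apply/funext => w; rewrite (ip_sub_approximant _ _ _ _ _ Hf) //; last exact: HL.
by rewrite approximant_orth ?subr0 //; exact: HL.
Qed.

Lemma kop_covform t j f g : L2 U f -> L2 U g ->
  ip U g (kop U (cov_fun P (X t j) (X t j)) f) = covform t j g f.
Proof. by move=> Lf Lg; rewrite (kop_cov mU (LX t j)) // !X_mean // mulr0 subr0. Qed.

Lemma kop_cov_H t j f : H f -> H (kop U (cov_fun P (X t j) (X t j)) f).
Proof.
move=> Hf; have Lf := HL Hf.
have Lk := kop_cov_L2 mU (LX t j) Lf.
pose hf w := ip U f (X t j w).
have Lhf : L2P hf := ip_random_L2 (LX t j) Lf.
have approx k : exists g, H g /\
    ip U ((kop U (cov_fun P (X t j) (X t j)) f : R -> R^o) - (g : R -> R^o))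
      ((kop U (cov_fun P (X t j) (X t j)) f : R -> R^o) - (g : R -> R^o)) <=
    k.+1%:R^-1 * ipP hf hf.
  have e0 : 0 < k.+1%:R^-1 :> R by rewrite invr_gt0.
  have [N [m [x [y [Hx Hy _ h]]]]] := approximation HH flp j [:: t] e0.
  have [|LD De] := h t; first by rewrite inE.
  have LN := @approximant_L2 _ _ _ P _ _ _ HH _ _ _ _ _ flp N m x y Hx Hy t.
  pose g u := ipP ((apx N x y t) ^~ u) hf.
  have Ls l i r : L2P (fun w => ip U (y l i r) (eps (t - (l : nat)%:Z) i w)).
    by apply: ip_random_L2; [have [] := eps_L2 HH flp (t - (l : nat)%:Z) i | exact: (HL (Hy l i r))].
  have Hg : H g.
    have -> : g = \sum_(l < N) \sum_(i < p) \sum_(r < m l i)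
        (ipP (fun w => ip U (y l i r) (eps (t - (l : nat)%:Z) i w)) hf *: (x l i r : R -> R^o)).
      apply/funext => u; rewrite /g.
      have -> : (apx N x y t) ^~ u = \sum_(l < N) \sum_(i < p) \sum_(r < m l i)
         (x l i r u *: ((fun w => ip U (y l i r) (eps (t - (l : nat)%:Z) i w)) : Om -> R^o)).
        apply/funext => w; rewrite /approximant fct_sumE; apply: eq_bigr => l _.
        by rewrite fct_sumE; apply: eq_bigr => i _; rewrite fct_sumE.
      have Z l i r : L2P (x l i r u *: ((fun w => ip U (y l i r) (eps (t - (l : nat)%:Z) i w)) : Om -> R^o)).
        by apply: (siZ SP); exact: Ls.
      have Z2 l i : L2P (\sum_(r < m l i) (x l i r u *: ((fun w => ip U (y l i r) (eps (t - (l : nat)%:Z) i w)) : Om -> R^o))).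
        by apply: (si_sum SP) => r _; exact: Z.
      have -> : ipP (\sum_(l < N) \sum_(i < p) \sum_(r < m l i)
         (x l i r u *: ((fun w => ip U (y l i r) (eps (t - (l : nat)%:Z) i w)) : Om -> R^o))) hf =
         \sum_(l < N) \sum_(i < p) \sum_(r < m l i)
           x l i r u * ipP (fun w => ip U (y l i r) (eps (t - (l : nat)%:Z) i w)) hf.
        rewrite (form_suml SP) //; try by move=> l _; apply: (si_sum SP) => i _; exact: Z2.
        apply: eq_bigr => l _; rewrite (form_suml SP) //; try by move=> i _; exact: Z2.
        apply: eq_bigr => i _; rewrite (form_suml SP) //; try by move=> r _; exact: Z.
        by apply: eq_bigr => r _; rewrite (formZl SP _ (Ls l i r) Lhf).
      rewrite fct_sumE; apply: eq_bigr => l _; rewrite fct_sumE; apply: eq_bigr => i _.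
      rewrite fct_sumE; apply: eq_bigr => r _; exact: mulrC.
    apply: (si_sum SHH) => l _; apply: (si_sum SHH) => i _; apply: (si_sum SHH) => r _.
    by apply: (siZ SHH); exact: Hx.
  exists g; split=> //.
  set z := (kop U (cov_fun P (X t j) (X t j)) f : R -> R^o) - (g : R -> R^o).
  have Lg : L2 U g := HL Hg.
  have Lz : L2 U z := siB S Lk Lg.
  have zz : ip U z z = ipP hf (fun w => ip U z (fun u => X t j w u - apx N x y t w u)).
    rewrite {2}/z (formBr S Lk Lg Lz) kop_covform // (moment_ip mU LN Lhf Lz).
    rewrite /covform (si_sym SP (ip_random_L2 (LX t j) Lz) Lhf).
    rewrite -(formBr SP (ip_random_L2 (LX t j) Lz) (ip_random_L2 LN Lz) Lhf).
    congr (ipP _ _); apply/funext => w.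
    by rewrite (ip_sub_approximant _ _ _ _ _ Hx).
  have [LDz le] := ip_L2P mU (V := fun w u => X t j w u - apx N x y t w u) LD Lz.
  have CS := form_CS SP Lhf LDz; rewrite -zz in CS.
  have hh0 : 0 <= ipP hf hf := si_ge0 SP Lhf.
  have z0 : 0 <= ip U z z := si_ge0 S Lz.
  have := le_trans CS (ler_wpM2l hh0 le).
  have [->|zn0] := eqVneq (ip U z z) 0; first by rewrite mulr_ge0 // ltW.
  have zp : 0 < ip U z z by rewrite lt_def zn0.
  move: zp hh0 De; move: (ip U z z) (ipP hf hf) (ipOU _ _) => a b c zp hh0 De.
  rewrite mulrA expr2 ler_pM2r // => h2.
  by apply: le_trans h2 _; rewrite mulrC ler_wpM2r.
have [g gP] := choice approx.
case: HH => h1 h2 h3 h4; apply: (h4 g) => //; first by move=> k; case: (gP k).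
apply: cvg0_sqrt; apply/cvgrPdist_lt => e e0.
have hh0 : 0 <= ipP hf hf := si_ge0 SP Lhf.
have [N NP] := invSn_lt (divr_gt0 e0 (ltr_wpDl hh0 ltr01)).
exists N => // n Nn /=; rewrite sub0r normrN ger0_norm.
  have [_ le] := gP n; apply: le_lt_trans le _.
  apply: (@le_lt_trans _ _ (n.+1%:R^-1 * (ipP hf hf + 1))); first by rewrite ler_wpM2l ?invr_ge0 // lerDl.
  by rewrite -ltr_pdivlMr ?NP // ltr_wpDl.
by have [Hg _] := gP n; apply: (si_ge0 S); apply: (siB S Lk (HL Hg)).
Qed.

Section Eigen.
Variables (j : 'I_p) (lam : nat -> R) (psi : nat -> R -> R).
Hypothesis ES : eigen_system U H (SigmaX P X 0 j j) lam psi.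

Let Hpsi l : H (psi l) := eig_in ES l.
Let one : orthonormal (ip U) (psi : nat -> R -> R^o) := eig_orthonormal ES.

Lemma covform_eig l f : H f -> covform 0 j (psi l) f = lam l * ip U (psi l) f.
Proof.
move=> Hf; have Hk := kop_cov_H 0 j (Hpsi l).
have z0 : ip U ((kop U (cov_fun P (X 0 j) (X 0 j)) (psi l) : R -> R^o) - lam l *: (psi l : R -> R^o))
   ((kop U (cov_fun P (X 0 j) (X 0 j)) (psi l) : R -> R^o) - lam l *: (psi l : R -> R^o)) = 0.
  have Hd := siB SHH Hk (siZ SHH (lam l) (Hpsi l)).
  have := eig_eq ES l; rewrite /nrm => /eqP; rewrite sqrtr_eq0 => h.
  by apply/eqP; rewrite eq_le (si_ge0 SHH Hd) andbT.
have := form_null SHH (siB SHH Hk (siZ SHH (lam l) (Hpsi l))) Hf z0.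
have HZ := siZ SHH (lam l) (Hpsi l).
rewrite (formBl SHH Hk HZ Hf) (formZl SHH _ (Hpsi l) Hf) => /eqP; rewrite subr_eq0 => /eqP <-.
rewrite (si_sym SHH Hk Hf) kop_covform; [|exact: (HL (Hpsi l))|exact: HL].
by rewrite (si_sym (covformP 0 j)).
Qed.

Lemma covform_null f : H f -> (forall l, ip U f (psi l) = 0) -> covform 0 j f f = 0.
Proof.
have B0 : 0 <= ipOU (unc (X 0 j)) (unc (X 0 j)) := si_ge0 SOU (LX 0 j).
apply: (form_orthogonal_null SHH (covformP 0 j) (H_complete HH) B0 _ (covform_compact 0 j) Hpsi one).
  by move=> g Hg; exact: covform_le.
move=> g c Hg g0 c0 gE.
have Hk := kop_cov_H 0 j Hg.
have Hz := siB SHH Hk (siZ SHH c Hg).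
have zE h : H h -> ip U ((kop U (cov_fun P (X 0 j) (X 0 j)) g : R -> R^o) - c *: (g : R -> R^o)) h =
    covform 0 j g h - c * ip U g h.
  move=> Hh; rewrite (formBl SHH Hk (siZ SHH c Hg) Hh) (formZl SHH _ Hg Hh).
  rewrite (si_sym SHH Hk Hh) kop_covform; [|exact: HL|exact: HL].
  by rewrite (si_sym (covformP 0 j)).
have z0 l : ip U ((kop U (cov_fun P (X 0 j) (X 0 j)) g : R -> R^o) - c *: (g : R -> R^o)) (psi l) = 0.
  rewrite zE // g0 mulr0 subr0 (si_sym (covformP 0 j)) // covform_eig //.
  by rewrite (si_sym SHH) // g0 mulr0.
have zz := zE _ Hz; rewrite (gE _ Hz z0) subrr in zz.
have n0 : nrm U g = 0.
  apply: (eig_exhaustive ES Hg c0 _ g0).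
  by rewrite /nrm -[X in Num.sqrt X]/(ip U ((kop U (cov_fun P (X 0 j) (X 0 j)) g : R -> R^o) - c *: (g : R -> R^o)) _) zz sqrtr0.
by move: n0 => /eqP; rewrite /nrm sqrtr_eq0 => h; apply/eqP; rewrite eq_le h (si_ge0 SHH Hg).
Qed.

Hypothesis stat : forall t, {ae (leb \x leb)%E, forall z, (U `*` U) z ->
  cov_fun P (X t j) (X t j) z.1 z.2 = cov_fun P (X 0 j) (X 0 j) z.1 z.2}.

(** The covariance functions agree almost everywhere only, which their integrals
    against products do not see. *)
Lemma covform_stationary t f g : H f -> H g -> covform t j f g = covform 0 j f g.
Proof.
move=> Hf Hg; have Lf := HL Hf; have Lg := HL Hg.
rewrite -(kop_covform t j Lg Lf) -(kop_covform 0 j Lg Lf).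
have mUU : measurable (U `*` U : set (measurableTypeR R * measurableTypeR R)).
  exact: measurableX.
pose Kt := cov_fun P (X t j) (X t j); pose K0 := cov_fun P (X 0 j) (X 0 j).
pose D u v := Kt u v - K0 u v.
have mKt : measurable_fun (U `*` U) (fun z => Kt z.1 z.2) by apply: measurable_cov_fun => //; exact: (X_meas flp).
have mK0 : measurable_fun (U `*` U) (fun z => K0 z.1 z.2) by apply: measurable_cov_fun => //; exact: (X_meas flp).
have SK := kernel_semi_inner mU.
have LD0 : L2_kernel U (fun _ _ => 0) := si_0 SK.
have Dae : {ae (leb \x leb)%E, forall z, (U `*` U) z -> D z.1 z.2 = (fun _ => 0) z}.
  by apply: (ae_imp (stat t)) => z h Uz; rewrite /D /Kt h // subrr.
have LD : L2_kernel U D.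
  apply: (L2m_ae mUU LD0) => //; exact: measurable_funB.
have D0 : HSnorm U D = 0.
  rewrite HSnormE // /snorm (ipm_ae mUU LD LD0 LD Dae).
  by rewrite (form0l SK LD) sqrtr0.
have [LkD le] := kop_L2 mU LD Lg; rewrite D0 mul0r in le.
have kD0 : ip U (kop U D g) (kop U D g) = 0.
  apply/eqP; rewrite eq_le (si_ge0 S LkD) andbT -(snorm_sq S LkD).
  by have := lerXn2r 2 (snorm_ge0 (ip U) (kop U D g)) (lexx 0) le; rewrite expr0n.
have kae : {ae leb, forall u, U u -> kop U Kt g u = kop U K0 g u}.
  have h1 := cov_section_ae mU (LX t j); have h2 := cov_section_ae mU (LX 0 j).
  have h3 := ipm_sq0_ae mU LkD kD0.
  have h12 : {ae leb, forall u, U u -> kop U D g u = kop U Kt g u - kop U K0 g u}.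
    apply: (ae_imp2 h1 h2) => u a1 a2 Uu.
    have [_ l1] := a1 Uu; have [_ l2] := a2 Uu.
    exact: (formBl S l1 l2 Lg).
  apply: (ae_imp2 h12 h3) => u a1 a2 Uu.
  by apply/eqP; rewrite -subr_eq0 -a1 // a2.
have Lkt := kop_cov_L2 mU (LX t j) Lg; have Lk0 := kop_cov_L2 mU (LX 0 j) Lg.
by rewrite (si_sym S Lf Lkt) (si_sym S Lf Lk0); exact: (ipm_ae mU Lkt Lk0 Lf kae).
Qed.

Let psi' : nat -> R -> R^o := psi.

(** Almost every realization lies in the closed span of the eigenfunctions: it is
    within arbitrarily small mean square distance of a finite-dimensional space whose
    part orthogonal to the eigenfunctions is not charged. *)
Lemma X_in_span t : {ae P, forall w,
  (fun N => ip U (coords_residual (ip U) psi' N (X t j w)) (coords_residual (ip U) psi' N (X t j w)))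
    @ \oo --> (0 : R)}.
Proof.
have op (f : R -> R^o) (Hf : H f) := orthogonal_part SHH (H_complete HH) Hpsi one Hf.
have XH w : H (X t j w) := X_H flp t j w.
have Hr N f : H f -> H (coords_residual (ip U) psi' N f) := Hresidual SHH Hpsi N (f := f).
pose rX w := sval (cid (op _ (XH w))).
have rXP w : [/\ H (rX w), forall l, ip U (rX w) (psi l) = 0 &
  (fun N => ip U (coords_residual (ip U) psi' N (X t j w) - rX w) (coords_residual (ip U) psi' N (X t j w) - rX w)) @ \oo --> (0 : R)].
  exact: svalP (cid (op _ (XH w))).
have step k : exists D : Om -> R, [/\ measurable_fun setT D, forall w, 0 <= D w,
    (\int[P]_w (D w)%:E <= (k.+1%:R^-1)%:E)%E & {ae P, forall w, ip U (rX w) (rX w) <= D w}].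
  have e0 : 0 < k.+1%:R^-1 :> R by rewrite invr_gt0.
  have [N [m [f [g [Hf Hg _ h]]]]] := approximation HH flp j [:: t] e0.
  have [|LD De] := h t; first by rewrite inE.
  pose D w : R -> R := fun u => X t j w u - apx N f g t w u.
  have HN w : H (apx N f g t w) by apply: approximant_H.
  have HD w : H (D w) := siB SHH (XH w) (HN w).
  have mD : measurable_fun (setT `*` U) (unc D) by case: LD.
  exists (fun w => ip U (D w) (D w)); split.
  - exact: measurable_sqnorm.
  - by move=> w; exact: (si_ge0 SHH).
  - have E : (\int[P]_w (ip U (D w) (D w))%:E = \int[P \x leb]_(z in setT `*` U) (unc D z ^+ 2)%:E)%E.
      rewrite (tonelli_rectangle P leb measurableT mU (measurable_funX 2 mD)) => [|z]; last exact: sqr_ge0.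
      by apply: eq_integral => w _; rewrite -(ipm_sqE mU (HL (HD w))).
    by rewrite E -(ipm_sqE mTU LD) lee_fin.
  pose q l i r := sval (cid (op _ (Hf l i r))).
  have qP l i r : [/\ H (q l i r), forall a, ip U (q l i r) (psi a) = 0 &
    (fun N => ip U (coords_residual (ip U) psi' N (f l i r) - q l i r) (coords_residual (ip U) psi' N (f l i r) - q l i r)) @ \oo --> (0 : R)].
    exact: svalP (cid (op _ (Hf l i r))).
  have ae1 (l : 'I_N) i r : {ae P, forall w, ip U (q l i r) (X t j w) = 0}.
    have [Hq q0 _] := qP l i r.
    have Lq := ip_random_L2 (LX t j) (HL Hq).
    have z0 : ipP (fun w => ip U (q l i r) (X t j w)) (fun w => ip U (q l i r) (X t j w)) = 0.
      by rewrite -/(covform t j _ _) covform_stationary // covform_null.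
    by apply: (ae_imp (ipm_sq0_ae measurableT Lq z0)) => w; apply.
  have ae2 : {ae P, forall w, forall (l : 'I_N) i r, ip U (q l i r) (X t j w) = 0}.
    by apply: filter_forall => l; apply: filter_forall => i; apply: filter_forall => r; exact: ae1.
  apply: (ae_imp ae2) => w qX0; have [Hrw rw0 rwc] := rXP w.
  apply: (orthogonal_part_le SHH Hpsi (XH w) (HN w) Hrw rw0 rwc).
  apply: (approximant_orth _ _ Hf Hg (HL Hrw)) => l i r.
  have [Hq q0 qc] := qP l i r.
  rewrite (orthogonal_part_sym SHH Hpsi (XH w) (Hf l i r) Hrw Hq rwc qc).
  by rewrite (si_sym SHH (XH w) Hq).
have [D DP] := choice step.
have aeall : {ae P, forall w, forall k, ip U (rX w) (rX w) <= D k w}.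
  by apply: ae_foralln => k; case: (DP k).
pose I w := einfs (fun k => (D k w)%:E) 0%N.
have mI : measurable_fun setT I.
  by apply: (measurable_fun_einfs (f := fun k w => (D k w)%:E)) => k; apply/measurable_EFinP; case: (DP k).
have I0 w : (0 <= I w)%E by apply: le_einfs => k; rewrite lee_fin; case: (DP k).
have II : (\int[P]_w `|I w| = 0)%E.
  apply/eqP; rewrite eq_le; apply/andP; split; last exact: integral_ge0.
  under eq_integral do rewrite gee0_abs //.
  apply/lee_addgt0Pr => e e0; rewrite add0e.
  have [N NP] := invSn_lt e0; have [mD D0 DI _] := DP N.
  apply: (@le_trans _ _ (\int[P]_w (D N w)%:E)%E).
    apply: ge0_le_integral => //; first exact/measurable_EFinP.
    by move=> w _; exact: (einfs_le (fun k => (D k w)%:E)).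
  by apply: le_trans DI _; rewrite lee_fin ltW // NP.
have aeI : {ae P, forall w, I w = 0%E}.
  have [h _] := ae_eq_integral_abs P measurableT mI.
  by apply: (ae_imp (h II)) => w; apply.
apply: (ae_imp2 aeall aeI) => w h1 h2.
have [Hrw rw0 rwc] := rXP w.
have rr0 : ip U (rX w) (rX w) = 0.
  apply/eqP; rewrite eq_le (si_ge0 SHH Hrw) andbT -lee_fin -[leRHS]h2.
  by apply: le_einfs => k; rewrite lee_fin.
apply: (cvg0_le _ (cvg0_Ml 2 rwc)) => N; rewrite (si_ge0 SHH) /=; last by apply: Hr; exact: XH.
have HrN := Hr N _ (XH w).
rewrite -{1 2}(subrK (rX w) (coords_residual (ip U) psi' N (X t j w))).
apply: le_trans (form_sqD_le SHH (siB SHH HrN Hrw) Hrw) _.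
by rewrite rr0 mulr0 addr0.
Qed.

End Eigen.
End Spectral.

(** * Independence *)

Section Independence.
Context {R : realType} {dsp : measure_display} {Om : measurableType dsp}.
Variable P : probability Om R.

(** The law of an independent pair is a product measure, so one component can be
    frozen while the other is integrated out. *)
Lemma independent_fubini {d1 d2} {T1 : measurableType d1} {T2 : measurableType d2}
    (V : Om -> T1) (W : Om -> T2) (phi : T1 * T2 -> \bar R) :
  measurable_fun setT V -> measurable_fun setT W ->
  (forall A B, measurable A -> measurable B ->
     P (V @^-1` A `&` W @^-1` B) = P (V @^-1` A) * P (W @^-1` B))%E ->
  measurable_fun setT phi -> (forall z, 0 <= phi z)%E ->
  (\int[P]_w phi (V w, W w) = \int[P]_w1 \int[P]_w2 phi (V w1, W w2))%E.
Proof.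
move=> mV mW ind mphi phi0.
pose V' : {mfun Om >-> T1} := HB.pack V (isMeasurableFun.Build _ _ _ _ V mV).
pose W' : {mfun Om >-> T2} := HB.pack W (isMeasurableFun.Build _ _ _ _ W mW).
have mVW : measurable_fun setT (fun w => (V w, W w)) by apply/measurable_fun_pairP.
pose VW : {mfun Om >-> (T1 * T2)%type} :=
  HB.pack (fun w => (V w, W w)) (isMeasurableFun.Build _ _ _ _ (fun w => (V w, W w)) mVW).
have E : forall X, measurable X -> (distribution P V' \x distribution P W')%E X = distribution P VW X.
  apply: product_measure_unique => A B mA mB.
  by rewrite /distribution /pushforward -ind.
transitivity (\int[distribution P VW]_z phi z)%E.
  by rewrite ge0_integral_pushforward.
rewrite (eq_measure_integral (distribution P V' \x distribution P W')%E); last first.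
  by move=> A mA _; rewrite -[LHS]/(distribution P VW A) -E.
rewrite fubini_tonelli1 //.
have mF : measurable_fun setT (fubini_F (distribution P W') phi).
  exact: measurable_fun_fubini_tonelli_F.
rewrite ge0_integral_pushforward //; last by move=> x _; exact: integral_ge0.
apply: eq_integral => w1 _ /=; rewrite /fubini_F ge0_integral_pushforward //.
by apply: measurableT_comp => //; exact: measurable_pair1.
Qed.

(** Cylinders over the coordinates in [J]: a pi-system generating the
    sigma-algebra of the corresponding subfamily. *)
Definition cylinder {I : choiceType} (F : I -> set (set Om)) (J : seq I) : set (set Om) :=
  [set E | exists2 A : I -> set Om, (forall i, i \in J -> F i (A i)) &
     E = [set w | forall i, i \in J -> A i w]].

Section Family.
Variables (I : choiceType) (g : I -> set (set Om)).
Let F i := <<s g i >>.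
Hypothesis gm : forall i, g i `<=` measurable.
Hypothesis ind : mutually_independent P F.

Let Fm i : F i `<=` measurable.
Proof. by move=> A; apply: smallest_sub => //; exact: sigma_algebra_measurable. Qed.

Let FI i A B : F i A -> F i B -> F i (A `&` B).
Proof. exact: (@measurableI _ (g_sigma_algebraType (g i))). Qed.

Lemma cylinder_measurable J : cylinder F J `<=` measurable.
Proof.
move=> _ [A FA ->].
have -> : [set w | forall i, i \in J -> A i w] = \bigcap_(i in [set` J]) A i.
  by apply/seteqP; split=> w h i iJ; exact: h.
by apply: fin_bigcap_measurable => // i iJ; apply: Fm; exact: FA.
Qed.

(** Mutual independence is the product rule on cylinders, which are stable under
    intersection; a monotone class argument extends it to the generated sigma-algebra. *)
Lemma cylinder_independent J s : s \notin J ->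
  independent P <<s cylinder F J >> (F s).
Proof.
move=> sJ A B GA FB.
have mB := Fm FB.
have pB : P B \is a fin_num by exact: fin_num_measure.
have pB0 : 0 <= fine (P B) by rewrite fine_ge0.
pose m2 := mscale (NngNum pB0) P.
have := @g_sigma_algebra_measure_unique _ R Om (cylinder F J) (@cylinder_measurable J)
  (fun=> setT) _ _ (mrestr P mB) m2.
move=> /(_ _ _ _ _ _ A GA) h.
have -> : (P A * P B = m2 A)%E by rewrite /m2 /mscale /= fineK // muleC.
rewrite -[LHS]/(mrestr P mB A); apply: h => //.
- by move=> _; exists (fun=> setT) => [i _|]; [exact: (@measurableT _ (g_sigma_algebraType (g i)))|apply/seteqP; split].
- by rewrite bigcup_const //; exists 0%N.
- move=> _ _ [C FC ->] [D FD ->]; exists (fun i => C i `&` D i).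
    by move=> i iJ; apply: FI; [exact: FC|exact: FD].
  apply/seteqP; split=> w; first by move=> [h1 h2] i iJ; split; [exact: h1|exact: h2].
  by move=> h1; split=> i iJ; have [] := h1 _ iJ.
- move=> _ [C FC ->].
  pose C' i := if i == s then B else C i.
  have sJ' : s \notin [fset x in J]%fset by rewrite in_fset.
  rewrite -[LHS]/(P ([set w | forall i, i \in J -> C i w] `&` B)).
  have -> : P ([set w | forall i, i \in J -> C i w] `&` B) =
     P [set w | forall i, i \in (s |` [fset x in J])%fset -> C' i w].
    congr (P _); apply/seteqP; split=> w /=.
      move=> [h1 h2] i; rewrite !inE /C'; case: eqP => //= _ iJ; exact: h1.
    move=> h1; split; last by have := h1 s; rewrite !inE eqxx /C' eqxx; apply.
    move=> i iJ; have := h1 i; rewrite !inE iJ orbT /C' => /(_ isT).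
    by case: eqP => // es; move: sJ; rewrite -es iJ.
  rewrite ind; last first.
    by move=> i; rewrite !inE /C'; case: eqP => [->|_] //= iJ; exact: FC.
  rewrite big_fsetU1 //= {1}/C' eqxx.
  rewrite /m2 /mscale /= fineK //.
  congr (_ * _)%E.
  have -> : [set w | forall i, i \in J -> C i w] = [set w | forall i, i \in [fset x in J]%fset -> C i w].
    by apply/seteqP; split=> w h1 i; [rewrite in_fset; exact: h1| move=> iJ; apply: h1; rewrite in_fset].
  rewrite ind; last by move=> i; rewrite in_fset; exact: FC.
  rewrite big_seq [RHS]big_seq; apply: eq_bigr => i; rewrite in_fset /C' => iJ.
  by case: eqP => // es; move: sJ; rewrite -es iJ.
- move=> _; rewrite -[X in (X < _)%E]/(P (setT `&` B)) setTI; apply: le_lt_trans (probability_le1 P mB) _; exact: ltry.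
Qed.

Notation TJ J := (g_sigma_algebraType (cylinder F J)).
Notation TF i := (g_sigma_algebraType (g i)).

Lemma measurable_cylinder J i (V : Om -> R) : i \in J ->
  measurable_fun setT (V : TF i -> R) -> measurable_fun setT (V : TJ J -> R).
Proof.
move=> iJ mV _ B mB; have := mV measurableT B mB; rewrite !setTI => h.
apply: sub_sigma_algebra; exists (fun j => if j == i then V @^-1` B else setT).
  by move=> j jJ; case: eqP => [->//|_]; exact: (@measurableT _ (TF j)).
apply/seteqP; split=> w /=; first by move=> Bw j jJ; case: eqP.
by move=> /(_ i iJ); rewrite eqxx.
Qed.

Lemma measurable_of_sub {G : set (set Om)} (V : Om -> R) : G `<=` measurable ->
  measurable_fun setT (V : g_sigma_algebraType G -> R) -> measurable_fun setT V.
Proof.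
move=> Gm mV _ B mB; have := mV measurableT B mB.
apply: smallest_sub => //; exact: sigma_algebra_measurable.
Qed.

(** One step of a supermartingale: the factor [phi (V, W)] is integrated out
    conditionally on a sigma-algebra that carries [G] and [V] and is independent of [W]. *)
Lemma conditional_step {G1 G2 : set (set Om)} (G V W : Om -> R) (phi : R * R -> R) (c : R) :
  G1 `<=` measurable -> G2 `<=` measurable ->
  independent P <<s G1 >> <<s G2 >> ->
  measurable_fun setT (G : g_sigma_algebraType G1 -> R) ->
  measurable_fun setT (V : g_sigma_algebraType G1 -> R) ->
  measurable_fun setT (W : g_sigma_algebraType G2 -> R) ->
  measurable_fun setT phi -> (forall z, 0 <= phi z) -> (forall w, 0 <= G w) ->
  (forall v, \int[P]_w (phi (v, W w))%:E <= c%:E)%E ->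
  (\int[P]_w (G w * phi (V w, W w))%:E <= c%:E * \int[P]_w (G w)%:E)%E.
Proof.
move=> G1m G2m iG mG mV mW mphi phi0 G0 hc.
pose T1 := g_sigma_algebraType G1; pose T2 := g_sigma_algebraType G2.
have id1 : measurable_fun setT (id : Om -> T1).
  by move=> _ B mB; rewrite setTI; apply: (@smallest_sub _ _ _ _ _ G1m B mB); exact: sigma_algebra_measurable.
have id2 : measurable_fun setT (id : Om -> T2).
  by move=> _ B mB; rewrite setTI; apply: (@smallest_sub _ _ _ _ _ G2m B mB); exact: sigma_algebra_measurable.
pose psi (z : T1 * T2) : \bar R := ((G : T1 -> R) z.1 * phi ((V : T1 -> R) z.1, (W : T2 -> R) z.2))%:E.
have mpsi : measurable_fun setT psi.
  apply/measurable_EFinP; apply: measurable_funM.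
    by apply: measurableT_comp mG _; exact: measurable_fst.
  apply: measurableT_comp => //; apply/measurable_fun_pairP; split.
    by apply: measurableT_comp mV _; exact: measurable_fst.
  by apply: measurableT_comp mW _; exact: measurable_snd.
have -> : (\int[P]_w (G w * phi (V w, W w))%:E = \int[P]_w psi ((id w : T1), (id w : T2)))%E by [].
rewrite (independent_fubini id1 id2 _ mpsi) //; last by move=> z; rewrite lee_fin mulr_ge0.
have mGO := measurable_of_sub G1m mG.
have mWO := measurable_of_sub G2m mW.
have mV1 v : measurable_fun setT (fun w => (phi (v, W w))%:E).
  apply/measurable_EFinP; apply: (measurableT_comp mphi).
  exact: (measurable_fun_pair (measurable_cst v) mWO).
have c0 : 0 <= c.
  by have := hc 0; rewrite -lee_fin; apply: le_trans; apply: integral_ge0 => w _; rewrite lee_fin.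
rewrite -ge0_integralZl ?lee_fin //; [|exact/measurable_EFinP|by move=> w _; rewrite lee_fin].
apply: ge0_le_integral => //.
- by move=> w _; apply: integral_ge0 => w' _; rewrite lee_fin mulr_ge0.
- pose fF := fubini_F P (fun z : T1 * Om => psi (z.1, (z.2 : T2))).
  have mfF : measurable_fun setT fF.
    apply: (@measurable_fun_fubini_tonelli_F _ _ T1 Om R P (fun z : T1 * Om => psi (z.1, (z.2 : T2)))); last first.
      by move=> z; rewrite lee_fin mulr_ge0.
    apply: measurableT_comp mpsi _; apply/measurable_fun_pairP; split; first exact: measurable_fst.
    by apply: measurableT_comp id2 _; exact: measurable_snd.
  exact: (measurableT_comp mfF id1).
- by apply/measurable_EFinP; apply: measurable_funM.
- move=> w _; rewrite /psi /=; under eq_integral do rewrite EFinM.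
  rewrite ge0_integralZl ?lee_fin //; last by move=> w' _; rewrite lee_fin.
  by rewrite muleC lee_wpmul2r ?lee_fin.
Qed.

(** The last factor is integrated out first, conditionally on all earlier ones. *)
Lemma sequential_bound n (J : nat -> seq I) (s : nat -> I) (V W : nat -> Om -> R)
    (phi : nat -> R * R -> R) (c : nat -> R) :
  (forall m, (m < n)%N -> s m \notin J m) ->
  (forall m, (m < n)%N -> measurable_fun setT (V m : TJ (J m) -> R)) ->
  (forall m, (m < n)%N -> measurable_fun setT (W m : TF (s m) -> R)) ->
  (forall m k, (m < n)%N -> (k < m)%N -> measurable_fun setT (V k : TJ (J m) -> R)) ->
  (forall m k, (m < n)%N -> (k < m)%N -> s k \in J m) ->
  (forall m, measurable_fun setT (phi m)) -> (forall m z, 0 <= phi m z) ->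
  (forall m v, (m < n)%N -> \int[P]_w (phi m (v, W m w))%:E <= (c m)%:E)%E ->
  (\int[P]_w (\prod_(m < n) phi m (V m w, W m w))%:E <= (\prod_(m < n) c m)%:E)%E.
Proof.
move=> sJ mV mW mVk sk mphi phi0 hc.
elim: n => [|n IH] in sJ mV mW mVk sk hc *.
  under eq_integral do rewrite big_ord0.
  by rewrite big_ord0 integral_cst //= probability_setT mule1.
under eq_integral do rewrite big_ord_recr /=.
have m1 k : (k < n)%N -> measurable_fun setT (W k : TJ (J n) -> R).
  move=> kn; apply: (measurable_cylinder (sk _ _ (ltnSn n) kn)); apply: mW; exact: ltnW.
have mG : measurable_fun setT ((fun w => \prod_(m < n) phi m (V m w, W m w)) : TJ (J n) -> R).
  apply: measurable_prod => k _; apply: measurableT_comp => //.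
  by apply/measurable_fun_pairP; split; [apply: mVk|apply: m1].
apply: le_trans (conditional_step (@cylinder_measurable (J n)) (@gm (s n)) (cylinder_independent (sJ _ (ltnSn n)))
  mG (mV _ (ltnSn n)) (mW _ (ltnSn n)) (mphi n) (phi0 n) _ (hc n ^~ (ltnSn n))) _.
  by move=> w; apply: prodr_ge0.
rewrite big_ord_recr /= mulrC EFinM lee_wpmul2l //.
  apply: (@le_trans _ _ (\int[P]_w (phi n (0, W n w))%:E)%E); last exact: hc.
  by apply: integral_ge0 => w _; rewrite lee_fin.
apply: IH => m; [by move=> h; apply: sJ; exact: ltnW|by move=> h; apply: mV; exact: ltnW|by move=> h; apply: mW; exact: ltnW|..].
- by move=> k h1 h2; apply: mVk => //; exact: ltnW.
- by move=> k h1 h2; apply: sk => //; exact: ltnW.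
- by move=> v h; apply: hc; exact: ltnW.
Qed.

Lemma product_bound n (s : nat -> I) (f : nat -> Om -> R) (c : nat -> R) :
  (forall m k, (k < m < n)%N -> s k != s m) ->
  (forall m, (m < n)%N -> measurable_fun setT (f m : TF (s m) -> R)) ->
  (forall m w, 0 <= f m w) ->
  (forall m, (m < n)%N -> \int[P]_w (f m w)%:E <= (c m)%:E)%E ->
  (\int[P]_w (\prod_(m < n) f m w)%:E <= (\prod_(m < n) c m)%:E)%E.
Proof.
move=> ds mf f0 hc.
have := @sequential_bound n (fun m => [seq s k | k <- iota 0 m]) s (fun _ _ => 0) f
   (fun _ z => Num.max 0 z.2) c.
have E m w : Num.max 0 (f m w) = f m w by apply: max_r.
under eq_integral do under eq_bigr do rewrite /= E.
apply.
- move=> m mn; apply/mapP => -[k]; rewrite mem_iota add0n /= => km e.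
  by have := ds m k; rewrite km mn /= e eqxx => /(_ isT).
- by move=> m _; exact: measurable_cst.
- exact: mf.
- by move=> m k _ _; exact: measurable_cst.
- by move=> m k _ km; apply/mapP; exists k => //; rewrite mem_iota.
- by move=> m; apply: measurable_maxr; [exact: measurable_cst|exact: measurable_snd].
- by move=> m z; rewrite le_max lexx.
- by move=> m v mn; under eq_integral do rewrite /= E; exact: hc.
Qed.

Lemma product_bound_fin (Q : finType) (s : Q -> I) (f : Q -> Om -> R) (c : Q -> R) :
  injective s -> (forall q, measurable_fun setT (f q : TF (s q) -> R)) -> (forall q w, 0 <= f q w) ->
  (forall q, \int[P]_w (f q w)%:E <= (c q)%:E)%E ->
  (\int[P]_w (\prod_q f q w)%:E <= (\prod_q c q)%:E)%E.
Proof.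
move=> sI mf f0 hc.
have [q0|noQ] := pickP (fun _ : Q => true); last first.
  have e (h : Q -> R) : \prod_q h q = 1 by rewrite big_pred0.
  under eq_integral do rewrite e.
  by rewrite e integral_cst //= probability_setT mule1.
move=> _; pose v m := nth q0 (enum Q) m.
have E (h : Q -> R) : \prod_q h q = \prod_(m < #|Q|) h (v m).
  by rewrite -big_enum /= (big_nth q0) big_mkord -cardE.
under eq_integral do rewrite E.
rewrite E; apply: (product_bound (s := s \o v) (f := fun m => f (v m)) (c := fun m => c (v m))) => //; last by move=> m _; exact: mf.
move=> m k /andP[km mn]; rewrite /= (inj_eq sI) /v nth_uniq ?enum_uniq -?cardE //; last exact: ltn_trans km mn.
by rewrite neq_ltn km.
Qed.

End Family.
End Independence.

(** * Exponential moments of squares and products *)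

Section GaussianKernel.
Context {R : realType}.
Notation leb := (@lebesgue_measure R).
Let s : R := Num.sqrt 2^-1.

Let s2 : s ^+ 2 = 2^-1. Proof. by rewrite sqr_sqrtr // invr_ge0. Qed.
Let s0 : s != 0. Proof. by rewrite gt_eqF // sqrtr_gt0 invr_gt0. Qed.

Lemma gauss_shift (z x : R) :
  expR (x * z) * normal_pdf 0 s x = expR (z ^+ 2 / 4) * normal_pdf (z / 2) s x.
Proof.
rewrite !normal_pdfE // /normal_fun s2 mulrCA [RHS]mulrCA -!expRD; congr (_ * expR _).
by field.
Qed.

Lemma gauss_linearize (z : R) :
  (\int[leb]_x (expR (x * z) * normal_pdf 0 s x)%:E = (expR (z ^+ 2 / 4))%:E)%E.
Proof.
under eq_integral do rewrite gauss_shift EFinM.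
rewrite ge0_integralZl ?lee_fin ?expR_ge0 //.
- by rewrite integral_normal_pdf mule1.
- by apply/measurable_EFinP; exact: measurable_normal_pdf.
- by move=> x _; rewrite lee_fin normal_pdf_ge0.
Qed.

Lemma gauss_square :
  (\int[leb]_x (expR (x ^+ 2 / 2) * normal_pdf 0 s x)%:E = (Num.sqrt 2)%:E)%E.
Proof.
have E x : expR (x ^+ 2 / 2) * normal_pdf 0 s x = Num.sqrt 2 * normal_pdf 0 1 x.
  rewrite !normal_pdfE // ?oner_neq0 // /normal_fun /normal_peak s2 expr1n !subr0.
  rewrite mulrCA -expRD mulrA; congr (_ * expR _); last by field.
  have -> : 2^-1 * pi *+ 2 = pi :> R by rewrite -mulr_natr mulrAC mulVf ?mul1r // pnatr_eq0.
  rewrite mul1r -[pi *+ 2]mulr_natl sqrtrM // invfM mulrA mulfV ?mul1r //.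
under eq_integral do rewrite E EFinM.
rewrite ge0_integralZl ?lee_fin ?sqrtr_ge0 //.
- by rewrite integral_normal_pdf mule1.
- by apply/measurable_EFinP; exact: measurable_normal_pdf.
- by move=> x _; rewrite lee_fin normal_pdf_ge0.
Qed.

Definition gauss_weight : R -> R := normal_pdf 0 s.

Lemma gauss_weight_ge0 x : 0 <= gauss_weight x. Proof. exact: normal_pdf_ge0. Qed.

Lemma measurable_gauss_weight : measurable_fun setT gauss_weight.
Proof. exact: measurable_normal_pdf. Qed.

End GaussianKernel.

Section SubGaussian.
Context {R : realType} {dsp : measure_display} {Om : measurableType dsp}.
Variable P : probability Om R.
Notation leb := (@lebesgue_measure R).

(** Squares are linearized by [exp (z^2 / 4) = E exp (z G)], [G] centred Gaussian of
    variance 1/2. One coordinate is linearized at a time, so that only joint moment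
    generating functions of the vector occur. *)
Lemma quadratic_exp_bound n (Z : nat -> Om -> R) :
  (forall t, measurable_fun setT (Z t)) ->
  (forall c : nat -> R, \int[P]_w (expR (\sum_(t < n) c t * Z t w))%:E <=
     (expR (\sum_(t < n) c t ^+ 2 / 2))%:E)%E ->
  (\int[P]_w (expR (\sum_(t < n) Z t w ^+ 2 / 4))%:E <= (Num.sqrt 2 ^+ n)%:E)%E.
Proof.
move=> mZ hZ.
pose S m (c : nat -> R) w := \sum_(t < n) (if (t < m)%N then Z t w ^+ 2 / 4 else c t * Z t w).
pose Q m (c : nat -> R) := \sum_(t < n) (if (t < m)%N then 0 else c t ^+ 2 / 2).
have mS m c : measurable_fun setT (S m c).
  apply: measurable_sum => t; case: (t < m)%N; last exact: measurable_funM.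
  by apply: measurable_funM => //; exact: measurable_funX.
suff step m : (m <= n)%N -> forall c, (\int[P]_w (expR (S m c w))%:E <= (Num.sqrt 2 ^+ m * expR (Q m c))%:E)%E.
  have := step n (leqnn n) (fun=> 0).
  rewrite /Q big1 => [|t _]; last by rewrite ltn_ord.
  rewrite expR0 mulr1; apply: le_trans; rewrite le_eqVlt; apply/orP; left; apply/eqP.
  by apply: eq_integral => w _; rewrite /S; congr (expR _)%:E; apply: eq_bigr => t _; rewrite ltn_ord.
elim: m => [_ c|m IH mn c]; first by rewrite expr0 mul1r; exact: hZ.
pose c' x t := if t == m then x else c t.
pose o := Ordinal mn.
have SE w : S m.+1 c w = Z m w ^+ 2 / 4 + S m (c' 0) w.
  rewrite /S (bigD1 o) //= ltnSn; congr (_ + _); rewrite [RHS](bigD1 o) //= ltnn /c' eqxx mul0r add0r.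
  apply: eq_bigr => t to; rewrite ltnS leq_eqVlt (negbTE (_ : t != m :> nat)) //=.
have Sx x w : S m (c' x) w = x * Z m w + S m (c' 0) w.
  rewrite /S (bigD1 o) //= ltnn {1}/c' eqxx; congr (_ + _).
  rewrite [RHS](bigD1 o) //= ltnn {2}/c' eqxx mul0r add0r.
  by apply: eq_bigr => t to; rewrite /c' (negbTE (_ : t != m :> nat)).
have Qx x : Q m (c' x) = x ^+ 2 / 2 + Q m.+1 c.
  rewrite /Q (bigD1 o) //= ltnn {1}/c' eqxx; congr (_ + _).
  rewrite [RHS](bigD1 o) //= ltnSn add0r.
  by apply: eq_bigr => t to; rewrite /c' ltnS [in RHS]leq_eqVlt (negbTE (_ : t != m :> nat)).
pose h (z : Om * R) := expR (S m (c' 0) z.1) * (expR (z.2 * Z m z.1) * gauss_weight z.2).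
have mh : measurable_fun setT h.
  apply: measurable_funM; first by apply: measurableT_comp => //; apply: measurableT_comp (mS _ _) _; exact: measurable_fst.
  apply: measurable_funM.
    apply: measurableT_comp => //; apply: measurable_funM; first exact: measurable_snd.
    by apply: measurableT_comp (mZ _) _; exact: measurable_fst.
  by apply: measurableT_comp; [exact: measurable_gauss_weight|exact: measurable_snd].
have h0 z : 0 <= h z by rewrite !mulr_ge0 ?expR_ge0 ?gauss_weight_ge0.
have -> : (\int[P]_w (expR (S m.+1 c w))%:E = \int[P]_w \int[leb]_x (h (w, x))%:E)%E.
  apply: eq_integral => w _; rewrite SE addrC expRD.
  under eq_integral do rewrite /h /= EFinM.
  rewrite ge0_integralZl ?lee_fin ?expR_ge0 //.
  - by rewrite gauss_linearize.
  - apply/measurable_EFinP; apply: measurable_funM; last exact: measurable_gauss_weight.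
    by apply: measurableT_comp => //; apply: measurable_funM.
  - by move=> x _; rewrite lee_fin mulr_ge0 ?expR_ge0 ?gauss_weight_ge0.
rewrite (@fubini_tonelli _ _ Om _ R P leb (fun z => (h z)%:E)) //; last exact/measurable_EFinP.
have E x : (\int[P]_w (h (w, x))%:E = (gauss_weight x)%:E * \int[P]_w (expR (S m (c' x) w))%:E)%E.
  rewrite -ge0_integralZl ?lee_fin ?gauss_weight_ge0 //.
  - by apply: eq_integral => w _; rewrite /h (Sx x) expRD -EFinM /=; congr (_%:E); ring.
  - by apply/measurable_EFinP; apply: measurableT_comp.
under eq_integral do rewrite E.
have mSQ : measurable_fun setT (fun x : R => (expR (x ^+ 2 / 2) * gauss_weight x)%:E).
  apply/measurable_EFinP; apply: measurable_funM; last exact: measurable_gauss_weight.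
  by apply: measurableT_comp => //; apply: measurable_funM => //; exact: measurable_funX.
have K0 : 0 <= Num.sqrt 2 ^+ m * expR (Q m.+1 c) :> R by rewrite mulr_ge0 ?expR_ge0 // exprn_ge0.
apply: (@le_trans _ _ (\int[leb]_x ((Num.sqrt 2 ^+ m * expR (Q m.+1 c))%:E * (expR (x ^+ 2 / 2) * gauss_weight x)%:E))%E).
  apply: ge0_le_integral => //.
  - by move=> x _; rewrite mule_ge0 ?lee_fin ?gauss_weight_ge0 //; apply: integral_ge0 => w _; rewrite lee_fin expR_ge0.
  - apply: (eq_measurable_fun (fun x => \int[P]_w (h (w, x))%:E)%E); first by move=> x _; exact: E.
    apply: (@measurable_fun_fubini_tonelli_G _ _ Om _ R P (fun z => (h z)%:E)); first exact/measurable_EFinP.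
    by move=> z; rewrite lee_fin.
  - by apply: emeasurable_funM => //; exact: measurable_cst.
  - move=> x _; apply: le_trans (lee_wpmul2l _ (IH (ltnW mn) (c' x))) _; first by rewrite lee_fin gauss_weight_ge0.
    rewrite -!EFinM lee_fin Qx expRD le_eqVlt; apply/orP; left; apply/eqP; ring.
rewrite ge0_integralZl ?lee_fin //; last by move=> x _; rewrite lee_fin mulr_ge0 ?expR_ge0 ?gauss_weight_ge0.
by rewrite gauss_square -EFinM lee_fin exprSr mulrAC.
Qed.

(** The variance proxy is normalized to 1, which makes the constants below absolute. *)
Record unit_subgaussian (V : Om -> R) : Prop := {
  usg_meas : measurable_fun setT V;
  usg_mgf : forall x, (\int[P]_w (expR (x * V w))%:E <= (expR (x ^+ 2 / 2))%:E)%E }.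

Lemma usg_square_exp V : unit_subgaussian V ->
  (\int[P]_w (expR (V w ^+ 2 / 4))%:E <= (Num.sqrt 2)%:E)%E.
Proof.
move=> [mV hV]; have := @quadratic_exp_bound 1 (fun=> V) (fun=> mV).
under eq_integral do rewrite big_ord1.
rewrite expr1; apply => c; rewrite big_ord1; under eq_integral do rewrite big_ord1; exact: hV.
Qed.

Lemma sqrt2_le : Num.sqrt 2 <= 3 / 2 :> R.
Proof. by rewrite -ler_sqr ?nnegrE ?sqrtr_ge0 // ?sqr_sqrtr //; lra. Qed.

Lemma expR_scale_le (th y : R) : 0 <= th <= 1 -> expR (th * y) <= 1 - th + th * expR y.
Proof.
move=> /andP[th0 th1].
have h1 : expR (th * y) * (1 + (1 - th) * y) <= expR y.
  rewrite (_ : expR y = expR (th * y) * expR ((1 - th) * y)); last by rewrite -expRD; congr expR; ring.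
  by rewrite ler_wpM2l ?expR_ge0 // expR_ge1Dx.
have h2 : expR (th * y) * (1 - th * y) <= 1.
  rewrite -[leRHS](expRxMexpNx_1 (th * y)) ler_wpM2l ?expR_ge0 //.
  exact: expR_ge1Dx.
have th1' : 0 <= 1 - th by lra.
have := lerD (ler_wpM2l th0 h1) (ler_wpM2l th1' h2).
rewrite mulr1; set e1 := expR (th * y); set e2 := expR y => h3.
apply: (@le_trans _ _ (th * (e1 * (1 + (1 - th) * y)) + (1 - th) * (e1 * (1 - th * y)))); last lra.
by rewrite le_eqVlt; apply/orP; left; apply/eqP; ring.
Qed.

Lemma expR_le_quadratic (x : R) : expR x <= 1 + x + x ^+ 2 * expR `|x|.
Proof.
have h : expR x - 1 <= x * expR x.
  have : expR x * (1 - x) <= 1.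
    by rewrite -[leRHS](expRxMexpNx_1 x) ler_wpM2l ?expR_ge0 // expR_ge1Dx.
  by rewrite mulrBr mulr1; lra.
have [x0|x0] := lerP 0 x.
  have := ler_wpM2l x0 h; rewrite (ger0_norm x0); nra.
have h2 := @expR_ge1Dx R x; have h3 : 1 <= expR `|x|.
  by apply: le_trans (expR_ge1Dx `|x|); rewrite lerDl.
have h4 : x ^+ 2 <= x ^+ 2 * expR `|x| by rewrite ler_peMr // sqr_ge0.
nra.
Qed.

Lemma sqr_le_expR (x : R) : x ^+ 2 <= 2 * expR `|x|.
Proof.
by have := expR_ge1Dxn 1 (normr_ge0 x); rewrite (_ : 2`! = 2)%N // real_normK ?num_real //; lra.
Qed.

Lemma expR_normr_le (x : R) : expR `|x| <= expR x + expR (- x).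
Proof.
by have [x0|x0] := lerP 0 x; [rewrite ger0_norm // lerDl expR_ge0|rewrite ltr0_norm // lerDr expR_ge0].
Qed.

Lemma integral_constD (a : R) (f : Om -> R) : measurable_fun setT f -> 0 <= a -> (forall w, 0 <= f w) ->
  (\int[P]_w (a + f w)%:E = a%:E + \int[P]_w (f w)%:E)%E.
Proof.
move=> mf a0 f0; under eq_integral do rewrite EFinD.
rewrite ge0_integralD //=; [|by move=> w _; rewrite lee_fin|exact/measurable_EFinP].
by rewrite integral_cst //= probability_setT mule1.
Qed.

Lemma expectationZ (c : R) (f : Om -> R) : measurable_fun setT f -> 0 <= c -> (forall w, 0 <= f w) ->
  (\int[P]_w (c * f w)%:E = c%:E * \int[P]_w (f w)%:E)%E.
Proof.
move=> mf c0 f0; under eq_integral do rewrite EFinM.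
by apply: ge0_integralZl => //; [exact/measurable_EFinP|move=> w _; rewrite lee_fin].
Qed.

Lemma expectationD (f g : Om -> R) : measurable_fun setT f -> measurable_fun setT g ->
  (forall w, 0 <= f w) -> (forall w, 0 <= g w) ->
  (\int[P]_w (f w + g w)%:E = \int[P]_w (f w)%:E + \int[P]_w (g w)%:E)%E.
Proof.
move=> mf mg f0 g0; under eq_integral do rewrite EFinD.
by apply: ge0_integralD => //; [move=> w _; rewrite lee_fin|exact/measurable_EFinP|
  move=> w _; rewrite lee_fin|exact/measurable_EFinP].
Qed.

Lemma le_expectation (f g : Om -> R) : measurable_fun setT f -> measurable_fun setT g ->
  (forall w, 0 <= f w) -> (forall w, f w <= g w) -> (\int[P]_w (f w)%:E <= \int[P]_w (g w)%:E)%E.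
Proof.
move=> mf mg f0 fg; apply: ge0_le_integral => //; [|exact/measurable_EFinP|exact/measurable_EFinP|].
  by move=> w _; rewrite lee_fin.
by move=> w _; rewrite lee_fin.
Qed.

(** Convexity of the exponential interpolates between the exponents 0 and 1/4. *)
Lemma usg_small_square_exp V c : unit_subgaussian V -> 0 <= c <= 1/4 ->
  (\int[P]_w (expR (c * V w ^+ 2))%:E <= (expR (2 * c))%:E)%E.
Proof.
move=> sV /andP[c0 c4]; have mV := usg_meas sV.
have th0 : 0 <= 1 - 4 * c by lra.
have b w : expR (c * V w ^+ 2) <= (1 - 4 * c) + 4 * c * expR (V w ^+ 2 / 4).
  have := @expR_scale_le (4 * c) (V w ^+ 2 / 4); rewrite (_ : 4 * c * (V w ^+ 2 / 4) = c * V w ^+ 2); last by field.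
  by apply; lra.
have mS : measurable_fun setT (fun w => expR (V w ^+ 2 / 4)).
  by apply: measurableT_comp => //; apply: measurable_funM => //; exact: measurable_funX.
have mc : measurable_fun setT (fun w => 4 * c * expR (V w ^+ 2 / 4)) by exact: measurable_funM.
have c1 : 0 <= 4 * c by lra.
apply: (@le_trans _ _ (\int[P]_w ((1 - 4 * c) + 4 * c * expR (V w ^+ 2 / 4))%:E)%E).
  apply: le_expectation => //.
  - by apply: measurableT_comp => //; apply: measurable_funM => //; exact: measurable_funX.
  - exact: measurable_funD.
rewrite integral_constD //; last by move=> w; rewrite mulr_ge0 ?expR_ge0.
rewrite expectationZ //.
apply: le_trans (leeD2l _ (lee_wpmul2l _ (usg_square_exp sV))) _; first by rewrite lee_fin.
rewrite -EFinM -EFinD lee_fin; apply: le_trans (expR_ge1Dx (2 * c)).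
by have := ler_wpM2l c1 sqrt2_le; lra.
Qed.

Section Product.
Variables V W : Om -> R.
Hypotheses (sV : unit_subgaussian V) (sW : unit_subgaussian W).
Let mV := usg_meas sV.
Let mW := usg_meas sW.

Lemma usg_product_exp : (\int[P]_w (expR (`|V w * W w| / 4))%:E <= (3 / 2)%:E)%E.
Proof.
have mq (X : Om -> R) : measurable_fun setT X -> measurable_fun setT (fun w => expR (X w ^+ 2 / 4)).
  by move=> mX; apply: measurableT_comp => //; apply: measurable_funM => //; exact: measurable_funX.
have mVW : measurable_fun setT (fun w => expR (V w ^+ 2 / 4) + expR (W w ^+ 2 / 4)).
  by apply: measurable_funD; exact: mq.
apply: (@le_trans _ _ (\int[P]_w (2^-1 * (expR (V w ^+ 2 / 4) + expR (W w ^+ 2 / 4)))%:E)%E).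
  apply: le_expectation => //.
  - apply: measurableT_comp => //; apply: measurable_funM => //.
    by apply: measurableT_comp => //; apply: measurable_funM.
  - exact: measurable_funM.
  - move=> w.
    have hab : `|V w * W w| / 4 <= V w ^+ 2 / 4 / 2 + W w ^+ 2 / 4 / 2.
      have := sqr_ge0 (`|V w| - `|W w|); rewrite sqrrB !real_normK ?num_real // normrM; lra.
    apply: (@le_trans _ _ (expR (V w ^+ 2 / 4 / 2) * expR (W w ^+ 2 / 4 / 2))).
      by rewrite -expRD ler_expR.
    have e2 (x : R) : expR x = expR (x / 2) ^+ 2 by rewrite -expRM_natl; congr expR; field.
    rewrite (e2 (V w ^+ 2 / 4)) (e2 (W w ^+ 2 / 4)).
    have := sqr_ge0 (expR (V w ^+ 2 / 4 / 2) - expR (W w ^+ 2 / 4 / 2)); rewrite sqrrB; lra.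
rewrite expectationZ //.
rewrite expectationD //; try exact: mq.
apply: le_trans (lee_wpmul2l _ (leeD (usg_square_exp sV) (usg_square_exp sW))) _; first by rewrite lee_fin.
by rewrite -EFinD -EFinM lee_fin; have := sqrt2_le; lra.
Qed.

Let mU : measurable_fun setT (fun w => V w * W w) := measurable_funM mV mW.

Lemma usg_product_abs : (\int[P]_w (`|V w * W w|)%:E <= 2%:E)%E.
Proof.
have mE : measurable_fun setT (fun w => expR (`|V w * W w| / 4)).
  by apply: measurableT_comp => //; apply: measurable_funM => //; exact: measurableT_comp.
have h : (\int[P]_w (1 + 4^-1 * `|V w * W w|)%:E <= (3/2)%:E)%E.
  apply: le_trans usg_product_exp; apply: le_expectation => //.
  - by apply: measurable_funD => //; apply: measurable_funM => //; exact: measurableT_comp.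
  - by move=> w; rewrite mulrC; exact: expR_ge1Dx.
rewrite integral_constD // in h; last by apply: measurable_funM => //; exact: measurableT_comp.
rewrite expectationZ // in h; last exact: measurableT_comp.
move: h; set I := (\int[P]_w _)%E.
have I0 : (0 <= I)%E by apply: integral_ge0 => w _; rewrite lee_fin.
case: I I0 => [r _| |] //; first by rewrite -EFinM -EFinD !lee_fin; lra.
by rewrite gt0_muley ?lte_fin ?invr_gt0 // addey.
Qed.

Lemma usg_product_integrable : P.-integrable setT (fun w => (V w * W w)%:E).
Proof.
apply/integrableP; split; first exact/measurable_EFinP.
by under eq_integral do rewrite abse_EFin; apply: le_lt_trans usg_product_abs _; rewrite ltry.
Qed.

Lemma usg_product_mean : `|ipm P setT V W| <= 2.
Proof.
have /integrableP[mVW _] := usg_product_integrable.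
have := le_trans (le_abse_integral P measurableT mVW) usg_product_abs.
rewrite /ipm /Rintegral.
have /fineK e : (\int[P]_w (V w * W w)%:E)%E \is a fin_num by exact: integrable_fin_num usg_product_integrable.
by rewrite -e abse_EFin lee_fin.
Qed.

(** The second-order remainder of the exponential is absorbed by the exponential moment
    of [|V * W| / 4], as [|lam| <= 1/8] leaves room for polynomial factors. *)
Lemma usg_product_mgf lam : `|lam| <= 1/8 ->
  (\int[P]_w (expR (lam * (V w * W w - ipm P setT V W)))%:E <= (expR (384 * lam ^+ 2))%:E)%E.
Proof.
move=> l8; set m := ipm P setT V W.
have m2 := usg_product_mean; rewrite -/m in m2.
have mD : measurable_fun setT (fun w => V w * W w - m) by apply: measurable_funB.
have mA : measurable_fun setT (fun w => expR (`|V w * W w| / 4)).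
  by apply: measurableT_comp => //; apply: measurable_funM => //; exact: measurableT_comp.
pose g w := expR (1 / 2) * expR (`|V w * W w| / 4).
have mg : measurable_fun setT g by exact: measurable_funM.
have b w : expR (lam * (V w * W w - m)) <= 1 + lam * (V w * W w - m) + 128 * lam ^+ 2 * g w.
  apply: le_trans (expR_le_quadratic _) _; rewrite lerD2l.
  set u := V w * W w - m.
  have e1 : `|lam * u| <= `|u / 8|.
    by rewrite !normrM mulrC ler_wpM2l // [leRHS]ger0_norm //; lra.
  have e2 : (lam * u) ^+ 2 = 64 * lam ^+ 2 * (u / 8) ^+ 2 by field.
  have e3 := sqr_le_expR (u / 8).
  have e4 : expR `|u / 8| * expR `|u / 8| <= g w.
    rewrite /g -!expRD ler_expR normrM (@ger0_norm _ (8^-1)) //.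
    have := ler_normB (V w * W w) m; rewrite -/u; lra.
  rewrite e2; apply: (@le_trans _ _ (64 * lam ^+ 2 * (2 * expR `|u / 8|) * expR `|u / 8|)).
    have l0 : 0 <= 64 * lam ^+ 2 by rewrite mulr_ge0 ?sqr_ge0.
    apply: ler_pM; [by rewrite mulr_ge0 ?sqr_ge0|exact: expR_ge0|exact: ler_wpM2l|by rewrite ler_expR].
  have := ler_wpM2l (_ : 0 <= 128 * lam ^+ 2) e4.
  by rewrite mulr_ge0 ?sqr_ge0 // => /(_ isT); apply: le_trans; rewrite le_eqVlt; apply/orP; left; apply/eqP; ring.
have iD : P.-integrable setT (fun w => (lam * (V w * W w - m))%:E).
  under eq_fun do rewrite mulrBr EFinB EFinM.
  apply: integrableB => //; first by apply: integrableZl => //; exact: usg_product_integrable.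
  exact: finite_measure_integrable_cst.
have i1 : P.-integrable setT (fun w : Om => 1%:E : \bar R) by exact: finite_measure_integrable_cst.
have Eg : (\int[P]_w (g w)%:E <= 3%:E)%E.
  rewrite /g expectationZ ?expR_ge0 //.
  apply: le_trans (lee_wpmul2l _ usg_product_exp) _; first by rewrite lee_fin expR_ge0.
  rewrite -EFinM lee_fin.
  have : expR (1/2) * (1 - 1/2) <= 1 :> R.
    by rewrite -[leRHS](expRxMexpNx_1 (1/2)) ler_wpM2l ?expR_ge0 // expR_ge1Dx.
  lra.
have ig : P.-integrable setT (fun w => (128 * lam ^+ 2 * g w)%:E).
  under eq_fun do rewrite EFinM; apply: integrableZl => //; apply/integrableP; split; first exact/measurable_EFinP.
  under eq_integral do rewrite gee0_abs ?lee_fin ?mulr_ge0 ?expR_ge0 //.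
  by apply: le_lt_trans Eg _; rewrite ltry.
apply: (@le_trans _ _ (\int[P]_w (1 + lam * (V w * W w - m) + 128 * lam ^+ 2 * g w)%:E)%E).
  apply: le_expectation => //.
  - by apply: measurableT_comp => //; exact: measurable_funM.
  - by apply: measurable_funD; [apply: measurable_funD => //|]; exact: measurable_funM.
under eq_integral do rewrite !EFinD.
rewrite integralD //; last exact: integrableD.
rewrite integralD // integral_cst //= probability_setT mule1.
have -> : (\int[P]_w (lam * (V w * W w - m))%:E = 0)%E.
  under eq_integral do rewrite EFinM.
  rewrite integralZl //; last first.
    under eq_fun do rewrite EFinB.
    by apply: integrableB => //; [exact: usg_product_integrable|exact: finite_measure_integrable_cst].
  under eq_integral do rewrite EFinB.
  rewrite integralB //; [|exact: usg_product_integrable|exact: finite_measure_integrable_cst].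
  rewrite integral_cst //= probability_setT mule1 /m /ipm /Rintegral fineK ?subee ?mule0 //; exact: integrable_fin_num usg_product_integrable.
have l0 : 0 <= 128 * lam ^+ 2 by rewrite mulr_ge0 ?sqr_ge0.
rewrite adde0 expectationZ //; last by move=> w; rewrite mulr_ge0 ?expR_ge0.
apply: le_trans (leeD2l _ (lee_wpmul2l _ Eg)) _; first by rewrite lee_fin.
rewrite -EFinM -EFinD lee_fin; apply: le_trans (expR_ge1Dx _); lra.
Qed.

End Product.
End SubGaussian.

(** * Bilinear sums of independent arrays *)

Lemma expR_prod {R : realType} n (c : R) : expR (c * n%:R) = \prod_(t < n) expR c.
Proof. by rewrite prodr_const card_ord expRM_natr. Qed.

Lemma small_linear_eq0 {R : realType} (c K : R) : (forall lam : R, 0 < `|lam| <= 1/8 -> lam * c <= K * lam ^+ 2) -> c = 0.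
Proof.
move=> h; apply/eqP; rewrite -normr_le0; apply/ler_addgt0Pr => e e0; rewrite add0r.
pose l := Num.min (1/8) (e / (`|K| + 1)).
have K0 : 0 < `|K| + 1 by rewrite ltr_wpDl.
have l0 : 0 < l by rewrite lt_min; apply/andP; split; [lra|exact: divr_gt0].
have le1 : l <= e / (`|K| + 1) by rewrite ge_min lexx orbT.
have le2 : l <= 1/8 by rewrite ge_min lexx.
rewrite ler_pdivlMr // in le1.
have Kl : K * l <= e.
  apply: le_trans le1; rewrite mulrC ler_wpM2l ?(ltW l0) //.
  by apply: le_trans (ler_norm K) _; rewrite lerDl.
have hp : c <= K * l.
  have := h l; rewrite gtr0_norm // l0 le2 => /(_ isT).
  by move=> h1; rewrite -(ler_pM2l l0); apply: le_trans h1 _; rewrite expr2 mulrCA.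
have hn : - c <= K * l.
  have := h (- l); rewrite normrN gtr0_norm // l0 le2 => /(_ isT).
  by rewrite sqrrN mulNr -mulrN => h1; rewrite -(ler_pM2l l0); apply: le_trans h1 _; rewrite expr2 mulrCA.
by rewrite ler_norml; apply/andP; split; lra.
Qed.

Lemma expR_sub1_le {R : realType} (x : R) : 0 <= x <= 6 -> expR x - 1 <= expR 6 * x.
Proof.
move=> /andP[x0 x6]; have : expR x * (1 - x) <= 1.
  by rewrite -[leRHS](expRxMexpNx_1 x) ler_wpM2l ?expR_ge0 // expR_ge1Dx.
have : expR x * x <= expR 6 * x by rewrite ler_wpM2r // ler_expR.
lra.
Qed.

Section Bilinear.
Context {R : realType} {dsp : measure_display} {Om : measurableType dsp}.
Variable P : probability Om R.
Variables (I : choiceType) (g : I -> set (set Om)).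
Let F i := <<s g i >>.
Hypothesis gm : forall i, g i `<=` measurable.
Hypothesis ind : mutually_independent P F.
Notation TF i := (g_sigma_algebraType (g i)).
Notation TJ J := (g_sigma_algebraType (cylinder (fun i => <<s g i >>) J)).

Section Sums.
Variables (n : nat) (r s : nat -> I) (V W : nat -> Om -> R).
Hypothesis mVr : forall t, measurable_fun setT (V t : TF (r t) -> R).
Hypothesis mWs : forall t, measurable_fun setT (W t : TF (s t) -> R).
Hypothesis sV : forall t, unit_subgaussian P (V t).
Hypothesis sW : forall t, unit_subgaussian P (W t).
Hypothesis s_inj : forall m k, (k < m < n)%N -> s k != s m.

Lemma diagonal_mgf lam : (forall t, r t = s t) -> `|lam| <= 1/8 ->
  (\int[P]_w (expR (lam * \sum_(t < n) (V t w * W t w - ipm P setT (V t) (W t))))%:E <=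
   (expR (384 * lam ^+ 2 * n%:R))%:E)%E.
Proof.
move=> rs l8.
under eq_integral do rewrite mulr_sumr expR_sum.
rewrite expR_prod.
apply: (@product_bound _ _ _ P I g gm ind n s (fun t w => expR (lam * (V t w * W t w - ipm P setT (V t) (W t))))
  (fun _ => expR (384 * lam ^+ 2))).
- exact: s_inj.
- move=> t _; apply: measurableT_comp => //; apply: measurable_funM => //; apply: measurable_funB => //.
  by apply: measurable_funM; [rewrite -rs; exact: mVr|exact: mWs].
- by move=> t w; exact: expR_ge0.
- by move=> t _; exact: usg_product_mgf.
Qed.

(** Conditionally on the past, [V t * W t] is sub-Gaussian with variance proxy [V t ^ 2];
    the quadratic compensator is then paid for by the square-exponential moments of [V]. *)
Lemma offdiagonal_mgf lam : (forall m k, (k <= m < n)%N -> r k != s m) ->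
  (forall m k, (k < m < n)%N -> r k != r m) -> `|lam| <= 1/8 ->
  (\int[P]_w (expR (lam * \sum_(t < n) (V t w * W t w)))%:E <=
   (expR (384 * lam ^+ 2 * n%:R))%:E)%E.
Proof.
move=> rs r_inj l8.
have l2 : lam ^+ 2 <= 1/64.
  by rewrite -real_normK ?num_real // (_ : 1/64 = (1/8) ^+ 2); [apply: lerXn2r; rewrite ?nnegrE //|field].
have mV t := usg_meas (sV t); have mW t := usg_meas (sW t).
pose S1 w := \sum_(t < n) (V t w * W t w).
pose S2 w := \sum_(t < n) V t w ^+ 2.
have mS1 : measurable_fun setT S1 by apply: measurable_sum => t; exact: measurable_funM.
have mS2 : measurable_fun setT S2 by apply: measurable_sum => t; exact: measurable_funX.
(* the exponent is doubled so that Cauchy-Schwarz can separate the compensator *)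
have h1 : (\int[P]_w (expR (2 * lam * S1 w - 2 * lam ^+ 2 * S2 w))%:E <= 1%:E)%E.
  have -> : (\int[P]_w (expR (2 * lam * S1 w - 2 * lam ^+ 2 * S2 w))%:E =
    \int[P]_w (\prod_(t < n) expR (2 * lam * V t w * W t w - 2 * lam ^+ 2 * V t w ^+ 2))%:E)%E.
    apply: eq_integral => w _; rewrite -expR_sum /S1 /S2 !mulr_sumr -sumrB; congr (expR _)%:E.
    by apply: eq_bigr => t _; rewrite !mulrA.
  rewrite [X in (_ <= X%:E)%E](_ : 1 = \prod_(t < n) (1 : R)); last by rewrite big1.
  apply: (@sequential_bound _ _ _ P I g gm ind n (fun m => [seq r k | k <- iota 0 m.+1] ++ [seq s k | k <- iota 0 m])
    s V W (fun _ z => expR (2 * lam * z.1 * z.2 - 2 * lam ^+ 2 * z.1 ^+ 2)) (fun=> 1)).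
  - move=> m mn; rewrite mem_cat negb_or; apply/andP; split; apply/mapP => -[k]; rewrite mem_iota add0n /= => km e.
      by have := rs m k; rewrite -ltnS km mn e eqxx => /(_ isT).
    by have := @s_inj m k; rewrite km mn e eqxx => /(_ isT).
  - move=> m mn; apply: (@measurable_cylinder _ _ _ I g _ (r m)) => //.
    by rewrite mem_cat (map_f r) // mem_iota add0n ltnSn.
  - by move=> m mn; exact: mWs.
  - move=> m k mn km; apply: (@measurable_cylinder _ _ _ I g _ (r k)) => //.
    by rewrite mem_cat (map_f r) // mem_iota; lia.
  - by move=> m k mn km; rewrite mem_cat (map_f s) ?orbT // mem_iota.
  - move=> m; apply: measurableT_comp => //; apply: measurable_funB.
      apply: measurable_funM; last exact: measurable_snd.
      by apply: measurable_funM => //; exact: measurable_fst.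
    by apply: measurable_funM => //; apply: measurable_funX; exact: measurable_fst.
  - by move=> m z; exact: expR_ge0.
  - move=> m v mn /=.
    have -> : (\int[P]_w (expR (2 * lam * v * W m w - 2 * lam ^+ 2 * v ^+ 2))%:E =
       (expR (- (2 * lam ^+ 2 * v ^+ 2)))%:E * \int[P]_w (expR (2 * lam * v * W m w))%:E)%E.
      rewrite -expectationZ //; last by apply: measurableT_comp => //; exact: measurable_funM.
      by apply: eq_integral => w _; rewrite -expRD addrC.
    apply: le_trans (lee_wpmul2l _ (usg_mgf (sW m) _)) _; first by rewrite lee_fin expR_ge0.
    rewrite -EFinM lee_fin -expRD; have -> : - (2 * lam ^+ 2 * v ^+ 2) + (2 * lam * v) ^+ 2 / 2 = 0 by field.
    by rewrite expR0.
have h2 : (\int[P]_w (expR (2 * lam ^+ 2 * S2 w))%:E <= (expR (4 * lam ^+ 2 * n%:R))%:E)%E.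
  under eq_integral do rewrite /S2 mulr_sumr expR_sum.
  rewrite expR_prod (_ : 4 * lam ^+ 2 = 2 * (2 * lam ^+ 2)); last by rewrite mulrA -natrM.
  apply: (@product_bound _ _ _ P I g gm ind n r (fun t w => expR (2 * lam ^+ 2 * V t w ^+ 2))
    (fun _ => expR (2 * (2 * lam ^+ 2)))).
  - exact: r_inj.
  - move=> t _; apply: measurableT_comp => //; apply: measurable_funM => //; exact: measurable_funX.
  - by move=> t w; exact: expR_ge0.
  - move=> t _; apply: usg_small_square_exp => //.
    by have l20 := sqr_ge0 lam; apply/andP; split; lra.
have m1 : measurable_fun setT (fun w => expR (2 * lam * S1 w - 2 * lam ^+ 2 * S2 w)).
  by apply: measurableT_comp => //; apply: measurable_funB; exact: measurable_funM.
have m2 : measurable_fun setT (fun w => expR (2 * lam ^+ 2 * S2 w)).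
  by apply: measurableT_comp => //; exact: measurable_funM.
apply: (@le_trans _ _ (\int[P]_w (2^-1 * (expR (2 * lam * S1 w - 2 * lam ^+ 2 * S2 w) + expR (2 * lam ^+ 2 * S2 w)))%:E)%E).
  apply: le_expectation => //.
  - by apply: measurableT_comp => //; exact: measurable_funM.
  - by apply: measurable_funM => //; exact: measurable_funD.
  - move=> w; rewrite -/(S1 w).
    have -> : lam * S1 w = (lam * S1 w - lam ^+ 2 * S2 w) + lam ^+ 2 * S2 w by rewrite subrK.
    have -> : 2 * lam * S1 w - 2 * lam ^+ 2 * S2 w = 2%:R * (lam * S1 w - lam ^+ 2 * S2 w) by ring.
    have -> : 2 * lam ^+ 2 * S2 w = 2%:R * (lam ^+ 2 * S2 w) by ring.
    rewrite expRD !expRM_natl; move: (expR _) (expR _) => x y.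
    by have := sqr_ge0 (x - y); rewrite sqrrB; lra.
rewrite expectationZ //; last exact: measurable_funD.
rewrite expectationD //.
apply: le_trans (lee_wpmul2l _ (leeD h1 h2)) _; first by rewrite lee_fin.
rewrite -EFinD -EFinM lee_fin.
have n0 : 0 <= lam ^+ 2 * n%:R by rewrite mulr_ge0 ?sqr_ge0.
move: n0; rewrite -[384 * _ * _]mulrA -[4 * _ * _]mulrA; move: (lam ^+ 2 * n%:R) => x x0.
have e1 : expR 0 <= expR (384 * x) by rewrite ler_expR; lra.
have e2 : expR (4 * x) <= expR (384 * x) by rewrite ler_expR; lra.
rewrite expR0 in e1; lra.
Qed.

End Sums.

Section Sums2.
Variables (r s : nat -> I) (V W : nat -> Om -> R).
Hypothesis mVr : forall t, measurable_fun setT (V t : TF (r t) -> R).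
Hypothesis mWs : forall t, measurable_fun setT (W t : TF (s t) -> R).
Hypothesis sV : forall t, unit_subgaussian P (V t).
Hypothesis sW : forall t, unit_subgaussian P (W t).
Hypothesis s_inj : forall m k, (k < m)%N -> s k != s m.
Hypothesis r_inj : forall m k, (k < m)%N -> r k != r m.

(** Uncorrelatedness is read off the moment generating function near 0. *)
Lemma offdiagonal_mean t : r t != s t -> ipm P setT (V t) (W t) = 0.
Proof.
move=> rst; apply: (@small_linear_eq0 R _ (expR 6 * 384)) => lam /andP[l0 l8].
have iVW := usg_product_integrable (sV t) (sW t).
have l2 : lam ^+ 2 <= 1/64.
  by rewrite -real_normK ?num_real // (_ : 1/64 = (1/8) ^+ 2); [apply: lerXn2r; rewrite ?nnegrE //|field].
have h : (\int[P]_w (expR (lam * (V t w * W t w)))%:E <= (expR (384 * lam ^+ 2))%:E)%E.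
  suff : (\int[P]_w (expR (lam * \sum_(u < 1) (V t w * W t w)))%:E <= (expR (384 * lam ^+ 2 * 1%:R))%:E)%E.
    by rewrite mulr1; under eq_integral do rewrite big_ord1.
  apply: (@offdiagonal_mgf 1 (fun=> r t) (fun=> s t) (fun=> V t) (fun=> W t)) => // m k.
    by rewrite ltnS leqn0; case: eqP => [->|]; rewrite ?andbF.
  by rewrite ltnS leqn0; case: eqP => [->|]; rewrite ?andbF.
have mE : measurable_fun setT (fun w => expR (lam * (V t w * W t w))).
  have mV := usg_meas (sV t); have mW := usg_meas (sW t).
  by apply: measurableT_comp => //; apply: measurable_funM => //; exact: measurable_funM.
have iE : P.-integrable setT (fun w => (expR (lam * (V t w * W t w)))%:E).
  apply/integrableP; split; first exact/measurable_EFinP.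
  under eq_integral do rewrite gee0_abs ?lee_fin ?expR_ge0 //.
  by apply: le_lt_trans h _; rewrite ltry.
have i1 : P.-integrable setT (fun w : Om => 1%:E : \bar R) by exact: finite_measure_integrable_cst.
have iL : P.-integrable setT (fun w => (lam%:E * (V t w * W t w)%:E)%E) by exact: integrableZl.
have : (\int[P]_w (1%:E + lam%:E * (V t w * W t w)%:E) <= (expR (384 * lam ^+ 2))%:E)%E.
  apply: le_trans h; apply: le_integral => //; first exact: integrableD.
  by move=> w _; rewrite -EFinM -EFinD lee_fin expR_ge1Dx.
rewrite integralD // integral_cst //= probability_setT mule1 integralZl //.
have /fineK e : (\int[P]_w (V t w * W t w)%:E)%E \is a fin_num by exact: integrable_fin_num iVW.
rewrite -e -EFinM -EFinD lee_fin -[fine _]/(ipm P setT (V t) (W t)) => h2.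
have l20 := sqr_ge0 lam.
have := @expR_sub1_le R (384 * lam ^+ 2); rewrite -mulrA => h1.
have : 0 <= 384 * lam ^+ 2 <= 6 by lra.
by move=> /h1; lra.
Qed.

(** The two innovations of a term are either the same one for all [t], and then the
    terms are independent, or one of them is new at every step, and then the sum is a
    martingale. *)
Lemma bilinear_mgf n lam :
  [\/ forall t, r t = s t, forall m k, (k <= m)%N -> r k != s m | forall m k, (k <= m)%N -> s k != r m] ->
  `|lam| <= 1/8 ->
  (\int[P]_w (expR (lam * \sum_(t < n) (V t w * W t w - ipm P setT (V t) (W t))))%:E <=
   (expR (384 * lam ^+ 2 * n%:R))%:E)%E.
Proof.
move=> [rs|rs|sr] l8; first by apply: (@diagonal_mgf n r s) => // m k /andP[km _]; exact: s_inj.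
  have z t : ipm P setT (V t) (W t) = 0 by apply: offdiagonal_mean; exact: rs.
  under eq_integral do under eq_bigr do rewrite z subr0.
  apply: (@offdiagonal_mgf n r s) => // m k /andP[km _]; [exact: s_inj|exact: rs|exact: r_inj].
have z t : ipm P setT (V t) (W t) = 0 by apply: offdiagonal_mean; rewrite eq_sym; exact: sr.
under eq_integral do under eq_bigr do rewrite z subr0 mulrC.
apply: (@offdiagonal_mgf n s r) => // m k /andP[km _]; [exact: r_inj|exact: sr|exact: s_inj].
Qed.

Definition moment_const : R := 4 * expR 384.

(** The moment is read off the exponential moments at [lam = sqrt (k / n)], close to the
    optimal choice; [64 * k <= n] is what makes this [lam] at most 1/8. *)
Lemma bilinear_moment n k : (0 < k)%N -> (64 * k <= n)%N ->
  [\/ forall t, r t = s t, forall m k, (k <= m)%N -> r k != s m | forall m k, (k <= m)%N -> s k != r m] ->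
  (\int[P]_w ((n%:R^-1 * \sum_(t < n) (V t w * W t w - ipm P setT (V t) (W t))) ^+ (2 * k))%:E <=
   (2 * (moment_const * k%:R / n%:R) ^+ k)%:E)%E.
Proof.
move=> k0 kn rs.
have n0 : (0 < n)%N by apply: leq_trans kn; rewrite muln_gt0.
have nR : 0 < n%:R :> R by rewrite ltr0n.
have kR : 0 < k%:R :> R by rewrite ltr0n.
pose S w := \sum_(t < n) (V t w * W t w - ipm P setT (V t) (W t)).
have mV t := usg_meas (sV t); have mW t := usg_meas (sW t).
have mS : measurable_fun setT S.
  by apply: measurable_sum => t; apply: measurable_funB => //; exact: measurable_funM.
pose lam : R := Num.sqrt (k%:R / n%:R).
have lam2 : lam ^+ 2 = k%:R / n%:R by rewrite sqr_sqrtr // divr_ge0.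
have lam0 : 0 < lam by rewrite sqrtr_gt0 divr_gt0.
have lam8 : lam <= 1/8.
  rewrite -ler_sqr ?nnegrE ?(ltW lam0) // lam2 ler_pdivrMr //.
  rewrite (_ : (1/8) ^+ 2 = 64^-1); last by field.
  by rewrite ler_pdivlMl // -natrM ler_nat.
have hp : (\int[P]_w (expR (lam * S w))%:E <= (expR (384 * k%:R))%:E)%E.
  have := @bilinear_mgf n lam rs; rewrite ger0_norm ?(ltW lam0) // => /(_ lam8).
  by rewrite lam2 -[_ * n%:R]mulrA (divfK (lt0r_neq0 nR)).
have hn : (\int[P]_w (expR (- lam * S w))%:E <= (expR (384 * k%:R))%:E)%E.
  have := @bilinear_mgf n (- lam) rs; rewrite normrN ger0_norm ?(ltW lam0) // sqrrN => /(_ lam8).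
  by rewrite lam2 -[_ * n%:R]mulrA (divfK (lt0r_neq0 nR)).
pose K : R := (4 * k%:R / n%:R) ^+ k.
have K0 : 0 <= K by rewrite exprn_ge0 // divr_ge0 // mulr_ge0.
have b w : (n%:R^-1 * S w) ^+ (2 * k) <= K * (expR (lam * S w) + expR (- lam * S w)).
  have e1 := le_trans (expR_ge1Dxn (2 * k).-1 (normr_ge0 (lam * S w))) (expR_normr_le (lam * S w)).
  rewrite prednK ?muln_gt0 // in e1.
  have f0 : 0 < (2 * k)`!%:R :> R by rewrite ltr0n fact_gt0.
  have e2 : `|lam * S w| ^+ (2 * k) <= (2 * k)`!%:R * (expR (lam * S w) + expR (- lam * S w)).
    rewrite -ler_pdivrMl // mulrC mulNr.
    by apply: le_trans e1; rewrite lerDr.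
  have e3 : (2 * k)`!%:R <= ((2 * k) ^ (2 * k))%:R :> R.
    rewrite ler_nat -ffactnn ffact_prod -[X in (_ <= (2 * k) ^ X)%N]card_ord -prod_nat_const.
    by apply: leq_prod => i _; exact: leq_subr.
  have e4 : `|lam * S w| ^+ (2 * k) = (k%:R * n%:R) ^+ k * (n%:R^-1 * S w) ^+ (2 * k).
    rewrite !exprM real_normK ?num_real // -exprMn; congr (_ ^+ _).
    by rewrite !exprMn lam2; field; rewrite gt_eqF.
  rewrite e4 in e2.
  have e5 : 0 < (k%:R * n%:R) ^+ k :> R by rewrite exprn_gt0 // mulr_gt0.
  rewrite -(ler_pM2l e5); apply: le_trans e2 _; rewrite mulrA ler_wpM2r ?addr_ge0 ?expR_ge0 //.
  apply: le_trans e3 _; rewrite /K -exprMn natrX natrM exprM le_eqVlt; apply/orP; left; apply/eqP; congr (_ ^+ _).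
  by field; rewrite gt_eqF.
have mp (c : R) : measurable_fun setT (fun w => expR (c * S w)).
  by apply: measurableT_comp => //; exact: measurable_funM.
apply: (@le_trans _ _ (\int[P]_w (K * (expR (lam * S w) + expR (- lam * S w)))%:E)%E).
  apply: le_expectation => //.
  - by apply: measurable_funX; exact: measurable_funM.
  - by apply: measurable_funM => //; exact: measurable_funD.
  - by move=> w; rewrite exprM exprn_ge0 // sqr_ge0.
rewrite expectationZ //; last exact: measurable_funD.
rewrite expectationD //.
apply: le_trans (lee_wpmul2l _ (leeD hp hn)) _; first by rewrite lee_fin.
rewrite -EFinD -EFinM lee_fin /K /moment_const le_eqVlt; apply/orP; left; apply/eqP.
by rewrite -mulr2n -[X in _ * X]mulr_natl mulrCA expRM_natr -exprMn; congr (_ * _ ^+ _); ring.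
Qed.

End Sums2.

End Bilinear.

(** * Moments of Frobenius norms *)

Section Jensen.
Context {R : realType}.

Lemma power_tangent (z m : R) k : 0 <= z -> 0 <= m ->
  m ^+ k.+1 + k.+1%:R * m ^+ k * (z - m) <= z ^+ k.+1.
Proof.
move=> z0 m0; elim: k => [|k IH]; first by rewrite expr0 mulr1 mul1r !expr1 subrKC.
rewrite [leRHS]exprS; apply: le_trans (ler_wpM2l z0 IH).
rewrite -subr_ge0 (_ : _ - _ = k.+1%:R * m ^+ k * (z - m) ^+ 2).
  by apply: mulr_ge0; [apply: mulr_ge0; [|exact: exprn_ge0]|exact: sqr_ge0].
rewrite -[k.+2%:R]natr1 !exprS; move: (m ^+ k) (k.+1%:R) => M K; ring.
Qed.

Lemma power_jensen (I : finType) (w z : I -> R) k : (forall i, 0 <= w i) -> (forall i, 0 <= z i) ->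
  \sum_i w i <= 1 -> (\sum_i w i * z i) ^+ k.+1 <= \sum_i w i * z i ^+ k.+1.
Proof.
move=> w0 z0 w1; set m := \sum_i w i * z i.
have m0 : 0 <= m by apply: sumr_ge0 => i _; exact: mulr_ge0.
have h : \sum_i w i * (m ^+ k.+1 + k.+1%:R * m ^+ k * (z i - m)) <= \sum_i w i * z i ^+ k.+1.
  by apply: ler_sum => i _; apply: ler_wpM2l => //; exact: power_tangent.
apply: le_trans h.
have -> : \sum_i w i * (m ^+ k.+1 + k.+1%:R * m ^+ k * (z i - m)) =
   m ^+ k.+1 * \sum_i w i + k.+1%:R * m ^+ k * (m - m * \sum_i w i).
  rewrite /m !mulr_sumr -sumrB mulr_sumr -big_split /=; apply: eq_bigr => i _; rewrite -/m; ring.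
rewrite -subr_ge0 (_ : _ - _ = (m ^+ k.+1) * (k%:R * (1 - \sum_i w i))).
  by rewrite !mulr_ge0 ?exprn_ge0 // subr_ge0.
rewrite -natr1 exprS; move: (m ^+ k) (\sum_i w i) => M W; ring.
Qed.

End Jensen.

Section Moments.
Context {R : realType} {dsp : measure_display} {Om : measurableType dsp}.
Variable P : probability Om R.

(** The [Q * Q] bilinear terms are averaged with weights [u^2 u'^2 / (r r')]: the row
    bounds on [u] make the total weight at most [Kr^4], whatever [Q] and [L]. *)
Lemma frobenius_moment (Q : finType) L (u : Q -> 'I_L -> R) (r : Q -> R)
    (T : Q -> Q -> 'I_L -> 'I_L -> Om -> R) (Kr B : R) k :
  (forall c, 0 <= r c) -> (forall c, \sum_a u c a ^+ 2 <= r c ^+ 2) -> \sum_c r c <= Kr -> 0 < Kr -> 0 <= B ->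
  (forall c c' a b, measurable_fun setT (T c c' a b)) ->
  (forall c c' a b, \int[P]_w ((T c c' a b w ^+ 2) ^+ k.+1)%:E <= B%:E)%E ->
  (\int[P]_w ((\sum_a \sum_b (\sum_c \sum_c' u c a * u c' b * T c c' a b w) ^+ 2) ^+ k.+1)%:E <=
   (Kr ^+ (4 * k.+1) * B)%:E)%E.
Proof.
move=> r0 ur sr Kr0 B0 mT hT.
pose J : finType := ((Q * Q) * ('I_L * 'I_L))%type.
pose y (z : J) : R := u z.1.1 z.2.1 ^+ 2 * u z.1.2 z.2.2 ^+ 2 / (r z.1.1 * r z.1.2).
pose S (z : J) w : R := T z.1.1 z.1.2 z.2.1 z.2.2 w ^+ 2.
have y0 z : 0 <= y z by apply: divr_ge0; apply: mulr_ge0; rewrite ?sqr_ge0.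
have ur0 c a : r c = 0 -> u c a = 0.
  move=> rc; have := ur c; rewrite rc expr0n /= => h; apply/eqP; rewrite -sqrf_eq0 eq_le sqr_ge0 andbT.
  by apply: le_trans h; rewrite (bigD1 a) //= lerDl sumr_ge0 // => b _; exact: sqr_ge0.
have sr2 : \sum_(p : Q * Q) r p.1 * r p.2 <= Kr ^+ 2.
  rewrite -(pair_big xpredT xpredT (fun c c' => r c * r c')) /=.
  under eq_bigr do rewrite -mulr_sumr.
  rewrite -mulr_suml expr2; have r00 : 0 <= \sum_c r c by apply: sumr_ge0.
  by rewrite ler_pM.
have sy : \sum_(z : J) y z <= Kr ^+ 2.
  rewrite -(pair_big xpredT xpredT (fun p q => y (p, q))) /=.
  apply: le_trans sr2; apply: ler_sum => -[c c'] _ /=.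
  rewrite -(pair_big xpredT xpredT (fun a b => y ((c, c'), (a, b)))) /= /y /=.
  have [rr|rr] := eqVneq (r c * r c') 0.
    by rewrite rr big1 // => a _; rewrite big1 // => b _; rewrite invr0 mulr0.
  have rr0 : 0 < r c * r c' by rewrite lt_def rr mulr_ge0.
  under eq_bigr do rewrite -mulr_suml -mulr_sumr.
  rewrite -mulr_suml -mulr_suml ler_pdivrMr // -expr2 exprMn.
  by rewrite ler_pM // sumr_ge0 // => a _; exact: sqr_ge0.
pose w z := y z / Kr ^+ 2.
have K2 : 0 < Kr ^+ 2 by exact: exprn_gt0.
have w0 z : 0 <= w z by rewrite divr_ge0 // ltW.
have sw : \sum_z w z <= 1 by rewrite -mulr_suml ler_pdivrMr // mul1r.
have S0 z om : 0 <= S z om by exact: sqr_ge0.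
have b1 om : \sum_a \sum_b (\sum_c \sum_c' u c a * u c' b * T c c' a b om) ^+ 2 <= Kr ^+ 4 * \sum_z w z * S z om.
  have CS a b : (\sum_c \sum_c' u c a * u c' b * T c c' a b om) ^+ 2 <=
      Kr ^+ 2 * \sum_(p : Q * Q) y (p, (a, b)) * S (p, (a, b)) om.
    rewrite pair_big /=.
    pose t (p : Q * Q) := Num.sqrt (r p.1 * r p.2).
    have -> : \sum_(p : Q * Q) u p.1 a * u p.2 b * T p.1 p.2 a b om =
       \sum_(p : Q * Q) t p * (u p.1 a * u p.2 b * T p.1 p.2 a b om / t p).
      apply: eq_bigr => p _; have [t0|t0] := eqVneq (t p) 0; last by rewrite mulrCA divff // mulr1.
      rewrite t0 mul0r; move/eqP: t0; rewrite sqrtr_eq0 => h.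
      have /eqP : r p.1 * r p.2 = 0 by apply/eqP; rewrite eq_le h mulr_ge0.
      by rewrite mulf_eq0 => /orP[] /eqP /ur0 ->; rewrite !(mul0r, mulr0).
    apply: le_trans (sum_CS _ _) _.
    have -> : \sum_p t p ^+ 2 = \sum_(p : Q * Q) r p.1 * r p.2.
      by apply: eq_bigr => p _; rewrite sqr_sqrtr // mulr_ge0.
    apply: ler_pM => //; [by apply: sumr_ge0 => p _; exact: mulr_ge0|by apply: sumr_ge0 => p _; exact: sqr_ge0|].
    apply: ler_sum => p _; rewrite /y /S /= !exprMn exprVn sqr_sqrtr ?mulr_ge0 //.
    by rewrite le_eqVlt; apply/orP; left; apply/eqP; rewrite mulrAC.
  apply: (@le_trans _ _ (\sum_a \sum_b Kr ^+ 2 * \sum_(p : Q * Q) y (p, (a, b)) * S (p, (a, b)) om)).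
    by apply: ler_sum => a _; apply: ler_sum => b _; exact: CS.
  under eq_bigr do rewrite -mulr_sumr.
  rewrite -mulr_sumr pair_big /= exchange_big /= pair_big /=.
  rewrite (_ : Kr ^+ 4 = Kr ^+ 2 * Kr ^+ 2); last by rewrite -exprD.
  rewrite -mulrA; apply: (ler_wpM2l (ltW K2)); rewrite mulr_sumr; apply: ler_sum => -[p [a b]] _ /=.
  by rewrite mulrA /w [Kr ^+ 2 * _]mulrC divfK // gt_eqF.
have b2 om : (\sum_a \sum_b (\sum_c \sum_c' u c a * u c' b * T c c' a b om) ^+ 2) ^+ k.+1 <=
   Kr ^+ (4 * k.+1) * \sum_z w z * S z om ^+ k.+1.
  apply: le_trans (lerXn2r _ _ _ (b1 om)) _; rewrite ?nnegrE.
  - by apply: sumr_ge0 => a _; apply: sumr_ge0 => b _; exact: sqr_ge0.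
  - by rewrite mulr_ge0 ?exprn_ge0 ?(ltW Kr0) // sumr_ge0 // => z _; exact: mulr_ge0.
  rewrite exprMn exprM ler_wpM2l ?exprn_ge0 ?(ltW Kr0) //; exact: power_jensen.
have mS z : measurable_fun setT (S z) by exact: measurable_funX.
have mSk : measurable_fun setT (fun om => \sum_z w z * S z om ^+ k.+1).
  by apply: measurable_sum => z; apply: measurable_funM => //; exact: measurable_funX.
apply: (@le_trans _ _ (\int[P]_om (Kr ^+ (4 * k.+1) * \sum_z w z * S z om ^+ k.+1)%:E)%E).
  apply: le_expectation => //.
  - apply: measurable_funX; apply: measurable_sum => a; apply: measurable_sum => b.
    apply: measurable_funX; apply: measurable_sum => c; apply: measurable_sum => c'.
    exact: measurable_funM.
  - exact: measurable_funM.
  - by move=> om; rewrite exprn_ge0 // sumr_ge0 // => a _; apply: sumr_ge0 => b _; exact: sqr_ge0.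
rewrite expectationZ //; [|by rewrite exprn_ge0 // ltW|by move=> om; apply: sumr_ge0 => z _; apply: mulr_ge0 => //; exact: exprn_ge0].
rewrite EFinM lee_wpmul2l ?lee_fin ?exprn_ge0 ?(ltW Kr0) //.
under eq_integral do rewrite -sumEFin.
rewrite ge0_integral_sum //; [|by move=> z; apply/measurable_EFinP; apply: measurable_funM => //; exact: measurable_funX|
  by move=> z om _; rewrite lee_fin; apply: mulr_ge0 => //; exact: exprn_ge0].
apply: (@le_trans _ _ (\sum_z (w z * B)%:E)%E).
  apply: lee_sum => z _; rewrite expectationZ //; [|exact: measurable_funX|by move=> om; exact: exprn_ge0].
  by rewrite [leRHS]EFinM; apply: lee_wpmul2l; [rewrite lee_fin|exact: hT].
by rewrite sumEFin lee_fin -mulr_suml ler_piMl.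
Qed.

Lemma same_law_square (V W : Om -> R) : measurable_fun setT V -> measurable_fun setT W ->
  (forall B, measurable B -> P (V @^-1` B) = P (W @^-1` B)) ->
  (\int[P]_w (V w ^+ 2)%:E = \int[P]_w (W w ^+ 2)%:E)%E.
Proof.
move=> mV mW h.
have msq : measurable_fun setT (fun x : R => (x ^+ 2)%:E) by apply/measurable_EFinP; exact: measurable_funX.
have E (X : Om -> R) : measurable_fun setT X ->
    (\int[P]_w (X w ^+ 2)%:E = \int[pushforward P X]_x (x ^+ 2)%:E)%E.
  by move=> mX; rewrite ge0_integral_pushforward // => x _; rewrite lee_fin sqr_ge0.
rewrite !E //; apply: eq_measure_integral => B mB _; exact: h.
Qed.

Lemma abs_product_le (f h : Om -> R) : L2m P setT f -> L2m P setT h ->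
  (\int[P]_w (`|f w * h w|)%:E <= (snorm (ipm P setT) f * snorm (ipm P setT) h)%:E)%E.
Proof.
move=> Lf Lh; have S := L2m_si P (@measurableT _ Om).
have La (x : Om -> R) : L2m P setT x -> L2m P setT (fun w => `|x w|).
  move=> [mx x2]; split; first exact: measurableT_comp.
  by apply: eq_integrable x2 => // w _; rewrite real_normK ?num_real.
have Ea (x : Om -> R) : snorm (ipm P setT) (fun w => `|x w|) = snorm (ipm P setT) x.
  by rewrite /snorm; congr Num.sqrt; apply: eq_Rintegral => w _; rewrite -!expr2 real_normK ?num_real.
have := form_CS_norm S (La _ Lf) (La _ Lh); rewrite !Ea => h1.
have fin : (\int[P]_w (`|f w * h w|)%:E)%E \is a fin_num.
  have := integrable_fin_num measurableT (L2m_mul measurableT (La _ Lf) (La _ Lh)).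
  by congr (_ \is a fin_num); apply: eq_integral => w _; rewrite /= normrM.
rewrite -(fineK fin) lee_fin; apply: le_trans h1; apply: le_trans (ler_norm _) _.
rewrite le_eqVlt; apply/orP; left; apply/eqP; congr `|_|.
by rewrite /ipm /Rintegral; congr fine; apply: eq_integral => w _; rewrite normrM.
Qed.

End Moments.

(** * Sub-Gaussian innovations *)

Section Innovations.
Context {R : realType} {dsp : measure_display} {Om : measurableType dsp}.
Variable P : probability Om R.
Variables (lo hi : R) (H : set (R -> R)).
Local Notation U := (`[lo, hi]%classic : set R).
Hypothesis HH : hilbert_subspace U H.
Variables (aX : R) (p : nat) (A : nat -> 'I_p -> 'I_p -> R -> R -> R)
  (eps X : int -> 'I_p -> Om -> R -> R).
Hypothesis flp : functional_linear_process P U H aX A eps X.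
Notation leb := (@lebesgue_measure R).
Notation L2P := (L2m P setT).
Notation ipP := (ipm P setT).
Notation L2OU := (L2m (P \x leb)%E (setT `*` U)).
Notation ipOU := (ipm (P \x leb)%E (setT `*` U)).
Notation unc V := (fun z : Om * R => V z.1 z.2).

Let mU : measurable (U : set (measurableTypeR R)) := mU_itv lo hi.
Let mTU : measurable ([set: Om] `*` (U : set (measurableTypeR R))).
Proof. exact: measurableX. Qed.
Let S := L2_semi_inner mU.
Let SHH := H_semi_inner HH.
Let SP : semi_inner L2P ipP := L2m_si P measurableT.
Let SOU : semi_inner L2OU ipOU := L2m_si _ mTU.
Let HL f : H f -> L2 U f := @H_L2 _ _ _ _ HH f.
Let Le t i : L2OU (unc (eps t i)). Proof. by have [] := eps_L2 HH flp t i. Qed.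

Lemma eps_ip_L2 t i x : H x -> L2P (fun w => ip U x (eps t i w)).
Proof. by move=> Hx; apply: ip_random_L2; [exact: Le|exact: HL]. Qed.

Lemma eps_ip_meas t i x : H x -> measurable_fun setT (fun w => ip U x (eps t i w)).
Proof. by move=> Hx; have [] := eps_ip_L2 t i Hx. Qed.

(** The mean function is orthogonal to [H], so testing against [H] only sees the
    centred element, whose mean square norm is the integral of the variance. *)
Lemma eps_variance_le t i x K0 : H x ->
  \int[leb]_(u in U) cov_fun P (eps t i) (eps t i) u u <= K0 ->
  ipP (fun w => ip U x (eps t i w)) (fun w => ip U x (eps t i w)) <= K0 * ip U x x.
Proof.
move=> Hx hK; have Lx := HL Hx; have L1 := L2m_one P.
pose V := eps t i; pose m u := mean P (V ^~ u).
have Lm : L2 U m := moment_L2 mU (Le t i) L1.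
have LmO : L2OU (fun z => m z.2).
  have := L2_tensor measurableT mU L1 Lm; congr L2m.
  by apply/funext => z /=; rewrite mul1r.
pose V0 (w : Om) (u : R) := V w u - m u.
have L0 : L2OU (unc V0) := siB SOU (Le t i) LmO.
have xm : ip U x m = 0.
  have := moment_ip mU (Le t i) L1 Lx; rewrite -[ip U x _]/(ip U x m) => ->.
  by rewrite (si_sym SP L1 (eps_ip_L2 t i Hx)); exact: (eps_mean flp t i Hx).
have e w : ip U x (V w) = ip U x (V0 w).
  by rewrite -[RHS]/(ip U x ((V w : R -> R^o) - (m : R -> R^o))) (formBr S (HL (eps_H flp t i w)) Lm Lx) xm subr0.
have -> : (fun w => ip U x (eps t i w)) = (fun w => ip U x (V0 w)) by apply/funext => w; exact: e.
have [_ le] := ip_L2P mU L0 Lx; apply: le_trans le _.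
rewrite ler_wpM2r ?(si_ge0 SHH Hx) //; apply: le_trans hK.
have -> : ipOU (unc V0) (unc V0) = fine (\int[leb]_(u in U) (cov_fun P V V u u)%:E)%E; last by [].
apply: EFin_inj; rewrite (ipm_sqE mTU L0).
rewrite (tonelli_rectangle_swap P leb measurableT mU (measurable_funX 2 (_ : measurable_fun _ (unc V0)))); last 2 first.
- by case: L0.
- by move=> z; exact: sqr_ge0.
have secE : {ae leb, forall u, U u -> (\int[P]_w (V0 w u ^+ 2)%:E = (cov_fun P V V u u)%:E)%E}.
  apply: (ae_imp (section_L2P_ae mU (Le t i))) => u Lu Uu; have {}Lu := Lu Uu.
  have LmP : L2P (m u *: (cst 1 : Om -> R^o)) := siZ SP (m u) L1.
  have LB := siB SP Lu LmP.
  have eB : (V ^~ u : Om -> R^o) - m u *: (cst 1 : Om -> R^o) = (fun w => V0 w u).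
    by apply/funext => w; rewrite /V0 -[(_ - _) w]/(V w u - m u * 1) mulr1.
  rewrite eB in LB; rewrite -(ipm_sqE measurableT LB) -eB; congr (_%:E).
  rewrite /cov_fun covE // (form_sqB SP Lu LmP) (formZr SP _ L1 Lu) (formZl SP _ L1 LmP) (formZr SP _ L1 L1) ipm11.
  rewrite -/V -![ipP (V ^~ u) (cst 1)]/(m u) -/(m u); ring.
have mUU : measurable (U `*` U : set (measurableTypeR R * measurableTypeR R)) by exact: measurableX.
have mc : measurable_fun U (fun u => (cov_fun P V V u u)%:E).
  have mC : measurable_fun (U `*` U) (fun z => cov_fun P V V z.1 z.2) by apply: measurable_cov_fun => //; exact: (eps_meas flp).
  move/(measurable_restrictT _ mUU): mC => mC; apply/measurable_EFinP.
  apply: (eq_measurable_fun (fun u => ((fun z => cov_fun P V V z.1 z.2) \_ (U `*` U)) (u, u))).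
    by move=> u; rewrite inE => Uu; rewrite /patch mem_set.
  by apply: measurable_funTS; apply: (measurableT_comp mC); exact: measurable_fun_pair.
have mi : measurable_fun U (fun u => \int[P]_w (V0 w u ^+ 2)%:E)%E.
  have m0 : measurable_fun (setT `*` U) (unc V0) by case: L0.
  have := measurable_swap_rectangle measurableT mU (measurable_funX 2 m0).
  have mD := measurable_rectangle mU (@measurableT _ Om).
  move=> /(measurable_restrictT _ mD)/measurable_parameter_integral mI.
  apply: (eq_measurable_fun _ _ (measurable_funTS (mI P))) => u; rewrite inE => Uu.
  by apply: eq_integral => w _; rewrite /patch mem_set.
have E : (\int[leb]_(u in U) \int[P]_w (unc V0 (w, u) ^+ 2)%:E = \int[leb]_(u in U) (cov_fun P V V u u)%:E)%E.
  apply: (@ae_eq_integral _ _ _ leb U (fun u => (cov_fun P V V u u)%:E) (fun u => \int[P]_w (V0 w u ^+ 2)%:E)%E mU mi mc).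
  exact: secE.
rewrite E fineK // -E -(tonelli_rectangle_swap P leb measurableT mU (measurable_funX 2 (_ : measurable_fun _ (unc V0)))).
- by rewrite -(ipm_sqE mTU L0).
- by case: L0.
- by move=> z; exact: sqr_ge0.
Qed.

Variable K0 : R.
Hypothesis K0P : forall j, \int[leb]_(u in U) cov_fun P (eps 0 j) (eps 0 j) u u <= K0.

Lemma eps_second_moment t i x : H x ->
  ipP (fun w => ip U x (eps t i w)) (fun w => ip U x (eps t i w)) <= K0 * ip U x x.
Proof.
move=> Hx; apply: le_trans (eps_variance_le Hx (K0P i)); rewrite le_eqVlt; apply/orP; left; apply/eqP.
apply: EFin_inj; rewrite !(ipm_sqE measurableT); [|exact: eps_ip_L2..].
apply: same_law_square; [exact: eps_ip_meas..|] => B mB.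
have := @flp_ident _ _ _ _ _ _ _ _ _ _ _ flp t 0 i 1 (fun=> x) (fun=> B) (fun=> Hx) (fun=> mB).
congr (P _ = P _); apply/seteqP; split=> w /=; [by move=> h; exact: (h ord0)|by []|by move=> h; exact: (h ord0)|by []].
Qed.

(** The 1 keeps the proxy positive for degenerate innovations. *)
Definition proxy : R := Num.sqrt (aX ^+ 2 * K0 + 1).

Hypothesis K0_ge0 : 0 <= K0.

Lemma proxy_sq : proxy ^+ 2 = aX ^+ 2 * K0 + 1.
Proof. by rewrite sqr_sqrtr // addr_ge0 // mulr_ge0 ?sqr_ge0. Qed.

Lemma proxy_gt0 : 0 < proxy.
Proof. by rewrite sqrtr_gt0 ltr_wpDl // mulr_ge0 ?sqr_ge0. Qed.

Lemma eps_mgf t i x (z : R) : H x ->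
  (\int[P]_w (expR (z * ip U x (eps t i w)))%:E <= (expR (z ^+ 2 * (proxy ^+ 2 * ip U x x) / 2))%:E)%E.
Proof.
move=> Hx; have HZ := siZ SHH z Hx.
have := sgp_mgf (flp_subgauss flp t i) HZ; rewrite expectation.unlock.
have e w : ip U (z *: (x : R -> R^o)) (eps t i w) = z * ip U x (eps t i w).
  by rewrite (formZl SHH z Hx (eps_H flp t i w)).
under eq_integral do rewrite /= e.
move=> h; apply: le_trans h _; rewrite lee_fin ler_expR ler_pM2r ?invr_gt0 //.
rewrite (kop_cov mU (Le t i) (HL HZ) (HL HZ)) (eps_mean flp t i HZ) mul0r subr0.
apply: le_trans (ler_wpM2l (sqr_ge0 aX) (eps_second_moment t i HZ)) _.
rewrite (formZl SHH _ Hx HZ) (formZr SHH _ Hx Hx) proxy_sq.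
have := si_ge0 SHH Hx; have := sqr_ge0 z; nra.
Qed.

Lemma eps_unit_subgaussian t i y : H y ->
  unit_subgaussian P (fun w => (proxy * nrm U y)^-1 * ip U y (eps t i w)).
Proof.
move=> Hy; split; first by apply: measurable_funM => //; exact: eps_ip_meas.
move=> x; under eq_integral do rewrite mulrA.
apply: le_trans (eps_mgf t i _ Hy) _; rewrite lee_fin ler_expR ler_pM2r ?invr_gt0 //.
rewrite exprMn -[leRHS]mulr1 -mulrA ler_wpM2l ?sqr_ge0 //.
rewrite -[ip U y y](snorm_sq S (HL Hy)) -exprMn -exprMn -/(nrm U y).
have [->|n0] := eqVneq (proxy * nrm U y) 0; first by rewrite mulr0 expr0n.
by rewrite mulVf // expr1n.
Qed.

Lemma eps_factor t i y w : H y ->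
  ip U y (eps t i w) = (proxy * nrm U y) * ((proxy * nrm U y)^-1 * ip U y (eps t i w)).
Proof.
move=> Hy; have [n0|n0] := eqVneq (proxy * nrm U y) 0; last by rewrite mulrA mulfV // mul1r.
rewrite n0 mul0r; move/eqP: n0; rewrite mulf_eq0 (gt_eqF proxy_gt0) /= => /eqP n0.
apply: (form_null SHH Hy (eps_H flp t i w)).
by rewrite -(snorm_sq SHH Hy) -[snorm _ _]/(nrm U y) n0 expr0n.
Qed.

End Innovations.

(** * Concentration of the Gram matrix of the scores *)

Lemma markov_bound {R : realType} {dsp : measure_display} {Om : measurableType dsp} (P : probability Om R)
    (Y : Om -> R) (c B : R) : measurable_fun setT Y -> (forall w, 0 <= Y w) -> 0 < c ->
  (\int[P]_w (Y w)%:E <= B%:E)%E -> (P [set w | (c <= Y w)%R] <= (B / c)%:E)%E.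
Proof.
move=> mY Y0 c0 hB.
have mA : measurable [set w | (c <= Y w)%R].
  have := mY measurableT _ (measurable_itv `[c, +oo[); rewrite setTI; congr (measurable _).
  by apply/seteqP; split=> w /=; rewrite in_itv /= andbT.
have h : (c%:E * P [set w | (c <= Y w)%R] <= B%:E)%E.
  rewrite -integral_cst //; apply: le_trans hB.
  apply: (@le_trans _ _ (\int[P]_(w in [set w | (c <= Y w)%R]) (Y w)%:E)%E).
    apply: ge0_le_integral => //; first by move=> w _; rewrite lee_fin ltW.
      by apply: measurable_funTS; exact/measurable_EFinP.
  apply: ge0_subset_integral => //; first exact/measurable_EFinP.
  by move=> w _; rewrite lee_fin.
have : P [set w | (c <= Y w)%R] \is a fin_num by exact: fin_num_measure.
move=> /fineK e; rewrite -e in h *; rewrite -EFinM in h; rewrite !lee_fin in h *.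
by rewrite ler_pdivlMr // mulrC.
Qed.

Section Gram.
Context {R : realType} {dsp : measure_display} {Om : measurableType dsp}.
Variable P : probability Om R.
Variables (lo hi : R) (H : set (R -> R)).
Local Notation U := (`[lo, hi]%classic : set R).
Hypothesis HH : hilbert_subspace U H.
Variables (aX : R) (p : nat) (A : nat -> 'I_p -> 'I_p -> R -> R -> R)
  (eps X : int -> 'I_p -> Om -> R -> R).
Hypothesis flp : functional_linear_process P U H aX A eps X.
Notation leb := (@lebesgue_measure R).
Notation L2P := (L2m P setT).
Notation ipP := (ipm P setT).
Notation L2OU := (L2m (P \x leb)%E (setT `*` U)).
Notation ipOU := (ipm (P \x leb)%E (setT `*` U)).
Notation unc V := (fun z : Om * R => V z.1 z.2).
Notation apx := (approximant lo hi eps).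

Let mU : measurable (U : set (measurableTypeR R)) := mU_itv lo hi.
Let mTU : measurable ([set: Om] `*` (U : set (measurableTypeR R))).
Proof. exact: measurableX. Qed.
Let S := L2_semi_inner mU.
Let SHH := H_semi_inner HH.
Let SP : semi_inner L2P ipP := L2m_si P measurableT.
Let SOU : semi_inner L2OU ipOU := L2m_si _ mTU.
Let HL f : H f -> L2 U f := @H_L2 _ _ _ _ HH f.

Variable K0 : R.
Hypothesis K0P : forall j, \int[leb]_(u in U) cov_fun P (eps 0 j) (eps 0 j) u u <= K0.
Hypothesis K0_ge0 : 0 <= K0.
Notation s := (proxy aX K0).

Variables (j : 'I_p) (psi : nat -> R -> R) (n : nat).
Hypothesis Hpsi : forall a, H (psi a).
Hypothesis one : forall a c, ip U (psi a) (psi c) = (a == c)%:R.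

Let tm (t : nat) : int := (t.+1)%:Z.

Definition innov_gen (c : int * 'I_p) : set (set Om) :=
  [set E | exists x (B : set R), [/\ H x, measurable B & E = (fun w => ip U x (eps c.1 c.2 w)) @^-1` B]].

Lemma innov_gen_measurable c : innov_gen c `<=` measurable.
Proof.
move=> _ [x [B [Hx mB ->]]]; rewrite -[X in measurable X]setTI.
exact: (eps_ip_meas HH flp c.1 c.2 Hx).
Qed.

Lemma innov_indep : mutually_independent P (fun c => <<s innov_gen c >>).
Proof. exact: flp_indep flp. Qed.

Lemma innov_ip_adapted c x : H x ->
  measurable_fun setT ((fun w => ip U x (eps c.1 c.2 w)) : g_sigma_algebraType (innov_gen c) -> R).
Proof.
by move=> Hx _ B mB; rewrite setTI; apply: sub_sigma_algebra; exists x, B.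
Qed.

Definition gram_dev (x : nat -> nat -> Om -> R) (a b : nat) (w : Om) : R :=
  n%:R^-1 * \sum_(t < n) (x t a w * x t b w - ipP (x t a) (x t b)).

Section Approx.
Variables (N : nat) (m : nat -> 'I_p -> nat) (f g : forall l i, 'I_(m l i) -> R -> R) (KH : R).
Hypotheses (Hf : forall l i r, H (@f l i r)) (Hg : forall l i r, H (@g l i r)).
Hypothesis KHP : \sum_(l < N) \sum_(i < p) HSnorm U (tensor (@f l i) (@g l i)) <= KH.
Hypothesis KH_gt0 : 0 < KH.

Let Q : finType := ('I_N * 'I_p)%type.
Let Y (c : Q) (a : nat) : R -> R := fun v => \sum_(r < m c.1 c.2) ip U (@f c.1 c.2 r) (psi a) * @g c.1 c.2 r v.
Let HY c a : H (Y c a).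
Proof.
have -> : Y c a = \sum_(r < m c.1 c.2) ip U (@f c.1 c.2 r) (psi a) *: (@g c.1 c.2 r : R -> R^o).
  by apply/funext => v; rewrite fct_sumE.
by apply: (si_sum SHH) => r _; apply: (siZ SHH); exact: Hg.
Qed.
Let idx (c : Q) (t : nat) : int * 'I_p := (tm t - (c.1 : nat)%:Z, c.2).
Let V (c : Q) (a t : nat) (w : Om) : R := (s * nrm U (Y c a))^-1 * ip U (Y c a) (eps (idx c t).1 (idx c t).2 w).

Let xN (t a : nat) (w : Om) : R := ip U (psi a) (apx N f g (tm t) w).

Let xN_sum t a w : xN t a w = \sum_(c : Q) (s * nrm U (Y c a)) * V c a t w.
Proof.
rewrite /xN (ip_approximant HH flp N Hf Hg) ?pair_big /=; last exact: HL.
apply: eq_bigr => c _; exact: (eps_factor HH flp K0_ge0 (tm t - (c.1 : nat)%:Z) c.2 w (HY c a)).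
Qed.

Let LV c a t : L2P (V c a t).
Proof.
have := siZ SP (s * nrm U (Y c a))^-1 (eps_ip_L2 HH flp (idx c t).1 (idx c t).2 (HY c a)).
by [].
Qed.

Let gram_dev_xN a b w : gram_dev xN a b w =
  \sum_(c : Q) \sum_(c' : Q) (s * nrm U (Y c a)) * (s * nrm U (Y c' b)) *
    (n%:R^-1 * \sum_(t < n) (V c a t w * V c' b t w - ipP (V c a t) (V c' b t))).
Proof.
have E t : ipP (xN t a) (xN t b) = \sum_(c : Q) \sum_(c' : Q) (s * nrm U (Y c a)) * (s * nrm U (Y c' b)) * ipP (V c a t) (V c' b t).
  have e a' : xN t a' = \sum_(c : Q) (s * nrm U (Y c a')) *: (V c a' t : Om -> R^o).
    by apply/funext => w'; rewrite xN_sum fct_sumE.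
  have LZ c a' : L2P ((s * nrm U (Y c a')) *: (V c a' t : Om -> R^o)) by apply: (siZ SP); exact: LV.
  rewrite !e (form_suml SP) //; last by apply: (si_sum SP) => c' _; exact: LZ.
  apply: eq_bigr => c _; rewrite (form_sumr SP) //.
  apply: eq_bigr => c' _.
  by rewrite (formZl SP _ (LV c a t) (LZ c' b)) (formZr SP _ (LV c' b t) (LV c a t)) mulrA.
rewrite /gram_dev mulr_sumr.
under [RHS]eq_bigr do under eq_bigr do rewrite !mulr_sumr.
under [RHS]eq_bigr do rewrite exchange_big /=.
rewrite exchange_big /=; apply: eq_bigr => t _.
rewrite E !xN_sum mulr_suml -sumrB mulr_sumr; apply: eq_bigr => c _.
rewrite mulr_sumr -sumrB mulr_sumr; apply: eq_bigr => c' _; ring.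
Qed.

(** The scores of an approximant are linear in normalized innovation scores, so their
    Gram deviations are combinations of the bilinear sums of [bilinear_moment]. *)
Lemma approx_gram_moment L k : (64 * k.+1 <= n)%N ->
  (\int[P]_w ((\sum_(a < L) \sum_(b < L) gram_dev xN a b w ^+ 2) ^+ k.+1)%:E <=
   ((s * KH) ^+ (4 * k.+1) * (2 * (moment_const * k.+1%:R / n%:R) ^+ k.+1))%:E)%E.
Proof.
move=> kn; have s0 : 0 < s := proxy_gt0 aX K0_ge0.
under eq_integral do under eq_bigr do under eq_bigr do rewrite gram_dev_xN.
apply: (@frobenius_moment _ _ _ P Q L (fun c a => s * nrm U (Y c a))
  (fun c => s * HSnorm U (tensor (@f c.1 c.2) (@g c.1 c.2)))
  (fun c c' a b w => n%:R^-1 * \sum_(t < n) (V c a t w * V c' b t w - ipP (V c a t) (V c' b t)))).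
- by move=> c; rewrite mulr_ge0 ?(ltW s0) // sqrtr_ge0.
- move=> c; under eq_bigr do rewrite exprMn.
  rewrite -mulr_sumr exprMn ler_wpM2l ?sqr_ge0 //.
  by apply: tensor_bessel => // *; apply: HL.
- rewrite -mulr_sumr ler_wpM2l ?(ltW s0) //; apply: le_trans KHP.
  by rewrite pair_big.
- by rewrite mulr_gt0.
- by rewrite mulr_ge0 // exprn_ge0 // divr_ge0 // mulr_ge0 // mulr_ge0 ?expR_ge0.
- move=> c c' a b; apply: measurable_funM => //; apply: measurable_sum => t; apply: measurable_funB => //.
  by apply: measurable_funM; case: (LV c a t); case: (LV c' b t).
- move=> c c' a b.
  under eq_integral do rewrite -exprM.
  apply: (@bilinear_moment _ _ _ P _ innov_gen innov_gen_measurable innov_indep (idx c) (idx c')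
    (V c a) (V c' b)) => //.
  + by move=> t; apply: measurable_funM => //; exact: innov_ip_adapted.
  + by move=> t; apply: measurable_funM => //; exact: innov_ip_adapted.
  + by move=> t; exact: (eps_unit_subgaussian HH flp K0P K0_ge0).
  + by move=> t; exact: (eps_unit_subgaussian HH flp K0P K0_ge0).
  + by move=> u v vu; apply/eqP => -[]; rewrite /tm; lia.
  + by move=> u v vu; apply/eqP => -[]; rewrite /tm; lia.
  + have [ii|ii] := eqVneq c.2 c'.2; last first.
      by apply: Or32 => u v _; apply/eqP => -[_ e]; rewrite e eqxx in ii.
    case: (ssrnat.ltngtP c.1 c'.1) => cc.
    * apply: Or33 => u v vu; apply/eqP => -[e _]; move: e vu cc; rewrite /tm.
      by move: (nat_of_ord c.1) (nat_of_ord c'.1) => l l' e vu cc; lia.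
    * apply: Or32 => u v vu; apply/eqP => -[e _]; move: e vu cc; rewrite /tm.
      by move: (nat_of_ord c.1) (nat_of_ord c'.1) => l l' e vu cc; lia.
    * by apply: Or31 => t; rewrite /idx ii (val_inj cc).
Qed.

End Approx.

Lemma gram_dev_measurable (x : nat -> nat -> Om -> R) a b : (forall t a, L2P (x t a)) ->
  measurable_fun setT (gram_dev x a b).
Proof.
move=> Lx; apply: measurable_funM => //; apply: measurable_sum => t; apply: measurable_funB => //.
by apply: measurable_funM; case: (Lx t a); case: (Lx t b).
Qed.

(** Perturbing the scores by at most [d] in mean square moves every entry by [O(d)] in L1. *)
Lemma gram_dev_close (x y : nat -> nat -> Om -> R) (M d : R) a b :
  (0 < n)%N -> (forall t a, L2P (x t a)) -> (forall t a, L2P (y t a)) -> 0 <= M -> 0 <= d ->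
  (forall t a, (t < n)%N -> snorm ipP (x t a) <= M) -> (forall t a, (t < n)%N -> snorm ipP (y t a) <= M) ->
  (forall t a, (t < n)%N -> snorm ipP ((x t a : Om -> R^o) - (y t a : Om -> R^o)) <= d) ->
  (\int[P]_w (`|gram_dev x a b w - gram_dev y a b w|)%:E <= (4 * M * d)%:E)%E.
Proof.
move=> n0 Lx Ly M0 d0 xM yM xyd.
pose De t w := x t a w * x t b w - y t a w * y t b w.
have mx t c : measurable_fun setT (x t c) by case: (Lx t c).
have my t c : measurable_fun setT (y t c) by case: (Ly t c).
have mDe t : measurable_fun setT (De t) by apply: measurable_funB; exact: measurable_funM.
have nR : 0 < n%:R :> R by rewrite ltr0n.
have hD t : (t < n)%N -> (\int[P]_w (`|De t w|)%:E <= (2 * M * d)%:E)%E.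
  move=> tn; pose z c := (x t c : Om -> R^o) - (y t c : Om -> R^o).
  have Lz c : L2P (z c) := siB SP (Lx t c) (Ly t c).
  have mz c : measurable_fun setT (z c) by case: (Lz c).
  apply: (@le_trans _ _ (\int[P]_w (`|x t a w * z b w| + `|z a w * y t b w|)%:E)%E).
    apply: le_expectation => //.
    - exact: measurableT_comp.
    - by apply: measurable_funD; apply: measurableT_comp => //; exact: measurable_funM.
    - move=> w; apply: le_trans (ler_normD _ _); rewrite le_eqVlt; apply/orP; left; apply/eqP; congr `|_|.
      rewrite /De -[z b w]/(x t b w - y t b w) -[z a w]/(x t a w - y t a w); ring.
  rewrite expectationD //; try by apply: measurableT_comp => //; exact: measurable_funM.
  apply: le_trans (leeD (abs_product_le (Lx t a) (Lz b)) (abs_product_le (Lz a) (Ly t b))) _.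
  rewrite -EFinD lee_fin.
  have := ler_pM (snorm_ge0 ipP (x t a)) (snorm_ge0 ipP (z b)) (xM t a tn) (xyd t b tn).
  have := ler_pM (snorm_ge0 ipP (z a)) (snorm_ge0 ipP (y t b)) (xyd t a tn) (yM t b tn).
  rewrite -/(z a) -/(z b); lra.
have iDe t : (t < n)%N -> `|ipP (x t a) (x t b) - ipP (y t a) (y t b)| <= 2 * M * d.
  move=> tn; have ix := L2m_mul measurableT (Lx t a) (Lx t b); have iy := L2m_mul measurableT (Ly t a) (Ly t b).
  have iDe : P.-integrable setT (fun w => (De t w)%:E).
    by under eq_fun do rewrite EFinB; exact: integrableB.
  have e : ipP (x t a) (x t b) - ipP (y t a) (y t b) = fine (\int[P]_w (De t w)%:E)%E.
    apply: EFin_inj; rewrite fineK; last exact: integrable_fin_num.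
    under eq_integral do rewrite EFinB; rewrite integralB //.
    by rewrite EFinB /ipm /Rintegral !fineK //; exact: integrable_fin_num.
  rewrite e -lee_fin; apply: le_trans (hD t tn).
  rewrite -abse_EFin fineK; last exact: integrable_fin_num.
  by under [leRHS]eq_integral do rewrite -abse_EFin; apply: le_abse_integral => //; exact/measurable_EFinP.
apply: (@le_trans _ _ (\int[P]_w (n%:R^-1 * \sum_(t < n) (`|De t w| + 2 * M * d))%:E)%E).
  apply: le_expectation => //.
  - by apply: measurableT_comp => //; apply: measurable_funB; exact: gram_dev_measurable.
  - apply: measurable_funM => //; apply: measurable_sum => t; apply: measurable_funD => //; exact: measurableT_comp.
  - move=> w; rewrite /gram_dev -mulrBr -sumrB normrM ger0_norm ?invr_ge0 // ler_wpM2l ?invr_ge0 //.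
    apply: le_trans (ler_norm_sum _ _ _) _; apply: ler_sum => t _.
    rewrite (_ : _ - _ = De t w - (ipP (x t a) (x t b) - ipP (y t a) (y t b))); last by rewrite /De; ring.
    by apply: le_trans (ler_normB _ _) _; rewrite lerD2l iDe.
have c0 : 0 <= 2 * M * d by rewrite !mulr_ge0.
rewrite expectationZ ?invr_ge0 //; last 2 first.
- apply: measurable_sum => t; apply: measurable_funD => //; exact: measurableT_comp.
- by move=> w; apply: sumr_ge0 => t _; rewrite addr_ge0.
under eq_integral do rewrite -sumEFin.
rewrite ge0_integral_sum //; last 2 first.
- move=> t; apply/measurable_EFinP; apply: measurable_funD => //; exact: measurableT_comp.
- by move=> t w _; rewrite lee_fin addr_ge0.
apply: (@le_trans _ _ ((n%:R^-1)%:E * \sum_(t < n) (4 * M * d)%:E)%E).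
  apply: lee_wpmul2l; first by rewrite lee_fin invr_ge0.
  apply: lee_sum => t _; rewrite expectationD //; last exact: measurableT_comp.
  rewrite integral_cst //= probability_setT mule1.
  by apply: le_trans (leeD2r _ (hD t (ltn_ord t))) _; rewrite -EFinD lee_fin; lra.
by rewrite sumEFin -EFinM lee_fin sumr_const card_ord -[X in _ * X]mulr_natl mulrA mulVf ?mul1r // gt_eqF.
Qed.

Variable KA : R.
Hypothesis KAP : forall N, \sum_(l < N) \sum_(i < p) HSnorm U (A l j i) <= KA.

Let KA_ge0 : 0 <= KA. Proof. by have := KAP 0; rewrite big_ord0. Qed.

Definition score (t a : nat) (w : Om) : R := ip U (psi a) (X (tm t) j w).
Let Lscore t a : L2P (score t a).
Proof. by apply: ip_random_L2; [exact: (X_L2 HH flp)|exact: HL]. Qed.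

Definition gram_moment_bound k : R :=
  (s * (KA + 1)) ^+ (4 * k.+1) * (2 * (moment_const * k.+1%:R / n%:R) ^+ k.+1).

(** The moment bound is uniform over the approximants, whose Gram deviations are
    arbitrarily close in L1 to those of the process; the factor 2 leaves room for both. *)
Lemma gram_tail_fixed L k (x : R) : (64 * k.+1 <= n)%N -> 0 < x ->
  (P [set w | ((2 * x) ^+ 2 <= \sum_(a < L) \sum_(b < L) gram_dev score a b w ^+ 2)%R] <=
   (gram_moment_bound k / (x ^+ 2) ^+ k.+1)%:E)%E.
Proof.
move=> kn x0; have n0 : (0 < n)%N by apply: leq_trans kn.
apply/lee_addgt0Pr => e e0.
pose M : R := \sum_(t < n) snorm ipOU (unc (X (tm t) j)) + 1.
have M0 : 0 <= M by rewrite addr_ge0 // sumr_ge0 // => t _; exact: snorm_ge0.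
pose d : R := Num.min 1 (e * x / (4 * M * (L%:R ^+ 2) + 1)).
have q0 : 0 < 4 * M * (L%:R ^+ 2) + 1 by rewrite ltr_wpDl // !mulr_ge0.
have d0 : 0 < d by rewrite lt_min ltr01 divr_gt0 ?mulr_gt0.
have [N [m [f [g [Hf Hg hs h]]]]] := approximation HH flp j [seq tm t | t <- iota 0 n] (exprn_gt0 2 d0).
pose xN (t a : nat) (w : Om) : R := ip U (psi a) (apx N f g (tm t) w).
have LN t : L2OU (unc (apx N f g (tm t))) := @approximant_L2 _ _ _ P _ _ _ HH _ _ _ _ _ flp N m f g Hf Hg (tm t).
have LxN t a : L2P (xN t a) by apply: ip_random_L2; [exact: LN|exact: HL].
have LX t : L2OU (unc (X (tm t) j)) := X_L2 HH flp (tm t) j.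
have DN t : (t < n)%N -> L2OU (fun z => X (tm t) j z.1 z.2 - apx N f g (tm t) z.1 z.2) /\
     snorm ipOU (fun z => X (tm t) j z.1 z.2 - apx N f g (tm t) z.1 z.2) <= d.
  move=> tn; have [|LD De] := h (tm t); first by apply: map_f; rewrite mem_iota add0n.
  split=> //; rewrite -ler_sqr ?nnegrE ?snorm_ge0 ?(ltW d0) //.
  by rewrite (snorm_sq SOU).
have unit_le (V : Om -> R -> R) a : L2OU (unc V) -> snorm ipP (fun w => ip U (psi a) (V w)) <= snorm ipOU (unc V).
  move=> LV; have [LV1 le] := ip_L2P mU LV (HL (Hpsi a)).
  rewrite one eqxx mulr1 in le.
  rewrite -ler_sqr ?nnegrE ?snorm_ge0 //.
  by rewrite (snorm_sq SOU) // (snorm_sq SP).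
have hdiff t a : (t < n)%N -> snorm ipP ((score t a : Om -> R^o) - (xN t a : Om -> R^o)) <= d.
  move=> tn; have [LD De] := DN t tn; apply: le_trans De.
  have -> : (score t a : Om -> R^o) - (xN t a : Om -> R^o) = (fun w => ip U (psi a) (fun u => X (tm t) j w u - apx N f g (tm t) w u)).
    by apply/funext => w; rewrite (ip_sub_approximant HH flp N g (tm t) j w Hf) //; exact: HL.
  by apply: (unit_le (fun w u => X (tm t) j w u - apx N f g (tm t) w u)).
have hM t a : (t < n)%N -> snorm ipP (score t a) <= M - 1.
  move=> tn; apply: le_trans (unit_le _ a (LX t)) _.
  rewrite /M addrK (bigD1 (Ordinal tn)) //= lerDl sumr_ge0 // => i _; exact: snorm_ge0.
have hMN t a : (t < n)%N -> snorm ipP (xN t a) <= M.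
  move=> tn.
  have -> : xN t a = ((score t a : Om -> R^o) - ((score t a : Om -> R^o) - (xN t a : Om -> R^o))).
    by rewrite subKr.
  have Lm := siB SP (Lscore t a) (LxN t a).
  have -> : (score t a : Om -> R^o) - ((score t a : Om -> R^o) - (xN t a : Om -> R^o)) =
     (score t a : Om -> R^o) + (-1) *: ((score t a : Om -> R^o) - (xN t a : Om -> R^o)) by rewrite scaleN1r.
  apply: le_trans (snorm_triangle SP (Lscore t a) (siZ SP (-1) Lm)) _.
  rewrite (snormZ SP) // normrN1 mul1r.
  have d1 : d <= 1 by rewrite ge_min lexx.
  by have := hM t a tn; have := hdiff t a tn; lra.
have close a b := @gram_dev_close score xN M d a b n0 Lscore LxN M0 (ltW d0)
  (fun t c tn => le_trans (hM t c tn) (_ : M - 1 <= M)) hMN hdiff.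
pose G w := \sum_(a < L) \sum_(b < L) `|gram_dev score a b w - gram_dev xN a b w|.
have mdiff a b : measurable_fun setT (fun w => `|gram_dev score a b w - gram_dev xN a b w|).
  by apply: measurableT_comp => //; apply: measurable_funB; exact: gram_dev_measurable.
have mG : measurable_fun setT G by apply: measurable_sum => a; apply: measurable_sum => b.
have G0 w : 0 <= G w by apply: sumr_ge0 => a _; apply: sumr_ge0.
have EG : (\int[P]_w (G w)%:E <= (e * x)%:E)%E.
  rewrite /G; under eq_integral do rewrite pair_big /= -sumEFin.
  rewrite ge0_integral_sum //; last by move=> z; apply/measurable_EFinP; exact: mdiff.
  apply: (@le_trans _ _ (\sum_(z : 'I_L * 'I_L) (4 * M * d)%:E)%E).
    by apply: lee_sum => z _; apply: close; rewrite lerBlDr lerDl.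
  rewrite sumEFin lee_fin sumr_const card_prod card_ord -[leLHS]mulr_natr natrM.
  have : d <= e * x / (4 * M * (L%:R ^+ 2) + 1) by rewrite ge_min lexx orbT.
  rewrite ler_pdivlMr // => hd; apply: le_trans hd.
  have e1 : 4 * M * d * (L%:R * L%:R) = d * (4 * M * L%:R ^+ 2) by ring.
  by rewrite e1; apply: ler_wpM2l; [exact: ltW|rewrite lerDl].
pose F w := \sum_(a < L) \sum_(b < L) gram_dev xN a b w ^+ 2.
have mF : measurable_fun setT F.
  by apply: measurable_sum => a; apply: measurable_sum => b; apply: measurable_funX; exact: gram_dev_measurable.
have F0 w : 0 <= F w by apply: sumr_ge0 => a _; apply: sumr_ge0 => b _; exact: sqr_ge0.
have KA1 : 0 < KA + 1 by rewrite ltr_wpDl.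
have hs' : \sum_(l < N) \sum_(i < p) HSnorm U (tensor (f l i) (g l i)) <= KA + 1.
  by apply: le_trans hs _; rewrite lerD2r.
have PF : (P [set w | ((x ^+ 2) ^+ k.+1 <= F w ^+ k.+1)%R] <= (gram_moment_bound k / (x ^+ 2) ^+ k.+1)%:E)%E.
  apply: markov_bound; [exact: measurable_funX|by move=> w; exact: exprn_ge0|by rewrite !exprn_gt0|].
  exact: (approx_gram_moment Hf Hg hs' KA1).
have PG : (P [set w | (x <= G w)%R] <= e%:E)%E.
  by have := markov_bound mG G0 x0 EG; rewrite mulfK // gt_eqF.
have mS (h' : Om -> R) (c : R) : measurable_fun setT h' -> measurable [set w | (c <= h' w)%R].
  move=> mh; have := mh measurableT _ (measurable_itv `[c, +oo[); rewrite setTI; congr (measurable _).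
  by apply/seteqP; split=> w /=; rewrite in_itv /= andbT.
have m1 : measurable [set w | ((x ^+ 2) ^+ k.+1 <= F w ^+ k.+1)%R] by apply: mS; exact: measurable_funX.
have m2 : measurable [set w | (x <= G w)%R] by exact: mS.
have sub : [set w | ((2 * x) ^+ 2 <= \sum_(a < L) \sum_(b < L) gram_dev score a b w ^+ 2)%R] `<=`
   [set w | ((x ^+ 2) ^+ k.+1 <= F w ^+ k.+1)%R] `|` [set w | (x <= G w)%R].
  move=> w /= big; have [gx|gx] := lerP x (G w); [by right|left].
  suff hx : x ^+ 2 <= F w by exact: (lerXn2r k.+1 (sqr_ge0 x) (F0 w) hx).
  have h1 : \sum_(a < L) \sum_(b < L) gram_dev score a b w ^+ 2 <= 2 * F w + 2 * G w ^+ 2.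
    have : \sum_(a < L) \sum_(b < L) (`|gram_dev score a b w - gram_dev xN a b w|) ^+ 2 <= G w ^+ 2.
      rewrite /G !pair_big /=.
      have sq (I : finType) (z : I -> R) : (forall i, 0 <= z i) -> \sum_i z i ^+ 2 <= (\sum_i z i) ^+ 2.
        move=> z0; rewrite [leRHS]expr2 mulr_sumr; apply: ler_sum => i _; rewrite expr2 ler_wpM2r //.
        by rewrite (bigD1 i) //= lerDl sumr_ge0.
      exact: (sq _ (fun z : 'I_L * 'I_L => `|gram_dev score z.1 z.2 w - gram_dev xN z.1 z.2 w|)).
    move=> hG; apply: (@le_trans _ _ (2 * F w + 2 * \sum_(a < L) \sum_(b < L) (`|gram_dev score a b w - gram_dev xN a b w|) ^+ 2)).
      rewrite /F !mulr_sumr -big_split /=; apply: ler_sum => a _.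
      rewrite !mulr_sumr -big_split /=; apply: ler_sum => b _.
      rewrite real_normK ?num_real //.
      move: (gram_dev score a b w) (gram_dev xN a b w) => u v.
      have := sqr_ge0 (u - 2 * v); nra.
    by rewrite lerD2l ler_wpM2l.
  have g2 : G w ^+ 2 <= x ^+ 2 by apply: lerXn2r; rewrite ?nnegrE ?(ltW x0) // ltW.
  have := le_trans big h1; rewrite exprMn; lra.
apply: le_trans (leeD PF PG).
apply: le_trans (measureU2 _ m1 m2); apply: le_measure => //; rewrite inE //; last exact: measurableU.
apply: mS; apply: measurable_sum => a; apply: measurable_sum => b; apply: measurable_funX; exact: gram_dev_measurable.
Qed.

(** The exceptional events increase with [L], so the bound passes to their union. *)
Lemma gram_tail k (x : R) : (64 * k.+1 <= n)%N -> 0 < x ->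
  exists2 E : set Om, measurable E /\ (P E <= (gram_moment_bound k / (x ^+ 2) ^+ k.+1)%:E)%E &
  forall w, ~ E w -> forall L, \sum_(a < L) \sum_(b < L) gram_dev score a b w ^+ 2 <= (2 * x) ^+ 2.
Proof.
move=> kn x0.
pose F L w := \sum_(a < L) \sum_(b < L) gram_dev score a b w ^+ 2.
pose E L := [set w | ((2 * x) ^+ 2 <= F L w)%R].
have mE L : measurable (E L).
  have mF : measurable_fun setT (F L).
    by apply: measurable_sum => a; apply: measurable_sum => b; apply: measurable_funX; exact: gram_dev_measurable.
  have := mF measurableT _ (measurable_itv `[(2 * x) ^+ 2, +oo[); rewrite setTI; congr (measurable _).
  by apply/seteqP; split=> w /=; rewrite in_itv /= andbT.
have ndF w : {homo F ^~ w : L L' / (L <= L')%N >-> L <= L'}.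
  apply: homo_leq; [by []|by move=> u v z; exact: le_trans|move=> L; rewrite /F big_ord_recr /=].
  rewrite -[leLHS]addr0 lerD ?sumr_ge0 // => [|b _]; last exact: sqr_ge0.
  by apply: ler_sum => a _; rewrite big_ord_recr /= lerDl sqr_ge0.
have ndE : nondecreasing_seq E.
  move=> L L' LL; apply/subsetPset => w /= h; exact: le_trans h (ndF w _ _ LL).
have mU' : measurable (\bigcup_L E L) by exact: bigcup_measurable.
exists (\bigcup_L E L).
  split=> //; have := nondecreasing_cvg_mu (mu := P) mE mU' ndE => /cvg_lim <- //.
  apply: lime_le; first by apply: ereal_nondecreasing_is_cvgn => L L' LL; apply: le_measure; rewrite ?inE //; apply/subsetPset; exact: ndE.
  by apply: nearW => L; exact: gram_tail_fixed.
move=> w nE L; rewrite leNgt; apply/negP => h; apply: nE; exists L => //=; exact: ltW.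
Qed.

End Gram.

(** * Sub-Gaussian linear processes *)

Section LinearProcess.
Context {R : realType} {dsp : measure_display} {Om : measurableType dsp}.
Variable P : probability Om R.
Variables (a : R) (d : nat) (B : nat -> 'M[R]_d) (eta Z : int -> 'I_d -> Om -> R).
Hypothesis lp : linear_process P a B eta Z.
Notation L2P := (L2m P setT).
Notation ipP := (ipm P setT).
Let SP : semi_inner L2P ipP := L2m_si P measurableT.

Definition noise_gen (c : int * 'I_d) : set (set Om) :=
  [set E | exists (i : unit) (S : set R), [/\ [set: unit] i, measurable S & E = (fun w => eta c.1 c.2 w) @^-1` S]].

Lemma eta_L2 t m : L2P (eta t m).
Proof. by have [mV V2 _ _] := lp_subgauss lp t m; split. Qed.

Lemma noise_gen_measurable c : noise_gen c `<=` measurable.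
Proof.
move=> _ [i [S [_ mS ->]]]; rewrite -[X in measurable X]setTI.
by have [m _] := eta_L2 c.1 c.2; exact: m.
Qed.

Lemma noise_indep : mutually_independent P (fun c => <<s noise_gen c >>).
Proof. exact: lp_indep lp. Qed.

Lemma noise_adapted c : measurable_fun setT (eta c.1 c.2 : g_sigma_algebraType (noise_gen c) -> R).
Proof. by move=> _ S mS; rewrite setTI; apply: sub_sigma_algebra; exists tt, S. Qed.

Definition noise_var (m : 'I_d) : R := ipP (eta 0 m) (eta 0 m).

Lemma noise_var_ge0 m : 0 <= noise_var m.
Proof. exact: (si_ge0 SP (eta_L2 0 m)). Qed.

Lemma eta_varE t m : ipP (eta t m) (eta t m) = noise_var m.
Proof.
apply: EFin_inj; rewrite (ipm_sqE measurableT (eta_L2 t m)) (ipm_sqE measurableT (eta_L2 0 m)).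
apply: same_law_square => [||S mS]; [by case: (eta_L2 t m)|by case: (eta_L2 0 m)|exact: (lp_ident lp)].
Qed.

Lemma eta_mgf t m x :
  (\int[P]_w (expR (x * eta t m w))%:E <= (expR (a ^+ 2 * (x ^+ 2 * noise_var m) / 2))%:E)%E.
Proof.
have := sgv_mgf (lp_subgauss lp t m) x; rewrite expectation.unlock => h; apply: le_trans h _.
rewrite lee_fin ler_expR ler_pM2r ?invr_gt0 // ler_wpM2l ?sqr_ge0 // ler_wpM2l ?sqr_ge0 //.
have L := eta_L2 t m; rewrite (covE L L) -(eta_varE t m) lerBlDr lerDl -expr2; exact: sqr_ge0.
Qed.

Let scale m : R := Num.sqrt (a ^+ 2 * noise_var m + 1).
Let scale2 m : scale m ^+ 2 = a ^+ 2 * noise_var m + 1.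
Proof. by rewrite sqr_sqrtr // addr_ge0 // mulr_ge0 ?sqr_ge0 ?noise_var_ge0. Qed.
Let scale0 m : 0 < scale m.
Proof. by rewrite sqrtr_gt0 ltr_wpDl // mulr_ge0 ?sqr_ge0 ?noise_var_ge0. Qed.

Let eta_unit t m : unit_subgaussian P (fun w => (scale m)^-1 * eta t m w).
Proof.
have [me _] := eta_L2 t m; split; first exact: measurable_funM.
move=> x; under eq_integral do rewrite mulrA.
apply: le_trans (eta_mgf t m _) _; rewrite lee_fin ler_expR ler_pM2r ?invr_gt0 //.
have -> : a ^+ 2 * ((x / scale m) ^+ 2 * noise_var m) = x ^+ 2 * (a ^+ 2 * noise_var m / scale m ^+ 2).
  by rewrite exprMn exprVn; ring.
rewrite -[leRHS]mulr1; apply: ler_wpM2l; [exact: sqr_ge0|rewrite scale2].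
by rewrite ler_pdivrMr ?mul1r ?lerDl // ltr_wpDl // mulr_ge0 ?sqr_ge0 ?noise_var_ge0.
Qed.

Lemma eta_orth c c' : c != c' -> ipP (eta c.1 c.2) (eta c'.1 c'.2) = 0.
Proof.
move=> cc.
have h := @offdiagonal_mean _ _ _ P _ noise_gen noise_gen_measurable noise_indep (fun=> c) (fun=> c')
  (fun _ w => (scale c.2)^-1 * eta c.1 c.2 w) (fun _ w => (scale c'.2)^-1 * eta c'.1 c'.2 w).
have := h _ _ (fun=> eta_unit c.1 c.2) (fun=> eta_unit c'.1 c'.2) 0%N cc.
move=> /(_ _ _)/wrap[].
- by move=> _; apply: measurable_funM => //; exact: noise_adapted.
- by move=> _; apply: measurable_funM => //; exact: noise_adapted.
have L1 := eta_L2 c.1 c.2; have L2 := eta_L2 c'.1 c'.2.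
rewrite (formZl SP (scale c.2)^-1 L1 (siZ SP (scale c'.2)^-1 L2)) (formZr SP _ L2 L1).
move=> /eqP; rewrite !mulf_eq0 !invr_eq0 (gt_eqF (scale0 c.2)) (gt_eqF (scale0 c'.2)) /= => /eqP //.
Qed.

Section Coordinate.
Variable k : 'I_d.
Let b l m : R := B l k m.

Definition lp_trunc N (t : int) (w : Om) : R :=
  \sum_(l < N) \sum_(m < d) b l m * eta (t - (l : nat)%:Z) m w.

Lemma lp_truncE N t : lp_trunc N t = \sum_(l < N) \sum_(m < d) (b l m *: (eta (t - (l : nat)%:Z) m : Om -> R^o)).
Proof. by apply/funext => w; rewrite fct_sumE; apply: eq_bigr => l _; rewrite fct_sumE. Qed.

Lemma lp_trunc_L2 N t : L2P (lp_trunc N t).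
Proof.
rewrite lp_truncE; apply: (si_sum SP) => l _; apply: (si_sum SP) => m _.
by apply: (siZ SP); exact: eta_L2.
Qed.

Lemma lp_trunc_cvg t : exists N0, forall N, (N0 <= N)%N ->
  L2P ((Z t k : Om -> R^o) - (lp_trunc N t : Om -> R^o)).
Proof.
have := lp_series lp t k => /ecvg0_lt /(_ ltr01)[N0 h]; exists N0 => N /h hN.
have mZ := lp_meas lp t k; have [mN _] := lp_trunc_L2 N t.
have mD : measurable_fun setT ((Z t k : Om -> R^o) - (lp_trunc N t : Om -> R^o)) by exact: measurable_funB.
split=> //; apply/integrableP; split; first by apply/measurable_EFinP; exact: measurable_funX.
under eq_integral do rewrite gee0_abs ?lee_fin ?sqr_ge0 //.
by apply: lt_le_trans hN _; rewrite leey.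
Qed.

Lemma lp_L2 t : L2P (Z t k).
Proof.
have [N /(_ N (leqnn N)) L] := lp_trunc_cvg t.
have -> : Z t k = ((Z t k : Om -> R^o) - (lp_trunc N t : Om -> R^o)) + (lp_trunc N t : Om -> R^o) by rewrite subrK.
exact: (siD SP L (lp_trunc_L2 N t)).
Qed.

Lemma lp_dist_cvg t : (fun N => snorm ipP ((Z t k : Om -> R^o) - (lp_trunc N t : Om -> R^o))) @ \oo --> (0 : R).
Proof.
apply: cvg0_sqrt; apply/cvgrPdist_lt => e e0.
have [N0 h] := ecvg0_lt (lp_series lp t k) e0; exists N0 => // N /h hN /=.
have L := siB SP (lp_L2 t) (lp_trunc_L2 N t).
rewrite sub0r normrN ger0_norm ?(si_ge0 SP L) // -lte_fin (ipm_sqE measurableT L).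
exact: hN.
Qed.

Lemma lp_mean0 t : mean P (Z t k) = 0.
Proof.
have L1 := L2m_one P.
have eta0 t' m : mean P (eta t' m) = 0 by rewrite meanE (sgv_mean (lp_subgauss lp t' m)).
have tr0 N : mean P (lp_trunc N t) = 0.
  rewrite /mean lp_truncE (form_suml SP) //; last first.
    by move=> l _; apply: (si_sum SP) => m _; apply: (siZ SP); exact: eta_L2.
  rewrite big1 // => l _; rewrite (form_suml SP) //; last by move=> m _; apply: (siZ SP); exact: eta_L2.
  rewrite big1 // => m _; rewrite (formZl SP _ (eta_L2 _ _) L1) -/(mean P _) eta0 mulr0 //.
apply/eqP; rewrite -normr_le0; apply/ler_addgt0Pr => e e0; rewrite add0r.
have /cvgrPdist_lt /(_ e e0)[N _ /(_ N (leqnn N))] := lp_dist_cvg t.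
rewrite /= sub0r normrN ger0_norm ?snorm_ge0 // => lt.
have LB := siB SP (lp_L2 t) (lp_trunc_L2 N t).
have := form_CS_norm SP LB L1; rewrite (formBl SP (lp_L2 t) (lp_trunc_L2 N t) L1) -!/(mean P _) tr0 subr0.
by rewrite {2}/snorm ipm11 sqrtr1 mulr1 => h; apply: le_trans h (ltW lt).
Qed.

Lemma lp_covE s t : cov P (Z s k) (Z t k) = ipP (Z s k) (Z t k).
Proof. by rewrite (covE (lp_L2 s) (lp_L2 t)) lp_mean0 mul0r subr0. Qed.

Lemma form_cvg (x y : nat -> Om -> R^o) (x0 y0 : Om -> R^o) :
  (forall N, L2P (x N)) -> (forall N, L2P (y N)) -> L2P x0 -> L2P y0 ->
  (fun N => snorm ipP (x0 - x N)) @ \oo --> (0 : R) ->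
  (fun N => snorm ipP (y0 - y N)) @ \oo --> (0 : R) ->
  (fun N => ipP (x N) (y N)) @ \oo --> ipP x0 y0.
Proof.
move=> Lx Ly Lx0 Ly0 cx cy; apply/cvgrPdist_le => e e0.
have M0 : 0 < snorm ipP x0 + snorm ipP y0 + 1 by rewrite ltr_wpDl // addr_ge0 // snorm_ge0.
pose e1 := Num.min 1 (e / (snorm ipP x0 + snorm ipP y0 + 1)).
have e10 : 0 < e1 by rewrite lt_min ltr01 divr_gt0.
move/cvgrPdist_lt: cx => /(_ e1 e10)[N1 _ h1]; move/cvgrPdist_lt: cy => /(_ e1 e10)[N2 _ h2].
exists (maxn N1 N2) => // N /=; rewrite geq_max => /andP[n1 n2].
have := h1 N n1; have := h2 N n2; rewrite /= !sub0r !normrN (ger0_norm (snorm_ge0 _ _)) (ger0_norm (snorm_ge0 _ _)) => hy hx.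
have LX := siB SP Lx0 (Lx N); have LY := siB SP Ly0 (Ly N).
have -> : ipP x0 y0 - ipP (x N) (y N) = ipP (x0 - x N) y0 + ipP x0 (y0 - y N) - ipP (x0 - x N) (y0 - y N).
  rewrite (formBl SP Lx0 (Lx N) Ly0) (formBr SP Ly0 (Ly N) Lx0) (formBl SP Lx0 (Lx N) LY).
  rewrite !(formBr SP Ly0 (Ly N)) //; ring.
have c1 := form_CS_norm SP LX Ly0; have c2 := form_CS_norm SP Lx0 LY; have c3 := form_CS_norm SP LX LY.
have e11 : e1 <= 1 by rewrite ge_min lexx.
have e12 : e1 * (snorm ipP x0 + snorm ipP y0 + 1) <= e by rewrite -ler_pdivlMr // ge_min lexx orbT.
apply: le_trans (ler_normB _ _) _; apply: le_trans (lerD (ler_normD _ _) (lexx _)) _.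
have := ler_wpM2r (snorm_ge0 ipP y0) (ltW hx); have := ler_wpM2l (snorm_ge0 ipP x0) (ltW hy).
have := ler_pM (snorm_ge0 ipP _) (snorm_ge0 ipP _) (ltW hx) (ltW hy).
have := ler_wpM2l (ltW e10) e11; lra.
Qed.

Definition trunc_cov N (s t : int) : R :=
  \sum_(m < d) noise_var m * \sum_(l < N) \sum_(l' < N) b l m * b l' m * (s - (l : nat)%:Z == t - (l' : nat)%:Z)%:R.

Lemma trunc_covE N s t : ipP (lp_trunc N s) (lp_trunc N t) = trunc_cov N s t.
Proof.
have LZ l m u : L2P (b l m *: (eta u m : Om -> R^o)) by apply: (siZ SP); exact: eta_L2.
have LS u l : L2P (\sum_(m < d) (b l m *: (eta u m : Om -> R^o))) by apply: (si_sum SP) => m _.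
rewrite !lp_truncE (form_suml SP) //; last by apply: (si_sum SP) => l' _; exact: LS.
rewrite /trunc_cov; under [RHS]eq_bigr do rewrite mulr_sumr.
rewrite [RHS]exchange_big /=; apply: eq_bigr => l _.
rewrite (form_sumr SP) //.
under [RHS]eq_bigr do rewrite mulr_sumr.
rewrite [RHS]exchange_big /=; apply: eq_bigr => l' _.
rewrite (form_suml SP) //.
apply: eq_bigr => m _; rewrite (form_sumr SP) //.
rewrite (bigD1 m) //= big1 ?addr0 => [|m' m'm].
  rewrite (formZl SP _ (eta_L2 _ _) (LZ _ _ _)) (formZr SP _ (eta_L2 _ _) (eta_L2 _ _)).
  have [e|ne] := eqVneq (s - (l : nat)%:Z) (t - (l' : nat)%:Z); first by rewrite e eta_varE mulr1; ring.
  by rewrite (@eta_orth (s - (l : nat)%:Z, m) (t - (l' : nat)%:Z, m)) ?mulr0 // xpair_eqE negb_and ne.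
rewrite (formZl SP _ (eta_L2 _ _) (LZ _ _ _)) (formZr SP _ (eta_L2 _ _) (eta_L2 _ _)).
by rewrite (@eta_orth (s - (l : nat)%:Z, m) (t - (l' : nat)%:Z, m')) ?mulr0 // xpair_eqE negb_and (eq_sym m) m'm orbT.
Qed.

Lemma trunc_cov_cvg s t : (fun N => trunc_cov N s t) @ \oo --> ipP (Z s k) (Z t k).
Proof.
under eq_fun do rewrite -trunc_covE.
by apply: form_cvg; [move=> N; exact: lp_trunc_L2..|exact: lp_L2|exact: lp_L2|exact: lp_dist_cvg|exact: lp_dist_cvg].
Qed.

Lemma lp_stationary s t u : ipP (Z (s + u) k) (Z (t + u) k) = ipP (Z s k) (Z t k).
Proof.
apply: (cvg_unique _ (@trunc_cov_cvg (s + u) (t + u))) => //.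
have ->: (fun N => trunc_cov N (s + u) (t + u)) = (fun N => trunc_cov N s t); last exact: trunc_cov_cvg.
apply/funext => N; apply: eq_bigr => m _; congr (_ * _); apply: eq_bigr => l _; apply: eq_bigr => l' _.
congr (_ * (_ : bool)%:R); apply/eqP/eqP; lia.
Qed.

Variable KB : R.
Hypothesis KBP : forall N m, \sum_(l < N) `|B l k m| <= KB.

(** The autocovariances of the truncations are double sums of products of coefficients,
    which are summed over the lag [h] first. *)
Lemma lp_summable M : \sum_(h < M) `|ipP (Z 0 k) (Z (h : nat)%:Z k)| <= \sum_(m < d) noise_var m * KB ^+ 2.
Proof.
have bound N : \sum_(h < M) `|trunc_cov N 0 (h : nat)%:Z| <= \sum_(m < d) noise_var m * KB ^+ 2.
  apply: (@le_trans _ _ (\sum_(h < M) \sum_(m < d) noise_var m * \sum_(l < N) \sum_(l' < N) `|b l m| * `|b l' m| *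
     (0 - (l : nat)%:Z == (h : nat)%:Z - (l' : nat)%:Z)%:R)).
    apply: ler_sum => h _; apply: le_trans (ler_norm_sum _ _ _) _; apply: ler_sum => m _.
    rewrite normrM ger0_norm ?noise_var_ge0 // ler_wpM2l ?noise_var_ge0 //.
    apply: le_trans (ler_norm_sum _ _ _) _; apply: ler_sum => l _.
    apply: le_trans (ler_norm_sum _ _ _) _; apply: ler_sum => l' _.
    by rewrite !normrM [X in _ * X]ger0_norm // ler0n.
  rewrite exchange_big /=; apply: ler_sum => m _; rewrite -mulr_sumr ler_wpM2l ?noise_var_ge0 //.
  rewrite exchange_big /=; under eq_bigr do rewrite exchange_big /=.
  have one_h l l' : \sum_(h < M) ((0 - (l : nat)%:Z == (h : nat)%:Z - (l' : nat)%:Z)%:R : R) <= 1.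
    have [/existsP[h0 /eqP e]|/existsPn no] := boolP [exists h : 'I_M, 0 - (l : nat)%:Z == (h : nat)%:Z - (l' : nat)%:Z].
      rewrite (bigD1 h0) //= e eqxx big1 ?addr0 // => h hh0.
      rewrite (_ : (_ == _) = false) //; apply/negbTE; apply: contra hh0 => /eqP e2; apply/eqP/val_inj => /=; lia.
    by rewrite big1 // => h _; rewrite (negbTE (no h)).
  apply: (@le_trans _ _ (\sum_(l < N) \sum_(l' < N) `|b l m| * `|b l' m|)).
    apply: ler_sum => l _; apply: ler_sum => l' _; rewrite -mulr_sumr -[leRHS]mulr1 ler_wpM2l ?mulr_ge0 //.
  under eq_bigr do rewrite -mulr_sumr.
  rewrite -mulr_suml expr2; have := KBP N m; have : 0 <= \sum_(l < N) `|b l m| by apply: sumr_ge0.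
  by move=> h0 h1; rewrite ler_pM.
have c : (fun N => \sum_(h < M) `|trunc_cov N 0 (h : nat)%:Z|) @ \oo --> \sum_(h < M) `|ipP (Z 0 k) (Z (h : nat)%:Z k)|.
  by apply: cvg_big => [|h _]; [exact: add_continuous|apply: cvg_norm; exact: trunc_cov_cvg].
have := cvg_lim _ c => <- //; apply: limr_le; last exact: nearW.
by apply/cvg_ex; eexists; exact: c.
Qed.

Section Mgf.
Variables (n : nat) (c : nat -> R).
Let tm (t : nat) : int := (t.+1)%:Z.

Definition trunc_comb N : Om -> R^o := \sum_(t < n) c t *: (lp_trunc N (tm t) : Om -> R^o).
Definition lp_comb : Om -> R^o := \sum_(t < n) c t *: (Z (tm t) k : Om -> R^o).

Let Ltr N : L2P (trunc_comb N).
Proof. by apply: (si_sum SP) => t _; apply: (siZ SP); exact: lp_trunc_L2. Qed.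
Lemma lp_comb_L2 : L2P lp_comb.
Proof. by apply: (si_sum SP) => t _; apply: (siZ SP); exact: lp_L2. Qed.

Lemma trunc_comb_cvg : (fun N => snorm ipP (lp_comb - trunc_comb N)) @ \oo --> (0 : R).
Proof.
have LD t N : L2P ((Z (tm t) k : Om -> R^o) - (lp_trunc N (tm t) : Om -> R^o)).
  exact: (siB SP (lp_L2 (tm t)) (lp_trunc_L2 N (tm t))).
apply: (@cvg0_le _ (fun N => \sum_(t < n) `|c t| * snorm ipP ((Z (tm t) k : Om -> R^o) - (lp_trunc N (tm t) : Om -> R^o)))).
  move=> N; rewrite snorm_ge0 /=.
  have -> : lp_comb - trunc_comb N = \sum_(t < n) c t *: ((Z (tm t) k : Om -> R^o) - (lp_trunc N (tm t) : Om -> R^o)).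
    by rewrite -sumrB; apply: eq_bigr => t _; rewrite scalerBr.
  apply: (le_trans (@snorm_sum _ _ _ _ SP _ (index_enum 'I_n) xpredT
    (fun t => c t *: ((Z (tm t) k : Om -> R^o) - (lp_trunc N (tm t) : Om -> R^o))) _)).
    by move=> t _; apply: (siZ SP); exact: LD.
  by apply: ler_sum => t _; rewrite (snormZ SP).
by apply: cvg0_sum => t; apply: cvg0_Ml; exact: lp_dist_cvg.
Qed.

Lemma trunc_mgf N :
  (\int[P]_w (expR (trunc_comb N w))%:E <= (expR (a ^+ 2 * ipP (trunc_comb N) (trunc_comb N) / 2))%:E)%E.
Proof.
pose Q : finType := ('I_(n + N) * 'I_d)%type.
pose idx (q : Q) : int * 'I_d := ((q.1 : nat)%:Z + 1 - N%:Z, q.2).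
pose W (q : Q) : R := \sum_(t < n) \sum_(l < N) c t * b l q.2 * (t + N - l == q.1)%N%:R.
have E : trunc_comb N = \sum_(q : Q) W q *: (eta (idx q).1 (idx q).2 : Om -> R^o).
  apply/funext => w; rewrite /trunc_comb !fct_sumE.
  transitivity (\sum_(t < n) \sum_(l < N) \sum_(m < d) c t * b l m * eta (tm t - (l : nat)%:Z) m w).
    apply: eq_bigr => t _; rewrite -[LHS]/(c t * lp_trunc N (tm t) w) /lp_trunc mulr_sumr; apply: eq_bigr => l _.
    by rewrite mulr_sumr; apply: eq_bigr => m _; rewrite mulrA.
  transitivity (\sum_(t < n) \sum_(l < N) \sum_(m < d) \sum_(u < n + N)
      c t * b l m * (t + N - l == u)%N%:R * eta ((u : nat)%:Z + 1 - N%:Z) m w).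
    apply: eq_bigr => t _; apply: eq_bigr => l _; apply: eq_bigr => m _.
    have lt : (t + N - l < n + N)%N by have := ltn_ord t; lia.
    rewrite (bigD1 (Ordinal lt)) //= eqxx mulr1 big1 ?addr0 => [|u une].
      by congr (_ * eta _ _ _); have := ltn_ord l; rewrite /tm; lia.
    rewrite (_ : (t + N - l == u)%N = false) ?mulr0 ?mul0r //; apply/negbTE.
    by apply: contra une => /eqP e; apply/eqP/val_inj; rewrite /= e.
  rewrite -(pair_big xpredT xpredT (fun (u : 'I_(n + N)) (m : 'I_d) => W (u, m) * eta ((u : nat)%:Z + 1 - N%:Z) m w)) /=.
  under eq_bigr do under eq_bigr do rewrite exchange_big /=.
  under eq_bigr do rewrite exchange_big /=.
  rewrite exchange_big /=; apply: eq_bigr => u _.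
  under eq_bigr do rewrite exchange_big /=.
  rewrite exchange_big /=; apply: eq_bigr => m _.
  by rewrite /W mulr_suml; apply: eq_bigr => t _; rewrite mulr_suml.
have idx_inj : injective idx.
  by move=> [u m] [u' m'] [h ->]; congr (_, _); apply/val_inj => /=; move: h => /=; lia.
have V : ipP (trunc_comb N) (trunc_comb N) = \sum_(q : Q) W q ^+ 2 * noise_var q.2.
  have LW q : L2P (W q *: (eta (idx q).1 (idx q).2 : Om -> R^o)) by apply: (siZ SP); exact: eta_L2.
  rewrite E (form_suml SP) //; last by apply: (si_sum SP) => q _; exact: LW.
  apply: eq_bigr => q _; rewrite (form_sumr SP) //.
  rewrite (bigD1 q) //= big1 ?addr0 => [|q' qq'].
    by rewrite (formZl SP _ (eta_L2 _ _) (LW q)) (formZr SP _ (eta_L2 _ _) (eta_L2 _ _)) eta_varE mulrA.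
  rewrite (formZl SP _ (eta_L2 _ _) (LW q')) (formZr SP _ (eta_L2 _ _) (eta_L2 _ _)).
  by rewrite (@eta_orth (idx q) (idx q')) ?mulr0 // (inj_eq idx_inj) eq_sym.
rewrite V.
have -> : (\int[P]_w (expR (trunc_comb N w))%:E =
   \int[P]_w (\prod_(q : Q) expR (W q * eta (idx q).1 (idx q).2 w))%:E)%E.
  by apply: eq_integral => w _; rewrite E fct_sumE expR_sum.
rewrite mulr_sumr mulr_suml expR_sum.
apply: (product_bound_fin noise_gen_measurable noise_indep (f := fun q w => expR (W q * eta (idx q).1 (idx q).2 w))
  (c := fun q => expR (a ^+ 2 * (W q ^+ 2 * noise_var q.2) / 2)) idx_inj).
- by move=> q; apply: measurableT_comp => //; apply: measurable_funM => //; exact: noise_adapted.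
- by move=> q w; exact: expR_ge0.
- by move=> q; exact: eta_mgf.
Qed.

(** Linear combinations inherit the sub-Gaussian bound from the truncations; capping the
    exponential at [exp K] makes it Lipschitz, so mean square convergence suffices. *)
Lemma lp_mgf : (\int[P]_w (expR (lp_comb w))%:E <= (expR (a ^+ 2 * ipP lp_comb lp_comb / 2))%:E)%E.
Proof.
have [mS _] := lp_comb_L2.
have mE : measurable_fun setT (fun w => expR (lp_comb w)) by exact: measurableT_comp.
have mc K : measurable_fun setT (fun w => Num.min (expR (lp_comb w)) (expR K)) by exact: measurable_minr.
(* [K] stays fixed while the truncation order of the process tends to infinity *)
have cap K : (\int[P]_w (Num.min (expR (lp_comb w)) (expR K))%:E <= (expR (a ^+ 2 * ipP lp_comb lp_comb / 2))%:E)%E.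
  have step N : (\int[P]_w (Num.min (expR (lp_comb w)) (expR K))%:E <=
      (expR (a ^+ 2 * ipP (trunc_comb N) (trunc_comb N) / 2) + expR K * snorm ipP (lp_comb - trunc_comb N))%:E)%E.
    have LD := siB SP lp_comb_L2 (Ltr N); have [mT _] := Ltr N; have [mD _] := LD.
    have lip w : Num.min (expR (lp_comb w)) (expR K) <= expR (trunc_comb N w) + expR K * `|(lp_comb - trunc_comb N) w|.
      have -> : (lp_comb - trunc_comb N) w = lp_comb w - trunc_comb N w by [].
      move: (lp_comb w) (trunc_comb N w) => x y.
      have [xK|Kx] := leP x K.
        rewrite min_l ?ler_expR //.
        have [xy|yx] := leP x y; first by have := mulr_ge0 (expR_ge0 K) (normr_ge0 (x - y)); rewrite -ler_expR in xy; lra.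
        have h : expR x * (1 - (x - y)) <= expR y.
          rewrite (_ : expR y = expR x * expR (- (x - y))); last by rewrite -expRD; congr expR; ring.
          by rewrite ler_wpM2l ?expR_ge0 // expR_ge1Dx.
        have h2 : expR x * (x - y) <= expR K * `|x - y|.
          by rewrite ger0_norm ?subr_ge0 ?(ltW yx) // ler_wpM2r ?subr_ge0 ?(ltW yx) // ler_expR.
        lra.
      rewrite min_r ?ler_expR ?(ltW Kx) //.
      have [Ky|yK] := leP K y; first by have := mulr_ge0 (expR_ge0 K) (normr_ge0 (x - y)); rewrite -ler_expR in Ky; lra.
      have h : expR K * (1 - (K - y)) <= expR y.
        rewrite (_ : expR y = expR K * expR (- (K - y))); last by rewrite -expRD; congr expR; ring.
        by rewrite ler_wpM2l ?expR_ge0 // expR_ge1Dx.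
      have h2 : expR K * (K - y) <= expR K * `|x - y|.
        by rewrite ler_wpM2l ?expR_ge0 // ger0_norm; lra.
      lra.
    have mA : measurable_fun setT (fun w => `|(lp_comb - trunc_comb N) w|) by exact: measurableT_comp.
    apply: (@le_trans _ _ (\int[P]_w (expR (trunc_comb N w) + expR K * `|(lp_comb - trunc_comb N) w|)%:E)%E).
      apply: le_expectation => //.
      by apply: measurable_funD; [exact: measurableT_comp|exact: measurable_funM].
    rewrite expectationD //; try by [exact: measurableT_comp|exact: measurable_funM|move=> w; rewrite mulr_ge0 ?expR_ge0].
    rewrite EFinD expectationZ ?expR_ge0 // EFinM; apply: leeD; first exact: trunc_mgf.
    apply: lee_wpmul2l; first by rewrite lee_fin expR_ge0.
    have := abs_product_le LD (L2m_one P); rewrite {2}/snorm ipm11 sqrtr1 mulr1.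
    by under eq_integral do rewrite /= mulr1.
  have c1 : (fun N => expR (a ^+ 2 * ipP (trunc_comb N) (trunc_comb N) / 2) + expR K * snorm ipP (lp_comb - trunc_comb N))
      @ \oo --> expR (a ^+ 2 * ipP lp_comb lp_comb / 2) + expR K * 0.
    apply: cvgD; last by apply: cvgMr; exact: trunc_comb_cvg.
    apply: continuous_cvg; first exact: continuous_expR.
    apply: cvgMl; apply: cvgMr; apply: form_cvg => //; try exact: lp_comb_L2; exact: trunc_comb_cvg.
  rewrite mulr0 addr0 in c1.
  have fin : (\int[P]_w (Num.min (expR (lp_comb w)) (expR K))%:E)%E \is a fin_num.
    rewrite ge0_fin_numE; last by apply: integral_ge0 => w _; rewrite lee_fin le_min !expR_ge0.
    by apply: le_lt_trans (step 0%N) _; rewrite ltry.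
  rewrite -(fineK fin) lee_fin; have := cvg_lim _ c1 => <- //.
  apply: limr_ge; first by apply/cvg_ex; eexists; exact: c1.
  by apply: nearW => N; rewrite -lee_fin fineK.
pose g K w := (Num.min (expR (lp_comb w)) (expR K%:R))%:E.
have := @cvg_monotone_convergence _ _ _ P setT measurableT g.
move=> /(_ _ _ _)/wrap[].
- by move=> K; apply/measurable_EFinP; exact: mc.
- by move=> K w _; rewrite lee_fin le_min !expR_ge0.
- move=> w _ K K' KK; have e : expR K%:R <= expR K'%:R :> R by rewrite ler_expR ler_nat.
  by rewrite lee_fin le_min; apply/andP; split; rewrite ge_min ?lexx // e orbT.
have -> : (\int[P]_w (fun w => limn (g ^~ w)) w = \int[P]_w (expR (lp_comb w))%:E)%E.
  apply: eq_integral => w _; apply/cvg_lim => //; apply: cvg_near_cst.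
  exists (Num.truncn `|lp_comb w|).+1 => // K /= KK; rewrite /g min_l // ler_expR.
  apply: le_trans (ler_norm _) _; apply: le_trans (ltW (truncnS_gt _)) _; rewrite ler_nat //.
move=> cv; have := cvg_lim _ cv => <- //.
by apply: lime_le; [apply/cvg_ex; eexists; exact: cv|apply: nearW => K; exact: cap].
Qed.

End Mgf.
End Coordinate.
End LinearProcess.

(** * Spectral densities and Toeplitz forms *)

Section Trigonometric.
Context {R : realType}.
Notation leb := (@lebesgue_measure R).
Local Notation D := (`[- pi, pi]%classic : set R).
Notation L2D := (L2m leb D).
Notation ipD := (ipm leb D).

Let mD : measurable (D : set (measurableTypeR R)). Proof. exact: measurable_itv. Qed.
Let SD : semi_inner L2D ipD := L2m_si leb mD.
Let pi0 : 0 < pi :> R. Proof. exact: pi_gt0. Qed.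

Lemma freq_measure : leb D = (2 * pi)%:E.
Proof. by rewrite lebesgue_measure_itv /= lte_fin gtrN // -EFinD; congr (_%:E); ring. Qed.

Lemma bounded_L2D (f : R -> R) (C : R) : measurable_fun setT f -> (forall x, `|f x| <= C) -> L2D f.
Proof.
move=> mf fC; split; first exact: measurable_funTS.
apply: measurable_bounded_integrable => //.
- by rewrite -[X in (X < _)%E]/(leb D) freq_measure ltry.
- by apply: measurable_funTS; exact: measurable_funX.
- exists (C ^+ 2); split; first exact: num_real.
  move=> y Cy x _ /=; rewrite normrX; apply: le_trans (ltW Cy).
  by apply: lerXn2r; rewrite ?nnegrE // (le_trans _ (fC x)).
Qed.

Definition cosf (m : int) (x : R) : R := cos (m%:~R * x).

Lemma measurable_cosf m : measurable_fun setT (cosf m).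
Proof.
apply: continuous_measurable_fun => x; apply: continuous_comp; first exact: mulrl_continuous.
exact: continuous_cos.
Qed.

Lemma cosf_L2 m : L2D (cosf m).
Proof.
by apply: (@bounded_L2D _ 1); [exact: measurable_cosf|move=> x; rewrite ler_norml cos_geN1 cos_le1].
Qed.

Lemma cosfN m : cosf (- m) = cosf m.
Proof. by apply/funext => x; rewrite /cosf intrN mulNr cosN. Qed.

Lemma cosf0 : cosf 0 = cst 1.
Proof. by apply/funext => x; rewrite /cosf mul0r cos0. Qed.

Lemma sin_natpi n : sin (n%:R * pi) = 0 :> R.
Proof.
elim: n => [|n IH]; first by rewrite mul0r sin0.
by rewrite -natr1 mulrDl mul1r sinD IH mul0r add0r sinpi mulr0.
Qed.

Lemma integral_cosf m : ipD (cosf m) (cst 1) = if m == 0 then 2 * pi else 0.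
Proof.
have [->|m0] := eqVneq m 0.
  rewrite cosf0 /ipm /Rintegral.
  by under eq_integral do rewrite /= mulr1; rewrite integral_cst // -[X in (_ * X)%E]/(leb D) freq_measure !mul1e.
have mR : m%:~R != 0 :> R by rewrite intr_eq0.
pose F (x : R) : R := sin (m%:~R * x) / m%:~R.
have dF (x : R) : is_derive x 1 F (cosf m x).
  apply: is_derive_eq; rewrite /cosf /GRing.scale /= !(mulr1, mulr0, addr0, add0r, mul0r) //.
  by rewrite mulrC mulfK.
have dvF (x : R) : derivable F x 1 by have [] := dF x.
have cF : continuous F.
  by move=> x; apply: differentiable_continuous; apply/derivable1_diffP.
rewrite /ipm /Rintegral; under eq_integral do rewrite /= mulr1.
rewrite (@continuous_FTC2 _ (cosf m) F).
- rewrite /F mulrN sinN.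
  have s0 : sin (m%:~R * pi) = 0 :> R.
    case: (intP m) => [|k|k]; first by rewrite mul0r sin0.
      by rewrite -pmulrn sin_natpi.
    by rewrite mulrNz mulNr sinN -pmulrn sin_natpi oppr0.
  by rewrite s0 oppr0 !mul0r subee.
- by rewrite gtrN.
- apply: continuous_subspaceT => x; apply: continuous_comp; [exact: mulrl_continuous|exact: continuous_cos].
- split; first by move=> x _; exact: dvF.
  + by apply: cvg_at_right_filter; exact: cF.
  + by apply: cvg_at_left_filter; exact: cF.
- by move=> x _; rewrite derive1E; have [_ ->] := dF x.
Qed.

Lemma ip_cosf m n : ipD (cosf m) (cosf n) = pi * ((m + n == 0)%:R + (m - n == 0)%:R).
Proof.
have L k := cosf_L2 k; have L1 := L 0; rewrite cosf0 in L1.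
have -> : ipD (cosf m) (cosf n) = ipD (2^-1 *: (cosf (m + n) : R -> R^o) + 2^-1 *: (cosf (m - n) : R -> R^o)) (cst 1).
  apply: eq_Rintegral => x _.
  rewrite -[(_ + _) x]/(2^-1 * cosf (m + n) x + 2^-1 * cosf (m - n) x) mulr1.
  by rewrite /cosf intrD mulrDl cosD rmorphB mulrBl cosB; field.
rewrite (formDl SD (siZ SD _ (L (m + n))) (siZ SD _ (L (m - n))) L1) !(formZl SD _ (L _) L1) !integral_cosf.
by case: eqP => _; case: eqP => _; rewrite ?mulr0n ?mulr1n; field.
Qed.

Section Quadratic.
Variable r : nat -> R.

(** The partial Fourier sum of an even real sequence, its imaginary part having cancelled. *)
Definition cos_sum N (x : R) : R :=
  (2 * pi)^-1 * r 0 + \sum_(h < N) pi^-1 * r h.+1 * cosf h.+1%:Z x.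

Lemma cos_sumE N : cos_sum N = ((2 * pi)^-1 * r 0) *: (cosf 0 : R -> R^o) +
  \sum_(h < N) (pi^-1 * r h.+1) *: (cosf h.+1%:Z : R -> R^o).
Proof.
apply/funext => x; rewrite -[RHS]/((2 * pi)^-1 * r 0 * cosf 0 x + _ x) fct_sumE cosf0 mulr1.
by congr (_ + _).
Qed.

Lemma cos_sum_L2 N : L2D (cos_sum N).
Proof.
rewrite cos_sumE; apply: (siD SD); first by apply: (siZ SD); exact: cosf_L2.
by apply: (si_sum SD) => h _; apply: (siZ SD); exact: cosf_L2.
Qed.

Variables (n : nat) (c : nat -> R).

(** The squared modulus of the trigonometric polynomial with coefficients [c]. *)
Definition trig_square : R -> R^o := \sum_(s < n) \sum_(t < n) (c s * c t) *: (cosf ((s : nat)%:Z - (t : nat)%:Z) : R -> R^o).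

Lemma trig_square_ge0 x : 0 <= trig_square x.
Proof.
have -> : trig_square x = (\sum_(s < n) c s * cosf (s : nat)%:Z x) ^+ 2 + (\sum_(s < n) c s * sin ((s : nat)%:R * x)) ^+ 2.
  rewrite /trig_square fct_sumE !expr2 !mulr_suml -big_split /=; apply: eq_bigr => s _.
  rewrite fct_sumE !mulr_sumr -big_split /=; apply: eq_bigr => t _.
  rewrite -[LHS]/(c s * c t * cosf ((s : nat)%:Z - (t : nat)%:Z) x) /cosf rmorphB mulrBl cosB -!pmulrn; ring.
by rewrite addr_ge0 ?sqr_ge0.
Qed.

Lemma trig_square_L2 : L2D trig_square.
Proof. by apply: (si_sum SD) => s _; apply: (si_sum SD) => t _; apply: (siZ SD); exact: cosf_L2. Qed.

Lemma trig_square_ip (f : R -> R^o) : L2D f -> ipD trig_square f =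
  \sum_(s < n) \sum_(t < n) c s * c t * ipD (cosf ((s : nat)%:Z - (t : nat)%:Z)) f.
Proof.
move=> Lf; have LZ s t : L2D ((c s * c t) *: (cosf ((s : nat)%:Z - (t : nat)%:Z) : R -> R^o)).
  by apply: (siZ SD); exact: cosf_L2.
rewrite (form_suml SD) //; last by move=> s _; apply: (si_sum SD) => t _; exact: LZ.
apply: eq_bigr => s _; rewrite (form_suml SD) //; try by move=> t _; exact: LZ.
by apply: eq_bigr => t _; rewrite (formZl SD _ (cosf_L2 _) Lf).
Qed.

Definition toeplitz_form : R := \sum_(s < n) \sum_(t < n) c s * c t * r `|(s : nat)%:Z - (t : nat)%:Z|%N.

Lemma toeplitz_ip N : (n <= N)%N -> ipD trig_square (cos_sum N) = toeplitz_form.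
Proof.
move=> nN; rewrite (trig_square_ip (cos_sum_L2 N)); apply: eq_bigr => s _; apply: eq_bigr => t _; congr (_ * _).
set m := _ - _ : int.
have LZ h : L2D ((pi^-1 * r h.+1) *: (cosf h.+1%:Z : R -> R^o)) by apply: (siZ SD); exact: cosf_L2.
have LS : L2D (\sum_(h < N) (pi^-1 * r h.+1) *: (cosf h.+1%:Z : R -> R^o)) by apply: (si_sum SD) => h _.
rewrite cos_sumE (formDr SD (siZ SD _ (cosf_L2 0)) LS (cosf_L2 m)).
rewrite (formZr SD _ (cosf_L2 0) (cosf_L2 m)) (form_sumr SD) //; last exact: cosf_L2.
under eq_bigr do rewrite (formZr SD _ (cosf_L2 _) (cosf_L2 m)) ip_cosf.
rewrite (ip_cosf m 0) oppr0 !addr0.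
have pn : pi != 0 :> R by rewrite gt_eqF.
have [m0|m0] := eqVneq m 0.
  rewrite m0 absz0 big1 ?addr0 => [|h _].
    have -> : (true%:R : R) = 1 by [].
    by move: pn; generalize (pi : R) => q q0; field.
  have -> : (0 + h.+1%:Z == 0) = false by [].
  have -> : (0 - h.+1%:Z == 0) = false by rewrite sub0r oppr_eq0.
  have -> : (false%:R : R) = 0 by [].
  by rewrite addr0 !mulr0.
have -> : (false%:R : R) = 0 by [].
rewrite addr0 !mulr0 add0r.
have lt : (`|m|.-1 < N)%N by have := ltn_ord s; have := ltn_ord t; rewrite /m; lia.
have mp : `|m|%N.-1.+1 = `|m|%N by rewrite prednK // absz_gt0.
rewrite (bigD1 (Ordinal lt)) //= big1 ?addr0 => [|h hne]; last first.
  have h1 : h.+1 != `|m|%N by apply: contra hne => /eqP e; apply/eqP/val_inj; rewrite /= -e.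
  have -> : (m + h.+1%:Z == 0) = false by apply/negbTE; move: h1; lia.
  have -> : (m - h.+1%:Z == 0) = false by apply/negbTE; move: h1; lia.
  by rewrite addr0 !mulr0.
rewrite mp.
have -> : ((m + `|m|%N%:Z == 0)%:R + (m - `|m|%N%:Z == 0)%:R : R) = 1.
  have [mneg|mpos] := ltP m 0.
    have -> : (m + `|m|%N%:Z == 0) = true by lia.
    have -> : (m - `|m|%N%:Z == 0) = false by lia.
    by rewrite addr0.
  have -> : (m + `|m|%N%:Z == 0) = false by lia.
  have -> : (m - `|m|%N%:Z == 0) = true by lia.
  by rewrite add0r.
by rewrite mulr1 mulrAC mulVf // mul1r.
Qed.

Lemma trig_square_one : ipD trig_square (cst 1) = 2 * pi * \sum_(t < n) c t ^+ 2.
Proof.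
have L1 : L2D (cst 1) by have := cosf_L2 0; rewrite cosf0.
rewrite (trig_square_ip L1) mulr_sumr; apply: eq_bigr => s _.
rewrite (bigD1 s) //= big1 ?addr0 => [|t ts]; rewrite integral_cosf.
  by rewrite subrr eqxx; ring.
rewrite (_ : (_ == 0) = false) ?mulr0 //; apply/negbTE; apply: contra ts => e; apply/eqP/val_inj => /=; move: e; lia.
Qed.

(** A nonnegative trigonometric polynomial is integrated against the nonnegative
    function [K - cos_sum N]. *)
Lemma toeplitz_le N K : (n <= N)%N ->
  {ae leb, forall x, D x -> cos_sum N x <= K} -> toeplitz_form <= K * (2 * pi * \sum_(t < n) c t ^+ 2).
Proof.
move=> nN h; rewrite -(toeplitz_ip nN) -trig_square_one.
have L1 : L2D (cst 1) by have := cosf_L2 0; rewrite cosf0.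
have Lc := cos_sum_L2 N; have LK := siZ SD K L1; have Lg := trig_square_L2.
have Lk' := siB SD LK Lc.
pose f x := Num.max 0 (K - cos_sum N x).
have fae : {ae leb, forall x, D x -> ((K *: (cst 1 : R -> R^o)) - (cos_sum N : R -> R^o)) x = f x}.
  apply: (ae_imp h) => x hx Dx; rewrite /f max_r ?subr_ge0 ?hx //.
  by rewrite -[LHS]/(K * 1 - cos_sum N x) mulr1.
have mf : measurable_fun D f.
  apply: measurable_maxr; first exact: measurable_cst.
  by apply: measurable_funB; [exact: measurable_cst|case: Lc].
have Lf : L2D f by apply: (L2m_ae mD Lk' mf); apply: (ae_imp fae) => x hx Dx; rewrite hx.
have := ipm_ae mD Lk' Lf Lg fae.
rewrite (formBl SD LK Lc Lg) (formZl SD _ L1 Lg) (si_sym SD L1 Lg) (si_sym SD Lc Lg) => e.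
rewrite -subr_ge0 e; apply: Rintegral_ge0 => x _.
by rewrite mulr_ge0 ?trig_square_ge0 // le_max lexx.
Qed.

End Quadratic.

Section SpectralBound.
Variable G : int -> R.
Hypothesis G_even : forall h, G (- h) = G h.
Variable B : R.
Hypothesis G_summable : forall M, \sum_(h < M) `|G (h : nat)%:Z| <= B.
Let r (h : nat) : R := G h%:Z.

Lemma Re_scale (x : R) (z : complex R) : complex.Re (real_complex R x * z) = x * complex.Re z.
Proof. by case: z => u v /=; rewrite mul0r subr0. Qed.

Lemma Re_inv_scale (x : R) (z : complex R) : complex.Re ((real_complex R x)^-1 * z) = x^-1 * complex.Re z.
Proof. by rewrite -fmorphV Re_scale. Qed.

Lemma Re_sum (I : Type) (s : seq I) (F : I -> complex R) :
  complex.Re (\sum_(i <- s) F i) = \sum_(i <- s) complex.Re (F i).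
Proof.
elim: s => [|i s IH]; first by rewrite !big_nil.
by rewrite !big_cons -IH; case: (F i) (\sum_(j <- s) F j) => a b [].
Qed.

Lemma Re_fourier_sum x N : complex.Re (fourier_sum G x N) = cos_sum r N x.
Proof.
rewrite /fourier_sum Re_inv_scale Re_sum.
under eq_bigr do rewrite /= mul0r subr0.
have pn : pi != 0 :> R by rewrite gt_eqF.
suff -> : \sum_(k < N.*2.+1) G ((k : nat)%:Z - N%:Z) * cos (((k : nat)%:Z - N%:Z)%:~R * x) =
   r 0 + \sum_(h < N) 2 * (r h.+1 * cosf h.+1%:Z x).
  rewrite mulrDr mulr_sumr /cos_sum; congr (_ + _); apply: eq_bigr => h _.
  by move: pn; generalize (pi : R) => z z0; field.
elim: N => [|N IH]; first by rewrite big_ord_recl !big_ord0 subr0 mul0r cos0 mulr1.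
rewrite doubleS big_ord_recr big_ord_recl /= [in RHS]big_ord_recr /= addrA -IH.
have e0 : (0%N : int) - N.+1%:Z = - N.+1%:Z by rewrite sub0r.
have e1 : (N.*2.+2 : int) - N.+1%:Z = N.+1%:Z by lia.
rewrite e0 e1 G_even -/(cosf _ x) cosfN -/(cosf N.+1%:Z x) -/(r N.+1).
have -> : \sum_(i < N.*2.+1) G ((bump 0 i : nat)%:Z - N.+1%:Z) * cos (((bump 0 i : nat)%:Z - N.+1%:Z)%:~R * x) =
   \sum_(k < N.*2.+1) G ((k : nat)%:Z - N%:Z) * cos (((k : nat)%:Z - N%:Z)%:~R * x).
  apply: eq_bigr => k _; have -> : (bump 0 k : nat)%:Z - N.+1%:Z = (k : nat)%:Z - N%:Z by rewrite /bump /=; lia.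
  by [].
ring.
Qed.

Lemma Re_le_normc (z : complex R) : `|complex.Re z| <= Normc.normc z.
Proof.
case: z => u v /=; rewrite -sqrtr_sqr ler_sqrt ?addr_ge0 ?sqr_ge0 //.
by rewrite lerDl sqr_ge0.
Qed.

Lemma cos_sum_tail e : 0 < e -> exists N0, forall N M x, (N0 <= N)%N -> (N <= M)%N ->
  cos_sum r N x <= cos_sum r M x + e.
Proof.
move=> e0; pose u M := \sum_(h < M) `|r h|.
have nd : {homo u : a b / (a <= b)%N >-> a <= b}.
  apply: homo_leq; [by []|by move=> a b c'; exact: le_trans|move=> M; by rewrite /u big_ord_recr lerDl].
have cu : cvgn u by apply: nondecreasing_is_cvgn => //; exists B => _ [M _ <-]; exact: G_summable.
have uM M : u M <= limn u by exact: nondecreasing_cvgn_le.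
have /cvgrPdist_lt /(_ (e * pi) (mulr_gt0 e0 pi0))[N0 _ h] := cu.
exists N0 => N M x n0 nM.
have hN := h N.+1 (leqW n0); rewrite /= in hN.
have dif : u M.+1 - u N.+1 <= e * pi.
  have := uM M.+1; have := ler_norm (limn u - u N.+1); lra.
have E : cos_sum r M x - cos_sum r N x = \sum_(N <= h < M) pi^-1 * r h.+1 * cosf h.+1%:Z x.
  rewrite /cos_sum -!(big_mkord xpredT (fun h => pi^-1 * r h.+1 * cosf h.+1%:Z x)).
  rewrite (big_cat_nat (n := N)) //=; ring.
have E2 : u M.+1 - u N.+1 = \sum_(N <= h < M) `|r h.+1|.
  rewrite /u !big_ord_recl /= -!(big_mkord xpredT (fun h => `|r h.+1|)) (big_cat_nat (n := N)) //=; ring.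
have : `|cos_sum r M x - cos_sum r N x| <= pi^-1 * (u M.+1 - u N.+1).
  rewrite E E2; apply: le_trans (ler_norm_sum _ _ _) _; rewrite mulr_sumr; apply: ler_sum => h' _.
  rewrite !normrM ger0_norm ?invr_ge0 ?(ltW pi0) // -[leRHS]mulr1 ler_wpM2l ?mulr_ge0 ?invr_ge0 ?(ltW pi0) //.
  by rewrite ler_norml cos_geN1 cos_le1.
have : pi^-1 * (u M.+1 - u N.+1) <= e by rewrite ler_pdivrMl // mulrC.
have := ler_norm (cos_sum r N x - cos_sum r M x); rewrite distrC; lra.
Qed.

(** The spectral density bounds Toeplitz forms: partial Fourier sums converge uniformly,
    and integrate exactly against trigonometric polynomials of lower degree. *)
Lemma spectral_toeplitz_le (f : R -> complex R) (kap : R) n (c : nat -> R) :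
  0 < G 0 ->
  (forall x, freq x -> Normc.normc (f x - fourier_sum G x N) @[N --> \oo] --> (0 : R)) ->
  ((2 * pi)%:E * ess_sup_freq (fun x => (complex.Re (f x) / G 0)%R) <= kap%:E)%E ->
  \sum_(s < n) \sum_(t < n) c s * c t * G ((s : nat)%:Z - (t : nat)%:Z) <= kap * G 0 * \sum_(t < n) c t ^+ 2.
Proof.
move=> G0 fc es.
have pp : 0 < 2 * pi :> R by rewrite mulr_gt0.
have es' : (ess_sup_freq (fun x => (complex.Re (f x) / G 0)%R) <= (kap / (2 * pi))%:E)%E.
  move: es; case: (ess_sup_freq _) => [x| |] //=.
    by rewrite -EFinM !lee_fin ler_pdivlMr // mulrC.
    by rewrite gt0_muley ?lte_fin.
  by move=> _; rewrite leNye.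
have fae : {ae leb, forall x, D x -> complex.Re (f x) <= kap * G 0 / (2 * pi)}.
  have /ess_supP [A [mA A0 sA]] := es'.
  exists (A `&` D); split; [exact: measurableI|exact: A0|].
  move=> x /= nx; split.
    apply: sA => /= h; apply: nx => Dx; rewrite lee_fin ler_pdivrMr // in h.
    by rewrite mulrAC.
  by apply: contrapT => nD; apply: nx.
have TE : \sum_(s < n) \sum_(t < n) c s * c t * G ((s : nat)%:Z - (t : nat)%:Z) = toeplitz_form r n c.
  apply: eq_bigr => s _; apply: eq_bigr => t _; congr (_ * _); rewrite /r.
  by have [h|h] := leP 0 ((s : nat)%:Z - (t : nat)%:Z); [rewrite gez0_abs|rewrite ltz0_abs // G_even].
rewrite TE; apply/ler_addgt0Pr => e e0.
set S := \sum_(t < n) c t ^+ 2.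
have S0 : 0 <= S by apply: sumr_ge0 => t _; exact: sqr_ge0.
have e1 : 0 < e / (2 * pi * (S + 1)) by rewrite divr_gt0 // mulr_gt0 // ltr_wpDl.
have [N0 tail] := cos_sum_tail e1.
have bound : {ae leb, forall x, D x -> cos_sum r (maxn n N0) x <= kap * G 0 / (2 * pi) + e / (2 * pi * (S + 1))}.
  apply: (ae_imp fae) => x hx Dx.
  have cv : (fun M => cos_sum r M x) @ \oo --> complex.Re (f x).
    apply/cvgrPdist_lt => e2 e20; have /cvgrPdist_lt /(_ e2 e20)[M0 _ h] := fc x Dx.
    exists M0 => // M Mm /=; have := h M Mm; rewrite /= sub0r normrN ger0_norm; last first.
      by apply: le_trans (Re_le_normc _).
    apply: le_lt_trans; rewrite -Re_fourier_sum; apply: le_trans (Re_le_normc _).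
    by case: (f x) (fourier_sum G x M) => a b [].
  apply: (@le_trans _ _ (complex.Re (f x) + e / (2 * pi * (S + 1)))); last by rewrite lerD2r hx.
  rewrite -lerBlDr; have := cvg_lim _ cv => <- //.
  apply: limr_ge; first by apply/cvg_ex; eexists; exact: cv.
  exists (maxn n N0) => // M Mm; rewrite lerBlDr; exact: (tail _ _ _ (leq_maxr _ _) Mm).
apply: le_trans (@toeplitz_le r n c _ _ (leq_maxl n N0) bound) _.
rewrite -/S mulrDl.
have -> : kap * G 0 / (2 * pi) * (2 * pi * S) = kap * G 0 * S.
  by rewrite mulrA divfK // gt_eqF.
rewrite lerD2l.
have -> : e / (2 * pi * (S + 1)) * (2 * pi * S) = e * (S / (S + 1)).
  have S1 : S + 1 != 0 by rewrite gt_eqF // ltr_wpDl.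
  by move: (lt0r_neq0 pp); generalize (2 * pi : R) => z z0; field; rewrite S1.
by rewrite -[leRHS]mulr1 ler_wpM2l ?(ltW e0) // ler_pdivrMr ?ltr_wpDl // mul1r lerDl.
Qed.

End SpectralBound.
End Trigonometric.

(** * Deviations of linear processes *)

Section Stability.
Context {R : realType} {dsp : measure_display} {Om : measurableType dsp}.
Variable P : probability Om R.
Notation L2P := (L2m P setT).
Notation ipP := (ipm P setT).
Let SP : semi_inner L2P ipP := L2m_si P measurableT.

Section Process.
Variables (a : R) (d : nat) (B : nat -> 'M[R]_d) (eta Z : int -> 'I_d -> Om -> R).
Hypothesis lp : linear_process P a B eta Z.
Variables (k : 'I_d) (KB : R).
Hypothesis KBP : forall N m, \sum_(l < N) `|B l k m| <= KB.
Variables (f : R -> 'M[complex R]_d) (A : set 'cV[R]_d) (M : R).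
Hypothesis spec : spectral_density_vec (SigmaZ P Z) f.
Hypothesis Ak : A (delta_mx k 0).
Hypothesis stab : (stability_vec f (SigmaZ P Z 0) A <= M%:E)%E.

Let G (h : int) : R := ipP (Z 0 k) (Z h k).
Let L t : L2P (Z t k) := lp_L2 lp k t.

Lemma autocov_even h : G (- h) = G h.
Proof.
rewrite /G -(lp_stationary lp k 0 (- h) h) add0r addNr.
exact: (si_sym SP (L h) (L 0)).
Qed.

Lemma autocovE h : SigmaZ P Z h k k = G h.
Proof. by rewrite mxE (lp_covE lp). Qed.

Lemma delta_form (T : pzSemiRingType) (C : 'M[T]_d) : ((delta_mx k 0 : 'cV[T]_d)^T *m C *m (delta_mx k 0 : 'cV[T]_d)) 0 0 = C k k.
Proof. by rewrite trmx_delta -mulmxA -colE -rowE !mxE. Qed.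

Lemma lp_toeplitz_le n (c : nat -> R) :
  \sum_(s < n) \sum_(t < n) c s * c t * G ((s : nat)%:Z - (t : nat)%:Z) <= M * G 0 * \sum_(t < n) c t ^+ 2.
Proof.
have G00 : 0 <= G 0 := si_ge0 SP (L 0).
have [G0|G0] := eqVneq (G 0) 0.
  rewrite G0 mulr0 mul0r big1 // => s _; rewrite big1 // => t _.
  by rewrite /G (form_null SP (L 0) (L _) G0) mulr0.
have Gp : 0 < G 0 by rewrite lt_def G0.
have := @spectral_toeplitz_le R G autocov_even _ (lp_summable lp KBP) (fun x => f x k k) M n c Gp.
move=> /(_ _ _)/wrap[] => //.
  move=> x xf; have := spec xf k k.
  by rewrite (_ : (fun h => SigmaZ P Z h k k) = G) //; apply/funext => h; rewrite autocovE.
apply: le_trans stab; rewrite /stability_vec lee_pmul2l //; last by rewrite lte_fin mulr_gt0 // pi_gt0.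
apply: ereal_sup_ubound; right; exists (delta_mx k 0); first split=> //=.
  by rewrite /vec_form delta_form autocovE.
congr ess_sup_freq; apply/funext => x.
by rewrite /vec_form delta_form autocovE /spectral_form_vec map_delta_mx delta_form.
Qed.

Lemma lp_comb_var n (c : nat -> R) : ipP (lp_comb Z k n c) (lp_comb Z k n c) <= M * G 0 * \sum_(t < n) c t ^+ 2.
Proof.
apply: le_trans (lp_toeplitz_le n c); rewrite le_eqVlt; apply/orP; left; apply/eqP.
have LZ t : L2P (c t *: (Z (t.+1)%:Z k : Om -> R^o)) by apply: (siZ SP).
rewrite /lp_comb (form_suml SP) //; last by apply: (si_sum SP) => t _; exact: LZ.
apply: eq_bigr => s _; rewrite (form_sumr SP) //; apply: eq_bigr => t _.
rewrite (formZl SP _ (L _) (LZ _)) (formZr SP _ (L _) (L _)) mulrA; congr (_ * _).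
have := lp_stationary lp k 0 ((t : nat)%:Z - (s : nat)%:Z) (s.+1)%:Z.
rewrite add0r (_ : (t : nat)%:Z - (s : nat)%:Z + (s.+1)%:Z = (t.+1)%:Z); last lia.
by move=> ->; rewrite -/(G _) -autocov_even opprB.
Qed.

(** Toeplitz forms of size one already give [G 0 <= M * G 0]. *)
Lemma autocov_stability_ge1 : 0 < G 0 -> 1 <= M.
Proof.
move=> G0; have := lp_toeplitz_le 1 (fun=> 1).
by rewrite !big_ord1 !mul1r subr0 expr1n mulr1 -[leLHS]mul1r ler_pM2r.
Qed.

Variables (V Lv : R).
Hypothesis VP : forall t, cov P (Z t k) (Z t k) <= V.
Hypothesis LvP : a ^+ 2 * V * M <= Lv.
Hypothesis M_ge0 : 0 <= M.

Lemma lp_combE n (c : nat -> R) w : lp_comb Z k n c w = \sum_(t < n) c t * Z (t.+1)%:Z k w.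
Proof. by rewrite /lp_comb fct_sumE. Qed.

Lemma lp_expsum n (c : nat -> R) :
  (\int[P]_w (expR (\sum_(t < n) c t * Z (t.+1)%:Z k w))%:E <= (expR (Lv * (\sum_(t < n) c t ^+ 2) / 2))%:E)%E.
Proof.
under eq_integral do rewrite -lp_combE.
apply: le_trans (lp_mgf lp k n c) _; rewrite lee_fin ler_expR ler_pM2r ?invr_gt0 //.
have S0 : 0 <= \sum_(t < n) c t ^+ 2 by apply: sumr_ge0 => t _; exact: sqr_ge0.
apply: le_trans (ler_wpM2l (sqr_ge0 a) (lp_comb_var n c)) _; rewrite mulrA ler_wpM2r //.
apply: le_trans LvP; rewrite -mulrA; apply: ler_wpM2l; first exact: sqr_ge0.
by rewrite mulrC; apply: ler_wpM2r => //; have := VP 0; rewrite (lp_covE lp).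
Qed.

Hypothesis Lv_gt0 : 0 < Lv.

(** Markov's inequality for [exp (|Z|^2 / (4 * Lv))], whose mean is at most
    [sqrt 2 ^ n <= exp n]. *)
Lemma lp_norm_tail n :
  (P [set w | (12 * Lv * n%:R <= \sum_(t < n) Z (t.+1)%:Z k w ^+ 2)%R] <= (expR (- (2 * n%:R)))%:E)%E.
Proof.
have mZ t : measurable_fun setT (Z t k) := lp_meas lp t k.
pose s := Num.sqrt Lv; have s2 : s ^+ 2 = Lv by rewrite sqr_sqrtr // ltW.
have s0 : s != 0 by rewrite gt_eqF // sqrtr_gt0.
have h := @quadratic_exp_bound _ _ _ P n (fun t w => s^-1 * Z (t.+1)%:Z k w) _ _.
have mY : measurable_fun setT (fun w => expR (\sum_(t < n) (s^-1 * Z (t.+1)%:Z k w) ^+ 2 / 4)).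
  apply: measurableT_comp => //; apply: measurable_sum => t; apply: measurable_funM => //.
  by apply: measurable_funX; exact: measurable_funM.
have {h} h : (\int[P]_w (expR (\sum_(t < n) (s^-1 * Z (t.+1)%:Z k w) ^+ 2 / 4))%:E <= (Num.sqrt 2 ^+ n)%:E)%E.
  apply: h => [t|c]; first exact: measurable_funM.
  under eq_integral do under eq_bigr do rewrite mulrA.
  apply: le_trans (lp_expsum n (fun t => c t * s^-1)) _; rewrite lee_fin ler_expR -mulr_suml.
  rewrite ler_pM2r ?invr_gt0 //; under eq_bigr do rewrite exprMn.
  by rewrite -mulr_suml exprVn s2 mulrCA mulfV ?mulr1 // gt_eqF.
have e w : \sum_(t < n) (s^-1 * Z (t.+1)%:Z k w) ^+ 2 / 4 = (4 * Lv)^-1 * \sum_(t < n) Z (t.+1)%:Z k w ^+ 2.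
  rewrite mulr_sumr; apply: eq_bigr => t _; rewrite exprMn exprVn s2 invfM; ring.
have -> : [set w | (12 * Lv * n%:R <= \sum_(t < n) Z (t.+1)%:Z k w ^+ 2)%R] =
   [set w | (expR (3 * n%:R) <= expR (\sum_(t < n) (s^-1 * Z (t.+1)%:Z k w) ^+ 2 / 4))%R].
  apply: eq_set => w; rewrite ler_expR e ler_pdivlMl ?mulr_gt0 //; congr (is_true (_ <= _)); ring.
apply: le_trans (markov_bound mY (fun w => expR_ge0 _) (expR_gt0 _) h) _; rewrite lee_fin.
have e1 : Num.sqrt 2 <= expR 1 :> R.
  by apply: le_trans sqrt2_le _; have := @expR_ge1Dx R 1; lra.
rewrite ler_pdivrMr ?expR_gt0 // -expRD (_ : - (2 * n%:R) + 3 * n%:R = n%:R * 1); last ring.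
by rewrite expRM_natl; apply: lerXn2r; rewrite ?nnegrE ?sqrtr_ge0 ?expR_ge0.
Qed.

End Process.

Section Noise.
Variables (d : nat) (Z : int -> 'I_d -> Om -> R) (e : int -> 'I_1 -> Om -> R) (Le : R) (k : 'I_d).
Hypothesis mZ : forall t k, measurable_fun setT (Z t k).
Hypothesis me : forall t k, measurable_fun setT (e t k).
Hypothesis ind : independent P (sigma_process e) (sigma_process Z).
Variable n : nat.
Hypothesis e_expsum : forall c : nat -> R,
  (\int[P]_w (expR (\sum_(t < n) c t * e (t.+1)%:Z 0 w))%:E <= (expR (Le * (\sum_(t < n) c t ^+ 2) / 2))%:E)%E.

Let gen (q : nat) (V : int -> 'I_q -> Om -> R) : set (set Om) :=
  [set E | exists (i : int * 'I_q) (S : set R), [/\ [set: int * 'I_q] i, measurable S & E = (fun w => V i.1 i.2 w) @^-1` S]].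

Let gen_measurable q (V : int -> 'I_q -> Om -> R) : (forall t k, measurable_fun setT (V t k)) -> gen V `<=` measurable.
Proof.
move=> mV _ [i [S [_ mS ->]]]; rewrite -[X in measurable X]setTI; exact: mV.
Qed.

Let adapted q (V : int -> 'I_q -> Om -> R) t j : measurable_fun setT (V t j : g_sigma_algebraType (gen V) -> R).
Proof. by move=> _ S mS; rewrite setTI; apply: sub_sigma_algebra; exists (t, j), S. Qed.

Let id_meas q (V : int -> 'I_q -> Om -> R) : (forall t k, measurable_fun setT (V t k)) ->
  measurable_fun setT (id : Om -> g_sigma_algebraType (gen V)).
Proof.
move=> mV _ S mS; rewrite setTI.
by apply: (@smallest_sub _ _ _ _ _ (gen_measurable mV) S mS); exact: sigma_algebra_measurable.
Qed.

(** Once [Z] is frozen, the sum is a linear combination of the noise, and the term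
    that is subtracted compensates its moment generating function. *)
Lemma noise_mgf (l : R) :
  (\int[P]_w (expR (l * (\sum_(t < n) Z (t.+1)%:Z k w * e (t.+1)%:Z 0 w) -
      l ^+ 2 * Le * (\sum_(t < n) Z (t.+1)%:Z k w ^+ 2) / 2))%:E <= 1%:E)%E.
Proof.
pose T1 := g_sigma_algebraType (gen Z); pose T2 := g_sigma_algebraType (gen e).
pose phi (z : T1 * T2) : R := expR (l * (\sum_(t < n) Z (t.+1)%:Z k z.1 * e (t.+1)%:Z 0 z.2) -
      l ^+ 2 * Le * (\sum_(t < n) Z (t.+1)%:Z k z.1 ^+ 2) / 2).
have mphi : measurable_fun setT (fun z => (phi z)%:E).
  apply/measurable_EFinP; apply: measurableT_comp => //.
  have m1 t : measurable_fun setT (fun z : T1 * T2 => Z t k z.1).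
    exact: (measurableT_comp (f := (Z t k : T1 -> R)) (@adapted _ Z t k) measurable_fst).
  have m2 t : measurable_fun setT (fun z : T1 * T2 => e t 0 z.2).
    exact: (measurableT_comp (f := (e t 0 : T2 -> R)) (@adapted _ e t 0) measurable_snd).
  apply: measurable_funB.
    by apply: measurable_funM => //; apply: measurable_sum => t; exact: measurable_funM.
  by apply: measurable_funM => //; apply: measurable_funM => //; apply: measurable_sum => t; exact: measurable_funX.
have := independent_fubini (P := P) (id_meas mZ) (id_meas me) (phi := fun z => (phi z)%:E) _ mphi _.
move=> /(_ _ _)/wrap[]; last 1 first.
- move=> ->.
  have -> : 1%:E = (\int[P]_w (1%:E : \bar R))%E by rewrite integral_cst //= probability_setT mule1.
  have pF : measurable_fun [set: Om] (fun w1 : Om => (\int[P]_w2 (phi (w1 : T1, w2 : T2))%:E)%E).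
    have := @measurable_fun_fubini_tonelli_F _ _ T1 Om R P (fun z => (phi (z.1, (z.2 : T2)))%:E) _ _.
    move=> /(_ _ _)/wrap[].
    - apply: (measurableT_comp mphi (f := fun z => (phi z)%:E)); apply/measurable_fun_pairP; split; first exact: measurable_fst.
      by apply: measurableT_comp (id_meas me) _; exact: measurable_snd.
    - by move=> z; rewrite lee_fin expR_ge0.
    by move=> mF; exact: (measurableT_comp mF (id_meas mZ)).
  apply: ge0_le_integral => //.
  + by move=> w _; apply: integral_ge0 => w' _; rewrite lee_fin expR_ge0.
  + move=> w1 _.
    have -> : (\int[P]_w2 (phi (w1 : T1, w2 : T2))%:E =
       (expR (- (l ^+ 2 * Le * (\sum_(t < n) Z (t.+1)%:Z k w1 ^+ 2) / 2)))%:E *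
       \int[P]_w2 (expR (\sum_(t < n) (l * Z (t.+1)%:Z k w1) * e (t.+1)%:Z 0 w2))%:E)%E.
      rewrite -expectationZ ?expR_ge0 //; last first.
        by apply: measurableT_comp => //; apply: measurable_sum => t; exact: measurable_funM.
      apply: eq_integral => w2 _; rewrite -expRD /phi /= mulr_sumr addrC; congr (expR (_ + _))%:E.
      by apply: eq_bigr => t _; rewrite mulrA.
    apply: le_trans (lee_wpmul2l _ (e_expsum (fun t => l * Z (t.+1)%:Z k w1))) _; first by rewrite lee_fin expR_ge0.
    rewrite -EFinM lee_fin -expRD -[X in _ <= X]expR0 ler_expR.
    under [X in Le * X]eq_bigr do rewrite exprMn.
    by rewrite -mulr_sumr le_eqVlt; apply/orP; left; apply/eqP; field.
- move=> SA SB mA mB; rewrite !preimage_id setIC muleC; exact: ind.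
- by move=> z; rewrite lee_fin expR_ge0.
Qed.

Lemma noise_tail (l y : R) : 0 < l -> 0 < y ->
  exists2 E : set Om, measurable E /\ (P E <= (2 / y)%:E)%E &
  forall w, ~ E w -> l * `|\sum_(t < n) Z (t.+1)%:Z k w * e (t.+1)%:Z 0 w| <=
    ln y + l ^+ 2 * Le * (\sum_(t < n) Z (t.+1)%:Z k w ^+ 2) / 2.
Proof.
move=> l0 y0; pose S w := \sum_(t < n) Z (t.+1)%:Z k w * e (t.+1)%:Z 0 w.
pose Q w := l ^+ 2 * Le * (\sum_(t < n) Z (t.+1)%:Z k w ^+ 2) / 2.
pose Y (c : R) w := expR (c * S w - Q w).
have mS : measurable_fun setT S by apply: measurable_sum => t; exact: measurable_funM.
have mQ : measurable_fun setT Q.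
  by apply: measurable_funM => //; apply: measurable_funM => //; apply: measurable_sum => t; exact: measurable_funX.
have mY c : measurable_fun setT (Y c).
  by apply: measurableT_comp => //; apply: measurable_funB => //; exact: measurable_funM.
have h c : c ^+ 2 = l ^+ 2 -> (P [set w | (y <= Y c w)%R] <= (1 / y)%:E)%E.
  move=> c2; apply: markov_bound => //; first by move=> w; exact: expR_ge0.
  by have := noise_mgf c; rewrite c2.
have mE c : measurable [set w | (y <= Y c w)%R].
  have := mY c measurableT _ (measurable_itv `[y, +oo[); rewrite setTI; congr (measurable _).
  by apply/seteqP; split=> w /=; rewrite in_itv /= andbT.
exists ([set w | (y <= Y l w)%R] `|` [set w | (y <= Y (- l) w)%R]).
  split; first exact: measurableU.
  apply: le_trans (measureU2 _ (mE l) (mE (- l))) _.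
  by apply: le_trans (leeD (h l _) (h (- l) _)) _; rewrite ?sqrrN // -EFinD lee_fin; lra.
move=> w nE; rewrite -/(S w) -/(Q w).
have b c : ~ (y <= Y c w)%R -> c * S w <= ln y + Q w.
  move=> /negP; rewrite -ltNge => lt; rewrite -lerBlDr -[leLHS]expRK ler_ln ?posrE ?expR_gt0 //; exact: ltW.
have b1 := b l (fun h1 => nE (or_introl h1)); have b2 := b (- l) (fun h1 => nE (or_intror h1)).
by have [s0|s0] := lerP 0 (S w); [rewrite ger0_norm|rewrite ltr0_norm // mulrN -mulNr].
Qed.

End Noise.
End Stability.

(** * Sample eigenpairs and sample scores *)

Section SampleForm.
Context {R : realType}.
Variables (lo hi : R) (H : set (R -> R)).
Local Notation U := (`[lo, hi]%classic : set R).
Hypothesis HH : hilbert_subspace U H.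
Variables (n p : nat) (x : int -> 'I_p -> R -> R) (j : 'I_p) (wh : nat -> R) (psih : nat -> R -> R).
Hypothesis Hx : forall t j, H (x t j).
Hypothesis ES : eigen_system U H (sample_cov n x j) wh psih.
Let SHH := H_semi_inner HH.
Let HL f : H f -> L2 U f := @H_L2 _ _ _ _ HH f.
Let xj (t : 'I_n) : R -> R^o := x (obs t) j.
Let Hxj t : H (xj t). Proof. exact: Hx. Qed.
Notation kh := (sample_form (ip U) xj).
Let KP : semi_inner (H : set (R -> R^o)) kh := sample_formP SHH Hxj.
Let Hpsih l : H (psih l) := eig_in ES l.
Let psih' := psih : nat -> R -> R^o.
Let oneh : orthonormal (ip U) psih' := eig_orthonormal ES.

Let kf (f : R -> R) : R -> R^o := \sum_(t < n) (n%:R^-1 * ip U (xj t) f) *: xj t.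

Let kfE f : H f -> kop U (sample_cov n x j) f = kf f.
Proof.
move=> Hf.
have -> : sample_cov n x j = tensor (fun (t : 'I_n) u => n%:R^-1 * x (obs t) j u) (fun (t : 'I_n) => x (obs t) j).
  apply/funext => u; apply/funext => v; rewrite /sample_cov /tensor mulr_sumr.
  by apply: eq_bigr => t _; rewrite mulrA.
rewrite kop_tensor; [|by move=> t; exact: HL|exact: HL].
apply/funext => u; rewrite /kf fct_sumE; apply: eq_bigr => t _.
by rewrite /xj /= -[RHS]/(_ * _); ring.
Qed.

Let Hkf f : H (kf f).
Proof. by apply: (si_sum SHH) => t _; exact: (siZ SHH). Qed.

Let ip_kf f g : H f -> H g -> ip U (kf f) g = kh f g.
Proof.
move=> Hf Hg; rewrite /kf (form_suml SHH) //; last by move=> t _; exact: (siZ SHH).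
rewrite /sample_form mulr_sumr; apply: eq_bigr => t _.
by rewrite (formZl SHH) // mulrA.
Qed.

Lemma sample_eig l f : H f -> kh (psih l) f = wh l * ip U (psih l) f.
Proof.
move=> Hf; have Hk := Hkf (psih l); have HZ := siZ SHH (wh l) (Hpsih l).
have z0 : ip U (kf (psih l) - wh l *: psih' l) (kf (psih l) - wh l *: psih' l) = 0.
  have := eig_eq ES l; rewrite kfE // /nrm => /eqP; rewrite sqrtr_eq0 => h.
  by apply/eqP; rewrite eq_le (si_ge0 SHH (siB SHH Hk HZ)) andbT.
have := form_null SHH (siB SHH Hk HZ) Hf z0.
rewrite (formBl SHH Hk HZ Hf) (formZl SHH _ (Hpsih l) Hf) => /eqP; rewrite subr_eq0 => /eqP <-.
by rewrite ip_kf.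
Qed.

(** The sample covariance has finite rank and its list of eigenpairs is exhaustive. *)
Lemma sample_expansion f : H f ->
  (fun N => kh (coords_residual (ip U) psih' N f) (coords_residual (ip U) psih' N f)) @ \oo --> (0 : R).
Proof.
have x0 : 0 <= n%:R^-1 * \sum_(t < n) ip U (xj t) (xj t).
  by rewrite mulr_ge0 ?invr_ge0 // sumr_ge0 // => t _; exact: (si_ge0 SHH).
apply: (form_residual_cvg SHH KP (H_complete HH) x0) => //.
- by move=> g Hg; exact: (sample_form_le SHH Hxj).
- move=> e e0; exists [seq (xj t : R -> R^o) | t <- enum 'I_n].
    by move=> _ /mapP[t _ ->].
  move=> g Hg g0; rewrite /sample_form big1 ?mulr0.
    by rewrite mulr_ge0 ?(si_ge0 SHH Hg) // ltW.
  move=> t _; rewrite (si_sym SHH (Hxj t) Hg) g0 ?mul0r //.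
  by apply/mapP; exists t; rewrite ?mem_enum.
move=> g c Hg g0 c0 gE.
have Hk := Hkf g; have HZ := siZ SHH c Hg; have Hz := siB SHH Hk HZ.
have zE h : H h -> ip U (kf g - c *: (g : R -> R^o)) h = kh g h - c * ip U g h.
  by move=> Hh; rewrite (formBl SHH Hk HZ Hh) (formZl SHH _ Hg Hh) ip_kf.
have z0 l : ip U (kf g - c *: (g : R -> R^o)) (psih l) = 0.
  rewrite zE // g0 mulr0 subr0 (si_sym KP) // sample_eig //.
  by rewrite (si_sym SHH (Hpsih l) Hg) g0 mulr0.
have zz := zE _ Hz; rewrite (gE _ Hz z0) subrr in zz.
have n0 : nrm U g = 0.
  apply: (eig_exhaustive ES Hg c0 _ g0); rewrite kfE //.
  by rewrite /nrm -[X in Num.sqrt X]/(ip U (kf g - c *: (g : R -> R^o)) (kf g - c *: (g : R -> R^o))) zz sqrtr0.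
by move: n0 => /eqP; rewrite /nrm sqrtr_eq0 => h; apply/eqP; rewrite eq_le h (si_ge0 SHH Hg).
Qed.

End SampleForm.

(** * The normalizing matrices *)

Section Matrices.
Context {R : realType}.

Lemma vec_form_sq q (y : 'cV[R]_q) : (y^T *m y) 0 0 = \sum_(l < q) y l 0 ^+ 2.
Proof. by rewrite mxE; apply: eq_bigr => l _; rewrite mxE expr2. Qed.

(** If [S ^ 2 = E ^ 2] then [S] maps the columns of [S - E] to their multiples by
    the negative entries of [- E], which positivity of [S] only allows for null columns. *)
Lemma psd_sqrt_diag q (S M : 'M[R]_q) (m : 'I_q -> R) : is_psd_sqrt S M ->
  (forall l, 0 < m l) -> M = diag_mx (\row_l (m l ^+ 2)) -> S = diag_mx (\row_l m l).
Proof.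
case=> Sym pos SS m0 ME; set E := diag_mx (\row_l m l).
have EE : E *m E = M.
  rewrite ME /E; apply/matrixP => i k; rewrite mul_diag_mx !mxE.
  by case: eqP => [->|_]; rewrite ?mulr1n ?mulr0n ?mulr0 // expr2.
have T : S *m (S - E) = - ((S - E) *m E).
  by rewrite mulmxBr mulmxBl SS EE opprB.
apply/eqP; rewrite -subr_eq0; apply/eqP/matrixP => i l; rewrite [RHS]mxE.
pose y := col l (S - E).
have Sy : S *m y = - m l *: y.
  rewrite /y; apply/matrixP => r c; rewrite !mxE.
  have := congr1 (fun Q : 'M[R]_q => Q r l) T; rewrite [X in _ = X]mxE mul_mx_diag [X in _ = - X]mxE [X in X = _]mxE => h.
  under eq_bigr do rewrite mxE.
  by rewrite h !mxE; ring.
have := pos y; rewrite /vec_form -mulmxA Sy -scalemxAr mxE vec_form_sq => h.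
have s0 : 0 <= \sum_(r < q) y r 0 ^+ 2 by apply: sumr_ge0 => r _; exact: sqr_ge0.
have z : \sum_(r < q) y r 0 ^+ 2 = 0.
  apply/eqP; rewrite eq_le s0 andbT; move: h; rewrite mulNr oppr_ge0 => h.
  by rewrite -(pmulr_rle0 _ (m0 l)).
have /eqP := psumr_eq0P (fun r _ => sqr_ge0 (y r 0)) z (i := i) isT.
by rewrite sqrf_eq0 mxE => /eqP.
Qed.

Lemma mxdiag_inv p q (D D' : 'I_p -> 'M[R]_q) : (forall j, D j *m D' j = 1%:M) ->
  invmx (\mxdiag_(j < p) D j) = \mxdiag_(j < p) D' j.
Proof.
move=> DD.
have e : (\mxdiag_(j < p) D j) *m (\mxdiag_(j < p) D' j) = 1%:M.
  rewrite [X in _ *m X]/(mxdiag _) mul_mxdiag_mxblock -[RHS](mxdiagZ (p_ := fun=> q)) /mxdiag.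
  apply/eq_mxblockP => i k; case: eqP => [ik|_]; last by rewrite mulmx0.
  by case: _ / ik; rewrite !conform_mx_id DD.
have [u _] := mulmx1_unit e; rewrite -[LHS]mulmx1 -e mulmxA mulVmx // mul1mx //.
Qed.

End Matrices.

Section Residual.
Context {R : realType}.
Variables (lo hi : R) (H : set (R -> R)).
Local Notation U := (`[lo, hi]%classic : set R).
Hypothesis HH : hilbert_subspace U H.
Variables (n p q d : nat) (x : int -> 'I_p -> R -> R) (z : int -> 'I_d -> R) (e y : int -> R).
Variables (w wh : 'I_p -> nat -> R) (psi psih : 'I_p -> nat -> R -> R) (Dh : 'I_p -> 'M[R]_q).
Variables (beta : 'I_p -> R -> R) (gamma : 'cV[R]_d).
Hypothesis n_gt0 : (0 < n)%N.
Hypothesis Hx : forall t j, H (x t j).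
Hypothesis ES : forall j, eigen_system U H (sample_cov n x j) (wh j) (psih j).
Hypothesis Dh_sqrt : forall j, let Xhj := score_mx U n q x psih j in
  is_psd_sqrt (Dh j) (n%:R^-1 *: (Xhj^T *m Xhj)).
Hypothesis wh_pos : forall j l, (l < q)%N -> 0 < wh j l.
Hypothesis Hpsi : forall j l, H (psi j l).
Hypothesis Hbeta : forall j, H (beta j).
Hypothesis model : forall t : 'I_n, y (obs t) = \sum_(j < p) ip U (x (obs t) j) (beta j) +
  \sum_(k < d) z (obs t) k * gamma k 0 + e (obs t).
Let SHH := H_semi_inner HH.
Let Hpsih j l : H (psih j l) := eig_in (ES j) l.

Lemma Dh_diag j : Dh j = diag_mx (\row_(l < q) Num.sqrt (wh j l)).
Proof.
apply: (psd_sqrt_diag (Dh_sqrt j)) => [l|]; first by rewrite sqrtr_gt0 wh_pos.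
apply/matrixP => l m; rewrite !mxE; under eq_bigr do rewrite !mxE.
rewrite -[LHS]/(sample_form (ip U) (fun t : 'I_n => x (obs t) j : R -> R^o) (psih j l) (psih j m)).
rewrite (sample_eig HH Hx (ES j)) // (eig_orthonormal (ES j)) sqr_sqrtr ?ltW ?wh_pos //.
by rewrite -(inj_eq val_inj); case: eqP; rewrite ?mulr1n ?mulr0n ?mulr1 ?mulr0.
Qed.

Lemma Omega_hat_B_entry (t : 'I_n) : (Omega_hat U n x psih Dh *m B_coef U q w psi beta) t 0 =
  \sum_(j < p) \sum_(l < q) Num.sqrt (w j l) / Num.sqrt (wh j l) * ip U (psi j l) (beta j) *
    ip U (x (obs t) j) (psih j l).
Proof.
rewrite /Omega_hat /B_coef (mxdiag_inv (D' := fun j => diag_mx (\row_(l < q) (Num.sqrt (wh j l))^-1))); last first.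
  move=> j; rewrite Dh_diag; apply/matrixP => l m; rewrite mul_diag_mx !mxE.
  case: eqP => [->|_]; rewrite ?mulr1n ?mulr0n ?mulr0 // mulfV //.
  by rewrite gt_eqF // sqrtr_gt0 wh_pos.
rewrite mul_mxrow_mxdiag mul_mxdiag_mxcol mul_mxrow_mxcol summxE; apply: eq_bigr => j _.
rewrite mxE; apply: eq_bigr => l _; rewrite mul_mx_diag mul_diag_mx !mxE; ring.
Qed.

Notation res j := (estimation_residual (psih j : nat -> R -> R^o) (w j) (wh j) q (beta j)
  (fun l => ip U (psi j l) (beta j))).

Lemma inactive_residual j : j \notin active_set U beta -> forall f, H f -> ip U f (res j) = 0.
Proof.
rewrite inE negbK => /eqP b0 f Hf.
have bb : ip U (beta j) (beta j) = 0.
  move: b0 => /eqP; rewrite /nrm sqrtr_eq0 => h; apply/eqP; rewrite eq_le h.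
  exact: (si_ge0 SHH (Hbeta j)).
have b0' g : H g -> ip U g (beta j) = 0.
  by move=> Hg; rewrite (si_sym SHH Hg (Hbeta j)) (form_null SHH (Hbeta j) Hg bb).
rewrite /estimation_residual (formBr SHH (Hbeta j) _ Hf); last first.
  by apply: (si_sum SHH) => l _; exact: (siZ SHH _ (Hpsih j l)).
rewrite b0' // sub0r (form_sumr SHH) //; last by move=> l _; exact: (siZ SHH _ (Hpsih j l)).
by rewrite big1 ?oppr0 // => l _; rewrite b0' // mulr0 (formZr SHH _ (Hpsih j l) Hf) mul0r.
Qed.

Lemma residual_entry (t : 'I_n) :
  (Y_vec n y - Omega_hat U n x psih Dh *m B_coef U q w psi beta - Z_mx n z *m gamma) t 0 =
  \sum_(j in active_set U beta) ip U (x (obs t) j) (res j) + e (obs t).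
Proof.
rewrite [\sum_(j in _) _]big_mkcond /=.
transitivity (\sum_(j < p) ip U (x (obs t) j) (res j) + e (obs t)); last first.
  congr (_ + _); apply: eq_bigr => j _; case: ifPn => // /inactive_residual; exact.
rewrite !mxE -/(Omega_hat U n x psih Dh) model.
have := Omega_hat_B_entry t; rewrite mxE => ->.
under [X in _ - X]eq_bigr do rewrite mxE.
have -> : \sum_(j < p) ip U (x (obs t) j) (res j) = \sum_(j < p) (ip U (x (obs t) j) (beta j) -
   \sum_(l < q) Num.sqrt (w j l) / Num.sqrt (wh j l) * ip U (psi j l) (beta j) * ip U (x (obs t) j) (psih j l)).
  apply: eq_bigr => j _; rewrite /estimation_residual (formBr SHH (Hbeta j) _ (Hx _ j)); last first.
    by apply: (si_sum SHH) => l _; exact: (siZ SHH _ (Hpsih j l)).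
  congr (_ - _); rewrite (form_sumr SHH) //; last by move=> l _; exact: (siZ SHH _ (Hpsih j l)).
  by apply: eq_bigr => l _; rewrite (formZr SHH _ (Hpsih j l)).
by rewrite sumrB; ring.
Qed.

(** Cauchy-Schwarz in the time index separates the covariate from the estimation
    error, so that each of them can be controlled on an event of its own. *)
Lemma residual_score_le (k : 'I_d) (r : R) :
  (forall j, j \in active_set U beta -> snorm (sample_form (ip U) (fun t : 'I_n => x (obs t) j : R -> R^o)) (res j) <= r) ->
  n%:R^-1 * `|((Z_mx n z)^T *m (Y_vec n y - Omega_hat U n x psih Dh *m B_coef U q w psi beta - Z_mx n z *m gamma)) k 0| <=
  #|active_set U beta|%:R * (Num.sqrt (n%:R^-1 * \sum_(t < n) z (obs t) k ^+ 2) * r) +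
  n%:R^-1 * `|\sum_(t < n) z (obs t) k * e (obs t)|.
Proof.
move=> hr; have n0 : 0 < n%:R^-1 :> R by rewrite invr_gt0 ltr0n.
rewrite mxE; under eq_bigr do rewrite residual_entry [in X in X * _]mxE [in X in X * _]mxE mulrDr.
rewrite big_split /=; apply: le_trans (ler_wpM2l (ltW n0) (ler_normD _ _)) _.
rewrite mulrDr lerD2r -[X in _ <= _ * X]/(_ * _).
under eq_bigr do rewrite mulr_sumr.
rewrite exchange_big /= -sum1_card natr_sum mulr_suml.
apply: le_trans (ler_wpM2l (ltW n0) (ler_norm_sum _ _ _)) _.
rewrite mulr_sumr; apply: ler_sum => j jS; rewrite mul1r.
apply: le_trans (ler_wpM2l (sqrtr_ge0 _) (hr j jS)).
have R0 : 0 <= n%:R^-1 * `|\sum_(t < n) z (obs t) k * ip U (x (obs t) j) (res j)|.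
  by rewrite mulr_ge0 // ltW.
rewrite -ler_sqr ?nnegrE ?mulr_ge0 ?sqrtr_ge0 //.
rewrite !exprMn real_normK ?num_real // !sqr_sqrtr; last first.
- by rewrite mulr_ge0 ?sumr_ge0 ?(ltW n0) // => t _; exact: sqr_ge0.
- by apply: (si_ge0 (sample_formP SHH (fun t => Hx (obs t) j))); apply: (siB SHH) => //;
   apply: (si_sum SHH) => l _; exact: (siZ SHH _ (Hpsih j l)).
rewrite /sample_form [X in _ <= X]mulrACA -expr2 ler_wpM2l ?sqr_ge0 //.
apply: le_trans (sum_CS _ _) _; rewrite le_eqVlt; apply/orP; left; apply/eqP.
by congr (_ * _); apply: eq_bigr => t _; rewrite expr2.
Qed.

End Residual.

(** * Sums under polynomial decay *)

Section Decay.
Context {R : realType}.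

Lemma powRN_le (x y r : R) : 0 < x -> x <= y -> 0 <= r -> y `^ (- r) <= x `^ (- r).
Proof.
move=> x0 xy r0; rewrite !powRN lef_pV2 ?posrE ?powR_gt0 //; last exact: lt_le_trans xy.
by apply: ge0_ler_powR => //; rewrite nnegrE ltW // (lt_le_trans x0).
Qed.

Lemma natS_powRN_le (l : nat) (r s : R) : r <= s -> (l.+1%:R : R) `^ (- s) <= l.+1%:R `^ (- r).
Proof. by move=> rs; apply: ler_powR; rewrite ?ler1n // lerN2. Qed.

Lemma powR_m2 (l : nat) : (l.+1%:R : R) `^ (- 2) = (l.+1%:R ^+ 2)^-1.
Proof. by rewrite powRN -(powR_mulrn 2). Qed.

Lemma sum_inv_sq_tail (q L : nat) : (0 < q)%N -> (q <= L)%N ->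
  \sum_(q <= l < L) (l.+1%:R : R) `^ (- 2) <= q%:R^-1.
Proof.
move=> q0 qL; suff : \sum_(q <= l < L) (l.+1%:R : R) `^ (- 2) <= q%:R^-1 - L%:R^-1.
  by move=> h; apply: le_trans h _; rewrite gerBl invr_ge0.
elim: L qL => [|L IH]; first by rewrite leqn0 => /eqP qz; rewrite qz in q0.
rewrite leq_eqVlt => /orP[/eqP<-|qL]; first by rewrite big_geq // subrr.
rewrite big_nat_recr //=; apply: le_trans (lerD (IH _) (lexx _)) _ => //.
have L0 : 0 < (L%:R : R) by rewrite ltr0n (leq_trans q0).
rewrite powR_m2 -natr1 -subr_ge0.
have -> : q%:R^-1 - (L%:R + 1)^-1 - (q%:R^-1 - L%:R^-1 + ((L%:R + 1) ^+ 2)^-1) =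
   (L%:R * (L%:R + 1) ^+ 2)^-1 :> R.
  by field; rewrite !lt0r_neq0 // ?ltr0n // addr_gt0.
by rewrite invr_ge0 mulr_ge0 ?sqr_ge0 // ltW.
Qed.

Lemma sum_inv_sq (L : nat) : \sum_(l < L) (l.+1%:R : R) `^ (- 2) <= 2.
Proof.
case: L => [|L]; first by rewrite big_ord0.
rewrite big_ord_recl /= powR1 -(big_mkord xpredT (fun l => (l.+2%:R : R) `^ (- 2))).
have -> : \sum_(0 <= l < L) (l.+2%:R : R) `^ (- 2) = \sum_(1 <= l < L.+1) (l.+1%:R : R) `^ (- 2).
  by rewrite big_add1.
have := @sum_inv_sq_tail 1 L.+1 isT isT; rewrite invr1 => h.
by apply: le_trans (lerD (lexx _) h) _; lra.
Qed.

(** The terms are dominated by the increments of [- 2 / sqrt l]. *)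
Lemma sum_inv_threehalves (L : nat) : \sum_(l < L) (l.+1%:R : R) `^ (- (3 / 2)) <= 3.
Proof.
have E l : (l.+1%:R : R) `^ (- (3 / 2)) = (Num.sqrt l.+1%:R ^+ 3)^-1.
  by rewrite powRN -powR_mulrn ?sqrtr_ge0 // -powR12_sqrt // -powRrM mulrC.
have sg (k : nat) : 0 < (Num.sqrt k.+1%:R : R) by rewrite sqrtr_gt0 ltr0n.
case: L => [|L]; first by rewrite big_ord0.
suff : \sum_(l < L.+1) (l.+1%:R : R) `^ (- (3 / 2)) <= 3 - 2 / Num.sqrt L.+1%:R.
  by move=> h; apply: le_trans h _; rewrite gerBl mulr_ge0 // invr_ge0 ltW.
elim: L => [|L IH]; first by rewrite big_ord1 powR1 sqrtr1; lra.
rewrite big_ord_recr /=; apply: le_trans (lerD IH (lexx _)) _.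
rewrite E; have a0 := sg L; have b0 := sg L.+1.
have ab : Num.sqrt L.+2%:R ^+ 2 = Num.sqrt L.+1%:R ^+ 2 + 1 :> R by rewrite !sqr_sqrtr // natr1.
have ab1 : (Num.sqrt L.+1%:R : R) <= Num.sqrt L.+2%:R by rewrite ler_sqrt // ler_nat.
move: a0 b0 ab ab1; set a := Num.sqrt _; set b := Num.sqrt _ => a0 b0 ab ab1.
rewrite -subr_ge0.
have -> : 3 - 2 / b - (3 - 2 / a + (b ^+ 3)^-1) = (2 * (b ^+ 2) * (b ^+ 2 - a ^+ 2) - a * (b + a)) / (a * b ^+ 3 * (a + b)).
  by field; rewrite !lt0r_neq0 // addr_gt0.
have -> : b ^+ 2 - a ^+ 2 = 1 by rewrite ab; ring.
rewrite mulr_ge0 ?invr_ge0 //; first by nra.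
by rewrite !mulr_ge0 ?exprn_ge0 ?addr_ge0 ?(ltW a0) ?(ltW b0).
Qed.

Variables (c0 alpha : R) (w : nat -> R).
Hypotheses (c0_gt0 : 0 < c0) (alpha_gt1 : 1 < alpha).
Hypotheses (w_gt0 : forall l, 0 < w l) (w_dec : forall l, w l.+1 <= w l).
Hypothesis gap_ge : forall l, c0 * l.+1%:R `^ (- alpha - 1) <= w l - w l.+1.

Let alpha_gt0 : 0 < alpha := lt_trans ltr01 alpha_gt1.

(** Adding up the spacings of the indices between [l] and [2 * l]. *)
Lemma eigenvalue_lower l : c0 * 2 `^ (- alpha - 1) * l.+1%:R `^ (- alpha) <= w l.
Proof.
have h k : (k <= l.+1)%N -> k%:R * (c0 * (2 * l.+1%:R) `^ (- alpha - 1)) <= w l - w (l + k)%N.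
  elim: k => [|k IH] kl; first by rewrite addn0 mul0r subrr.
  rewrite -natr1 mulrDl mul1r addnS; apply: le_trans (lerD (IH (ltnW kl)) (lexx _)) _.
  rewrite -[X in _ <= X](subrKA (w (l + k)%N)) lerD2l; apply: le_trans (gap_ge _).
  rewrite ler_pM2l // -opprD; apply: powRN_le => //; last by rewrite addr_ge0 // ltW.
  by rewrite -natrM ler_nat; lia.
apply: le_trans (le_trans (h l.+1 (leqnn _)) _); last by rewrite gerBl ltW.
rewrite powRM // mulrCA -[X in X <= _]mulrA ler_pM2l // mulrCA ler_pM2l ?powR_gt0 //.
have l0 : (l.+1%:R : R) != 0 by rewrite pnatr_eq0.
by rewrite powRD ?l0 ?implybT // powR_inv1 // mulrCA mulfV // mulr1.
Qed.

Lemma gap_upto (q l : nat) : (l < q)%N ->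
  c0 * q%:R `^ (- alpha - 1) <= w l - w l.+1 /\
  ((0 < l)%N -> c0 * q%:R `^ (- alpha - 1) <= w l.-1 - w l).
Proof.
move=> lq; have g k : (k < q)%N -> c0 * q%:R `^ (- alpha - 1) <= w k - w k.+1.
  move=> kq; apply: le_trans (gap_ge k); rewrite ler_pM2l // -opprD.
  by apply: powRN_le; rewrite ?ltr0n ?ler_nat // addr_ge0 // ltW.
by split; [exact: g | case: l lq => // l lq _; apply: g; exact: ltnW].
Qed.

Variables (kappa mubar W : R) (a : nat -> R).
Hypothesis kappa_gt : alpha / 2 + 1 < kappa.
Hypothesis a_le : forall l, `|a l| <= mubar * l.+1%:R `^ (- kappa).
Hypothesis mubar_ge0 : 0 <= mubar.
Hypothesis W_ge : forall l, w l <= W.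

Let a_sq l : a l ^+ 2 <= mubar ^+ 2 * l.+1%:R `^ (- (2 * kappa)).
Proof.
rewrite -real_normK ?num_real //.
have -> : mubar ^+ 2 * l.+1%:R `^ (- (2 * kappa)) = (mubar * l.+1%:R `^ (- kappa)) ^+ 2.
  by rewrite exprMn -[(_ `^ _) ^+ 2]powR_mulrn ?powR_ge0 // -powRrM; congr (_ * _ `^ _); ring.
by rewrite ler_sqr ?nnegrE // mulr_ge0 ?powR_ge0.
Qed.

(** By [eigenvalue_lower] the terms decay with exponent [2 * kappa - alpha > 2]. *)
Lemma coef_ratio_sum L : \sum_(l < L) a l ^+ 2 / w l <=
  2 * mubar ^+ 2 / (c0 * 2 `^ (- alpha - 1)).
Proof.
set cw := c0 * _; have cw0 : 0 < cw by rewrite mulr_gt0 // powR_gt0.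
apply: (@le_trans _ _ (\sum_(l < L) mubar ^+ 2 / cw * l.+1%:R `^ (- 2))); last first.
  rewrite -mulr_sumr [2 * _]mulrC -[X in _ <= X]mulrAC; apply: ler_wpM2l (sum_inv_sq L).
  by rewrite mulr_ge0 ?sqr_ge0 // invr_ge0 ltW.
apply: ler_sum => l _.
have l0 : (l.+1%:R : R) != 0 by rewrite pnatr_eq0.
have p0 : 0 < (l.+1%:R : R) `^ (- alpha) by rewrite powR_gt0.
rewrite ler_pdivrMr //; apply: le_trans (a_sq l) _.
have -> : mubar ^+ 2 / cw * l.+1%:R `^ (- 2) * w l = mubar ^+ 2 * (l.+1%:R `^ (- 2) * w l / cw) by ring.
apply: ler_wpM2l; first exact: sqr_ge0.
rewrite ler_pdivlMr // mulrC; apply: le_trans _ (ler_wpM2l (powR_ge0 _ _) (eigenvalue_lower l)).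
rewrite -/cw [X in _ <= X]mulrCA ler_pM2l // -powRD ?l0 ?implybT // -opprD; apply: natS_powRN_le.
by move: kappa_gt; lra.
Qed.

Lemma coef_root_sum q : \sum_(l < q) Num.sqrt (w l) * `|a l| <= Num.sqrt W * mubar * 3.
Proof.
apply: (@le_trans _ _ (\sum_(l < q) Num.sqrt W * mubar * l.+1%:R `^ (- (3 / 2)))); last first.
  by rewrite -mulr_sumr; apply: ler_wpM2l (sum_inv_threehalves q); rewrite mulr_ge0 ?sqrtr_ge0.
apply: ler_sum => l _; rewrite -mulrA; apply: ler_pM; rewrite ?sqrtr_ge0 //.
  by rewrite ler_sqrt ?W_ge // (le_trans (ltW (w_gt0 l))).
apply: le_trans (a_le l) _; apply: ler_wpM2l => //; apply: natS_powRN_le.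
by move: kappa_gt alpha_gt1; lra.
Qed.

Lemma coef_tail_sum q L : (0 < q)%N -> (q <= L)%N ->
  \sum_(q <= l < L) w l * a l ^+ 2 <= (Num.sqrt W * mubar * q%:R `^ (- kappa + 1 / 2)) ^+ 2.
Proof.
move=> q0 qL; have W0 : 0 <= W := le_trans (ltW (w_gt0 0)) (W_ge 0).
have q0' : (q%:R : R) != 0 by rewrite pnatr_eq0 -lt0n.
apply: (@le_trans _ _ (\sum_(q <= l < L) W * mubar ^+ 2 * q%:R `^ (- (2 * kappa - 2)) * l.+1%:R `^ (- 2))).
  apply: ler_sum_nat => l /andP[ql lL]; rewrite -mulrA -[X in _ <= X]mulrA; apply: ler_pM; rewrite ?sqr_ge0 ?(ltW (w_gt0 l)) //.
  apply: le_trans (a_sq l) _; apply: ler_wpM2l; first exact: sqr_ge0.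
  have l0 : (l.+1%:R : R) != 0 by rewrite pnatr_eq0.
  have -> : - (2 * kappa) = - (2 * kappa - 2) + - 2 :> R by ring.
  rewrite powRD ?l0 ?implybT // ler_wpM2r ?powR_ge0 //; apply: powRN_le.
  - by rewrite ltr0n.
  - by rewrite ler_nat leqW.
  - by move: kappa_gt alpha_gt0; lra.
rewrite -mulr_sumr; apply: le_trans (ler_wpM2l _ (sum_inv_sq_tail q0 qL)) _.
  by rewrite !mulr_ge0 ?sqr_ge0 ?powR_ge0.
rewrite !exprMn sqr_sqrtr // -[(q%:R `^ _) ^+ 2]powR_mulrn ?powR_ge0 // -powRrM -mulrA.
rewrite -[q%:R^-1]powR_inv1 // (mulrA W) -[X in X <= _]mulrA -powRD ?q0' ?implybT //.
by rewrite le_eqVlt; apply/orP; left; apply/eqP; congr (_ * _ `^ _); field.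
Qed.

End Decay.

(** * The estimation error of one functional covariate *)

Section Covariate.
Context {R : realType} {dsp : measure_display} {Om : measurableType dsp}.
Variable P : probability Om R.
Variables (lo hi : R) (H : set (R -> R)).
Local Notation U := (`[lo, hi]%classic : set R).
Hypothesis HH : hilbert_subspace U H.
Variables (aX : R) (p : nat) (A : nat -> 'I_p -> 'I_p -> R -> R -> R)
  (eps X : int -> 'I_p -> Om -> R -> R).
Hypothesis flp : functional_linear_process P U H aX A eps X.
Notation leb := (@lebesgue_measure R).
Notation L2P := (L2m P setT).
Notation ipP := (ipm P setT).
Notation L2OU := (L2m (P \x leb)%E (setT `*` U)).
Notation ipOU := (ipm (P \x leb)%E (setT `*` U)).
Variable K0 : R.
Hypothesis K0P : forall j, \int[leb]_(u in U) cov_fun P (eps 0 j) (eps 0 j) u u <= K0.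
Hypothesis K0_ge0 : 0 <= K0.
Variables (j : 'I_p) (w : nat -> R) (psi : nat -> R -> R).
Hypothesis ES : eigen_system U H (SigmaX P X 0 j j) w psi.
Variable KA : R.
Hypothesis KAP : forall N, \sum_(l < N) \sum_(i < p) HSnorm U (A l j i) <= KA.

Let mU : measurable (U : set (measurableTypeR R)) := mU_itv lo hi.
Let SHH := H_semi_inner HH.
Let SP : semi_inner L2P ipP := L2m_si P measurableT.
Let SOU : semi_inner L2OU ipOU := L2m_si _ (measurableX measurableT mU).
Let HL f : H f -> L2 U f := @H_L2 _ _ _ _ HH f.
Let Hpsi l : H (psi l) := eig_in ES l.
Let one : orthonormal (ip U) (psi : nat -> R -> R^o) := eig_orthonormal ES.

(** Every normalized score of an approximant has standard deviation at most [sqrt K0]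
    times the sum of the norms of its kernels. *)
Lemma eigenvalue_upper l : w l <= (Num.sqrt K0 * (KA + 1) + 1) ^+ 2.
Proof.
have w0 : w 0%N = covform P lo hi X 0 j (psi 0%N) (psi 0%N).
  by rewrite (covform_eig HH flp ES) // one eqxx mulr1.
have wl : w l <= w 0%N.
  by elim: l => // l IH; apply: le_trans (eig_decr ES l) IH.
apply: le_trans wl _; rewrite w0.
have [N [m [f [g [Hf Hg hs h]]]]] := approximation HH flp j [:: 0] ltr01.
have [|LD De] := h 0; first by rewrite inE.
have [LDp Dle] := ip_L2P (V := fun v u => X 0 j v u - approximant lo hi eps N f g 0 v u) mU LD (HL (Hpsi 0%N)).
have LX : L2P (fun v => ip U (psi 0%N) (X 0 j v)) := ip_random_L2 (X_L2 HH flp 0 j) (HL (Hpsi 0%N)).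
pose y l i : R -> R := fun v => \sum_(r < m l i) ip U (@f l i r) (psi 0%N) * @g l i r v.
have Hy l' i : H (y l' i).
  have -> : y l' i = \sum_(r < m l' i) ip U (@f l' i r) (psi 0%N) *: (@g l' i r : R -> R^o).
    by apply/funext => v; rewrite fct_sumE.
  by apply: (si_sum SHH) => r _; apply: (siZ SHH); exact: Hg.
have Le l' i := eps_ip_L2 HH flp (0 - (l' : nat)%:Z) i (Hy l' i).
pose S1 : Om -> R^o := fun v => ip U (psi 0%N) (fun u => X 0 j v u - approximant lo hi eps N f g 0 v u).
pose S2 : Om -> R^o := \sum_(l' < N) \sum_(i < p)
  ((fun v => ip U (y l' i) (eps (0 - (l' : nat)%:Z) i v)) : Om -> R^o).
have L2S : L2P S2 by apply: (si_sum SP) => l' _; apply: (si_sum SP) => i _; exact: Le.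
have e : (fun v => ip U (psi 0%N) (X 0 j v)) = S1 + S2.
  apply/funext => v; rewrite /S1 /S2 -[RHS]/(_ + _) fct_sumE.
  rewrite (ip_sub_approximant HH flp N g 0 j v Hf (HL (Hpsi 0%N))).
  rewrite (ip_approximant HH flp N Hf Hg 0 v (HL (Hpsi 0%N))).
  rewrite [X in _ + X](_ : _ = \sum_(l' < N) \sum_(i < p) ip U (y l' i) (eps (0 - (l' : nat)%:Z) i v)).
    by rewrite subrK.
  by apply: eq_bigr => l' _; rewrite fct_sumE.
rewrite /covform -(snorm_sq SP LX) ler_sqr ?nnegrE ?snorm_ge0 //; last first.
  have KA0 : 0 <= KA by have := KAP 0; rewrite big_ord0.
  by rewrite addr_ge0 // mulr_ge0 ?sqrtr_ge0 // addr_ge0.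
rewrite e; apply: le_trans (snorm_triangle SP LDp L2S) _; rewrite addrC; apply: lerD.
  have h1 := snorm_sum SP (index_enum 'I_N) (P := xpredT)
    (F := fun l' : 'I_N => \sum_(i < p) ((fun v => ip U (y l' i) (eps (0 - (l' : nat)%:Z) i v)) : Om -> R^o))
    (fun l' _ => si_sum SP _ (fun i _ => Le l' i)); apply: (le_trans h1).
  apply: (@le_trans _ _ (Num.sqrt K0 * \sum_(l' < N) \sum_(i < p) HSnorm U (tensor (f l' i) (g l' i)))).
    rewrite mulr_sumr; apply: ler_sum => l' _.
    have h2 := snorm_sum SP (index_enum 'I_p) (P := xpredT)
      (F := fun i : 'I_p => (fun v => ip U (y l' i) (eps (0 - (l' : nat)%:Z) i v)) : Om -> R^o)
      (fun i _ => Le l' i); apply: (le_trans h2).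
    rewrite mulr_sumr; apply: ler_sum => i _.
    apply: (@le_trans _ _ (Num.sqrt K0 * nrm U (y l' i))).
      rewrite -sqrtrM // /snorm; apply: ler_wsqrtr; exact: (eps_second_moment HH flp K0P).
    apply: ler_wpM2l; first exact: sqrtr_ge0.
    have := tensor_bessel 1 (fun r => HL (Hf l' i r)) (fun r => HL (Hg l' i r)) (fun a => HL (Hpsi a)) one.
    rewrite big_ord1 => hb; rewrite -ler_sqr ?nnegrE ?sqrtr_ge0 //.
  apply: ler_wpM2l; first exact: sqrtr_ge0.
  by apply: le_trans hs _; rewrite lerD2r.
rewrite -[leRHS]sqrtr1 /snorm; apply: ler_wsqrtr; apply: le_trans Dle _.
by rewrite one eqxx mulr1.
Qed.

Hypothesis stat : forall t, {ae (leb \x leb)%E, forall z, (U `*` U) z ->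
  cov_fun P (X t j) (X t j) z.1 z.2 = cov_fun P (X 0 j) (X 0 j) z.1 z.2}.
Variable n : nat.
Hypothesis n_gt0 : (0 < n)%N.

Lemma gram_error_dev v a c :
  gram_error (ip U) (fun t : 'I_n => X (obs t) j v : R -> R^o) (psi : nat -> R -> R^o) w a c =
  gram_dev P n (score lo hi X j psi) a c v.
Proof.
rewrite /gram_error /gram_dev sumrB mulrBr.
have XH t : H (X t j v) := X_H flp t j v.
congr (_ - _).
  congr (_ * _); apply: eq_bigr => t _; rewrite /score.
  by rewrite !(si_sym SHH (XH _) (Hpsi _)).
rewrite (eq_bigr (fun=> w a * (a == c)%:R)); last first.
  move=> t _; rewrite -[LHS]/(covform P lo hi X t.+1%:Z j (psi a) (psi c)).
  by rewrite (covform_stationary HH flp stat) // (covform_eig HH flp ES) // one.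
move: (w a * _) => wd; by rewrite sumr_const card_ord -[X in _ * X]mulr_natl mulrA mulVf ?mul1r // pnatr_eq0 -lt0n.
Qed.

Variables (c0 alpha kappa mubar : R) (q : nat) (beta : R -> R) (a : nat -> R).
Hypotheses (c0_gt0 : 0 < c0) (alpha_gt1 : 1 < alpha) (kappa_gt : alpha / 2 + 1 < kappa).
Hypothesis q_gt0 : (0 < q)%N.
Hypothesis w_gt0 : forall l, 0 < w l.
Hypothesis gap_ge : forall l, c0 * l.+1%:R `^ (- alpha - 1) <= w l - w l.+1.
Hypothesis Hbeta : H beta.
Hypothesis mubar_ge0 : 0 <= mubar.
Hypothesis a_le : forall l, `|a l| <= mubar * l.+1%:R `^ (- kappa).
Hypothesis beta_cvg : nrm U (fun u => beta u - \sum_(l < N) a l * psi l u) @[N --> \oo] --> (0 : R).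

Let HcombR N : H (\sum_(l < N) a l *: (psi l : R -> R^o)).
Proof. by apply: (si_sum SHH) => l _; exact: (siZ SHH). Qed.

Let beta_cvg' : (fun L => ip U ((beta : R -> R^o) - \sum_(l < L) a l *: (psi l : R -> R^o))
  ((beta : R -> R^o) - \sum_(l < L) a l *: (psi l : R -> R^o))) @ \oo --> (0 : R).
Proof.
have -> : (fun L => ip U ((beta : R -> R^o) - \sum_(l < L) a l *: (psi l : R -> R^o))
  ((beta : R -> R^o) - \sum_(l < L) a l *: (psi l : R -> R^o))) =
  (fun L => nrm U (fun u => beta u - \sum_(l < L) a l * psi l u) * nrm U (fun u => beta u - \sum_(l < L) a l * psi l u)).
  apply/funext => L; rewrite -expr2.
  have -> : (fun u => beta u - \sum_(l < L) a l * psi l u) = (beta : R -> R^o) - \sum_(l < L) a l *: (psi l : R -> R^o).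
    by apply/funext => u; rewrite -[RHS]/(_ - _) fct_sumE.
  by rewrite (snorm_sq SHH) //; exact: (siB SHH).
by rewrite -[X in _ --> X](mulr0 (0 : R)); exact: cvgM.
Qed.

Lemma coefE l : ip U (psi l) beta = a l.
Proof.
apply/eqP; rewrite -subr_eq0 -sqrf_eq0 eq_le sqr_ge0 andbT.
apply/ler_addgt0Pr => e e0; rewrite add0r.
have /cvgrPdist_lt/(_ _ e0)[N _ NP] := beta_cvg'.
have := NP (maxn N l.+1) (leq_maxl _ _); rewrite /= sub0r normrN => /ltW h.
set M := maxn N l.+1 in h; have lM : (l < M)%N := leq_maxr _ _.
have HB := siB SHH Hbeta (HcombR M).
apply: le_trans (le_trans (ler_norm _) h).
have -> : ip U (psi l) beta - a l = ip U ((beta : R -> R^o) - \sum_(i < M) a i *: (psi i : R -> R^o)) (psi l).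
  rewrite (formBl SHH Hbeta (HcombR M) (Hpsi l)) (si_sym SHH Hbeta (Hpsi l)); congr (_ - _).
  by rewrite (ortho_coord SHH (fun i _ => Hpsi i) (fun i k _ _ => one i k)).
apply: le_trans (form_CS SHH HB (Hpsi l)) _; rewrite one eqxx mulr1.
by rewrite le_eqVlt; apply/orP; left.
Qed.

(** The three terms come from [coef_ratio_sum], [coef_root_sum] and [coef_tail_sum]. *)
Definition rate_const : R := let W := (Num.sqrt K0 * (KA + 1) + 1) ^+ 2 in
  2 * (Num.sqrt (2 * mubar ^+ 2 / (c0 * 2 `^ (- alpha - 1))) +
       4 / c0 * (Num.sqrt W * mubar * 3) + Num.sqrt W * mubar).

Variables (v : Om) (wh : nat -> R) (psih : nat -> R -> R) (delta : R).
Hypothesis ESh : eigen_system U H (sample_cov n (fun t i => X t i v) j) wh psih.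
Hypothesis x_span : forall t : 'I_n,
  (fun N => ip U (coords_residual (ip U) (psi : nat -> R -> R^o) N (X (obs t) j v))
    (coords_residual (ip U) (psi : nat -> R -> R^o) N (X (obs t) j v))) @ \oo --> (0 : R).
Hypothesis delta_ge0 : 0 <= delta.
Hypothesis D_le : forall L, \sum_(a < L) \sum_(b < L) gram_dev P n (score lo hi X j psi) a b v ^+ 2 <= delta ^+ 2.
Hypothesis delta_le : delta <= c0 * q%:R `^ (- alpha - 1) / 2.
Hypothesis sgn : forall l, 0 <= ip U (psih l) (psi l).

Let xv (t : 'I_n) : R -> R^o := X (obs t) j v.
Let Hx t : H (xv t). Proof. exact: (X_H flp). Qed.
Let w_dec l : w l.+1 <= w l := eig_decr ES l.
Let D_le' N : \sum_(b < N) \sum_(c < N) gram_error (ip U) xv (psi : nat -> R -> R^o) w b c ^+ 2 <= delta ^+ 2.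
Proof.
apply: le_trans (D_le N); apply: ler_sum => b _; apply: ler_sum => c _.
by rewrite gram_error_dev.
Qed.
Let HX t i : H (X t i v) := X_H flp t i v.
Let g_gt0 : 0 < c0 * q%:R `^ (- alpha - 1).
Proof. by rewrite mulr_gt0 // powR_gt0 // ltr0n. Qed.

Lemma sample_eigenvalue_gt0 l : (l < q)%N -> 0 < wh l.
Proof.
move=> lq.
have gp k : (k < q)%N -> _ := fun kq => gap_upto c0_gt0 alpha_gt1 gap_ge kq.
apply: (@sample_spectrum_gt0 _ _ _ _ SHH n xv Hx psi psih w wh Hpsi one (eig_in ESh) (eig_orthonormal ESh) w_dec w_gt0 (eig_decr ESh)
  (sample_eig HH (x := fun t i => X t i v) HX ESh) (sample_expansion HH (x := fun t i => X t i v) HX ESh) delta delta_ge0 D_le' q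
  (c0 * q%:R `^ (- alpha - 1)) g_gt0 delta_le gp l lq).
Qed.

(** The loss [q ^ (alpha + 1)] is the inverse of the spacing of the first [q]
    eigenvalues, and [q ^ (- kappa + 1/2)] is the truncated part of [beta]. *)
Lemma projection_rate :
  snorm (sample_form (ip U) xv) (estimation_residual (psih : nat -> R -> R^o) w wh q beta
    (fun l => ip U (psi l) beta)) <=
  rate_const * (delta * q%:R `^ (alpha + 1) + q%:R `^ (- kappa + 1 / 2)).
Proof.
have -> : (fun l => ip U (psi l) beta) = a by apply/funext => l; exact: coefE.
set W := (Num.sqrt K0 * (KA + 1) + 1) ^+ 2.
have W0 : 0 <= W := sqr_ge0 _.
have gp k : (k < q)%N -> _ := fun kq => gap_upto c0_gt0 alpha_gt1 gap_ge kq.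
have aT := coef_ratio_sum c0_gt0 alpha_gt1 w_gt0 gap_ge kappa_gt a_le mubar_ge0.
have aT1 := coef_root_sum alpha_gt1 w_gt0 kappa_gt a_le mubar_ge0 eigenvalue_upper q.
have aT2 L := @coef_tail_sum _ _ w alpha_gt1 w_gt0 _ _ _ a kappa_gt a_le mubar_ge0 eigenvalue_upper q L q_gt0.
have pe := (@projection_error _ _ _ _ SHH n xv Hx psi psih w wh Hpsi one (eig_in ESh) (eig_orthonormal ESh) w_dec w_gt0
  (eig_decr ESh) (sample_eig HH (x := fun t i => X t i v) HX ESh) (sample_expansion HH (x := fun t i => X t i v) HX ESh) x_span delta delta_ge0 D_le' q
  beta a _ _ _ _ g_gt0 delta_le gp (fun l _ => sgn l) Hbeta beta_cvg' aT aT1 aT2).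
apply: (le_trans pe).
have b0 : 0 <= Num.sqrt W * mubar by rewrite mulr_ge0 ?sqrtr_ge0.
rewrite -/W [Num.sqrt ((_ * _) ^+ 2)]sqrtr_sqr (ger0_norm (mulr_ge0 b0 (powR_ge0 _ _))).
have q1 : 1 <= (q%:R : R) `^ (alpha + 1).
  have q1' : 1 <= (q%:R : R) by rewrite ler1n.
  rewrite -[leLHS](powRr0 q%:R); apply: ler_powR => //.
  by rewrite addr_ge0 // ltW // (lt_trans ltr01).
have -> : (c0 * q%:R `^ (- alpha - 1))^-1 = c0^-1 * q%:R `^ (alpha + 1) :> R.
  by rewrite invfM -opprD powRN invrK.
rewrite /rate_const -/W; move: q1 (powR_ge0 (q%:R : R) (- kappa + 1 / 2)).
set Q := _ `^ (alpha + 1); set r := _ `^ (- kappa + _); set sT := Num.sqrt (_ / _).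
set B := Num.sqrt W * mubar in b0 * => Q1 r0.
have sT0 : 0 <= sT by exact: sqrtr_ge0.
have c1 : 0 <= c0^-1 by rewrite invr_ge0 ltW.
have d1 : delta * sT <= delta * Q * sT by rewrite ler_wpM2r // ler_peMr.
have cB : 0 <= 4 / c0 * (B * 3) by rewrite !mulr_ge0.
have p1 : 0 <= r * sT by rewrite mulr_ge0.
have p2 : 0 <= delta * Q * B by rewrite !mulr_ge0 // (le_trans ler01).
have p3 : 0 <= 4 / c0 * (B * 3) * r by rewrite mulr_ge0.
rewrite -subr_ge0.
have -> : 2 * (sT + 4 / c0 * (B * 3) + B) * (delta * Q + r) -
  2 * (delta * sT + 4 * delta * (c0^-1 * Q) * (B * 3) + B * r) =
  2 * ((delta * Q * sT - delta * sT) + r * sT + delta * Q * B + 4 / c0 * (B * 3) * r) by ring.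
by rewrite mulr_ge0 // addr_ge0 // addr_ge0 // addr_ge0 // subr_ge0.
Qed.

End Covariate.

(** * Stability measures and events *)

Section StabilityMeasures.
Context {R : realType}.

Let pi2_ge0 : (0 <= (2 * pi)%:E :> \bar R)%E.
Proof. by rewrite lee_fin mulr_ge0 // pi_ge0. Qed.

Let sup_ge0 (S : set (\bar R)) : (0 <= (2 * pi)%:E * ereal_sup (0 |` S))%E.
Proof. by rewrite mule_ge0 //; apply: ereal_sup_ubound; left. Qed.

Let sup_le (S S' : set (\bar R)) : S `<=` S' ->
  ((2 * pi)%:E * ereal_sup (0 |` S) <= (2 * pi)%:E * ereal_sup (0 |` S'))%E.
Proof. by move=> SS; apply: lee_wpmul2l => //; apply: ereal_sup_le; exact: setUS. Qed.

Lemma stability_fun_ge0 U p f S0 A : (0 <= @stability_fun R U p f S0 A)%E.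
Proof. exact: sup_ge0. Qed.

Lemma stability_vec_ge0 d f S0 A : (0 <= @stability_vec R d f S0 A)%E.
Proof. exact: sup_ge0. Qed.

Lemma stability_cross_ge0 U p d f SX SZ A B : (0 <= @stability_cross R U p d f SX SZ A B)%E.
Proof. exact: sup_ge0. Qed.

Lemma stability_fun_le U p f S0 A A' : A `<=` A' -> (@stability_fun R U p f S0 A <= stability_fun U f S0 A')%E.
Proof. by move=> AA; apply: sup_le; apply: image_subset; exact: setSI. Qed.

Lemma stability_vec_le d f S0 A A' : A `<=` A' -> (@stability_vec R d f S0 A <= stability_vec f S0 A')%E.
Proof. by move=> AA; apply: sup_le; apply: image_subset; exact: setSI. Qed.

Lemma stability_cross_le U p d f SX SZ A A' B B' : A `<=` A' -> B `<=` B' ->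
  (@stability_cross R U p d f SX SZ A B <= stability_cross U f SX SZ A' B')%E.
Proof. by move=> AA BB; apply: sup_le; apply: image_subset; apply: setSI; exact: setSX. Qed.

Lemma fine_sum3 (x y z : \bar R) : (0 <= x < +oo)%E -> (0 <= y < +oo)%E -> (0 <= z < +oo)%E ->
  [/\ 0 <= fine (x + y + z)%E, (y <= (fine (x + y + z)%E)%:E)%E & fine (x + y + z)%E = fine x + fine y + fine z].
Proof.
move=> /andP[+ +] /andP[+ +] /andP[+ +]; move: x y z => [x| |] [y| |] [z| |] //=.
rewrite !lee_fin => x0 _ y0 _ z0 _.
by split=> //; rewrite ?addr_ge0 //; lra.
Qed.

End StabilityMeasures.

Section Summation.
Context {R : realType}.

Lemma partial_sum_le (u : nat -> R) (v : nat -> R) (K : R) (N : nat) :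
  (forall l, 0 <= u l) -> (forall l, v l <= u l) ->
  (\sum_(0 <= l <oo) (u l)%:E <= K%:E)%E -> \sum_(l < N) v l <= K.
Proof.
move=> u0 vu h; rewrite -lee_fin; apply: le_trans h.
apply: (@le_trans _ _ (\sum_(0 <= l < N) (u l)%:E)%E).
  by rewrite big_mkord sumEFin lee_fin; exact: ler_sum.
by apply: nneseries_lim_ge => l _ _; rewrite lee_fin.
Qed.

Lemma big_max_ge (I : finType) (F : I -> R) i : (forall i, 0 <= F i) -> F i <= \big[Num.max/0]_i F i.
Proof. by move=> F0; rewrite (bigD1 i) //= le_max lexx. Qed.

Lemma big_max_ge0 (I : finType) (F : I -> R) : 0 <= \big[Num.max/0]_i F i.
Proof. by elim/big_rec: _ => // i x _ x0; rewrite le_max x0 orbT. Qed.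

Lemma kernel_rowsum_le U p (A : nat -> 'I_p -> 'I_p -> R -> R -> R) (K : R) (N : nat) j :
  (\sum_(0 <= l <oo) (kmx_norm_inf U (A l))%:E <= K%:E)%E ->
  \sum_(l < N) \sum_(i < p) HSnorm U (A l j i) <= K.
Proof.
move=> h; apply: (@partial_sum_le (fun l => kmx_norm_inf U (A l)) (fun l => \sum_(i < p) HSnorm U (A l j i)) K N) => // l; first exact: big_max_ge0.
apply: (big_max_ge (F := fun j => \sum_(i < p) HSnorm U (A l j i))) => i.
by apply: sumr_ge0 => m _; exact: sqrtr_ge0.
Qed.

Lemma matrix_rowsum_le d (B : nat -> 'M[R]_d) (K : R) (N : nat) k m :
  (\sum_(0 <= l <oo) (mx_norm_inf (B l))%:E <= K%:E)%E -> \sum_(l < N) `|B l k m| <= K.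
Proof.
move=> h; apply: (@partial_sum_le (fun l => mx_norm_inf (B l)) (fun l => `|B l k m|) K N) => // l; first exact: big_max_ge0.
apply: le_trans (big_max_ge (F := fun k => \sum_(m < d) `|B l k m|) k _).
  by rewrite (bigD1 m) //= lerDl sumr_ge0.
by move=> i; exact: sumr_ge0.
Qed.

End Summation.

Section Events.
Context {R : realType} {dsp : measure_display} {Om : measurableType dsp}.
Variable P : probability Om R.

Lemma good_event (I : finType) (B : I -> set Om) (b : R) (Q : Om -> Prop) :
  (forall i, measurable (B i) /\ (P (B i) <= b%:E)%E) -> {ae P, forall w, Q w} ->
  exists E, [/\ measurable E, ((1 - #|I|%:R * b)%:E <= P E)%E &
    forall w, E w -> Q w /\ forall i, ~ B i w].
Proof.
move=> BP [M [mM PM QM]].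
pose BU := \big[setU/set0]_(i : I) B i; pose F := BU `|` M.
have [mB PB] : measurable BU /\ (P BU <= \sum_(i : I) b%:E)%E.
  rewrite /BU; elim/big_rec2: _ => [|i y A _ [mA PA]]; first by rewrite measure0.
  have [mBi PBi] := BP i; split; first exact: measurableU.
  by apply: le_trans (measureU2 _ mBi mA) _; exact: leeD.
have mF : measurable F by exact: measurableU.
have PF : (P F <= (#|I|%:R * b)%:E)%E.
  apply: le_trans (measureU2 _ mB mM) _; rewrite [X in (_ + X)%E]PM adde0.
  by apply: le_trans PB _; rewrite sumEFin sumr_const -[X in (X%:E <= _)%E]mulr_natl.
exists (~` F); split; first exact: measurableC.
  rewrite probability_setC // EFinB; exact: leeB.
move=> w nF; split; first by apply: contrapT => nQ; apply: nF; right; exact: QM.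
by move=> i Bi; apply: nF; left; rewrite /BU (bigD1 i) //=; left.
Qed.

End Events.

Lemma trunc_between {R : realType} (x : R) : 1 <= x -> exists k : nat, x <= k.+1%:R <= 2 * x.
Proof.
move=> x1; exists (Num.truncn x).
have /truncn_itv/andP[h1 h2] : 0 <= x by apply: le_trans x1.
by rewrite (ltW h2) -natr1; move: h1 x1; lra.
Qed.

(** A product of positive integers is at least their sum minus one. *)
Lemma ln_dimension_bounds {R : realType} (p q d : nat) : (0 < p)%N -> (0 < q)%N -> (0 < d)%N -> (6 <= p * q + d)%N ->
  [/\ 1 <= ln (p * q + d)%:R :> R & ln (p * q + d)%:R <= 2 * ln (p * q * d)%:R :> R].
Proof.
move=> p0 q0 d0 N6.
have m0 : (0 < p * q)%N by rewrite muln_gt0 p0.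
move: m0 N6; set m := (p * q)%N => m0 N6.
have md : (m + d <= m * d + 1)%N by nia.
have N0 : 0 < ((m + d)%:R : R) by rewrite ltr0n; lia.
split.
  rewrite -[X in X <= _]expRK ler_ln ?posrE ?expR_gt0 //.
  have e4 : expR 1 <= 4 :> R.
    have := expR_ge1Dx (- (1 / 2) : R); have h2 : expR (1 / 2) * expR (- (1 / 2)) = 1 :> R by rewrite -expRD subrr expR0.
    have -> : expR 1 = expR (1 / 2) ^+ 2 :> R by rewrite -expRM_natr; congr expR; field.
    by move: h2 (expR_gt0 (1 / 2 : R)) (expR_gt0 (- (1 / 2) : R)); move: (expR _) (expR _) => u v; nra.
  by apply: le_trans e4 _; rewrite ler_nat; lia.
have md0 : 0 < ((m * d)%:R : R) by rewrite ltr0n muln_gt0 m0.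
have -> : 2 * ln (m * d)%:R = ln (m * d)%:R + ln (m * d)%:R :> R by ring.
rewrite -lnM ?posrE // ler_ln ?posrE ?mulr_gt0 //.
by rewrite -natrM ler_nat; nia.
Qed.

(** * Assembling the bound *)

Section Assembly.
Context {R : realType}.

(** Square of the radius, in units of [sqrt (ln N / n)], at which the moment bound
    of order [k + 1 ~ ln N] on the Gram matrix of the scores decays like [N ^ (- 2)]. *)
Definition gram_const (aX K0 KA : R) : R :=
  2 * expR 2 * (proxy aX K0 * (KA + 1)) ^+ 4 * moment_const.

Lemma moment_const_gt0 : 0 < moment_const :> R.
Proof. by apply: mulr_gt0; [rewrite ltr0n|exact: expR_gt0]. Qed.

Lemma gram_const_gt0 (aX K0 KA : R) : 0 <= K0 -> 0 <= KA -> 0 < gram_const aX K0 KA.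
Proof.
move=> k0 ka; apply: mulr_gt0 moment_const_gt0; apply: mulr_gt0.
  by rewrite mulr_gt0 ?expR_gt0.
by rewrite exprn_gt0 // mulr_gt0 ?proxy_gt0 // ltr_wpDl.
Qed.

Lemma gram_moment_le (aX K0 KA L : R) (n k : nat) : 0 <= K0 -> 0 <= KA -> (0 < n)%N ->
  0 < L -> L <= k.+1%:R <= 2 * L ->
  gram_moment_bound aX K0 n KA k / (Num.sqrt (gram_const aX K0 KA * L / n%:R) ^+ 2) ^+ k.+1 <=
  2 * expR (- (2 * L)).
Proof.
move=> k0 ka n0 L0 /andP[Lk kL].
have n0' : 0 < (n%:R : R) by rewrite ltr0n.
have g0 := gram_const_gt0 aX k0 ka.
set s4 := proxy aX K0 * (KA + 1).
have s0 : 0 < s4 by rewrite mulr_gt0 ?proxy_gt0 // ltr_wpDl.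
rewrite (sqr_sqrtr (ltW (divr_gt0 (mulr_gt0 g0 L0) n0'))).
have -> : gram_moment_bound aX K0 n KA k / (gram_const aX K0 KA * L / n%:R) ^+ k.+1 =
    2 * (s4 ^+ 4 * (moment_const * k.+1%:R / n%:R) / (gram_const aX K0 KA * L / n%:R)) ^+ k.+1.
  rewrite /gram_moment_bound -/s4 exprM; move: (s4 ^+ 4) (moment_const * _ / _) (_ * L / _) => u v G.
  by rewrite expr_div_n exprMn; ring.
apply: ler_wpM2l => //.
have k1 : 0 < (k.+1%:R : R) by rewrite ltr0n.
have -> : s4 ^+ 4 * (moment_const * k.+1%:R / n%:R) / (gram_const aX K0 KA * L / n%:R) =
   k.+1%:R / (2 * L) * expR (- 2).
  rewrite expRN /gram_const -/s4; move: (expR_gt0 (2 : R)) moment_const_gt0 => e0 m0.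
  by field; rewrite !lt0r_neq0 // ?mulr_gt0.
have L2 : 0 <= 2 * L by rewrite mulr_ge0 // ltW.
apply: (@le_trans _ _ (expR (- 2) ^+ k.+1)).
  apply: lerXn2r; rewrite ?nnegrE ?expR_ge0 ?mulr_ge0 ?invr_ge0 ?(ltW k1) ?(ltW L0) //.
  by rewrite ler_piMl ?expR_ge0 // ler_pdivrMr ?mul1r // mulr_gt0.
by rewrite -expRM_natr ler_expR mulNr lerN2 ler_pM2l.
Qed.

(** The deviations entering the bound, combined at the common scale [sqrt (L / n)]. *)
Lemma combine_deviations (s1 Lv rate cx r qa qk L S2 NS lhs : R) (n : nat) :
  0 < n%:R :> R -> 1 <= L -> r = Num.sqrt (L / n%:R) -> 1 <= Lv -> 1 <= qa -> 0 <= qk -> 1 <= s1 ->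
  0 <= rate -> 0 <= S2 <= 12 * Lv * n%:R ->
  r / Lv * NS <= 2 * L + (r / Lv) ^+ 2 * Lv * S2 / 2 ->
  lhs <= s1 * (Num.sqrt (n%:R^-1 * S2) * (rate * (2 * Num.sqrt (cx * L / n%:R) * qa + qk))) + n%:R^-1 * NS ->
  0 <= cx ->
  lhs <= s1 * Lv * (4 * (rate * (2 * Num.sqrt cx + 1)) + 8) * (qa * r + qk).
Proof.
move=> n0 L1 rE Lv1 qa1 qk0 s11 rate0 /andP[S20 S2le] NSle lhsle cx0.
have L0 : 0 < L := lt_le_trans ltr01 L1.
have Lv0 : 0 < Lv := lt_le_trans ltr01 Lv1.
have r0 : 0 < r by rewrite rE sqrtr_gt0 divr_gt0.
have rr : r ^+ 2 = L / n%:R by rewrite rE sqr_sqrtr // divr_ge0 // ltW.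
have LE : L = r ^+ 2 * n%:R by rewrite rr divfK // gt_eqF.
have h1 : n%:R^-1 * NS <= 8 * Lv * r.
  rewrite mulrC ler_pdivrMr //.
  have : r / Lv * NS <= 8 * r ^+ 2 * n%:R.
    apply: (le_trans NSle).
    have : (r / Lv) ^+ 2 * Lv * S2 / 2 <= (r / Lv) ^+ 2 * Lv * (12 * Lv * n%:R) / 2.
      by rewrite ler_pM2r ?invr_gt0 // ler_wpM2l // mulr_ge0 ?sqr_ge0 // ltW.
    have -> : (r / Lv) ^+ 2 * Lv * (12 * Lv * n%:R) / 2 = 6 * r ^+ 2 * n%:R by field; rewrite gt_eqF.
    by rewrite LE; lra.
  move=> h; rewrite -(ler_pM2l (_ : 0 < r / Lv)) ?divr_gt0 //; apply: (le_trans h).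
  by rewrite le_eqVlt; apply/orP; left; apply/eqP; field; rewrite gt_eqF.
have h2 : Num.sqrt (n%:R^-1 * S2) <= 4 * Lv.
  have -> : 4 * Lv = Num.sqrt ((4 * Lv) ^+ 2) by rewrite sqrtr_sqr ger0_norm // mulr_ge0 // ltW.
  apply: ler_wsqrtr; rewrite mulrC ler_pdivrMr //; apply: (le_trans S2le).
  rewrite ler_pM2r //; nra.
have h3 : Num.sqrt (cx * L / n%:R) = Num.sqrt cx * r by rewrite rE -sqrtrM // mulrA.
have c0 := sqrtr_ge0 cx.
rewrite h3 in lhsle; apply: (le_trans lhsle).
have b0 : 0 <= rate * (2 * (Num.sqrt cx * r) * qa + qk).
  by rewrite mulr_ge0 // addr_ge0 // !mulr_ge0 ?(ltW r0) // (le_trans ler01).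
have h4 : rate * (2 * (Num.sqrt cx * r) * qa + qk) <= rate * (2 * Num.sqrt cx + 1) * (qa * r + qk).
  rewrite -[X in _ <= X]mulrA; apply: ler_wpM2l => //.
  have p1 : 0 <= Num.sqrt cx * qk by rewrite mulr_ge0.
  have p2 : 0 <= qa * r by rewrite mulr_ge0 ?(ltW r0) // (le_trans ler01).
  have -> : (2 * Num.sqrt cx + 1) * (qa * r + qk) = 2 * (Num.sqrt cx * r) * qa + qk + (2 * (Num.sqrt cx * qk) + qa * r) by ring.
  by rewrite lerDl addr_ge0 // mulr_ge0.
have h5 : Num.sqrt (n%:R^-1 * S2) * (rate * (2 * (Num.sqrt cx * r) * qa + qk)) <=
   4 * Lv * (rate * (2 * Num.sqrt cx + 1) * (qa * r + qk)).
  by apply: ler_pM; rewrite ?sqrtr_ge0.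
have h6 : 8 * Lv * r <= s1 * (8 * Lv * (qa * r + qk)).
  have t : 8 * Lv * r <= 8 * Lv * (qa * r + qk).
    apply: ler_wpM2l; first by rewrite mulr_ge0 // ltW.
    by rewrite -[leLHS]addr0; apply: lerD => //; rewrite ler_peMl // ltW.
  apply: (le_trans t); rewrite ler_peMl // mulr_ge0 ?mulr_ge0 ?(ltW Lv0) // addr_ge0 // mulr_ge0 ?(ltW r0) //.
  exact: le_trans qa1.
apply: le_trans (lerD (ler_wpM2l (le_trans ler01 s11) h5) (le_trans h1 h6)) _.
by rewrite -mulrDr le_eqVlt; apply/orP; left; apply/eqP; ring.
Qed.

End Assembly.

Section ProcessEvents.
Context {R : realType} {dsp : measure_display} {Om : measurableType dsp}.
Variable P : probability Om R.

Lemma gram_event (lo hi : R) (H : set (R -> R)) (U := `[lo, hi]%classic : set R) (HH : hilbert_subspace U H)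
  (aX : R) p A eps X (flp : functional_linear_process P U H aX A eps X) (K0 KA L : R)
  (K0P : forall j : 'I_p, \int[lebesgue_measure]_(u in U) cov_fun P (eps 0 j) (eps 0 j) u u <= K0) (K0_ge0 : 0 <= K0)
  (j : 'I_p) (psi : nat -> R -> R) (n : nat)
  (Hpsi : forall l, H (psi l)) (one : forall l m, ip U (psi l) (psi m) = (l == m)%:R)
  (KAP : forall N, \sum_(l < N) \sum_(i < p) HSnorm U (A l j i) <= KA) :
  (0 < n)%N -> 1 <= L -> 128 * L <= n%:R ->
  exists2 E : set Om, measurable E /\ (P E <= (2 * expR (- (2 * L)))%:E)%E &
  forall w, ~ E w -> forall N, \sum_(a < N) \sum_(b < N) gram_dev P n (score lo hi X j psi) a b w ^+ 2 <=
    (2 * Num.sqrt (gram_const aX K0 KA * L / n%:R)) ^+ 2.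
Proof.
move=> n0 L1 Ln; have [k kL] := trunc_between L1.
have KA0 : 0 <= KA by have := KAP 0; rewrite big_ord0.
have L0 : 0 < L := lt_le_trans ltr01 L1.
have [||E [mE PE] EP] := gram_tail HH flp K0P K0_ge0 (n := n) Hpsi one KAP (k := k) (x := Num.sqrt (gram_const aX K0 KA * L / n%:R)).
- by rewrite -(@ler_nat R) natrM; move/andP: kL => [_ kL]; lra.
- rewrite sqrtr_gt0; apply: divr_gt0; last by rewrite ltr0n.
  exact: mulr_gt0 (gram_const_gt0 aX K0_ge0 KA0) L0.
exists E => //; split=> //; apply: le_trans PE _; rewrite lee_fin.
exact: gram_moment_le.
Qed.

End ProcessEvents.

Lemma max_norm_le {R : realType} d (x : 'cV[R]_d) (c : R) : 0 <= c -> (forall k, `|x k 0| <= c) -> max_norm x <= c.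
Proof. by move=> c0 xc; rewrite /max_norm; elim/big_rec: _ => // k y _ yc; rewrite ge_max xc. Qed.

Lemma bad_event_count (p q d : nat) : (0 < q)%N -> (0 < d)%N -> ((p + (d + d)) * 2 < 6 * (p * q + d))%N.
Proof. by move=> q0 d0; have := leq_pmulr p q0; lia. Qed.

Lemma one_entry_delta {R : realType} d (k : 'I_d) : one_entry (delta_mx k 0 : 'cV[R]_d).
Proof.
by move=> i i'; rewrite !mxE !andbT; case: (eqVneq i k) => [->|]; case: (eqVneq i' k) => [->|]; rewrite ?eqxx.
Qed.

Theorem proposition9 (R : realType) (lo hi : R) (H : set (R -> R))
  (c0 alpha kappa mubar aX aZ aE KA KZ KE K0 VZ VE : R)
  (lohi : lo < hi)
  (H_hilbert : hilbert_subspace `[lo, hi]%classic H)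
  (c0_gt0 : 0 < c0) (alpha_gt1 : 1 < alpha) (kappa_gt : alpha / 2 + 1 < kappa)
  (aX_ge0 : 0 <= aX) (aZ_ge0 : 0 <= aZ) (aE_ge0 : 0 <= aE) :
  exists C C0star c1star c2star : R,
  [/\ 0 < C, 0 < C0star, 0 < c1star, 0 < c2star &
  forall (dsp : measure_display) (Om : measurableType dsp)
    (P : probability Om R)
    (n p d q : nat)
    (X : int -> 'I_p -> Om -> R -> R) (Z : int -> 'I_d -> Om -> R)
    (e Y : int -> Om -> R)
    (A : nat -> 'I_p -> 'I_p -> R -> R -> R)
    (epsX : int -> 'I_p -> Om -> R -> R)
    (BZ : nat -> 'M[R]_d) (etaZ : int -> 'I_d -> Om -> R)
    (bE : nat -> R) (etaE : int -> Om -> R)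
    (beta : 'I_p -> R -> R) (gamma : 'cV[R]_d)
    (omega : 'I_p -> nat -> R) (psi : 'I_p -> nat -> R -> R)
    (mu : 'I_p -> R) (a : 'I_p -> nat -> R)
    (omegah : 'I_p -> nat -> Om -> R) (psih : 'I_p -> nat -> Om -> R -> R)
    (Dh : 'I_p -> Om -> 'M[R]_q)
    (fX : R -> 'I_p -> 'I_p -> R -> R -> complex R)
    (fZ : R -> 'M[complex R]_d) (fE : R -> 'M[complex R]_1)
    (fXZ : R -> 'I_p -> 'I_d -> R -> complex R),
  let U : set R := `[lo, hi]%classic in
  let S0X := SigmaX P X 0 in
  let S0Z := SigmaZ P Z 0 in
  let S0E := SigmaZ P (scalar_proc e) 0 in
  let M1X := stability_fun U fX S0X (prod_space H `&` one_component U) in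
  let M1Z := stability_vec fZ S0Z one_entry in
  let M11XZ := stability_cross U fXZ S0X S0Z
    (prod_space H `&` one_component U) one_entry in
  let ME := stability_vec fE S0E setT in
  let MXZ := fine (M1X + M1Z + M11XZ)%E in
  let S1 := active_set U beta in
  let s1 := #|S1| in
  (* for S1 empty the right-hand side of the conclusion would be 0 *)
  (0 < n)%N -> (0 < p)%N -> (0 < d)%N -> (0 < q)%N -> (0 < s1)%N ->
  (* the processes *)
  functional_linear_process P U H aX A epsX X ->
  linear_process P aZ BZ etaZ Z ->
  linear_process P aE (fun l => (bE l)%:M) (scalar_proc etaE) (scalar_proc e) ->
  jointly_weakly_stationary P U X Z ->
  independent P (sigma_process (scalar_proc e)) (sigma_fun_process U H X) ->
  independent P (sigma_process (scalar_proc e)) (sigma_process Z) ->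
  (* bounded variances *)
  (forall t k, cov P (Z t k) (Z t k) <= VZ) ->
  (forall t, cov P (e t) (e t) <= VE) ->
  (* the regression model *)
  (forall j, H (beta j)) ->
  (forall (t : 'I_n) w, Y (obs t) w =
     \sum_(j < p) ip U (X (obs t) j w) (beta j) +
     \sum_(k < d) Z (obs t) k w * gamma k 0 + e (obs t) w) ->
  (* (i) *)
  spectral_density_fun U (SigmaX P X) fX ->
  spectral_density_vec (SigmaZ P Z) fZ ->
  spectral_density_vec (SigmaZ P (scalar_proc e)) fE ->
  (stability_fun U fX S0X (prod_space H) < +oo)%E ->
  (stability_vec fZ S0Z setT < +oo)%E ->
  (ME < +oo)%E ->
  (* (ii) *)
  spectral_density_cross U (SigmaXZ P X Z) fXZ ->
  (stability_cross U fXZ S0X S0Z (prod_space H) setT < +oo)%E ->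
  (* (iii) *)
  (\sum_(0 <= l <oo) (kmx_norm_inf U (A l))%:E <= KA%:E)%E ->
  (\sum_(0 <= l <oo) (mx_norm_inf (BZ l))%:E <= KZ%:E)%E ->
  (\sum_(0 <= l <oo) `|bE l|%:E <= KE%:E)%E ->
  (* (iv) *)
  (forall j u, U u ->
     P.-integrable setT (fun w => (epsX 0 j w u ^+ 2)%:E)) ->
  (forall j, {within U `*` U, continuous
     (fun z : R * R => cov_fun P (epsX 0 j) (epsX 0 j) z.1 z.2)}) ->
  (exists K : R, forall j u v, U u -> U v ->
     `|cov_fun P (epsX 0 j) (epsX 0 j) u v| <= K) ->
  (forall j, \int[lebesgue_measure]_(u in U)
     cov_fun P (epsX 0 j) (epsX 0 j) u u <= K0) ->
  (* (v) *)
  (forall j, eigen_system U H (S0X j j) (omega j) (psi j)) ->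
  (forall j l, omega j l.+1 < omega j l /\ 0 < omega j l) ->
  (forall j l,
     c0 * l.+1%:R `^ (- alpha - 1) <= omega j l - omega j l.+1) ->
  (* (vi) *)
  (forall j, j \in S1 ->
     [/\ 0 < mu j <= mubar,
         nrm U (fun u => beta j u - \sum_(l < N) a j l * psi j l u)
           @[N --> \oo] --> (0 : R) &
         forall l, `|a j l| <= mu j * l.+1%:R `^ (- kappa)]) ->
  (* sample eigenpairs and normalization *)
  (forall j w,
     eigen_system U H (sample_cov n (fun t i => X t i w) j)
       (fun l => omegah j l w) (fun l => psih j l w)) ->
  (forall j l w, 0 <= ip U (psih j l w) (psi j l)) ->
  (forall j w,
     let Xhj := score_mx U n q (fun t i => X t i w)
                  (fun i l => psih i l w) j in
     is_psd_sqrt (Dh j w) (n%:R^-1 *: (Xhj^T *m Xhj))) ->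
  C * ln (p * q * d)%:R * q%:R `^ (3 * alpha + 2) * MXZ ^+ 2 <= n%:R ->
  (* E is a measurable event on which the inequality holds: psih is not assumed
     measurable in w *)
  exists E : set Om,
  [/\ measurable E,
      ((1 - c1star * (p * q + d)%:R `^ (- c2star))%:E < P E)%E &
      forall w, E w ->
        n%:R^-1 * max_norm ((Z_mx n (fun t k => Z t k w))^T *m
          (Y_vec n (fun t => Y t w) -
           Omega_hat U n (fun t i => X t i w) (fun i l => psih i l w)
             (fun i => Dh i w) *m B_coef U q omega psi beta -
           Z_mx n (fun t k => Z t k w) *m gamma))
        <= C0star * s1%:R * (MXZ + fine ME) *
           (q%:R `^ (alpha + 1) * Num.sqrt (ln (p * q + d)%:R / n%:R) +
            q%:R `^ (- kappa + 1 / 2))]].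
Proof.
(* the absolute values make the constants independent of the signs of the bounds *)
pose K0' := `|K0|; pose KA' := `|KA|; pose mb := `|mubar|.
have K0'0 : 0 <= K0' := normr_ge0 _. have KA'0 : 0 <= KA' := normr_ge0 _. have mb0 : 0 <= mb := normr_ge0 _.
have [cx cx_def] : {cx | cx = gram_const aX K0' KA'} by exists (gram_const aX K0' KA').
have cx0 : 0 < cx by rewrite cx_def; exact: gram_const_gt0.
pose rate := rate_const K0' KA' c0 alpha mb.
have rate0 : 0 <= rate.
  by rewrite /rate /rate_const !(mulr_ge0, addr_ge0, sqrtr_ge0, invr_ge0) // ltW.
(* [L1] times the stability measures is a variance proxy for covariates and noise *)
pose L1 := aZ ^+ 2 * `|VZ| + aE ^+ 2 * `|VE| + 1.
have L1z : 0 <= aZ ^+ 2 * `|VZ| by rewrite mulr_ge0 ?sqr_ge0.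
have L1e : 0 <= aE ^+ 2 * `|VE| by rewrite mulr_ge0 ?sqr_ge0.
have L11 : 1 <= L1 by rewrite lerDr addr_ge0.
have sc0 : 0 <= Num.sqrt cx := sqrtr_ge0 _.
pose C0 := L1 * (4 * (rate * (2 * Num.sqrt cx + 1)) + 8).
have C00 : 0 < C0.
  apply: mulr_gt0; first exact: lt_le_trans ltr01 L11.
  by rewrite ltr_wpDl // mulr_ge0 // mulr_ge0 // addr_ge0 // mulr_ge0.
have ax32 : (alpha + 1) * 2 <= 3 * alpha + 2 by move: alpha_gt1; lra.
(* 128 admits moments of order [2 * ln N]; the other term keeps the Gram deviation
   below half of the spacing of the first [q] eigenvalues *)
have [Kn [Kn0 Kn128 Kn16]] : exists Kn, [/\ 0 < Kn, 128 <= Kn & 16 * cx / c0 ^+ 2 <= Kn].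
  have C1 : 0 <= 16 * cx / c0 ^+ 2 by rewrite divr_ge0 ?sqr_ge0 // mulr_ge0 // ltW.
  by exists (128 + 16 * cx / c0 ^+ 2); rewrite lerDl lerDr; split=> //; apply: ltr_wpDr.
exists (2 * Kn), C0, 6, 1; split; [exact: mulr_gt0|exact: C00|exact: ltr0n|exact: ltr01|].
move=> dsp Om P n p d q X Z e Y A epsX BZ etaZ bE etaE beta gamma omega psi mu a omegah psih Dh fX fZ fE fXZ.
move=> U S0X S0Z S0E M1X M1Z M11XZ ME MXZ S1 s1 n0 p0 d0 q0 s10.
move=> flp lpZ lpE jws _ indZ VZP VEP Hbeta model.
move=> specX specZ specE MXfin MZfin MEfin specXZ MXZfin KAs KZs KEs.
move=> _ _ _ K0s ES omega_dec omega_gap beta_exp ESh sgn Dhs nC.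
(* the probability bound is void for [N < 6], and afterwards [ln N >= 1] *)
have [N6|N6] := ltnP (p * q + d) 6.
  exists set0; split=> //.
  rewrite measure0 lte_fin subr_lt0 powRN powRr1 // ltr_pdivlMr ?mul1r ?ltr_nat //.
  by rewrite ltr0n addn_gt0 d0 orbT.
have [L1' Lle] := @ln_dimension_bounds R p q d p0 q0 d0 N6.
set N := (p * q + d)%N in N6 L1' Lle *; set L := ln N%:R in L1' Lle *.
have N0 : 0 < (N%:R : R) by rewrite ltr0n (leq_trans _ N6).
have NE : N%:R = expR L :> R by rewrite lnK // posrE.
have n0' : 0 < (n%:R : R) by rewrite ltr0n.
have [MXZ0 M1Zle MXZE] : [/\ 0 <= MXZ, (M1Z <= MXZ%:E)%E & MXZ = fine M1X + fine M1Z + fine M11XZ].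
  apply: fine_sum3.
  - rewrite stability_fun_ge0; apply: le_lt_trans MXfin; exact: stability_fun_le (@subIsetl _ _ _).
  - rewrite stability_vec_ge0; apply: le_lt_trans MZfin; exact: stability_vec_le.
  - rewrite stability_cross_ge0; apply: le_lt_trans MXZfin; exact: stability_cross_le.
have ME0 : 0 <= fine ME by apply: fine_ge0; exact: stability_vec_ge0.
pose Mt := MXZ + fine ME.
have Mt0 : 0 <= Mt by rewrite addr_ge0.
have rhs0 : 0 <= q%:R `^ (alpha + 1) * Num.sqrt (L / n%:R) + q%:R `^ (- kappa + 1 / 2) :> R.
  by rewrite addr_ge0 ?mulr_ge0 ?powR_ge0 ?sqrtr_ge0.
have s11 : 1 <= (s1%:R : R) by rewrite ler1n.
have KZP k NN m : \sum_(l < NN) `|BZ l k m| <= KZ := matrix_rowsum_le NN k m KZs.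
(* if no covariate is random, then all of them vanish almost surely *)
have [[k0 Gk0]|deg] := pselect (exists k, 0 < ipm P setT (Z 0 k) (Z 0 k)); last first.
  have Zae : {ae P, forall w, forall (t : 'I_n) (k : 'I_d), Z (obs t) k w = 0}.
    apply: filter_forall => t; apply: filter_forall => k.
    have z0 : ipm P setT (Z (obs t) k) (Z (obs t) k) = 0.
      have := lp_stationary lpZ k 0 0 (obs t); rewrite add0r => ->.
      apply/eqP; rewrite eq_le (si_ge0 (L2m_si P measurableT) (lp_L2 lpZ k 0)) andbT leNgt.
      by apply/negP => h; apply: deg; exists k.
    by apply: (ae_imp (ipm_sq0_ae measurableT (lp_L2 lpZ k (obs t)) z0)) => w; apply.
  have [|E [mE PE EP]] := @good_event _ _ _ P 'I_0 (fun=> set0) 0 _ _ Zae; first by case.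
  exists E; split=> //.
    apply: lt_le_trans PE; rewrite lte_fin mulr0 ltrD2l ltrN2 mulr_gt0 // powR_gt0 //.
  move=> w /EP[Z0 _].
  have -> : Z_mx n (fun t k => Z t k w) = 0 by apply/matrixP => t k; rewrite !mxE Z0.
  rewrite trmx0 mul0mx; apply: (@le_trans _ _ (n%:R^-1 * 0)).
    apply: ler_wpM2l; first by rewrite invr_ge0.
    by apply: max_norm_le => // k; rewrite mxE normr0.
  by rewrite mulr0 mulr_ge0 // mulr_ge0 // mulr_ge0 // ltW.
have MXZ1 : 1 <= MXZ.
  have h := autocov_stability_ge1 lpZ (KZP k0) specZ (@one_entry_delta R d k0) M1Zle.
  exact: (h Gk0).
have Mt1 : 1 <= Mt by rewrite (le_trans MXZ1) // lerDl.
pose Lv := L1 * Mt; have Lv1 : 1 <= Lv by rewrite mulr_ege1.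
pose qa : R := q%:R `^ (alpha + 1); pose qk : R := q%:R `^ (- kappa + 1 / 2).
have q1 : 1 <= (q%:R : R) by rewrite ler1n.
have a0 : 0 <= alpha by rewrite ltW // (lt_trans ltr01).
have qa1 : 1 <= qa.
  by rewrite -[leLHS](powRr0 q%:R); apply: ler_powR => //; rewrite addr_ge0.
have qk0 : 0 <= qk by exact: powR_ge0.
have L0 : 0 < L := lt_le_trans ltr01 L1'.
have hn : Kn * L * qa ^+ 2 <= n%:R.
  apply: le_trans nC.
  have qq : qa ^+ 2 <= q%:R `^ (3 * alpha + 2).
    rewrite -powR_mulrn ?powR_ge0 // -powRrM; exact: ler_powR.
  have M2 : 1 <= MXZ ^+ 2 by rewrite exprn_ege1.
  have l0 : 0 <= ln (p * q * d)%:R :> R by rewrite -(pmulr_rge0 _ (ltr0n _ 2)) (le_trans (ltW L0)).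
  apply: (@le_trans _ _ (2 * Kn * ln (p * q * d)%:R * q%:R `^ (3 * alpha + 2))).
    apply: ler_pM qq; [exact: mulr_ge0 (ltW Kn0) (ltW L0)|exact: sqr_ge0|].
    by rewrite [2 * _]mulrC -[X in _ <= X]mulrA; apply: ler_wpM2l Lle; exact: ltW.
  rewrite ler_peMr //; apply: mulr_ge0 (powR_ge0 _ _); apply: mulr_ge0 l0.
  by rewrite mulr_ge0 // ltW.
have qa2 : 1 <= qa ^+ 2 by rewrite exprn_ege1.
have n128 : 128 * L <= n%:R.
  apply: le_trans hn; apply: (@le_trans _ _ (Kn * L)); first by rewrite ler_pM2r.
  by rewrite ler_peMr // mulr_ge0 // ltW.
pose delta := 2 * Num.sqrt (cx * L / n%:R).
have delta0 : 0 <= delta by rewrite mulr_ge0 // sqrtr_ge0.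
have delta_le : delta <= c0 * q%:R `^ (- alpha - 1) / 2.
  have -> : q%:R `^ (- alpha - 1) = qa^-1 :> R by rewrite -opprD powRN.
  have qa0 : 0 < qa := lt_le_trans ltr01 qa1.
  rewrite -ler_sqr ?nnegrE ?divr_ge0 ?mulr_ge0 ?invr_ge0 ?(ltW c0_gt0) ?(ltW qa0) //.
  rewrite exprMn sqr_sqrtr; last by rewrite divr_ge0 // mulr_ge0 // ltW.
  rewrite mulrA ler_pdivrMr //.
  have -> : (c0 / qa / 2) ^+ 2 * n%:R = n%:R * c0 ^+ 2 / (4 * qa ^+ 2) by field; rewrite gt_eqF.
  rewrite ler_pdivlMr; last by rewrite mulr_gt0 // exprn_gt0.
  have -> : 2 ^+ 2 * (cx * L) * (4 * qa ^+ 2) = (16 * cx / c0 ^+ 2) * L * qa ^+ 2 * c0 ^+ 2 by field; rewrite gt_eqF.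
  rewrite ler_pM2r ?exprn_gt0 //; apply: le_trans hn; rewrite ler_pM2r ?(lt_le_trans ltr01 qa2) //.
  by rewrite ler_pM2r.
(* [b = 2 / N ^ 2] bounds the probability of each of the [p + 2 * d] bad events *)
pose b := 2 * expR (- (2 * L)) : R.
have K0P j : \int[lebesgue_measure]_(u in U) cov_fun P (epsX 0 j) (epsX 0 j) u u <= K0'.
  exact: le_trans (K0s j) (ler_norm _).
have KAP j NN : \sum_(l < NN) \sum_(i < p) HSnorm U (A l j i) <= KA'.
  by apply: le_trans (kernel_rowsum_le NN j KAs) (ler_norm _).
have Hpsi j l : H (psi j l) := eig_in (ES j) l.
have /choice[EX EXP] : forall j, exists E : set Om, (measurable E /\ (P E <= b%:E)%E) /\
    forall w, ~ E w -> forall NN, \sum_(a < NN) \sum_(b < NN) gram_dev P n (score lo hi X j (psi j)) a b w ^+ 2 <= delta ^+ 2.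
  move=> j.
  have [E mE EP] := gram_event H_hilbert flp K0P K0'0 (Hpsi j) (eig_orthonormal (ES j)) (KAP j) n0 L1' n128.
  by exists E; split=> // w nE NN; rewrite /delta cx_def; exact: EP.
have Lv0 : 0 < Lv := lt_le_trans ltr01 Lv1.
have VZP' k t : cov P (Z t k) (Z t k) <= `|VZ| := le_trans (VZP t k) (ler_norm _).
have VEP' t : cov P (scalar_proc e t 0) (scalar_proc e t 0) <= `|VE| := le_trans (VEP t) (ler_norm _).
have LvZ : aZ ^+ 2 * `|VZ| * MXZ <= Lv.
  by apply: ler_pM => //; [rewrite /L1 -addrA lerDl addr_ge0 | rewrite lerDl].
have LvE : aE ^+ 2 * `|VE| * fine ME <= Lv.
  by apply: ler_pM => //; [rewrite /L1 [X in X + 1]addrC -addrA lerDl addr_ge0 | rewrite lerDr].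
have MEle : (ME <= (fine ME)%:E)%E.
  by rewrite fineK // ge0_fin_numE //; exact: stability_vec_ge0.
have KEP NN (m : 'I_1) : \sum_(l < NN) `|(bE l)%:M 0 m| <= KE.
  apply: (partial_sum_le (u := fun l => `|bE l|) (v := fun l => `|(bE l)%:M 0 m|)) => // l.
  by rewrite mxE (ord1 m).
have eexp (c : nat -> R) : (\int[P]_w (expR (\sum_(t < n) c t * scalar_proc e t.+1%:Z 0 w))%:E <=
    (expR (Lv * (\sum_(t < n) c t ^+ 2) / 2))%:E)%E.
  exact: (@lp_expsum _ _ _ P _ _ _ _ _ lpE 0 KE KEP fE setT (fine ME) specE I MEle _ _ VEP' LvE ME0 n c).
pose S2 k w := \sum_(t < n) Z (t.+1)%:Z k w ^+ 2.
have mZ t k : measurable_fun setT (Z t k) := lp_meas lpZ t k.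
have mS2 k : measurable [set w | (12 * Lv * n%:R <= S2 k w)%R].
  have mh : measurable_fun setT (S2 k) by apply: measurable_sum => t; exact: measurable_funX.
  have := mh measurableT _ (measurable_itv `[12 * Lv * n%:R, +oo[); rewrite setTI; congr (measurable _).
  by apply/seteqP; split=> w /=; rewrite in_itv /= andbT.
have L_n : L <= n%:R by apply: le_trans n128; apply: ler_peMl; [exact: ltW|rewrite ler1n].
have PS2 k : (P [set w | (12 * Lv * n%:R <= S2 k w)%R] <= b%:E)%E.
  apply: le_trans (lp_norm_tail lpZ (KZP k) specZ (@one_entry_delta R d k) M1Zle (VZP' k) LvZ MXZ0 Lv0 n) _.
  rewrite lee_fin; apply: (@le_trans _ _ (expR (- (2 * L)))).
    by rewrite ler_expR lerN2 ler_pM2l.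
  by rewrite ler_peMl ?expR_ge0 // ler1n.
pose r := Num.sqrt (L / n%:R); have r0 : 0 < r by rewrite sqrtr_gt0 divr_gt0.
have /choice[EN ENP] : forall k, exists E : set Om, (measurable E /\ (P E <= b%:E)%E) /\
    forall w, ~ E w -> r / Lv * `|\sum_(t < n) Z t.+1%:Z k w * scalar_proc e t.+1%:Z 0 w| <=
      2 * L + (r / Lv) ^+ 2 * Lv * S2 k w / 2.
  move=> k.
  have [E [mE PE] EP] := noise_tail k mZ (lp_meas lpE) indZ eexp (divr_gt0 r0 Lv0) (expR_gt0 (2 * L)).
  exists E; split; first by rewrite /b expRN.
  by move=> w nE; have := EP w nE; rewrite expRK.
have stat j t : {ae (@lebesgue_measure R \x @lebesgue_measure R)%E, forall z, (U `*` U) z ->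
    cov_fun P (X t j) (X t j) z.1 z.2 = cov_fun P (X 0 j) (X 0 j) z.1 z.2}.
  by have := jws_X jws t 0 j j; rewrite addr0.
have Xae : {ae P, forall w, forall (t : 'I_n) j,
    (fun NN => ip U (coords_residual (ip U) (psi j : nat -> R -> R^o) NN (X (obs t) j w))
      (coords_residual (ip U) (psi j : nat -> R -> R^o) NN (X (obs t) j w))) @ \oo --> (0 : R)}.
  apply: filter_forall => t; apply: filter_forall => j.
  exact: (X_in_span H_hilbert flp (ES j) (stat j) (obs t)).
pose bad (i : 'I_p + ('I_d + 'I_d)) := match i with
  | inl j => EX j | inr (inl k) => [set w | (12 * Lv * n%:R <= S2 k w)%R] | inr (inr k) => EN k end.
have [|E [mE PE EP]] := @good_event _ _ _ P ('I_p + ('I_d + 'I_d))%type bad b _ _ Xae.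
  by case=> [j|[k|k]] /=; [case: (EXP j)|split; [exact: mS2|exact: PS2]|case: (ENP k)].
exists E; split=> //.
  apply: lt_le_trans PE; rewrite lte_fin ltrD2l ltrN2 !card_sum !card_ord.
  rewrite powRN powRr1 ?(ltW N0) // NE /b.
  have -> : 2 * expR (- (2 * L)) = 2 * (expR L)^-1 ^+ 2 by rewrite -expRN -expRM_natr mulNr [L * _]mulrC.
  rewrite -NE mulrA ltr_pdivlMr //.
  have -> : (p + (d + d))%:R * 2 * N%:R^-1 ^+ 2 * N%:R = ((p + (d + d)) * 2)%:R / N%:R :> R.
    by rewrite natrM; field; rewrite gt_eqF.
  by rewrite ltr_pdivrMr // -natrM ltr_nat; exact: bad_event_count.
move=> w /EP[span nbad].
have nEX j := (EXP j).2 w (nbad (inl j)).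
have hS2 k : S2 k w <= 12 * Lv * n%:R by rewrite leNgt; apply/negP => h; apply: (nbad (inr (inl k))); exact: ltW.
have hEN k := (ENP k).2 w (nbad (inr (inr k))).
have whp j l : (l < q)%N -> 0 < omegah j l w.
  exact: (sample_eigenvalue_gt0 H_hilbert flp (ES j) (stat j) n0 c0_gt0 alpha_gt1 q0
    (fun l => (omega_dec j l).2) (omega_gap j) (ESh j w) delta0 (nEX j) delta_le).
pose rr := rate * (2 * Num.sqrt (cx * L / n%:R) * qa + qk).
have rrP j : j \in active_set U beta -> snorm (sample_form (ip U) (fun t : 'I_n => X (obs t) j w : R -> R^o))
   (estimation_residual (fun l => psih j l w : R -> R^o) (omega j) (fun l => omegah j l w) q (beta j)
      (fun l => ip U (psi j l) (beta j))) <= rr.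
  move=> jS; have [/andP[mu0 mule] bcvg ale] := beta_exp j jS.
  have ale' l : `|a j l| <= mb * l.+1%:R `^ (- kappa).
    apply: le_trans (ale l) _; rewrite ler_wpM2r ?powR_ge0 //; exact: le_trans mule (ler_norm _).
  have pr := @projection_rate R dsp Om P lo hi H H_hilbert aX p A epsX X flp K0' K0P K0'0 j (omega j) (psi j) (ES j) KA' (KAP j)
    (stat j) n n0 c0 alpha kappa mb q (beta j) (a j) c0_gt0 alpha_gt1 kappa_gt q0 (fun l => (omega_dec j l).2) (omega_gap j)
    (Hbeta j) mb0 ale' bcvg w (fun l => omegah j l w) (fun l => psih j l w) delta (ESh j w) (span^~ j) delta0 (nEX j) delta_le
    (fun l => sgn j l w).
  exact: pr.
have lhs k := residual_score_le H_hilbert n0 (x := fun t i => X t i w) (z := fun t k => Z t k w) (e := e ^~ w)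
  (y := Y ^~ w) (fun t j => (flp_random flp t j).2 w) (fun j => ESh j w) (fun j => Dhs j w) whp Hpsi Hbeta (fun t => model t w) k rrP.
rewrite mulrC ler_pdivrMr //; apply: max_norm_le.
  by rewrite mulr_ge0 // mulr_ge0 // mulr_ge0 // mulr_ge0 // ltW.
move=> k; rewrite -ler_pdivrMr // mulrC.
have S20 : 0 <= S2 k w by apply: sumr_ge0 => t _; exact: sqr_ge0.
have S2b : 0 <= S2 k w <= 12 * Lv * n%:R by rewrite S20 hS2.
have := combine_deviations n0' L1' (erefl r) Lv1 qa1 qk0 s11 rate0 S2b (hEN k) (lhs k) (ltW cx0).
move=> h; apply: (le_trans h); rewrite le_eqVlt; apply/orP; left; apply/eqP.
by rewrite /C0 /Lv /Mt /qa /qk /r; ring.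
Qed.
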